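(* Let $k$ be a rational number with $k\not\equiv0,4,5,11\pmod{12}$. The Stiller basis $(y_1(\tau),iy_3(\tau))$ satisfies the following transformation properties under the generators $T\tau=\tau+1$ and $S\tau=-1/\tau$ of the modular group: $$(y_1(T\tau),iy_3(T\tau))=(y_1(\tau),iy_3(\tau))\,\rho(T),$$ $$(y_1(S\tau),iy_3(S\tau))=(y_1(\tau),iy_3(\tau))\,\rho(S),$$ where $$\rho(T)=\begin{pmatrix}1&4iG_{12}(1-Z_1)\\0&Z_1\end{pmatrix},\qquad \rho(S)=\begin{pmatrix}-1&0\\-4iG_{21}&1\end{pmatrix}.$$
   Context: For rational $k$ and integer $m$, ''$k\equiv m\pmod{12}$'' means $k-m\in12\mathbb{Z}$. Put $\theta=\frac{1+k}{6}\pi$, $Z_1=e^{2i\theta}$, $$G_{12}=\frac{\sqrt\pi\,\Gamma(\frac{1+k}{6})}{4\Gamma(\frac{2+k}{12})\Gamma(\frac{6+k}{12})},\qquad G_{21}=\frac{\sqrt\pi\,\Gamma(\frac{5-k}{6})}{2\Gamma(\frac{6-k}{12})\Gamma(\frac{10-k}{12})}.$$ Stiller basis: with $a=-\frac{k}{12}$, $b=-\frac{k-4}{12}$, $c=-\frac{k-5}{6}$ and $F$ the Gauss hypergeometric function, let $y_1(x)=F(a,b,c;x)$ and $y_3(x)=F(a,b,a+b-c+1;1-x)$; these are solutions of $x(1-x)y''+(c-(a+b+1)x)y'-ab\,y=0$, and for $k\not\equiv0,4,5,11\pmod{12}$ they form a fundamental system. For $\tau$ in the upper half-plane $\mathbb{H}$,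 the functions $y_1(\tau)$ and $iy_3(\tau)$ are obtained by composing $y_1(x)$ and $iy_3(x)$ with $x=1728/j(\tau)$, where $j$ is the modular invariant. The relations are understood through analytic continuation: under $\tau\mapsto T\tau$ near the cusp at infinity, $x$ traces a full counterclockwise loop around $x=0$, and under $\tau\mapsto S\tau$ near $\tau=i$, $x$ traces a full loop around $x=1$. *)

(* Defs.v *)
From Stdlib Require Import Reals List ZArith QArith Qreals.
From Coquelicot Require Import Coquelicot.
Open Scope R_scope.

Definition cong12 (k : Q) (m : Z) : Prop :=
  exists n : Z, (k - inject_Z m == 12 * inject_Z n)%Q.

(* The rising factorial a (a + 1) ... (a + n - 1). *)
Fixpoint poch (a : R) (n : nat) : R :=
  match n with
  | O => 1
  | S n' => poch a n' * (a + INR n')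
  end.

(* Gauss's limit for 1 / Gamma, an entire function that vanishes exactly at the
   poles 0, -1, -2, ... of Gamma.  A factor Gamma in a denominator is written
   with rGamma, so that it means 0 at those poles. *)
Definition rGamma (z : R) : R :=
  real (Lim_seq (fun n => poch z (S n) / (INR (fact n) * Rpower (INR n) z))).

(* Meaningful only away from 0, -1, -2, ... *)
Definition Gamma (z : R) : R := / rGamma z.

Open Scope C_scope.

Definition Cexp (z : C) : C := RtoC (exp (Re z)) * (cos (Im z), sin (Im z)).

(* Meaningful only when both real series converge. *)
Definition CSeries (u : nat -> C) : C :=
  (Series (fun n => Re (u n)), Series (fun n => Im (u n))).

(* The Gauss hypergeometric series, meaningful for Cmod z < 1 and c not in
   {0, -1, -2, ...}. *)
Definition hypF (a b c : R) (z : C) : C :=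
  CSeries (fun n =>
    RtoC (poch a n * poch b n / (poch c n * INR (fact n)))%R * z ^ n).

Definition divisor_sum (p n : nat) : nat :=
  fold_right Nat.add 0%nat
    (map (fun d => Nat.pow d p)
       (filter (fun d => Nat.eqb (Nat.modulo n d) 0) (seq 1 n))).

Definition nome (tau : C) : C := Cexp (2 * PI * Ci * tau).

Definition E4 (tau : C) : C :=
  1 + 240 * CSeries (fun n => INR (divisor_sum 3 (S n)) * nome tau ^ S n).

Definition E6 (tau : C) : C :=
  1 - 504 * CSeries (fun n => INR (divisor_sum 5 (S n)) * nome tau ^ S n).

Definition j_inv (tau : C) : C :=
  1728 * E4 tau ^ 3 / (E4 tau ^ 3 - E6 tau ^ 2).

Definition x_of (tau : C) : C := 1728 / j_inv tau.

Definition par_a (k : R) : R := (- (k / 12))%R.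
Definition par_b (k : R) : R := (- ((k - 4) / 12))%R.
Definition par_c (k : R) : R := (- ((k - 5) / 6))%R.

Definition y1 (k : R) (x : C) : C := hypF (par_a k) (par_b k) (par_c k) x.

Definition y3 (k : R) (x : C) : C :=
  hypF (par_a k) (par_b k) (par_a k + par_b k - par_c k + 1)%R (1 - x).

Definition holomorphic_above (h : R) (f : C -> C) : Prop :=
  forall tau : C, (h < Im tau)%R -> ex_derive f tau.

(* Y1 and Y3 are the analytic continuations to the half-plane Im tau > h of the
   germs of y1(x(tau)) and y3(x(tau)) at the points tau = i t, t > 1.  There
   0 < x(tau) < 1, so that both hypergeometric series converge; as the
   half-plane is connected, Y1 and Y3 are determined on it by these germs.
   Agreement with the series is not asked elsewhere: at i t with t < 1, or at
   1 + i t, the continuation is in general a different branch. *)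
Definition stiller_continuation (k h : R) (Y1 Y3 : C -> C) : Prop :=
  holomorphic_above h Y1 /\ holomorphic_above h Y3 /\
  forall t : R, (1 < t)%R ->
    locally (Ci * t) (fun tau => Y1 tau = y1 k (x_of tau)) /\
    locally (Ci * t) (fun tau => Y3 tau = y3 k (x_of tau)).

Definition T_act (tau : C) : C := tau + 1.
Definition S_act (tau : C) : C := - (1) / tau.

Definition theta (k : R) : R := ((1 + k) / 6 * PI)%R.
Definition Z1 (k : R) : C := Cexp (2 * Ci * theta k).

Definition G12 (k : R) : R :=
  (sqrt PI * Gamma ((1 + k) / 6) / 4
   * rGamma ((2 + k) / 12) * rGamma ((6 + k) / 12))%R.

Definition G21 (k : R) : R :=
  (sqrt PI * Gamma ((5 - k) / 6) / 2
   * rGamma ((6 - k) / 12) * rGamma ((10 - k) / 12))%R.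

Definition row2 (u v : C) : @matrix C 1 2 := ((u, (v, tt)), tt).

Definition mat2 (a b c d : C) : @matrix C 2 2 :=
  ((a, (b, tt)), ((c, (d, tt)), tt)).

Definition rho_T (k : R) : @matrix C 2 2 :=
  mat2 1 (4 * Ci * G12 k * (1 - Z1 k))
       0 (Z1 k).

Definition rho_S (k : R) : @matrix C 2 2 :=
  mat2 (- (1))              0
       (- (4 * Ci * G21 k)) 1.

(* The row vector (y1(tau), i y3(tau)). *)
Definition stiller_row (Y1 Y3 : C -> C) (tau : C) : @matrix C 1 2 :=
  row2 (Y1 tau) (Ci * Y3 tau).

(* Main.v *)
(* Let [s = E6 / E4 ^ (3 / 2)], so that [x = 1728 / j = 1 - s ^ 2].  As [c = a + b + 1/2], the
   hypergeometric equation becomes [(1 - s^2) y'' = 2 c s y' + 4 a b y], regular at [s = 0].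
   There [y3 = F(a, b; 1/2; s^2)] is the even solution [ev] and [y1 = cA ev + cB od], with
   [od] the odd solution; the constants are found by Abel summation as [s] tends to 0 along
   the reals.  If [Im tau] exceeds some [h < 1], then [s] lies in the union of the half-plane
   [Re s > 0] and the unit disk, where [y1] continues to a function [Gf] of [s].

   [T] fixes [s], hence [y1].  Near [tau = i] the function [y3] is the combination
   [A y1 + B x^(1 - c) F(a - c + 1, b - c + 1; 2 - c; x)], with [A] given by a Wronskian, and [T]
   multiplies the second summand by [Z1].  If [Im tau] and [Im (- 1 / tau)] both exceed [h],
   then [tau] is close to [i], and [S] maps [s] to [- s]: it fixes [y3] and sends [y1] to
   [- y1 + 2 cA y3].

   The modularity of [E4] and [E6] under [S] comes from the sum of [(m tau + n)^(-k)] over a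
   square box, which is visibly modular.  The rational function [f q], the sum of
   [n^(k - 1) q^n], satisfies [f e + f (- e) = 2^k f (e^2)]; iterating this and comparing
   [f] with its polar part at [q = 1] identifies the limit of the box sums with the Lambert
   series. *)

Require Import Defs.
From Stdlib Require Import Reals ZArith QArith Qreals.
From Coquelicot Require Import Coquelicot.
From Stdlib Require Import Lra Lia Psatz Factorial List.

(** * Complex derivatives *)

Open Scope C_scope.

(** The hypergeometric series cannot carry the continuation by themselves: near [1/2 + i] both [|x|]
    and [|1 - x|] exceed 1, and no half-plane [Im tau > h] with [h < 1] avoids such points. This is
    why a series in [(1 - s) / (1 + s)] is used, which converges for [Re s > 0].

    No classical transformation of [F] is derived by manipulating series or integrals. Each is an
    equality between two solutions of one linear equation, obtained from uniqueness: at ordinary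
    points by an energy estimate, and at the singular point [s = 1] by asymptotic expansions on the
    real axis, which a non-integral power cannot have. Even the Gamma identities that are needed
    come out as values of Wronskians.

    The requirement [h < 1], without which [S] would have no room to act, makes the estimates
    numerical: everything has to hold for [|q|] slightly above [exp (- 2 PI)], about [1 / 535], and
    [1 / 530] is the bound chosen. On the other hand [S] is only ever applied close to [i], so the
    modularity of [E4] and [E6] is needed on a small domain only. *)

Definition cder (f : C -> C) (z l : C) : Prop :=
  forall eps : R, (0 < eps)%R -> exists delta : R, (0 < delta)%R /\
  forall h : C, (Cmod h < delta)%R ->
    (Cmod (f (z + h)%C - f z - l * h)%C <= eps * Cmod h)%R.

(** Two module structures on [C] occur: this one is that of the final holomorphy claim, while the
    product and chain rules below are used over [AbsRing_NormedModule C_AbsRing]. *)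
Lemma cder_is_derive f z l :
  cder f z l -> is_derive (K := C_AbsRing) (V := C_NormedModule) f z l.
Proof.
intros H; split.
- apply (is_linear_scal_l (K := C_AbsRing) (V := C_NormedModule)).
- intros x Hx.
  apply (is_filter_lim_locally_unique (V := AbsRing_NormedModule C_AbsRing)) in Hx.
  subst x.
  intros eps. destruct (H eps (cond_pos eps)) as [d [Hd Hh]].
  exists (mkposreal d Hd). intros y Hy. change C in y. change C in z.
  specialize (Hh (y - z) Hy).
  replace (z + (y - z)) with y in Hh by ring.
  replace (f y - f z - l * (y - z)) with (f y - f z - (y - z) * l) in Hh by ring.
  exact Hh.
Qed.

Lemma is_derive_cder f z l :
  is_derive (K := C_AbsRing) (V := AbsRing_NormedModule C_AbsRing) f z l -> cder f z l.
Proof.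
intros [_ H] eps He.
specialize (H z (fun P HP => HP) (mkposreal eps He)).
destruct H as [d Hd].
exists d. split. apply cond_pos.
intros h Hh.
assert (Hb : ball (M := AbsRing_UniformSpace C_AbsRing) z d (z + h)).
{ change (Cmod (z + h - z)%C < d)%R. replace (z + h - z) with h by ring. exact Hh. }
specialize (Hd _ Hb).
change (Cmod (f (z + h)%C - f z - (z + h - z) * l)%C <= eps * Cmod (z + h - z)%C)%R in Hd.
replace (z + h - z) with h in Hd by ring.
replace (f (z + h)%C - f z - l * h) with (f (z + h)%C - f z - h * l) by ring.
exact Hd.
Qed.

Lemma cder_is_derive' f z l :
  cder f z l -> is_derive (K := C_AbsRing) (V := (AbsRing_NormedModule C_AbsRing)) f z l.
Proof.
intros H; split.
- apply (is_linear_scal_l (K := C_AbsRing) (V := (AbsRing_NormedModule C_AbsRing))).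
- intros x Hx.
  apply (is_filter_lim_locally_unique (V := AbsRing_NormedModule C_AbsRing)) in Hx.
  subst x.
  intros eps. destruct (H eps (cond_pos eps)) as [d [Hd Hh]].
  exists (mkposreal d Hd). intros y Hy. change C in y. change C in z.
  specialize (Hh (y - z) Hy).
  replace (z + (y - z)) with y in Hh by ring.
  replace (f y - f z - l * (y - z)) with (f y - f z - (y - z) * l) in Hh by ring.
  exact Hh.
Qed.

Lemma cder_mult f g z df dg : cder f z df -> cder g z dg ->
  cder (fun x => f x * g x) z (df * g z + f z * dg).
Proof.
intros Hf Hg. apply is_derive_cder.
apply (is_derive_mult (K := C_AbsRing) f g z df dg).
now apply cder_is_derive'. now apply cder_is_derive'. intros; apply Cmult_comm.
Qed.

Lemma cder_comp f g z df dg : cder f (g z) df -> cder g z dg ->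
  cder (fun x => f (g x)) z (dg * df).
Proof.
intros Hf Hg. apply is_derive_cder.
apply (is_derive_comp (K := C_AbsRing) (V := AbsRing_NormedModule C_AbsRing) f g z df dg).
now apply cder_is_derive'. now apply cder_is_derive'.
Qed.

Lemma cder_plus f g z df dg : cder f z df -> cder g z dg ->
  cder (fun x => f x + g x) z (df + dg).
Proof.
intros Hf Hg. apply is_derive_cder.
apply (is_derive_plus (K := C_AbsRing) (V := AbsRing_NormedModule C_AbsRing) f g z df dg); now apply cder_is_derive'.
Qed.

Lemma cder_ext f g z l : (forall x, f x = g x) -> cder f z l -> cder g z l.
Proof. intros E H eps He. destruct (H eps He) as [d [Hd Hh]].
exists d; split; auto. intros h Hl. rewrite <- !E; auto. Qed.

Lemma cder_eq f z l l' : l = l' -> cder f z l -> cder f z l'.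
Proof. now intros ->. Qed.

Lemma cder_ext_loc f g z l (d : R) : (0 < d)%R ->
  (forall x, (Cmod (x - z)%C < d)%R -> f x = g x) -> cder f z l -> cder g z l.
Proof.
intros Hd0 E H eps He. destruct (H eps He) as [d' [Hd Hh]].
exists (Rmin d d'). split. apply Rmin_case; lra.
intros h Hl.
assert (Hl1 := Rlt_le_trans _ _ _ Hl (Rmin_l _ _)).
assert (Hl2 := Rlt_le_trans _ _ _ Hl (Rmin_r _ _)).
rewrite <- !E; auto.
replace (z - z) with (RtoC 0) by ring. rewrite Cmod_0. lra.
replace (z + h - z) with h by ring. auto.
Qed.

Lemma cder_const c z : cder (fun _ => c) z 0.
Proof. intros eps He; exists 1%R; split; [lra|]. intros h _.
replace (c - c - 0 * h) with (RtoC 0) by ring. rewrite Cmod_0.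
apply Rmult_le_pos; [lra|apply Cmod_ge_0]. Qed.

Lemma cder_id z : cder (fun x => x) z 1.
Proof. intros eps He; exists 1%R; split; [lra|]. intros h _.
replace (z + h - z - 1 * h) with (RtoC 0) by ring. rewrite Cmod_0.
apply Rmult_le_pos; [lra|apply Cmod_ge_0]. Qed.

Lemma cder_scal c f z l : cder f z l -> cder (fun x => c * f x) z (c * l).
Proof. intros H. eapply cder_eq; [|apply (cder_mult _ _ _ _ _ (cder_const c z) H)]. ring. Qed.

Lemma cder_minus f g z df dg : cder f z df -> cder g z dg ->
  cder (fun x => f x - g x) z (df - dg).
Proof.
intros Hf Hg. apply (cder_ext (fun x => f x + (-(1)) * g x)). intros; ring.
eapply cder_eq; [|apply (cder_plus _ _ _ _ _ Hf (cder_scal (-(1)) _ _ _ Hg))]. ring.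
Qed.

Definition ccont (f : C -> C) (z : C) : Prop :=
  forall eps : R, (0 < eps)%R -> exists delta : R, (0 < delta)%R /\
  forall h : C, (Cmod h < delta)%R -> (Cmod (f (z + h)%C - f z)%C < eps)%R.

Lemma cder_ccont f z l : cder f z l -> ccont f z.
Proof.
intros H eps He. destruct (H 1%R Rlt_0_1) as [d [Hd Hh]].
exists (Rmin d (eps / (2 + Cmod l))).
assert (Hl := Cmod_ge_0 l).
split. apply Rmin_case; auto. apply Rdiv_lt_0_compat; lra.
intros h Hl'.
assert (Hl1 := Rlt_le_trans _ _ _ Hl' (Rmin_l _ _)).
assert (Hl2 := Rlt_le_trans _ _ _ Hl' (Rmin_r _ _)).
specialize (Hh _ Hl1).
replace (f (z + h)%C - f z) with ((f (z + h)%C - f z - l * h) + l * h) by ring.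
apply Rle_lt_trans with (1 := Cmod_triangle _ _). rewrite Cmod_mult.
assert (Hh0 := Cmod_ge_0 h).
apply Rmult_lt_compat_r with (r := (2 + Cmod l)%R) in Hl2; [|lra].
replace (eps / (2 + Cmod l) * (2 + Cmod l))%R with eps in Hl2 by (field; lra).
nra.
Qed.

Lemma cder_inv (z : C) : z <> 0 -> cder (fun x => / x) z (- / (z * z)).
Proof.
intros Hz eps He.
assert (Hz0 : (0 < Cmod z)%R) by (apply Cmod_gt_0; exact Hz).
set (m := Cmod z) in *.
exists (Rmin (m / 2) (eps * (m * m * m) / 2)).
split. apply Rmin_case; [lra|]. apply Rmult_lt_0_compat; [|lra].
repeat apply Rmult_lt_0_compat; auto.
intros h Hl'.
assert (Hl1 := Rlt_le_trans _ _ _ Hl' (Rmin_l _ _)).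
assert (Hl2 := Rlt_le_trans _ _ _ Hl' (Rmin_r _ _)).
assert (Hzh : (m / 2 <= Cmod (z + h)%C)%R).
{ assert (H := Cmod_triangle (z + h) (- h)).
  replace (z + h + - h) with z in H by ring. rewrite Cmod_opp in H. fold m in H. lra. }
assert (Hn : z + h <> 0) by (apply Cmod_gt_0; lra).
replace (/ (z + h) - / z - - / (z * z) * h) with (h * h / ((z + h) * (z * z)))
  by (field; auto).
assert (Hzz : (z + h) * (z * z) <> 0).
{ apply Cmult_neq_0; auto. apply Cmult_neq_0; auto. }
rewrite Cmod_div, !Cmod_mult; auto. fold m.
assert (Hh0 := Cmod_ge_0 h).
apply Rle_div_l.
{ apply Rmult_lt_0_compat; [lra|]. now apply Rmult_lt_0_compat. }
apply Rle_trans with (Cmod h * (eps * (m * m * m) / 2))%R.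
- apply Rmult_le_compat_l; lra.
- replace (Cmod h * (eps * (m * m * m) / 2))%R with (eps * Cmod h * (m / 2 * (m * m)))%R by field.
  apply Rmult_le_compat_l. apply Rmult_le_pos; lra.
  apply Rmult_le_compat_r; auto. apply Rmult_le_pos; lra.
Qed.

Lemma cder_Cinv (f : C -> C) (z l : C) : f z <> 0 -> cder f z l ->
  cder (fun x => / f x) z (- l / (f z * f z)).
Proof.
intros Hz H. eapply cder_eq; [|apply (cder_comp _ f z _ _ (cder_inv _ Hz) H)].
field; auto.
Qed.

Lemma cder_div (f g : C -> C) (z df dg : C) : g z <> 0 -> cder f z df -> cder g z dg ->
  cder (fun x => f x / g x) z ((df * g z - f z * dg) / (g z * g z)).
Proof.
intros Hz Hf Hg. eapply cder_eq; [|apply (cder_mult _ _ _ _ _ Hf (cder_Cinv _ _ _ Hz Hg))].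
field; auto.
Qed.

Lemma cder_pow (f : C -> C) (z l : C) (n : nat) : cder f z l ->
  cder (fun x => f x ^ n) z (INR n * f z ^ pred n * l).
Proof.
intros H. induction n as [|n IH].
- simpl. eapply cder_eq; [|apply cder_const]. simpl; ring.
- apply (cder_ext (fun x => f x * f x ^ n)). reflexivity.
  eapply cder_eq; [|apply (cder_mult _ _ _ _ _ H IH)].
  rewrite S_INR, RtoC_plus. destruct n; simpl; ring.
Qed.

Lemma ccont_cder f z : (exists l, cder f z l) -> ccont f z.
Proof. intros [l H]. now apply cder_ccont with l. Qed.

Lemma cder_unique f z l l' : cder f z l -> cder f z l' -> l = l'.
Proof.
intros H H'. apply cder_is_derive in H, H'.
rewrite <- (is_C_derive_unique _ _ _ H). now rewrite <- (is_C_derive_unique _ _ _ H').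
Qed.

Lemma cder_Re_line f z v l (t : R) : cder f (z + t * v)%C l ->
  is_derive (fun u : R => Re (f (z + u * v)%C)) t (Re (l * v)).
Proof.
intros H. apply is_derive_Reals. intros eps He.
assert (Hv := Cmod_ge_0 v).
destruct (H (eps / (2 * (Cmod v + 1)))%R) as [d [Hd Hh]].
{ apply Rdiv_lt_0_compat; lra. }
assert (Hd' : (0 < d / (Cmod v + 1))%R) by (apply Rdiv_lt_0_compat; lra).
exists (mkposreal _ Hd'). intros h Hh0 Hhd. simpl in Hhd.
assert (Hhv : (Cmod (h * v)%C < d)%R).
{ rewrite Cmod_mult, Cmod_R.
  apply Rmult_lt_compat_r with (r := (Cmod v + 1)%R) in Hhd; [|lra].
  replace (d / (Cmod v + 1) * (Cmod v + 1))%R with d in Hhd by (field; lra).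
  apply Rle_lt_trans with (2 := Hhd). apply Rmult_le_compat_l. apply Rabs_pos. lra. }
specialize (Hh _ Hhv).
replace (z + t * v + h * v) with (z + (t + h)%R * v) in Hh by (rewrite RtoC_plus; ring).
assert (Hre := re_le_Cmod (f (z + (t + h)%R * v)%C - f (z + t * v)%C - l * (h * v))).
set (A := f (z + (t + h)%R * v)%C) in *. set (B := f (z + t * v)%C) in *.
assert (E : Re (A - B - l * (h * v)) = ((Re A - Re B) - h * Re (l * v))%R).
{ destruct A, B, l, v; simpl; ring. }
rewrite E in Hre.
replace ((Re A - Re B) / h - Re (l * v))%R with (((Re A - Re B) - h * Re (l * v)) / h)%R by (field; auto).
unfold Rdiv at 1. rewrite Rabs_mult, Rabs_inv.
apply Rlt_div_l. { apply Rlt_gt. now apply Rabs_pos_lt. }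
apply Rle_lt_trans with (1 := Hre). apply Rle_lt_trans with (1 := Hh).
rewrite Cmod_mult, Cmod_R.
assert (0 < Rabs h)%R by now apply Rabs_pos_lt.
apply Rle_lt_trans with (eps / 2 * Rabs h)%R.
- replace (eps / 2 * Rabs h)%R with (eps / (2 * (Cmod v + 1)) * (Rabs h * (Cmod v + 1)))%R by (field; lra).
  apply Rmult_le_compat_l. apply Rlt_le, Rdiv_lt_0_compat; lra.
  apply Rmult_le_compat_l; lra.
- nra.
Qed.

Lemma mvt_bound (f df : R -> R) (M : R) :
  (forall t, 0 <= t <= 1 -> is_derive f t (df t))%R ->
  (forall t, 0 <= t <= 1 -> Rabs (df t) <= M)%R -> (Rabs (f 1 - f 0) <= M)%R.
Proof.
intros Hd Hb.
destruct (MVT_gen f 0 1 df) as [c [Hc E]].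
- intros x Hx. apply Hd. rewrite Rmin_left, Rmax_right in Hx by lra. lra.
- intros x Hx. rewrite Rmin_left, Rmax_right in Hx by lra.
  apply ex_derive_continuous_pt || idtac.
  apply continuity_pt_filterlim. apply (ex_derive_continuous (K := R_AbsRing) (V := R_NormedModule)).
  exists (df x). now apply Hd.
- rewrite Rmin_left, Rmax_right in Hc by lra. rewrite E, Rminus_0_r, Rmult_1_r. now apply Hb.
Qed.

Lemma cmvt (f df : C -> C) (z w : C) (M : R) :
  (forall t : R, 0 <= t <= 1 -> cder f (z + t * (w - z))%C (df (z + t * (w - z))%C))%R ->
  (forall t : R, 0 <= t <= 1 -> Cmod (df (z + t * (w - z))%C)%C <= M)%R ->
  (Cmod (f w - f z)%C <= M * Cmod (w - z)%C)%R.
Proof.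
intros Hd Hb.
set (D := f w - f z).
(* project on the direction of [f w - f z] *)
assert (H : (Cmod D * Cmod D <= Cmod D * (M * Cmod (w - z)%C))%R).
{ assert (E := mvt_bound (fun u : R => Re (Cconj D * f (z + u * (w - z))%C))
     (fun t : R => Re (Cconj D * df (z + t * (w - z))%C * (w - z))) (Cmod D * (M * Cmod (w - z)%C))).
  cbv beta in E.
  replace (z + 1%R * (w - z)) with w in E by ring.
  replace (z + 0%R * (w - z)) with z in E by ring.
  assert (ED : (Re (Cconj D * f w) - Re (Cconj D * f z) = Cmod D * Cmod D)%R).
  { replace (Cmod D * Cmod D)%R with (Cmod D ^ 2)%R by ring. rewrite Cmod2_alt.
    unfold D. destruct (f w), (f z); simpl; ring. }
  rewrite ED in E. rewrite Rabs_pos_eq in E by (apply Rmult_le_pos; apply Cmod_ge_0).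
  apply E.
  - intros t Ht. apply (cder_Re_line (fun x => Cconj D * f x)).
    apply cder_scal. now apply Hd.
  - intros t Ht. apply Rle_trans with (1 := re_le_Cmod _). rewrite !Cmod_mult, Cmod_conj, Rmult_assoc.
    apply Rmult_le_compat_l. apply Cmod_ge_0. apply Rmult_le_compat_r. apply Cmod_ge_0. auto. }
destruct (Req_dec (Cmod D) 0) as [E|E].
- rewrite E. apply Rmult_le_pos; [|apply Cmod_ge_0].
  apply Rle_trans with (2 := Hb 0%R ltac:(lra)). apply Cmod_ge_0.
- apply Rmult_le_reg_l with (2 := H). assert (H0 := Cmod_ge_0 D). lra.
Qed.

Lemma cder0_const (f : C -> C) (z w : C) :
  (forall t : R, 0 <= t <= 1 -> cder f (z + t * (w - z))%C 0)%R -> f w = f z.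
Proof.
intros H. assert (E := cmvt f (fun _ => 0) z w 0 H).
assert (E0 : (Cmod (f w - f z)%C <= 0)%R).
{ rewrite <- (Rmult_0_l (Cmod (w - z)%C)). apply E. intros; rewrite Cmod_0; lra. }
assert (E1 : f w - f z = 0) by (apply Cmod_eq_0; apply Rle_antisym; auto; apply Cmod_ge_0).
replace (f w) with (f w - f z + f z) by ring. rewrite E1. ring.
Qed.

(** * The complex exponential *)

Lemma Cexp_add (z w : C) : Cexp (z + w) = Cexp z * Cexp w.
Proof.
unfold Cexp. destruct z as [a b], w as [c d]. simpl.
rewrite exp_plus, cos_plus, sin_plus. unfold Cmult, RtoC; simpl. f_equal; ring.
Qed.

Lemma Cexp_RtoC (x : R) : Cexp x = exp x.
Proof. unfold Cexp; simpl. rewrite cos_0, sin_0. unfold Cmult, RtoC; simpl. f_equal; ring. Qed.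

Lemma Cexp_0 : Cexp 0 = 1.
Proof. now rewrite Cexp_RtoC, exp_0. Qed.

Lemma Cmod_Cexp (z : C) : Cmod (Cexp z) = exp (Re z).
Proof.
unfold Cexp. rewrite Cmod_mult, Cmod_R, Rabs_pos_eq by apply Rlt_le, exp_pos.
unfold Cmod; simpl.
replace (cos (Im z) * (cos (Im z) * 1) + sin (Im z) * (sin (Im z) * 1))%R with 1%R.
rewrite sqrt_1; ring.
assert (H := sin2_cos2 (Im z)). unfold Rsqr in H. lra.
Qed.

Lemma Cexp_neq_0 (z : C) : Cexp z <> 0.
Proof. apply Cmod_gt_0. rewrite Cmod_Cexp. apply exp_pos. Qed.

Lemma Rabs_sin_le (x : R) : Rabs (sin x) <= Rabs x.
Proof.
replace (sin x) with (sin (1 * x) - sin (0 * x))%R by (rewrite Rmult_1_l, Rmult_0_l, sin_0; ring).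
apply (mvt_bound (fun t => sin (t * x)) (fun t => x * cos (t * x))%R).
- intros t _. auto_derive; auto. ring.
- intros t _. rewrite Rabs_mult. rewrite <- (Rmult_1_r (Rabs x)) at 2.
  apply Rmult_le_compat_l. apply Rabs_pos. apply Rabs_le, COS_bound.
Qed.

Lemma Rabs_cos_1_le (x : R) : Rabs (cos x - 1) <= x ^ 2 / 2.
Proof.
replace x with (2 * (x / 2))%R at 1 by field. rewrite cos_2a_sin.
replace (1 - 2 * sin (x / 2) * sin (x / 2) - 1)%R with (- (2 * (sin (x / 2)) ^ 2))%R by ring.
rewrite Rabs_Ropp, Rabs_pos_eq by nra. rewrite <- pow2_abs.
assert (H := Rabs_sin_le (x / 2)). assert (H0 := Rabs_pos (sin (x / 2))).
assert (E : (Rabs (x / 2) ^ 2 = (x / 2) ^ 2)%R) by apply pow2_abs. nra.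
Qed.

Lemma Rabs_sin_sub_le (x : R) : Rabs (sin x - x) <= Rabs x * (x ^ 2 / 2).
Proof.
replace (sin x - x)%R with ((sin (1 * x) - 1 * x) - (sin (0 * x) - 0 * x))%R
  by (rewrite !Rmult_1_l, !Rmult_0_l, sin_0; ring).
apply (mvt_bound (fun t => sin (t * x) - t * x)%R (fun t => x * (cos (t * x) - 1))%R).
- intros t _. auto_derive; auto. ring.
- intros t Ht. rewrite Rabs_mult.
  apply Rmult_le_compat_l. apply Rabs_pos. apply Rle_trans with (1 := Rabs_cos_1_le _).
  assert (Hx : (0 <= x ^ 2)%R) by nra. rewrite Rpow_mult_distr.
  assert (Ht2 : (0 <= t ^ 2 <= 1)%R) by (split; simpl; nra). nra.
Qed.

Lemma exp_le_inv (x : R) : (x < 1)%R -> (exp x <= / (1 - x))%R.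
Proof.
intros H. rewrite <- (Ropp_involutive x) at 1. rewrite exp_Ropp.
apply Rinv_le_contravar. lra. assert (E := exp_ineq1_le (- x)). lra.
Qed.

Lemma Rabs_exp_sub_le (x : R) : Rabs x <= / 2 -> Rabs (exp x - 1 - x) <= 2 * x ^ 2.
Proof.
intros H. apply Rabs_le_between in H.
assert (H1 := exp_ineq1_le x). assert (H2 := exp_le_inv x ltac:(lra)).
assert (H3 : (/ (1 - x) <= 1 + x + 2 * x ^ 2)%R).
{ apply Rmult_le_reg_r with (1 - x)%R. lra. rewrite Rinv_l by lra. nra. }
rewrite Rabs_pos_eq; nra.
Qed.

Lemma Cmod_le_abs (z : C) : Cmod z <= Rabs (Re z) + Rabs (Im z).
Proof.
assert (H := Cmod2_alt z). assert (H0 := Cmod_ge_0 z).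
assert (H1 := Rabs_pos (Re z)). assert (H2 := Rabs_pos (Im z)).
rewrite <- (pow2_abs (Re z)), <- (pow2_abs (Im z)) in H.
apply Rsqr_incr_0_var; unfold Rsqr; nra.
Qed.

Lemma im_le_Cmod (z : C) : Rabs (Im z) <= Cmod z.
Proof. apply Rle_trans with (2 := Rmax_Cmod z). apply Rmax_r. Qed.

Lemma Cexp_sub_le (h : C) : Cmod h <= / 2 -> Cmod (Cexp h - 1 - h) <= 8 * Cmod h ^ 2.
Proof.
intros H. assert (Hx := re_le_Cmod h). assert (Hy := im_le_Cmod h).
apply Rle_trans with (1 := Cmod_le_abs _).
set (x := Re h) in *. set (y := Im h) in *. set (m := Cmod h) in *.
assert (Hm : (0 <= m)%R) by apply Cmod_ge_0.
replace (Re (Cexp h - 1 - h)%C) with ((exp x - 1 - x) + exp x * (cos y - 1))%R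
  by (unfold Cexp; fold x; fold y; subst x y; destruct h; simpl; ring).
replace (Im (Cexp h - 1 - h)%C) with (exp x * (sin y - y) + ((exp x - 1 - x) + x) * y)%R
  by (unfold Cexp; fold x; fold y; subst x y; destruct h; simpl; ring).
assert (E1 := Rabs_exp_sub_le x ltac:(lra)).
assert (E2 := Rabs_cos_1_le y). assert (E3 := Rabs_sin_sub_le y).
assert (Hx2 : (x ^ 2 <= m ^ 2)%R) by (apply pow_maj_Rabs; lra).
assert (Hy2 : (y ^ 2 <= m ^ 2)%R) by (apply pow_maj_Rabs; lra).
assert (E4 : (Rabs (exp x) <= 2)%R).
{ rewrite Rabs_pos_eq by apply Rlt_le, exp_pos.
  apply Rle_trans with (1 := exp_le_inv x ltac:(apply Rabs_le_between in Hx; lra)).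
  replace 2%R with (/ (/ 2))%R by field. apply Rinv_le_contravar. lra.
  apply Rabs_le_between in Hx; lra. }
assert (H1 := Rabs_triang (exp x - 1 - x) (exp x * (cos y - 1))).
assert (H2 := Rabs_triang (exp x * (sin y - y)) (((exp x - 1 - x) + x) * y)).
rewrite Rabs_mult in H1. rewrite !Rabs_mult in H2.
assert (H3 := Rabs_triang (exp x - 1 - x) x).
assert (P1 := Rabs_pos (exp x)). assert (P2 := Rabs_pos (cos y - 1)). assert (P3 := Rabs_pos (sin y - y)).
assert (P4 := Rabs_pos y). assert (P5 := Rabs_pos x). assert (P6 := Rabs_pos (exp x - 1 - x)).
assert (P7 := Rabs_pos (exp x - 1 - x + x)).
assert (F1 : (Rabs (exp x) * Rabs (cos y - 1) <= 2 * (m ^ 2 / 2))%R) by (apply Rmult_le_compat; lra).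
assert (F2 : (Rabs (sin y - y) <= / 2 * (m ^ 2 / 2))%R).
{ apply Rle_trans with (1 := E3). apply Rmult_le_compat; nra. }
assert (F3 : (Rabs (exp x) * Rabs (sin y - y) <= 2 * (/ 2 * (m ^ 2 / 2)))%R) by (apply Rmult_le_compat; lra).
assert (F4 : (Rabs (exp x - 1 - x + x) * Rabs y <= (2 * m ^ 2 + m) * m)%R) by (apply Rmult_le_compat; lra).
nra.
Qed.

Lemma cder_Cexp (z : C) : cder Cexp z (Cexp z).
Proof.
intros eps He. assert (Hz := Cmod_ge_0 (Cexp z)).
exists (Rmin (/ 2) (eps / (8 * (Cmod (Cexp z) + 1)))). split.
{ apply Rmin_case. lra. apply Rdiv_lt_0_compat; lra. }
intros h Hh.
assert (H1 := Rlt_le_trans _ _ _ Hh (Rmin_l _ _)).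
assert (H2 := Rlt_le_trans _ _ _ Hh (Rmin_r _ _)).
rewrite Cexp_add.
replace (Cexp z * Cexp h - Cexp z - Cexp z * h)%C with (Cexp z * (Cexp h - 1 - h))%C by ring.
rewrite Cmod_mult. assert (H3 := Cexp_sub_le h ltac:(lra)).
assert (Hh0 := Cmod_ge_0 h).
apply Rle_trans with (Cmod (Cexp z) * (8 * Cmod h ^ 2))%R.
now apply Rmult_le_compat_l.
apply Rmult_lt_compat_r with (r := (8 * (Cmod (Cexp z) + 1))%R) in H2; [|lra].
replace (eps / (8 * (Cmod (Cexp z) + 1)) * (8 * (Cmod (Cexp z) + 1)))%R with eps in H2 by (field; lra).
nra.
Qed.

(** * Power series *)

(** The coefficients stay real, so that [CV_radius] and the real theory of power series apply; only
    the argument is complex. *)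
Definition CPS (a : nat -> R) (z : C) : C := CSeries (fun n => a n * z ^ n).

Definition cabs (u : nat -> C) : Prop := ex_series (fun n => Cmod (u n)).

Lemma exS_scal (c : R) (u : nat -> R) : ex_series u -> ex_series (fun n => c * u n)%R.
Proof. exact (ex_series_scal (K := R_AbsRing) (V := R_NormedModule) c u). Qed.

Lemma Series_zero (u : nat -> R) : (forall n, u n = 0)%R -> Series u = 0%R.
Proof.
intros H. rewrite (Series_ext u (fun n => 0 * u n)%R). rewrite Series_scal_l; ring.
intros n; rewrite H; ring.
Qed.

Lemma Series_pos (u : nat -> R) : (forall n, 0 <= u n)%R -> ex_series u -> (0 <= Series u)%R.
Proof.
intros H E. apply Rle_trans with (Series (fun _ => 0)%R).
rewrite Series_zero; auto; lra.
apply Series_le; auto. intros n; split; auto; lra.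
Qed.

Lemma Series_le_ex (u v : nat -> R) : (forall n, u n <= v n)%R -> ex_series u -> ex_series v ->
  (Series u <= Series v)%R.
Proof.
intros H Hu Hv. assert (E := Series_pos (fun n => v n - u n)%R).
rewrite Series_minus in E by auto.
enough (0 <= Series v - Series u)%R by lra. apply E.
intros n; specialize (H n); lra.
now apply (ex_series_minus (K := R_AbsRing) (V := R_NormedModule)).
Qed.

Lemma C_ext (z w : C) : Re z = Re w -> Im z = Im w -> z = w.
Proof. destruct z, w; simpl; congruence. Qed.

Lemma Re_CSeries u : Re (CSeries u) = Series (fun n => Re (u n)).
Proof. reflexivity. Qed.

Lemma Im_CSeries u : Im (CSeries u) = Series (fun n => Im (u n)).
Proof. reflexivity. Qed.

Lemma CSeries_ext u v : (forall n, u n = v n) -> CSeries u = CSeries v.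
Proof. intros H. apply C_ext; apply Series_ext; intros n; now rewrite H. Qed.

Lemma cabs_Re u : cabs u -> ex_series (fun n => Re (u n)).
Proof.
intros H. apply (ex_series_le (K := R_AbsRing) (V := R_CompleteNormedModule) _ (fun n => Cmod (u n))).
intros n; apply re_le_Cmod. exact H.
Qed.

Lemma cabs_Im u : cabs u -> ex_series (fun n => Im (u n)).
Proof.
intros H. apply (ex_series_le (K := R_AbsRing) (V := R_CompleteNormedModule) _ (fun n => Cmod (u n))).
intros n; apply im_le_Cmod. exact H.
Qed.

Lemma cabs_le u (b : nat -> R) : (forall n, Cmod (u n) <= b n) -> ex_series b -> cabs u.
Proof.
intros H Hb. apply (ex_series_le (K := R_AbsRing) (V := R_CompleteNormedModule) _ b); auto.
intros n. change (Rabs (Cmod (u n)) <= b n). rewrite Rabs_pos_eq; auto. apply Cmod_ge_0.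
Qed.

Lemma CSeries_plus u v : cabs u -> cabs v ->
  CSeries (fun n => u n + v n) = CSeries u + CSeries v.
Proof.
intros Hu Hv. apply C_ext.
- change (Series (fun n => Re (u n) + Re (v n))%R = (Series (fun n => Re (u n)) + Series (fun n => Re (v n)))%R).
  apply Series_plus; now apply cabs_Re.
- change (Series (fun n => Im (u n) + Im (v n))%R = (Series (fun n => Im (u n)) + Series (fun n => Im (v n)))%R).
  apply Series_plus; now apply cabs_Im.
Qed.

Lemma CSeries_scal (c : C) u : cabs u -> CSeries (fun n => c * u n) = c * CSeries u.
Proof.
intros Hu. apply C_ext.
- change (Series (fun n => Re c * Re (u n) - Im c * Im (u n))%R =
   (Re c * Series (fun n => Re (u n)) - Im c * Series (fun n => Im (u n)))%R).
  rewrite Series_minus, !Series_scal_l; auto.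
  apply exS_scal. now apply cabs_Re.
  apply exS_scal. now apply cabs_Im.
- change (Series (fun n => Re c * Im (u n) + Im c * Re (u n))%R =
   (Re c * Series (fun n => Im (u n)) + Im c * Series (fun n => Re (u n)))%R).
  rewrite Series_plus, !Series_scal_l; auto.
  apply exS_scal. now apply cabs_Im.
  apply exS_scal. now apply cabs_Re.
Qed.

Lemma cabs_scal (c : C) u : cabs u -> cabs (fun n => c * u n).
Proof.
intros H. apply (cabs_le _ (fun n => Cmod c * Cmod (u n))%R).
intros n; rewrite Cmod_mult; lra.
now apply exS_scal.
Qed.

Lemma cabs_plus u v : cabs u -> cabs v -> cabs (fun n => u n + v n).
Proof.
intros H H'. apply (cabs_le _ (fun n => Cmod (u n) + Cmod (v n))%R).
intros n; apply Cmod_triangle.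
now apply (ex_series_plus (K := R_AbsRing) (V := R_NormedModule)).
Qed.

Lemma CSeries_incr_1 u : cabs u -> CSeries u = u O + CSeries (fun n => u (S n)).
Proof.
intros H. apply C_ext.
- exact (Series_incr_1 _ (cabs_Re _ H)).
- exact (Series_incr_1 _ (cabs_Im _ H)).
Qed.

Lemma Re_Cconj_mult_le (z w : C) : Re z * Re w + Im z * Im w <= Cmod z * Cmod w.
Proof.
assert (H := re_le_Cmod (Cconj z * w)). rewrite Cmod_mult, Cmod_conj in H.
apply Rle_trans with (2 := H). apply Rle_trans with (2 := Rle_abs _).
destruct z, w; simpl; lra.
Qed.

(** As [CSeries] is defined by components, the sum [S] is paired with itself: [|S|^2] is the sum of
    the scalar products of [S] with [u n], each at most [|S| |u n|]; then [|S|] is cancelled. *)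
Lemma Cmod_CSeries_le u : cabs u -> Cmod (CSeries u) <= Series (fun n => Cmod (u n)).
Proof.
intros H. set (S := CSeries u).
assert (E : Cmod S * Cmod S <= Cmod S * Series (fun n => Cmod (u n))).
{ replace (Cmod S * Cmod S)%R with (Cmod S ^ 2)%R by ring. rewrite Cmod2_alt.
  replace (Re S ^ 2 + Im S ^ 2)%R with (Re S * Re S + Im S * Im S)%R by ring.
  unfold S at 2 4. rewrite Re_CSeries, Im_CSeries, <- !Series_scal_l, <- Series_plus.
  - apply Series_le_ex.
    + intros n; apply Re_Cconj_mult_le.
    + apply (ex_series_plus (K := R_AbsRing) (V := R_NormedModule));
      apply exS_scal. now apply cabs_Re. now apply cabs_Im.
    + now apply exS_scal.
  - apply exS_scal. now apply cabs_Re.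
  - apply exS_scal. now apply cabs_Im. }
destruct (Req_dec (Cmod S) 0) as [E0|E0].
- rewrite E0. apply Series_pos; auto. intros n; apply Cmod_ge_0.
- assert (H0 := Cmod_ge_0 S). apply Rmult_le_reg_l with (2 := E). lra.
Qed.

Definition in_disk (a : nat -> R) (z : C) : Prop := Rbar_lt (Cmod z) (CV_radius a).

Lemma cabs_CPS a z : in_disk a z -> cabs (fun n => a n * z ^ n).
Proof.
intros H. unfold cabs. apply (ex_series_ext (fun n => Rabs (a n * Cmod z ^ n))).
- intros n. rewrite Cmod_mult, Cmod_pow, Cmod_R, Rabs_mult, (Rabs_pos_eq (_ ^ n)); auto.
  apply pow_le, Cmod_ge_0.
- apply CV_disk_inside. rewrite Rabs_pos_eq; auto. apply Cmod_ge_0.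
Qed.

Lemma CPS_ext a b z : (forall n, a n = b n) -> CPS a z = CPS b z.
Proof. intros H. apply CSeries_ext. intros n; now rewrite H. Qed.

Lemma CPS_plus a b z : in_disk a z -> in_disk b z ->
  CPS (fun n => a n + b n)%R z = CPS a z + CPS b z.
Proof.
intros Ha Hb. unfold CPS. rewrite <- CSeries_plus by now apply cabs_CPS.
apply CSeries_ext. intros n. rewrite RtoC_plus. ring.
Qed.

Lemma CPS_scal (c : R) a z : in_disk a z -> CPS (fun n => c * a n)%R z = c * CPS a z.
Proof.
intros Ha. unfold CPS. rewrite <- CSeries_scal by now apply cabs_CPS.
apply CSeries_ext. intros n. rewrite RtoC_mult. ring.
Qed.

Lemma CPS_incr a z : in_disk a z ->
  CPS (fun n => match n with O => 0%R | S n => a n end) z = z * CPS a z.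
Proof.
intros Ha. unfold CPS. rewrite CSeries_incr_1.
- rewrite <- CSeries_scal by now apply cabs_CPS. simpl.
  rewrite Cmult_0_l, Cplus_0_l. apply CSeries_ext. intros n; simpl; ring.
- unfold cabs. apply ex_series_incr_1. 
  apply (ex_series_ext (fun n => Cmod (z * (a n * z ^ n)))).
  intros n; f_equal; simpl; ring.
  apply cabs_scal. now apply cabs_CPS.
Qed.

Lemma CPS_head a z : in_disk a z -> CPS a z = a O + z * CPS (fun n => a (S n)) z.
Proof.
intros Ha. unfold CPS. rewrite CSeries_incr_1 by now apply cabs_CPS.
f_equal. simpl; ring.
destruct (Ceq_dec z 0) as [->|Hz].
- rewrite Cmult_0_l. apply C_ext; apply Series_zero; intros n; simpl; ring.
- rewrite <- CSeries_scal. apply CSeries_ext. intros n; simpl; ring.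
  apply cabs_CPS in Ha. unfold cabs in Ha. rewrite ex_series_incr_1 in Ha.
  apply (ex_series_ext (fun n => Cmod (/ z * (a (S n) * z ^ S n)))).
  intros n; f_equal; simpl; field; auto.
  now apply (cabs_scal (/ z) (fun n => a (S n) * z ^ S n)).
Qed.

Lemma CPS_RtoC a (x : R) : CPS a x = PSeries a x.
Proof.
apply C_ext.
- apply Series_ext. intros n. rewrite <- RtoC_pow, <- RtoC_mult. reflexivity.
- change (Series (fun n => Im (a n * RtoC x ^ n)) = 0%R). apply Series_zero. intros n. rewrite <- RtoC_pow, <- RtoC_mult. reflexivity.
Qed.

Lemma CPS_0 a : CPS a 0 = a O.
Proof. rewrite CPS_RtoC, PSeries_0. reflexivity. Qed.

(** The second derivative of [r ^ n]; the truncated predecessors are harmless because a factor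
    vanishes for [n = 0] and [n = 1]. *)
Definition pderD (r : R) (n : nat) : R := (INR n * INR (pred n) * r ^ pred (pred n))%R.

Lemma pow_taylor_bound (z h : C) (r : R) (n : nat) : Cmod z <= r -> Cmod (z + h) <= r ->
  Cmod ((z + h) ^ n - z ^ n - INR n * z ^ pred n * h) <= Cmod h ^ 2 * pderD r n.
Proof.
intros Hz Hzh. assert (H0 := Cmod_ge_0 z).
assert (Hr : (0 <= r)%R) by lra.
induction n as [|n IH].
- simpl. unfold pderD; simpl. replace (1 - 1 - 0 * 1 * h) with (RtoC 0) by ring.
  rewrite Cmod_0. lra.
- destruct n as [|n].
  + unfold pderD; simpl. replace ((z + h) * 1 - z * 1 - 1 * 1 * h) with (RtoC 0) by ring.
    rewrite Cmod_0. lra.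
  + set (m := S n) in *.
    replace ((z + h) ^ S m - z ^ S m - INR (S m) * z ^ pred (S m) * h)
      with ((z + h) * ((z + h) ^ m - z ^ m - INR m * z ^ pred m * h) + INR m * z ^ pred m * (h * h)).
    2:{ rewrite S_INR, RtoC_plus. unfold m; simpl. ring. }
    apply Rle_trans with (1 := Cmod_triangle _ _). rewrite !Cmod_mult, Cmod_pow, Cmod_R.
    rewrite (Rabs_pos_eq (INR m)) by apply pos_INR.
    assert (Hh := Cmod_ge_0 h).
    apply Rle_trans with (r * (Cmod h ^ 2 * pderD r m) + INR m * r ^ pred m * (Cmod h * Cmod h))%R.
    * apply Rplus_le_compat.
      apply Rmult_le_compat; auto; apply Cmod_ge_0.
      apply Rmult_le_compat_r; [nra|]. apply Rmult_le_compat_l; [apply pos_INR|].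
      apply pow_incr; lra.
    * assert (Hp : 0 <= INR m * r ^ pred m * (Cmod h * Cmod h)).
      { apply Rmult_le_pos; [apply Rmult_le_pos|nra]. apply pos_INR. now apply pow_le. }
      apply Rle_trans with (r * (Cmod h ^ 2 * pderD r m) + 2 * (INR m * r ^ pred m * (Cmod h * Cmod h)))%R; [lra|].
      apply Req_le. unfold pderD, m. destruct n as [|n]. simpl; ring.
      simpl Init.Nat.pred. rewrite (S_INR (S (S n))), (S_INR (S n)), (S_INR n). simpl pow. ring.
Qed.

Lemma Rbar_lt_between (x : R) (y : Rbar) : Rbar_lt x y -> exists r : R, (x < r)%R /\ Rbar_lt r y.
Proof.
destruct y as [y| |]; simpl; intros H.
- exists ((x + y) / 2)%R. lra.
- exists (x + 1)%R. split; auto; lra.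
- easy.
Qed.

Lemma ex_series_pderD a (r : R) : 0 <= r -> Rbar_lt r (CV_radius a) ->
  ex_series (fun n => Rabs (a n) * pderD r n)%R.
Proof.
intros Hr H. apply ex_series_incr_1, ex_series_incr_1.
apply (ex_series_ext (fun n => Rabs (PS_derive (PS_derive a) n * r ^ n))).
- intros n. unfold PS_derive, pderD. rewrite !Rabs_mult.
  simpl pred. rewrite (Rabs_pos_eq (INR (S n))), (Rabs_pos_eq (INR (S (S n)))) by apply pos_INR.
  rewrite (Rabs_pos_eq (r ^ n)) by now apply pow_le. simpl Init.Nat.pred. match goal with |- ?x = ?y => change (@eq R x y) end. ring.
- apply CV_disk_inside. rewrite !CV_radius_derive. rewrite Rabs_pos_eq; auto.
Qed.

(** Termwise Taylor estimate: the remainder is at most [|h|^2] times the sum of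
    [|a n| n (n - 1) r^(n - 2)], which converges for [r] strictly between [|z|] and the radius of
    convergence. *)
Lemma cder_CPS a (z : C) : in_disk a z -> cder (CPS a) z (CPS (PS_derive a) z).
Proof.
intros Hz. destruct (Rbar_lt_between _ _ Hz) as [r [Hr HR]].
assert (Hz0 := Cmod_ge_0 z).
set (K := Series (fun n => Rabs (a n) * pderD r n)%R).
assert (HK : 0 <= K).
{ unfold K. apply Series_pos. 2: apply ex_series_pderD; auto; lra.
  intros n. apply Rmult_le_pos; [apply Rabs_pos|].
  unfold pderD. apply Rmult_le_pos. apply Rmult_le_pos; apply pos_INR. apply pow_le; lra. }
assert (Main : forall h : C, Cmod h < r - Cmod z ->
  Cmod (CPS a (z + h)%C - CPS a z - CPS (PS_derive a) z * h) <= Cmod h ^ 2 * K).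
{ intros h Hh.
  assert (Hzh : Cmod (z + h) <= r) by (apply Rle_trans with (1 := Cmod_triangle _ _); lra).
  assert (D1 : in_disk a (z + h)).
  { apply Rbar_le_lt_trans with (2 := HR). exact Hzh. }
  assert (D2 : in_disk (PS_derive a) z) by (unfold in_disk; now rewrite CV_radius_derive).
  assert (A1 := cabs_CPS _ _ D1). assert (A2 := cabs_CPS _ _ Hz). assert (A3 := cabs_CPS _ _ D2).
  assert (A4 : cabs (fun n => a n * (INR n * z ^ pred n))).
  { unfold cabs. apply ex_series_incr_1.
    apply (ex_series_ext (fun n => Cmod (PS_derive a n * z ^ n))); auto.
    intros n. f_equal. unfold PS_derive. rewrite RtoC_mult. simpl pred. ring. }
  assert (E3 : CPS (PS_derive a) z = CSeries (fun n => a n * (INR n * z ^ pred n))).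
  { rewrite (CSeries_incr_1 _ A4). simpl (INR 0). rewrite Cmult_0_l, Cmult_0_r, Cplus_0_l.
    apply CSeries_ext. intros n. unfold PS_derive. rewrite RtoC_mult. simpl pred. ring. }
  rewrite E3. unfold CPS.
  replace (CSeries (fun n => a n * (z + h) ^ n) - CSeries (fun n => a n * z ^ n)
     - CSeries (fun n => a n * (INR n * z ^ pred n)) * h)
   with (CSeries (fun n => a n * ((z + h) ^ n - z ^ n - INR n * z ^ pred n * h))).
  2:{ transitivity (CSeries (fun n => a n * (z + h) ^ n) + (-(1)) * CSeries (fun n => a n * z ^ n)
     + (- h) * CSeries (fun n => a n * (INR n * z ^ pred n))); [|ring].
     rewrite <- !CSeries_scal, <- !CSeries_plus; auto.
     - apply CSeries_ext; intros n; ring.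
     - apply cabs_plus; auto. now apply cabs_scal.
     - now apply cabs_scal.
     - now apply cabs_scal. }
  assert (B : forall n, Cmod (a n * ((z + h) ^ n - z ^ n - INR n * z ^ pred n * h))
      <= Cmod h ^ 2 * (Rabs (a n) * pderD r n)).
  { intros n. rewrite Cmod_mult, Cmod_R.
    replace (Cmod h ^ 2 * (Rabs (a n) * pderD r n))%R with (Rabs (a n) * (Cmod h ^ 2 * pderD r n))%R by ring.
    apply Rmult_le_compat_l. apply Rabs_pos. apply pow_taylor_bound; lra. }
  assert (Ex : ex_series (fun n => Cmod h ^ 2 * (Rabs (a n) * pderD r n))%R).
  { apply exS_scal. apply ex_series_pderD; auto; lra. }
  apply Rle_trans with (1 := Cmod_CSeries_le _ (cabs_le _ _ B Ex)).
  unfold K. rewrite <- Series_scal_l. apply Series_le; auto.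
  intros n; split; auto. apply Cmod_ge_0. }
intros eps He. exists (Rmin (r - Cmod z) (eps / (K + 1))). split.
{ apply Rmin_case. lra. apply Rdiv_lt_0_compat; lra. }
intros h Hh.
assert (H1 := Rlt_le_trans _ _ _ Hh (Rmin_l _ _)).
assert (H2 := Rlt_le_trans _ _ _ Hh (Rmin_r _ _)).
apply Rle_trans with (1 := Main h H1).
apply Rmult_lt_compat_r with (r := (K + 1)%R) in H2; [|lra].
replace (eps / (K + 1) * (K + 1))%R with eps in H2 by (field; lra).
assert (Hh0 := Cmod_ge_0 h). nra.
Qed.

Definition rad1 (a : nat -> R) : Prop := Rbar_le 1 (CV_radius a).

Lemma rad1_disk a z : rad1 a -> Cmod z < 1 -> in_disk a z.
Proof. intros H Hz. apply (Rbar_lt_le_trans (Cmod z) 1 (CV_radius a)). exact Hz. exact H. Qed.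

Lemma rad1_derive a : rad1 a -> rad1 (PS_derive a).
Proof. unfold rad1. now rewrite CV_radius_derive. Qed.

Lemma rad1_bounded a :
  (forall r : R, 0 <= r < 1 -> exists M : R, forall n, Rabs (a n * r ^ n) <= M)%R -> rad1 a.
Proof.
intros H. unfold rad1. destruct (CV_radius_bounded a) as [Hub _].
assert (E : forall r : R, (0 <= r < 1)%R -> Rbar_le r (CV_radius a)).
{ intros r Hr. apply Hub. now apply H. }
destruct (CV_radius a) as [R| |]; simpl in *; auto.
- apply Rnot_lt_le. intros HR. specialize (E (Rmax 0 ((1 + R) / 2))).
  assert (0 <= Rmax 0 ((1 + R) / 2) < 1)%R.
  { split. apply Rmax_l. apply Rmax_case; lra. }
  specialize (E H0). simpl in E. assert (F := Rmax_r 0 ((1 + R) / 2)). lra.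
- apply (E 0%R ltac:(lra)).
Qed.

(** A ratio test without division, hence valid for series that terminate. For [r < 1] the factor
    [(1 + K / (n + 1)) r] is eventually at most 1, so the terms [a n * r ^ n] stop growing. *)
Lemma rad1_ratio a (K : R) (N : nat) :
  (forall n, (N <= n)%nat -> Rabs (a (S n)) <= (1 + K / (INR n + 1)) * Rabs (a n)) -> rad1 a.
Proof.
intros H. apply rad1_bounded. intros r Hr.
destruct (Req_dec r 0) as [Hr0|Hr0].
{ exists (Rabs (a O)). intros n. subst r. destruct n; simpl.
  rewrite Rmult_1_r; lra. rewrite Rmult_0_l, Rmult_0_r, Rabs_R0. apply Rabs_pos. }
assert (HK : exists N', forall n, (N' <= n)%nat -> (1 + K / (INR n + 1)) * r <= 1).
{ destruct (nfloor_ex (Rabs K / (1 - r))) as [N' HN'].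
  { apply Rmult_le_pos. apply Rabs_pos. apply Rlt_le, Rinv_0_lt_compat; lra. }
  exists (S N'). intros n Hn. apply le_INR in Hn. rewrite S_INR in Hn.
  assert (HN2 : (Rabs K / (1 - r) <= INR n + 1)%R) by lra.
  apply (Rmult_le_compat_r (1 - r)) in HN2; [|lra].
  replace (Rabs K / (1 - r) * (1 - r))%R with (Rabs K) in HN2 by (field; lra).
  assert (Hp := pos_INR n).
  assert (K / (INR n + 1) <= 1 - r)%R.
  { apply Rle_div_l. lra. apply Rle_trans with (1 := Rle_abs _). lra. }
  nra. }
destruct HK as [N' HN'].
set (P := (N + N')%nat).
assert (Hbig : forall k, Rabs (a (k + P)%nat * r ^ (k + P)) <= Rabs (a P * r ^ P)).
{ induction k as [|k IH]. simpl; lra.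
  apply Rle_trans with (2 := IH).
  specialize (H (k + P)%nat ltac:(unfold P; lia)). specialize (HN' (k + P)%nat ltac:(unfold P; lia)).
  simpl. rewrite !Rabs_mult, (Rabs_pos_eq r) by lra.
  assert (H0 := Rabs_pos (a (k + P)%nat)). assert (H1 := Rabs_pos (r ^ (k + P))).
  apply Rle_trans with (((1 + K / (INR (k + P) + 1)) * Rabs (a (k + P)%nat)) * (r * Rabs (r ^ (k + P))))%R.
  apply Rmult_le_compat_r; auto. apply Rmult_le_pos; lra.
  replace ((1 + K / (INR (k + P) + 1)) * Rabs (a (k + P)%nat) * (r * Rabs (r ^ (k + P))))%R
   with (((1 + K / (INR (k + P) + 1)) * r) * (Rabs (a (k + P)%nat) * Rabs (r ^ (k + P))))%R by ring.
  rewrite <- (Rmult_1_l (Rabs _ * Rabs _)) at 2.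
  apply Rmult_le_compat_r; auto. now apply Rmult_le_pos. }
assert (Hsmall : forall p, exists M, forall n, (n < p)%nat -> Rabs (a n * r ^ n) <= M).
{ induction p as [|p [M IH]]. exists 0%R; intros; lia.
  exists (Rmax M (Rabs (a p * r ^ p))). intros n Hn.
  destruct (Nat.eq_dec n p) as [->|Hnp]. apply Rmax_r.
  apply Rle_trans with (2 := Rmax_l _ _). apply IH. lia. }
destruct (Hsmall P) as [M HM].
exists (Rmax M (Rabs (a P * r ^ P))). intros n.
destruct (Nat.lt_ge_cases n P) as [HnP|HnP].
- apply Rle_trans with (2 := Rmax_l _ _). auto.
- apply Rle_trans with (2 := Rmax_r _ _).
  replace n with ((n - P) + P)%nat by lia. auto.
Qed.

Lemma rad1_ext a b : (forall n, a n = b n) -> rad1 a -> rad1 b.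
Proof. intros H. unfold rad1. now rewrite (CV_radius_ext a b H). Qed.

Lemma rad1_plus a b : rad1 a -> rad1 b -> rad1 (fun n => a n + b n)%R.
Proof.
intros Ha Hb. unfold rad1. apply Rbar_le_trans with (2 := CV_radius_plus a b).
apply Rbar_min_case; auto.
Qed.

Lemma rad1_scal c a : rad1 a -> rad1 (fun n => c * a n)%R.
Proof.
intros Ha. unfold rad1. destruct (Req_dec c 0) as [->|Hc].
- rewrite (CV_radius_ext _ (fun _ => 0%R)) by (intros; ring). rewrite CV_radius_const_0. exact I.
- change (Rbar_le 1 (CV_radius (PS_scal c a))). rewrite (CV_radius_scal c a Hc). auto.
Qed.

Lemma rad1_incr a : rad1 a -> rad1 (fun n => match n with O => 0%R | S n => a n end).
Proof. intros Ha. unfold rad1. change (Rbar_le 1 (CV_radius (PS_incr_1 a))). now rewrite CV_radius_incr_1. Qed.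

Lemma rad1_theta a : rad1 a -> rad1 (fun n => INR n * a n)%R.
Proof.
intros Ha. apply rad1_derive, rad1_incr in Ha. revert Ha. apply rad1_ext.
intros [|n]; unfold PS_derive; simpl; ring.
Qed.

(** The Euler operator [z d/dz] multiplies the [n]-th coefficient by [n]; it translates recurrences
    between coefficients into differential equations. *)
Lemma CPS_theta a z : rad1 a -> Cmod z < 1 ->
  z * CPS (PS_derive a) z = CPS (fun n => INR n * a n)%R z.
Proof.
intros Ha Hz. rewrite <- CPS_incr.
- apply CPS_ext. intros [|n]; unfold PS_derive; simpl; ring.
- apply rad1_disk; auto. now apply rad1_derive.
Qed.

(** * The hypergeometric equation *)

Definition hc (a b c : R) (n : nat) : R := (poch a n * poch b n / (poch c n * INR (fact n)))%R.

Definition nonpole (c : R) : Prop := forall n : nat, (c + INR n <> 0)%R.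

Lemma poch_neq_0 c n : nonpole c -> poch c n <> 0%R.
Proof.
intros H. induction n as [|n IH]; simpl. lra. now apply Rmult_integral_contrapositive.
Qed.

Lemma hc_S a b c n : nonpole c ->
  (INR (S n) * (c + INR n) * hc a b c (S n) = (a + INR n) * (b + INR n) * hc a b c n)%R.
Proof.
intros H. unfold hc. rewrite fact_simpl, mult_INR. simpl poch.
assert (H1 := poch_neq_0 c n H). assert (H2 := INR_fact_neq_0 n). assert (H3 := H n).
assert (H4 : INR (S n) <> 0%R) by (apply not_0_INR; lia).
field; auto.
Qed.

Lemma rad1_hc a b c : nonpole c -> rad1 (hc a b c).
Proof.
intros Hc.
(* For [n >= 1 + 2 |c|] one has [c + n >= (n + 1) / 2], which bounds [1 / (c + n)] by
   [2 / (n + 1)]. *)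
destruct (nfloor_ex (1 + 2 * Rabs c)) as [N HN]. { assert (H := Rabs_pos c); lra. }
apply (rad1_ratio _ (2 * Rabs (a - c) + Rabs (b - 1) + 2 * Rabs (a - c) * Rabs (b - 1)) (S N)).
intros n Hn. apply le_INR in Hn. rewrite S_INR in Hn.
assert (E := hc_S a b c n Hc). rewrite S_INR in E.
assert (Hn0 := pos_INR n).
assert (Hcn : ((INR n + 1) / 2 <= c + INR n)%R).
{ assert (H := Rle_abs (- c)). rewrite Rabs_Ropp in H. lra. }
assert (E1 : (hc a b c (S n) = (1 + (a - c) / (c + INR n)) * (1 + (b - 1) / (INR n + 1)) * hc a b c n)%R).
{ apply (Rmult_eq_reg_l ((INR n + 1) * (c + INR n))%R). rewrite E. field. split; lra.
  apply Rmult_integral_contrapositive; lra. }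
rewrite E1, !Rabs_mult. apply Rmult_le_compat_r. apply Rabs_pos.
set (A := Rabs (a - c)). set (B := Rabs (b - 1)).
assert (HA : (0 <= A)%R) by apply Rabs_pos. assert (HB : (0 <= B)%R) by apply Rabs_pos.
assert (F1 : (Rabs (1 + (a - c) / (c + INR n)) <= 1 + 2 * A / (INR n + 1))%R).
{ apply Rle_trans with (1 := Rabs_triang _ _). rewrite Rabs_R1. apply Rplus_le_compat_l.
  unfold Rdiv. rewrite Rabs_mult, Rabs_inv, (Rabs_pos_eq (c + INR n)) by lra. fold A.
  replace (2 * A * / (INR n + 1))%R with (A * / ((INR n + 1) / 2))%R by (field; lra).
  apply Rmult_le_compat_l; auto. apply Rinv_le_contravar; lra. }
assert (F2 : (Rabs (1 + (b - 1) / (INR n + 1)) <= 1 + B / (INR n + 1))%R).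
{ apply Rle_trans with (1 := Rabs_triang _ _). rewrite Rabs_R1. apply Rplus_le_compat_l.
  unfold Rdiv. rewrite Rabs_mult, Rabs_inv, (Rabs_pos_eq (INR n + 1)) by lra. apply Rle_refl. }
apply Rle_trans with ((1 + 2 * A / (INR n + 1)) * (1 + B / (INR n + 1)))%R.
apply Rmult_le_compat; auto; apply Rabs_pos.
assert (Hi : (/ (INR n + 1) <= 1)%R).
{ rewrite <- Rinv_1. apply Rinv_le_contravar; lra. }
assert (Hi0 : (0 < / (INR n + 1))%R) by (apply Rinv_0_lt_compat; lra).
unfold Rdiv. set (i := (/ (INR n + 1))%R) in *.
assert (0 <= A * B)%R by now apply Rmult_le_pos.
assert (A * B * (i * i) <= A * B * i)%R. { apply Rmult_le_compat_l; auto. nra. }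
nra.
Qed.

Notation CPS1 u := (CPS (PS_derive u)).

Notation CPS2 u := (CPS (PS_derive (PS_derive u))).

(** The recurrence [hc_S] reads [(T + c) u' = (T + a) (T + b) u], where [T] is the Euler operator
    [z d/dz]; the two sides are [L] and [R2]. *)
Lemma hyp_ode a b c (z : C) : nonpole c -> Cmod z < 1 ->
  let u := hc a b c in
  z * (1 - z) * CPS2 u z + (c - (a + b + 1) * z) * CPS1 u z - a * b * CPS u z = 0.
Proof.
intros Hc Hz u.
assert (Hu : rad1 u) by now apply rad1_hc.
assert (Hu1 := rad1_derive _ Hu). assert (Hu2 := rad1_derive _ Hu1).
assert (T1 := CPS_theta u z Hu Hz). assert (T2 := CPS_theta (PS_derive u) z Hu1 Hz).
assert (L : CPS (fun n => INR n * PS_derive u n + c * PS_derive u n)%R z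
   = z * CPS2 u z + c * CPS1 u z).
{ rewrite CPS_plus, CPS_scal, T2; auto; apply rad1_disk; auto. now apply rad1_theta. now apply rad1_scal. }
assert (R1 : CPS (fun n => match n with O => 0 | S n => INR n * PS_derive u n end)%R z = z * (z * CPS2 u z)).
{ rewrite T2. apply CPS_incr. apply rad1_disk; auto. now apply rad1_theta. }
assert (Hu3 := rad1_incr _ (rad1_theta _ Hu1)). cbv beta in Hu3.
assert (R2 : CPS (fun n => match n with O => 0 | S n => INR n * PS_derive u n end
      + ((a + b + 1) * (INR n * u n) + (a * b) * u n))%R z
    = z * (z * CPS2 u z) + ((a + b + 1)%R * (z * CPS1 u z) + (a * b)%R * CPS u z)).
{ rewrite !CPS_plus, !CPS_scal, R1, T1; auto; apply rad1_disk; auto.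
  now apply rad1_theta. apply rad1_scal. now apply rad1_theta. now apply rad1_scal.
  apply rad1_plus. apply rad1_scal. now apply rad1_theta. now apply rad1_scal. }
assert (E : z * CPS2 u z + c * CPS1 u z =
   z * (z * CPS2 u z) + ((a + b + 1)%R * (z * CPS1 u z) + (a * b)%R * CPS u z)).
{ rewrite <- L, <- R2. apply CPS_ext. intros n.
  assert (E := hc_S a b c n Hc). fold u in E. unfold PS_derive at 1 2.
  replace (INR n * (INR (S n) * u (S n)) + c * (INR (S n) * u (S n)))%R
    with (INR (S n) * (c + INR n) * u (S n))%R by ring.
  rewrite E. destruct n as [|n]; unfold PS_derive; rewrite ?S_INR; simpl; ring. }
rewrite !RtoC_plus, RtoC_mult in E.
replace (z * (1 - z) * CPS2 u z + (c - (a + b + 1) * z) * CPS1 u z - a * b * CPS u z)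
  with ((z * CPS2 u z + c * CPS1 u z) -
   (z * (z * CPS2 u z) + ((a + b + 1) * (z * CPS1 u z) + (a * b) * CPS u z))) by ring.
rewrite E. ring.
Qed.

(** * The binomial series *)

Definition bc (r : R) (n : nat) : R := ((-1) ^ n * poch (- r) n / INR (fact n))%R.

(* The principal branch of [(1 + z) ^ r], for [Cmod z < 1]. *)
Definition pow1p (r : R) (z : C) : C := CPS (bc r) z.

Lemma bc_S r n : (INR (S n) * bc r (S n) = (r - INR n) * bc r n)%R.
Proof.
unfold bc. rewrite fact_simpl, mult_INR. simpl poch. rewrite <- tech_pow_Rmult.
assert (H2 := INR_fact_neq_0 n).
assert (H4 : INR (S n) <> 0%R) by (apply not_0_INR; lia).
field; auto.
Qed.

Lemma rad1_bc r : rad1 (bc r).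
Proof.
apply (rad1_ratio _ (Rabs (r + 1)) 0). intros n _.
assert (E := bc_S r n). rewrite S_INR in E. assert (Hn0 := pos_INR n).
assert (E1 : (bc r (S n) = (-1 + (r + 1) / (INR n + 1)) * bc r n)%R).
{ apply (Rmult_eq_reg_l (INR n + 1)%R). rewrite E. field. lra. lra. }
rewrite E1, Rabs_mult. apply Rmult_le_compat_r. apply Rabs_pos.
apply Rle_trans with (1 := Rabs_triang _ _).
unfold Rdiv. rewrite Rabs_mult, Rabs_inv, (Rabs_pos_eq (INR n + 1)) by lra.
replace (Rabs (-1)) with 1%R. lra. rewrite Rabs_left; lra.
Qed.

Lemma C1z_neq_0 (z : C) : Cmod z < 1 -> 1 + z <> 0.
Proof.
intros H E. assert (z = -(1)). { replace z with (1 + z - 1) by ring. rewrite E. ring. }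
subst z. rewrite Cmod_m1 in H. lra.
Qed.

Lemma cder_pow1p r (z : C) : Cmod z < 1 -> cder (pow1p r) z (r * pow1p r z / (1 + z)).
Proof.
intros Hz. assert (Hu := rad1_bc r).
assert (H1 := C1z_neq_0 z Hz).
eapply cder_eq; [|apply (cder_CPS (bc r) z); now apply rad1_disk].
assert (E : CPS1 (bc r) z + z * CPS1 (bc r) z = r * pow1p r z).
{ rewrite (CPS_theta _ _ Hu Hz). unfold pow1p. rewrite <- CPS_scal, <- CPS_plus.
  - apply CPS_ext. intros n. unfold PS_derive. rewrite bc_S. ring.
  - apply rad1_disk; auto. now apply rad1_derive.
  - apply rad1_disk; auto. now apply rad1_theta.
  - now apply rad1_disk. }
rewrite <- E. field; auto.
Qed.

Lemma pow1p_at_0 r : pow1p r 0 = 1.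
Proof. unfold pow1p. rewrite CPS_0. unfold bc; simpl. f_equal. field. Qed.

Lemma Cmod_seg (z : C) (t : R) : 0 <= t <= 1 -> Cmod z < 1 -> Cmod (0 + t * (z - 0)) < 1.
Proof.
intros Ht Hz. replace (0 + t * (z - 0)) with (t * z) by ring.
rewrite Cmod_mult, Cmod_R, Rabs_pos_eq by lra. assert (H := Cmod_ge_0 z). nra.
Qed.

(** The exponents add up to 0, so the logarithmic derivatives cancel. Taking [r' = 0] yields
    inverses, and inverses together with the general case yield additivity. *)
Lemma pow1p_triple r r' (z : C) : Cmod z < 1 -> pow1p r z * (pow1p r' z * pow1p (- (r + r')) z) = 1.
Proof.
intros Hz.
rewrite (cder0_const (fun z => pow1p r z * (pow1p r' z * pow1p (- (r + r')) z)) 0 z).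
- rewrite !pow1p_at_0; ring.
- intros t Ht. assert (H := Cmod_seg z t Ht Hz). set (y := 0 + t * (z - 0)) in *.
  assert (H1 := C1z_neq_0 y H).
  eapply cder_eq; [|apply cder_mult; [now apply cder_pow1p|apply cder_mult; now apply cder_pow1p]].
  rewrite RtoC_opp, RtoC_plus. field; auto.
Qed.

Lemma pow1p_0 (z : C) : Cmod z < 1 -> pow1p 0 z = 1.
Proof.
intros Hz. rewrite (cder0_const (pow1p 0) 0 z). apply pow1p_at_0.
intros t Ht. assert (H := Cmod_seg z t Ht Hz). set (y := 0 + t * (z - 0)) in *.
assert (H1 := C1z_neq_0 y H).
eapply cder_eq; [|now apply cder_pow1p]. field; auto.
Qed.

Lemma pow1p_opp r (z : C) : Cmod z < 1 -> pow1p r z * pow1p (- r) z = 1.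
Proof.
intros Hz. assert (H := pow1p_triple r 0 z Hz). rewrite pow1p_0 in H by auto.
rewrite Rplus_0_r in H. rewrite <- H. ring.
Qed.

Lemma pow1p_neq_0 r (z : C) : Cmod z < 1 -> pow1p r z <> 0.
Proof.
intros Hz E. assert (H := pow1p_opp r z Hz). rewrite E, Cmult_0_l in H.
apply (f_equal Re) in H. simpl in H. lra.
Qed.

Lemma pow1p_add r r' (z : C) : Cmod z < 1 -> pow1p r z * pow1p r' z = pow1p (r + r') z.
Proof.
intros Hz. assert (H := pow1p_triple r r' z Hz). assert (H' := pow1p_opp (r + r') z Hz).
assert (Hn := pow1p_neq_0 (- (r + r')) z Hz).
set (p := pow1p (- (r + r')) z) in *.
transitivity (pow1p (r + r') z * p * (pow1p r z * pow1p r' z)).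
rewrite H'. ring. transitivity (pow1p (r + r') z * (pow1p r z * (pow1p r' z * p))). ring. rewrite H. ring.
Qed.

Lemma pow1p_1 (z : C) : Cmod z < 1 -> pow1p 1 z = 1 + z.
Proof.
intros Hz. assert (H1 := C1z_neq_0 z Hz).
assert (H : pow1p 1 z / (1 + z) = pow1p 1 0 / (1 + 0)).
{ apply (cder0_const (fun z => pow1p 1 z / (1 + z)) 0 z).
  intros t Ht. assert (H := Cmod_seg z t Ht Hz). set (y := 0 + t * (z - 0)) in *.
  assert (H2 := C1z_neq_0 y H).
  eapply cder_eq; [|apply cder_div; [exact H2|now apply cder_pow1p|
    apply cder_plus; [apply cder_const|apply cder_id]]].
  field; auto. }
rewrite pow1p_at_0 in H. replace (pow1p 1 z) with (pow1p 1 z / (1 + z) * (1 + z)) by (field; auto).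
rewrite H. field.
Qed.

Lemma is_derive_const_on (f : R -> R) (x y : R) :
  (forall t, Rmin x y <= t <= Rmax x y -> is_derive f t 0)%R -> f x = f y.
Proof.
intros H. destruct (MVT_gen f x y (fun _ => 0%R)) as [c [_ E]].
- intros t Ht. apply H; lra.
- intros t Ht. apply continuity_pt_filterlim.
  apply (ex_derive_continuous (K := R_AbsRing) (V := R_NormedModule)). exists 0%R. now apply H.
- lra.
Qed.

Lemma pow1p_RtoC r (x : R) : -1 < x < 1 -> pow1p r x = Rpower (1 + x) r.
Proof.
intros Hx.
set (f := fun t : R => Re (pow1p r t)).
assert (Ef : forall t : R, pow1p r t = f t).
{ intros t. unfold f, pow1p. rewrite CPS_RtoC. reflexivity. }
rewrite Ef. f_equal.
assert (Hd : forall t : R, (-1 < t < 1)%R -> is_derive f t (r * f t / (1 + t))%R).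
{ intros t Ht. assert (Hm : Cmod t < 1) by (rewrite Cmod_R; apply Rabs_lt_between; lra).
  assert (D := cder_pow1p r t Hm).
  replace (RtoC t) with (0 + t * 1) in D by ring. apply cder_Re_line in D.
  replace (0 + t * 1) with (RtoC t) in D by ring.
  eapply is_derive_ext; [|eapply (eq_ind _ (fun l => is_derive _ _ l)); [exact D|]].
  - intros u. unfold f. f_equal. f_equal. simpl. ring.
  - rewrite Ef. rewrite <- !RtoC_plus, <- RtoC_mult, <- RtoC_div by lra. simpl. field. lra. }
assert (E : (f x * Rpower (1 + x) (- r) = f 0 * Rpower (1 + 0) (- r))%R).
{ apply (is_derive_const_on (fun t => f t * Rpower (1 + t) (- r))%R).
  intros t Ht.
  assert (Ht' : (-1 < t < 1)%R).
  { revert Ht. unfold Rmin, Rmax. destruct Rle_dec; lra. }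
  eapply (eq_ind _ (fun l => is_derive _ _ l)).
  apply (is_derive_mult f (fun t => Rpower (1 + t) (- r)) t). now apply Hd.
  { unfold Rpower. auto_derive. lra. reflexivity. }
  intros; apply Rmult_comm.
  unfold plus, mult; simpl. unfold Rpower. field. lra. }
assert (E0 : f 0%R = 1%R) by (unfold f; rewrite pow1p_at_0; reflexivity).
rewrite E0, Rplus_0_r in E. rewrite Rpower_Ropp in E. unfold Rpower at 2 in E.
rewrite ln_1, Rmult_0_r, exp_0 in E.
assert (Hp : (0 < Rpower (1 + x) r)%R) by apply exp_pos.
apply (Rmult_eq_reg_r (/ Rpower (1 + x) r)). rewrite E. field; lra.
apply Rinv_neq_0_compat; lra.
Qed.

(* The hypergeometric equation with [c = a + b + 1/2] in the variable [s], [x = 1 - s^2]. *)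
Definition gsol (a b : R) (f f1 f2 : C -> C) (s : C) : Prop :=
  cder f s (f1 s) /\ cder f1 s (f2 s) /\
  (1 - s * s) * f2 s = (2 * a + 2 * b + 1) * s * f1 s + 4 * a * b * f s.

Lemma RtoC_neq_0 (x : R) : x <> 0%R -> RtoC x <> 0.
Proof. intros H E. apply H. now apply (f_equal Re) in E. Qed.

Ltac cnz := repeat split; auto; try (apply RtoC_neq_0; lra).

Lemma Csub_eq (x y : C) : x - y = 0 -> x = y.
Proof. intros H. replace x with (x - y + y) by ring. rewrite H. cbv beta; ring. Qed.

Lemma Cmod_mult_lt1 (s : C) : Cmod s < 1 -> Cmod (s * s) < 1.
Proof. intros H. rewrite Cmod_mult. assert (H0 := Cmod_ge_0 s). nra. Qed.

Lemma cder_sq (s : C) : cder (fun s => s * s) s (2 * s).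
Proof. eapply cder_eq; [|apply cder_mult; apply cder_id]. cbv beta; ring. Qed.

Lemma cder_1sq (s : C) : cder (fun s => 1 - s * s) s (- (2 * s)).
Proof. eapply cder_eq; [|apply cder_minus; [apply cder_const|apply cder_sq]]. cbv beta; ring. Qed.

Lemma cder_CPS_comp u (g : C -> C) (s dg : C) : rad1 u -> Cmod (g s) < 1 -> cder g s dg ->
  cder (fun s => CPS u (g s)) s (dg * CPS1 u (g s)).
Proof.
intros Hu Hg Hd. apply cder_comp; auto. apply cder_CPS. now apply rad1_disk.
Qed.

Definition ev (a b : R) (s : C) : C := CPS (hc a b (1 / 2)) (s * s).

Definition ev1 (a b : R) (s : C) : C := 2 * s * CPS1 (hc a b (1 / 2)) (s * s).

Definition ev2 (a b : R) (s : C) : C :=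
  2 * CPS1 (hc a b (1 / 2)) (s * s) + 2 * s * (2 * s * CPS2 (hc a b (1 / 2)) (s * s)).

Lemma nonpole_half : nonpole (1 / 2).
Proof. intros n. assert (H := pos_INR n). lra. Qed.

Lemma nonpole_3half : nonpole (3 / 2).
Proof. intros n. assert (H := pos_INR n). lra. Qed.

Lemma cder_2s (s : C) : cder (fun s => 2 * s) s 2.
Proof. eapply cder_eq; [|apply cder_scal, cder_id]. cbv beta; ring. Qed.

Lemma ev_gsol a b s : Cmod s < 1 -> gsol a b (ev a b) (ev1 a b) (ev2 a b) s.
Proof.
intros Hs. assert (Hu := rad1_hc a b _ nonpole_half). assert (Hu1 := rad1_derive _ Hu).
assert (Hss := Cmod_mult_lt1 s Hs).
split; [|split].
- unfold ev, ev1. apply (cder_CPS_comp (hc a b (1 / 2)) (fun s => s * s)); auto. apply cder_sq.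
- unfold ev1, ev2. apply (cder_mult (fun s => 2 * s) (fun s => CPS1 (hc a b (1 / 2)) (s * s))). apply cder_2s.
  apply (cder_CPS_comp (PS_derive (hc a b (1 / 2))) (fun s => s * s)); auto. apply cder_sq.
- assert (E := hyp_ode a b (1 / 2) (s * s) nonpole_half Hss). cbv zeta in E.
  unfold ev, ev1, ev2. set (U := CPS (hc a b (1 / 2)) (s * s)) in *.
  set (U1 := CPS1 (hc a b (1 / 2)) (s * s)) in *. set (U2 := CPS2 (hc a b (1 / 2)) (s * s)) in *.
  apply Csub_eq. rewrite RtoC_div in E by lra.
  match type of E with ?X = _ => transitivity (4 * X) end; [field; cnz|rewrite E; ring].
Qed.

Definition od (a b : R) (s : C) : C := s * CPS (hc (a + 1 / 2) (b + 1 / 2) (3 / 2)) (s * s).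

Definition od1 (a b : R) (s : C) : C := let u := hc (a + 1 / 2) (b + 1 / 2) (3 / 2) in
  1 * CPS u (s * s) + s * (2 * s * CPS1 u (s * s)).

Definition od2 (a b : R) (s : C) : C := let u := hc (a + 1 / 2) (b + 1 / 2) (3 / 2) in
  1 * (2 * s * CPS1 u (s * s)) +
  (1 * (2 * s * CPS1 u (s * s)) + s * (2 * CPS1 u (s * s) + 2 * s * (2 * s * CPS2 u (s * s)))).

Lemma od_gsol a b s : Cmod s < 1 -> gsol a b (od a b) (od1 a b) (od2 a b) s.
Proof.
intros Hs. assert (Hu := rad1_hc (a + 1 / 2) (b + 1 / 2) _ nonpole_3half). assert (Hu1 := rad1_derive _ Hu).
assert (Hss := Cmod_mult_lt1 s Hs).
split; [|split].
- unfold od, od1. apply (cder_mult (fun s => s) (fun s => CPS (hc (a + 1 / 2) (b + 1 / 2) (3 / 2)) (s * s))). apply cder_id.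
  apply (cder_CPS_comp (hc (a + 1 / 2) (b + 1 / 2) (3 / 2)) (fun s => s * s)); auto. apply cder_sq.
- unfold od1, od2. apply cder_plus.
  + apply cder_scal. apply (cder_CPS_comp (hc (a + 1 / 2) (b + 1 / 2) (3 / 2)) (fun s => s * s)); auto. apply cder_sq.
  + set (u := hc _ _ _) in *.
    apply (cder_mult (fun s => s) (fun s => 2 * s * CPS1 u (s * s))). apply cder_id.
    apply (cder_mult (fun s => 2 * s) (fun s => CPS1 u (s * s))). apply cder_2s.
    apply (cder_CPS_comp (PS_derive u) (fun s => s * s)); auto. apply cder_sq.
- assert (E := hyp_ode (a + 1 / 2) (b + 1 / 2) (3 / 2) (s * s) nonpole_3half Hss). cbv zeta in E.
  unfold od, od1, od2. set (u := hc (a + 1 / 2) (b + 1 / 2) (3 / 2)) in *. cbv zeta.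
  set (U := CPS u (s * s)) in *.
  set (U1 := CPS1 u (s * s)) in *. set (U2 := CPS2 u (s * s)) in *.
  apply Csub_eq. rewrite !RtoC_plus, !RtoC_div in E by lra.
  match type of E with ?X = _ => transitivity (4 * s * X) end; [field; cnz|rewrite E; ring].
Qed.

Definition Fx (a b c : R) (s : C) : C := CPS (hc a b c) (1 - s * s).

Definition Fx1 (a b c : R) (s : C) : C := - (2 * s) * CPS1 (hc a b c) (1 - s * s).

Definition Fx2 (a b c : R) (s : C) : C :=
  - (2) * CPS1 (hc a b c) (1 - s * s) + - (2 * s) * (- (2 * s) * CPS2 (hc a b c) (1 - s * s)).

Lemma cder_m2s (s : C) : cder (fun s => - (2 * s)) s (- (2)).
Proof. apply (cder_ext (fun s => (- (2)) * s)). intros; ring.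
eapply cder_eq; [|apply cder_scal, cder_id]. cbv beta; ring. Qed.

(** Kept apart from the equation, with [c] free, because [Ex] uses these derivatives for parameters
    that do not satisfy [c = a + b + 1/2]. *)
Lemma Fx_der a b c s : nonpole c -> Cmod (1 - s * s) < 1 ->
  cder (Fx a b c) s (Fx1 a b c s) /\ cder (Fx1 a b c) s (Fx2 a b c s).
Proof.
intros Hc Hs. assert (Hu := rad1_hc a b c Hc). assert (Hu1 := rad1_derive _ Hu).
split.
- apply (cder_CPS_comp (hc a b c) (fun s => 1 - s * s)); auto. apply cder_1sq.
- unfold Fx1, Fx2. apply (cder_mult (fun s => - (2 * s)) (fun s => CPS1 (hc a b c) (1 - s * s))). apply cder_m2s.
  apply (cder_CPS_comp (PS_derive (hc a b c)) (fun s => 1 - s * s)); auto. apply cder_1sq.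
Qed.

Lemma Fx_gsol a b s : nonpole (a + b + 1 / 2) -> Cmod (1 - s * s) < 1 ->
  gsol a b (Fx a b (a + b + 1 / 2)) (Fx1 a b (a + b + 1 / 2)) (Fx2 a b (a + b + 1 / 2)) s.
Proof.
intros Hc Hs. destruct (Fx_der a b _ s Hc Hs) as [D1 D2]. split; [|split]; auto.
assert (E := hyp_ode a b _ (1 - s * s) Hc Hs). cbv zeta in E.
unfold Fx, Fx1, Fx2. set (u := hc a b (a + b + 1 / 2)) in *.
set (U := CPS u (1 - s * s)) in *.
set (U1 := CPS1 u (1 - s * s)) in *. set (U2 := CPS2 u (1 - s * s)) in *.
apply Csub_eq. rewrite !RtoC_plus, !RtoC_div in E by lra.
match type of E with ?X = _ => transitivity (4 * X) end; [field; cnz|rewrite E; ring].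
Qed.

(* Euler's transform [(1 - x) ^ (c - a - b) F(c - a, c - b; c; x)] of [Fx], in the variable [s]. *)
Definition Ex (a b : R) (s : C) : C := s * Fx (a + 1 / 2) (b + 1 / 2) (a + b + 1 / 2) s.

Definition Ex1 (a b : R) (s : C) : C :=
  1 * Fx (a + 1 / 2) (b + 1 / 2) (a + b + 1 / 2) s + s * Fx1 (a + 1 / 2) (b + 1 / 2) (a + b + 1 / 2) s.

Definition Ex2 (a b : R) (s : C) : C := let c := (a + b + 1 / 2)%R in
  1 * Fx1 (a + 1 / 2) (b + 1 / 2) c s +
  (1 * Fx1 (a + 1 / 2) (b + 1 / 2) c s + s * Fx2 (a + 1 / 2) (b + 1 / 2) c s).

Lemma Ex_gsol a b s : nonpole (a + b + 1 / 2) -> Cmod (1 - s * s) < 1 ->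
  gsol a b (Ex a b) (Ex1 a b) (Ex2 a b) s.
Proof.
intros Hc Hs. destruct (Fx_der (a + 1 / 2) (b + 1 / 2) _ s Hc Hs) as [D1 D2].
split; [|split].
- apply cder_mult; auto. apply cder_id.
- apply cder_plus. now apply cder_scal. apply cder_mult; auto. apply cder_id.
- assert (E := hyp_ode (a + 1 / 2) (b + 1 / 2) _ (1 - s * s) Hc Hs). cbv zeta in E.
  unfold Ex, Ex1, Ex2. cbv zeta. unfold Fx, Fx1, Fx2.
  set (u := hc (a + 1 / 2) (b + 1 / 2) (a + b + 1 / 2)) in *.
  set (U := CPS u (1 - s * s)) in *.
  set (U1 := CPS1 u (1 - s * s)) in *. set (U2 := CPS2 u (1 - s * s)) in *.
  apply Csub_eq. rewrite !RtoC_plus, !RtoC_div in E by lra.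
  match type of E with ?X = _ => transitivity (4 * s * X) end; [field; cnz|rewrite E; ring].
Qed.

(* The branch of [x ^ r], [x = 1 - s ^ 2], equal to 1 at [s = 0]. *)
Definition xpw (r : R) (s : C) : C := pow1p r (- (s * s)).

Lemma cder_xpw r s : Cmod s < 1 -> cder (xpw r) s (r * xpw r s / (1 - s * s) * (- (2 * s))).
Proof.
intros Hs. unfold xpw.
assert (Hss : Cmod (- (s * s)) < 1) by (rewrite Cmod_opp; now apply Cmod_mult_lt1).
assert (Hn := C1z_neq_0 _ Hss).
eapply cder_eq; [|apply (cder_comp (pow1p r) (fun s => - (s * s)))].
2: now apply cder_pow1p.
2: { apply (cder_ext (fun s => - (1) * (s * s))). intros; ring. apply cder_scal, cder_sq. }
cbv beta. field. now replace (1 - s * s) with (1 + - (s * s)) by ring.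
Qed.

Definition xm1 (r : R) (f f1 : C -> C) (s : C) : C :=
  xpw r s * (f1 s - 2 * r * s / (1 - s * s) * f s).

Definition xm2 (r : R) (f f1 f2 : C -> C) (s : C) : C :=
  (r * xpw r s / (1 - s * s) * (- (2 * s))) * (f1 s - 2 * r * s / (1 - s * s) * f s)
  + xpw r s * (f2 s - ((2 * r * (1 - s * s) - 2 * r * s * (- (2 * s))) / ((1 - s * s) * (1 - s * s)) * f s
     + 2 * r * s / (1 - s * s) * f1 s)).

(** The exponents at [x = 0] are 0 and [r = 1 - c]. The parameters of the second solution are
    [a - c + 1 = 1/2 - b], [b - c + 1 = 1/2 - a] and [2 - c], which again satisfy the relation
    [c = a + b + 1/2]; all results on the first solution therefore apply to the second. *)
Lemma xm_gsol a b f f1 f2 s : Cmod s < 1 -> gsol (1 / 2 - b) (1 / 2 - a) f f1 f2 s ->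
  let r := (1 / 2 - a - b)%R in
  gsol a b (fun s => xpw r s * f s) (xm1 r f f1) (xm2 r f f1 f2) s.
Proof.
intros Hs [D1 [D2 E]] r. assert (Dx := cder_xpw r s Hs).
assert (Hn : 1 - s * s <> 0).
{ replace (1 - s * s) with (1 + - (s * s)) by ring. apply C1z_neq_0. rewrite Cmod_opp. now apply Cmod_mult_lt1. }
split; [|split].
- eapply cder_eq; [|apply cder_mult; eauto]. unfold xm1. cbv beta; field; auto.
- unfold xm1, xm2. apply (cder_mult (xpw r) (fun s => f1 s - 2 * r * s / (1 - s * s) * f s)); auto.
  apply cder_minus; auto. apply (cder_mult (fun s => 2 * r * s / (1 - s * s)) f); auto.
  apply (cder_div (fun s => 2 * r * s) (fun s => 1 - s * s)); auto. 2: apply cder_1sq.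
  eapply cder_eq; [|apply cder_scal, cder_id]. cbv beta; ring.
- unfold xm1, xm2. apply Csub_eq.
  assert (E' : f2 s = ((2 * (1 / 2 - b)%R + 2 * (1 / 2 - a)%R + 1) * s * f1 s
      + 4 * (1 / 2 - b)%R * (1 / 2 - a)%R * f s) / (1 - s * s)).
  { rewrite <- E. field; auto. }
  rewrite E'. unfold r. rewrite !RtoC_minus, !RtoC_div by lra. field. cnz.
Qed.

(** The Cayley transform from the half-plane [Re s > 0] to the unit disk, with [s = 1] sent to 0.
    For [z = (1 - s) / 2] one has [1 - s^2 = 4 z (1 - z)], the argument of the quadratic
    transformation, and Pfaff's argument [z / (z - 1)] is [- wv s]. *)
Definition wv (s : C) : C := (1 - s) / (1 + s).

Lemma Cmod_wv s : 0 < Re s -> Cmod (wv s) < 1.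
Proof.
intros Hs.
assert (Hn : 1 + s <> 0). { intros E. apply (f_equal Re) in E. destruct s; simpl in *. lra. }
assert (H0 : 0 < Cmod (1 + s)) by now apply Cmod_gt_0.
unfold wv. rewrite Cmod_div by auto. apply Rlt_div_l; [exact H0|].
rewrite Rmult_1_l. apply Rsqr_incrst_0; [|apply Cmod_ge_0|apply Cmod_ge_0].
rewrite !Rsqr_pow2, !Cmod2_alt. destruct s as [x y]; simpl in *. nra.
Qed.

Lemma cder_wv (s : C) : 1 + s <> 0 -> cder wv s (- (2) / ((1 + s) * (1 + s))).
Proof.
intros Hn. unfold wv. eapply cder_eq; [|apply (cder_div (fun s => 1 - s) (fun s => 1 + s)); auto].
2: apply cder_minus; [apply cder_const|apply cder_id].
2: apply cder_plus; [apply cder_const|apply cder_id].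
cbv beta. field; auto.
Qed.

(* A quadratic transformation followed by Pfaff's turns [F(a, b; c; 1 - s ^ 2)] into a series
   that converges on the whole half-plane [0 < Re s]. *)
Definition ph (a b : R) (s : C) : C :=
  pow1p (2 * a) (wv s) * CPS (hc (2 * a) (a - b + 1 / 2) (a + b + 1 / 2)) (- wv s).

Definition ph1 (a b : R) (s : C) : C := let u := hc (2 * a) (a - b + 1 / 2) (a + b + 1 / 2) in
  pow1p (2 * a) (wv s) * (- (2 * a) / (1 + s) * CPS u (- wv s)
   + 2 / ((1 + s) * (1 + s)) * CPS1 u (- wv s)).

Definition ph2 (a b : R) (s : C) : C := let u := hc (2 * a) (a - b + 1 / 2) (a + b + 1 / 2) in
  (pow1p (2 * a) (wv s) * (- (2 * a) / (1 + s))) * (- (2 * a) / (1 + s) * CPS u (- wv s)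
   + 2 / ((1 + s) * (1 + s)) * CPS1 u (- wv s))
  + pow1p (2 * a) (wv s) * (2 * a / ((1 + s) * (1 + s)) * CPS u (- wv s)
     + - (2 * a) / (1 + s) * (2 / ((1 + s) * (1 + s)) * CPS1 u (- wv s))
     + (- (4) / ((1 + s) * (1 + s) * (1 + s)) * CPS1 u (- wv s)
     + 2 / ((1 + s) * (1 + s)) * (2 / ((1 + s) * (1 + s)) * CPS2 u (- wv s)))).

(** Only the differential equation is checked here, from that of the inner series; the equality with
    [F(a, b; c; 1 - s^2)] follows in [Fx_ph] from uniqueness at [s = 1]. *)
Lemma ph_gsol a b s : nonpole (a + b + 1 / 2) -> 0 < Re s -> gsol a b (ph a b) (ph1 a b) (ph2 a b) s.
Proof.
intros Hc Hs. assert (Hw := Cmod_wv s Hs).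
assert (Hn : 1 + s <> 0). { intros E. apply (f_equal Re) in E. destruct s; simpl in *. lra. }
set (u := hc (2 * a) (a - b + 1 / 2) (a + b + 1 / 2)).
assert (Hu : rad1 u) by now apply rad1_hc. assert (Hu1 := rad1_derive _ Hu).
assert (Dw := cder_wv s Hn).
assert (Dmw : cder (fun s => - wv s) s (2 / ((1 + s) * (1 + s)))).
{ apply (cder_ext (fun s => - (1) * wv s)). intros; ring.
  eapply cder_eq; [|apply cder_scal, Dw]. field; auto. }
assert (Hmw : Cmod (- wv s) < 1) by now rewrite Cmod_opp.
assert (Ew : 1 + wv s = 2 / (1 + s)) by (unfold wv; field; auto).
assert (DP : cder (fun s => pow1p (2 * a) (wv s)) s (pow1p (2 * a) (wv s) * (- (2 * a) / (1 + s)))).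
{ eapply cder_eq; [|apply cder_comp; [now apply cder_pow1p|exact Dw]].
  cbv beta; rewrite Ew, RtoC_mult. field. cnz. }
assert (DU : cder (fun s => CPS u (- wv s)) s (2 / ((1 + s) * (1 + s)) * CPS1 u (- wv s))).
{ apply (cder_CPS_comp u (fun s => - wv s)); auto. }
assert (DU1 : cder (fun s => CPS1 u (- wv s)) s (2 / ((1 + s) * (1 + s)) * CPS2 u (- wv s))).
{ apply (cder_CPS_comp (PS_derive u) (fun s => - wv s)); auto. }
assert (D1 : cder (fun s => 1 + s) s 1).
{ eapply cder_eq; [|apply cder_plus; [apply cder_const|apply cder_id]]. cbv beta; ring. }
split; [|split].
- unfold ph, ph1. fold u. cbv zeta. eapply cder_eq; [|apply cder_mult; [exact DP|exact DU]].
  cbv beta; field; auto.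
- unfold ph1, ph2. fold u. cbv zeta.
  apply (cder_mult (fun s => pow1p (2 * a) (wv s)) (fun s => - (2 * a) / (1 + s) * CPS u (- wv s)
   + 2 / ((1 + s) * (1 + s)) * CPS1 u (- wv s))); auto.
  apply cder_plus; [apply (cder_mult (fun s => - (2 * a) / (1 + s)) (fun s => CPS u (- wv s)))|
    apply (cder_mult (fun s => 2 / ((1 + s) * (1 + s))) (fun s => CPS1 u (- wv s)))]; auto.
  + eapply cder_eq; [|apply (cder_div (fun _ => - (2 * a)) (fun s => 1 + s)); [auto|apply cder_const|exact D1]].
    cbv beta; field; auto.
  + eapply cder_eq; [|apply (cder_div (fun _ => 2) (fun s => (1 + s) * (1 + s)));
      [now apply Cmult_neq_0|apply cder_const|apply cder_mult; exact D1]].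
    cbv beta; field; auto.
- assert (E := hyp_ode (2 * a) (a - b + 1 / 2) (a + b + 1 / 2) (- wv s) Hc Hmw). cbv zeta in E.
  unfold ph, ph1, ph2. fold u in E |- *. cbv zeta.
  set (U := CPS u (- wv s)) in *.
  set (U1 := CPS1 u (- wv s)) in *. set (U2 := CPS2 u (- wv s)) in *.
  set (P := pow1p (2 * a) (wv s)) in *. clearbody U U1 U2 P.
  apply Csub_eq. rewrite !RtoC_plus, !RtoC_minus, !RtoC_mult, !RtoC_div in E by lra.
  unfold wv in E.
  match type of E with ?X = _ => transitivity (- (2) * P / (1 + s) * X) end; [field; cnz|rewrite E; ring].
Qed.

(** * Uniqueness of solutions *)

Lemma cder_Im_line f z v l (t : R) : cder f (z + t * v) l ->
  is_derive (fun u : R => Im (f (z + u * v)%C)) t (Im (l * v)).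
Proof.
intros H. apply (cder_scal (- Ci)) in H. apply (cder_Re_line (fun x => - Ci * f x)) in H.
replace (Im (l * v)) with (Re (- Ci * l * v)) by (destruct l, v; simpl; ring).
revert H. apply is_derive_ext. intros u. destruct (f (z + u * v)); simpl; ring.
Qed.

Lemma gsol_lin a b f f1 f2 g g1 g2 (x y s : C) : gsol a b f f1 f2 s -> gsol a b g g1 g2 s ->
  gsol a b (fun s => x * f s + y * g s) (fun s => x * f1 s + y * g1 s) (fun s => x * f2 s + y * g2 s) s.
Proof.
intros [F1 [F2 E]] [G1 [G2 E']]. split; [|split].
- apply cder_plus; now apply cder_scal.
- apply cder_plus; now apply cder_scal.
- transitivity (x * ((1 - s * s) * f2 s) + y * ((1 - s * s) * g2 s)). ring. rewrite E, E'. ring.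
Qed.

Definition energy (f f1 : C -> C) (s : C) : R := (Cmod (f s) ^ 2 + Cmod (f1 s) ^ 2)%R.

Lemma gronwall (g dg : R -> R) (K : R) :
  (forall t, 0 <= t <= 1 -> is_derive g t (dg t))%R ->
  (forall t, 0 <= t <= 1 -> dg t <= K * g t)%R -> (g 1 <= exp K * g 0)%R.
Proof.
intros Hd Hb.
assert (D : forall t, (0 <= t <= 1)%R -> is_derive (fun t => g t * exp (- K * t))%R t ((dg t - K * g t) * exp (- K * t))%R).
{ intros t Ht. eapply (eq_ind _ (fun l => is_derive _ _ l)).
  apply (is_derive_mult g (fun t => exp (- K * t)) t). now apply Hd.
  auto_derive. auto. reflexivity. intros; apply Rmult_comm.
  unfold plus, mult; simpl. ring. }
destruct (MVT_gen (fun t => g t * exp (- K * t))%R 0 1 (fun t => (dg t - K * g t) * exp (- K * t))%R) as [c [Hc E]].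
- intros x Hx. apply D. rewrite Rmin_left, Rmax_right in Hx by lra. lra.
- intros x Hx. rewrite Rmin_left, Rmax_right in Hx by lra.
  apply continuity_pt_filterlim. apply (ex_derive_continuous (K := R_AbsRing) (V := R_NormedModule) (fun t => g t * exp (- K * t))%R x).
  exact (ex_intro _ _ (D x Hx)).
- rewrite Rmin_left, Rmax_right in Hc by lra. specialize (Hb c Hc).
  assert (P := exp_pos (- K * c)).
  rewrite Rmult_0_r, exp_0, Rmult_1_r, Rmult_1_r in E.
  assert (E2 : (g 1 * exp (- K) <= g 0)%R) by nra.
  assert (P2 := exp_pos K).
  apply Rmult_le_reg_r with (exp (- K)). apply exp_pos.
  apply Rle_trans with (1 := E2). apply Req_le.
  replace (exp K * g 0 * exp (- K))%R with (g 0 * (exp K * exp (- K)))%R by ring.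
  rewrite <- exp_plus, Rplus_opp_r, exp_0. ring.
Qed.

(** Gronwall constant of a segment inside the disk of radius [r]: the segment has length at most 2,
    and the equation bounds [f2] by [f] and [f1] with denominator [1 - r^2]. *)
Definition growth (a b r : R) : R := (4 * (1 + (Rabs (2 * a + 2 * b + 1) + Rabs (4 * a * b)) / (1 - r * r)))%R.

(** The constant depends on the endpoints only through [r]; this is what allows [s0] to tend to 0 in
    [ode_from_limits]. *)
Lemma energy_bound a b f f1 f2 (s0 s1 : C) (r : R) : r < 1 -> Cmod s0 <= r -> Cmod s1 <= r ->
  (forall t : R, 0 <= t <= 1 -> gsol a b f f1 f2 (s0 + t * (s1 - s0))) ->
  energy f f1 s1 <= exp (growth a b r) * energy f f1 s0.
Proof.
intros Hr H0 H1 H.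
assert (Hr0 : 0 <= r) by (apply Rle_trans with (2 := H0); apply Cmod_ge_0).
set (v := s1 - s0).
assert (Hv : Cmod v <= 2).
{ apply Rle_trans with (1 := Cmod_triangle _ _). rewrite Cmod_opp. lra. }
set (p := fun t : R => s0 + t * v).
assert (E1 : s1 = p 1%R) by (unfold p, v; ring).
assert (E0 : s0 = p 0%R) by (unfold p, v; ring).
replace (energy f f1 s1) with (energy f f1 (p 1%R)) by now rewrite <- E1.
replace (energy f f1 s0) with (energy f f1 (p 0%R)) by now rewrite <- E0.
apply (gronwall (fun t => energy f f1 (p t))
  (fun t => 2 * (Re (f (p t)) * Re (f1 (p t) * v) + Im (f (p t)) * Im (f1 (p t) * v))
   + 2 * (Re (f1 (p t)) * Re (f2 (p t) * v) + Im (f1 (p t)) * Im (f2 (p t) * v)))%R).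
- intros t Ht. destruct (H t Ht) as [D1 [D2 _]]. fold v in D1, D2.
  apply (is_derive_ext (fun t => (Re (f (p t)) * Re (f (p t)) + Im (f (p t)) * Im (f (p t)))
    + (Re (f1 (p t)) * Re (f1 (p t)) + Im (f1 (p t)) * Im (f1 (p t))))%R).
  { intros u. unfold energy. rewrite !Cmod2_alt. simpl; ring. }
  assert (A1 := cder_Re_line _ _ _ _ _ D1). assert (A2 := cder_Im_line _ _ _ _ _ D1).
  assert (A3 := cder_Re_line _ _ _ _ _ D2). assert (A4 := cder_Im_line _ _ _ _ _ D2).
  eapply (eq_ind _ (fun l => is_derive _ _ l)).
  apply (is_derive_plus (K := R_AbsRing) (V := R_NormedModule));
   apply (is_derive_plus (K := R_AbsRing) (V := R_NormedModule));
   (apply (is_derive_mult (K := R_AbsRing)); [eassumption|eassumption|intros; apply Rmult_comm]).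
  unfold plus, mult; simpl. fold (p t). ring.
- intros t Ht. destruct (H t Ht) as [_ [_ E]]. fold v in E. fold (p t) in E.
  assert (Hp : Cmod (p t) <= r).
  { unfold p, v. replace (s0 + t * (s1 - s0)) with ((1 - t)%R * s0 + t * s1) by (rewrite RtoC_minus; ring).
    apply Rle_trans with (1 := Cmod_triangle _ _). rewrite !Cmod_mult, !Cmod_R, !Rabs_pos_eq by lra. nra. }
  assert (Hp0 := Cmod_ge_0 (p t)).
  assert (Hd : (1 - r * r <= Cmod (1 - p t * p t))).
  { assert (T := Cmod_triangle (1 - p t * p t) (p t * p t)).
    replace (1 - p t * p t + p t * p t) with (RtoC 1) in T by ring.
    rewrite Cmod_1, Cmod_mult in T. nra. }
  assert (Hrr : 0 < 1 - r * r) by nra.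
  set (P := Rabs (2 * a + 2 * b + 1)). set (Q := Rabs (4 * a * b)).
  assert (HP : 0 <= P) by apply Rabs_pos. assert (HQ : 0 <= Q) by apply Rabs_pos.
  set (F := f (p t)) in *. set (F1 := f1 (p t)) in *. set (F2 := f2 (p t)) in *.
  assert (HF := Cmod_ge_0 F). assert (HF1 := Cmod_ge_0 F1). assert (HF2 := Cmod_ge_0 F2).
  assert (B2 : Cmod F2 * (1 - r * r) <= P * Cmod F1 + Q * Cmod F).
  { apply Rle_trans with (Cmod ((1 - p t * p t) * F2)).
    rewrite Cmod_mult, Rmult_comm. now apply Rmult_le_compat_r.
    rewrite E. apply Rle_trans with (1 := Cmod_triangle _ _).
    replace (2 * a + 2 * b + 1) with (RtoC (2 * a + 2 * b + 1)%R) by (rewrite !RtoC_plus, !RtoC_mult; ring).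
    replace (4 * a * b) with (RtoC (4 * a * b)%R) by (rewrite !RtoC_mult; ring).
    rewrite !Cmod_mult, !Cmod_R. fold P Q.
    apply Rplus_le_compat_r. apply Rmult_le_compat_r; auto. nra. }
  assert (B2' : Cmod F2 <= (P * Cmod F1 + Q * Cmod F) / (1 - r * r)) by (apply Rle_div_r; auto).
  assert (C1 := Re_Cconj_mult_le F (F1 * v)). assert (C2 := Re_Cconj_mult_le F1 (F2 * v)).
  rewrite Cmod_mult in C1, C2.
  unfold growth, energy. fold F F1. set (e := (Cmod F ^ 2 + Cmod F1 ^ 2)%R).
  assert (X1 : (Cmod F * Cmod F1 <= e)%R) by (unfold e; nra).
  assert (X2 : (Cmod F1 * (P * Cmod F1 + Q * Cmod F) <= (P + Q) * e)%R).
  { replace (Cmod F1 * (P * Cmod F1 + Q * Cmod F))%R with (P * (Cmod F1 * Cmod F1) + Q * (Cmod F * Cmod F1))%R by ring.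
    assert (Cmod F1 * Cmod F1 <= e)%R by (unfold e; nra). nra. }
  assert (X3 : (Cmod F1 * Cmod F2 <= (P + Q) / (1 - r * r) * e)%R).
  { apply Rle_trans with (Cmod F1 * ((P * Cmod F1 + Q * Cmod F) / (1 - r * r)))%R.
    now apply Rmult_le_compat_l.
    unfold Rdiv. rewrite <- Rmult_assoc.
    replace ((P + Q) * / (1 - r * r) * e)%R with (((P + Q) * e) * / (1 - r * r))%R by ring.
    apply Rmult_le_compat_r; auto. apply Rlt_le, Rinv_0_lt_compat; auto. }
  assert (Y1 : (Cmod F * (Cmod F1 * Cmod v) <= 2 * e)%R).
  { rewrite <- Rmult_assoc. assert (0 <= Cmod F * Cmod F1)%R by nra. assert (Hv0 := Cmod_ge_0 v). nra. }
  assert (Y2 : (Cmod F1 * (Cmod F2 * Cmod v) <= 2 * ((P + Q) / (1 - r * r) * e))%R).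
  { rewrite <- Rmult_assoc. assert (0 <= Cmod F1 * Cmod F2)%R by nra. assert (Hv0 := Cmod_ge_0 v). nra. }
  fold P Q. nra.
Qed.

Lemma energy_0 f f1 s : energy f f1 s <= 0 -> f s = 0 /\ f1 s = 0.
Proof.
unfold energy. intros H. assert (A := Cmod_ge_0 (f s)). assert (B := Cmod_ge_0 (f1 s)).
split; apply Cmod_eq_0; nra.
Qed.

Lemma ode_unique a b f f1 f2 g g1 g2 (s0 s1 : C) : Cmod s0 < 1 -> Cmod s1 < 1 ->
  (forall t : R, 0 <= t <= 1 -> gsol a b f f1 f2 (s0 + t * (s1 - s0))) ->
  (forall t : R, 0 <= t <= 1 -> gsol a b g g1 g2 (s0 + t * (s1 - s0))) ->
  f s0 = g s0 -> f1 s0 = g1 s0 -> f s1 = g s1 /\ f1 s1 = g1 s1.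
Proof.
intros H0 H1 Hf Hg E0 E1.
set (d := fun s => 1 * f s + - (1) * g s). set (d1 := fun s => 1 * f1 s + - (1) * g1 s).
assert (B := energy_bound a b d d1 (fun s => 1 * f2 s + - (1) * g2 s) s0 s1 (Rmax (Cmod s0) (Cmod s1))).
assert (Z : energy d d1 s0 = 0%R).
{ unfold energy, d, d1. rewrite E0, E1.
  replace (1 * g s0 + - (1) * g s0) with (RtoC 0) by ring.
  replace (1 * g1 s0 + - (1) * g1 s0) with (RtoC 0) by ring. rewrite Cmod_0. ring. }
rewrite Z, Rmult_0_r in B. destruct (energy_0 d d1 s1) as [A1 A2].
- apply B.
  + apply Rmax_case; auto.
  + apply Rmax_l.
  + apply Rmax_r.
  + intros t Ht. apply gsol_lin; auto.
- unfold d, d1 in A1, A2. split; apply Csub_eq.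
  rewrite <- A1; ring. rewrite <- A2; ring.
Qed.

(** Initial data at [s = 0] given as limits only: the series of [F(a, b; c; 1 - s^2)] is on its
    circle of convergence there. The difference with the regular solution has small energy near 0,
    and the growth bound transports this to [s]. *)
Lemma ode_from_limits a b f f1 f2 (A B : C) :
  (forall s : R, 0 < s < 1 -> gsol a b f f1 f2 s) ->
  (forall eps : R, 0 < eps -> exists delta : R, 0 < delta /\ forall s : R, 0 < s < delta ->
     Cmod (f s - A) < eps /\ Cmod (f1 s - B) < eps) ->
  forall s : R, 0 < s < 1 ->
  f s = A * ev a b s + B * od a b s /\ f1 s = A * ev1 a b s + B * od1 a b s.
Proof.
intros Hf Hl s Hs.
set (g := fun s => A * ev a b s + B * od a b s). set (g1 := fun s => A * ev1 a b s + B * od1 a b s).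
set (g2 := fun s => A * ev2 a b s + B * od2 a b s).
assert (Hg : forall s, Cmod s < 1 -> gsol a b g g1 g2 s).
{ intros x Hx. apply gsol_lin. now apply ev_gsol. now apply od_gsol. }
set (d := fun s => 1 * f s + - (1) * g s). set (d1 := fun s => 1 * f1 s + - (1) * g1 s).
assert (G0 : g 0 = A).
{ unfold g, ev, od. replace (RtoC 0 * 0) with (RtoC 0) by ring. rewrite !CPS_0. unfold hc. simpl.
  replace (1 * 1 / (1 * 1))%R with 1%R by field. ring. }
assert (G10 : g1 0 = B).
{ unfold g1, ev1, od1. cbv zeta. replace (RtoC 0 * 0) with (RtoC 0) by ring. rewrite !CPS_0. unfold hc at 2. simpl.
  replace (1 * 1 / (1 * 1))%R with 1%R by field. ring. }
assert (Z : energy d d1 s <= 0).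
{ apply Rnot_lt_le. intros Hpos.
  set (K := exp (growth a b s)). assert (HK : 0 < K) by apply exp_pos.
  (* Near 0 the energy of the difference will be at most [8 * eta^2 <= 8 * eta]; the factor 9 makes
     the contradiction strict. *)
  set (eta := (Rmin 1 (energy d d1 s / (9 * K)))%R).
  assert (He : 0 < eta). { apply Rmin_case. lra. apply Rdiv_lt_0_compat; lra. }
  assert (He1 : eta <= 1) by apply Rmin_l.
  assert (He2 : (9 * K * eta <= energy d d1 s)%R).
  { assert (H := Rmin_r 1 (energy d d1 s / (9 * K))). fold eta in H.
    apply Rmult_le_compat_l with (r := (9 * K)%R) in H; [|lra].
    replace (9 * K * (energy d d1 s / (9 * K)))%R with (energy d d1 s) in H by (field; lra). lra. }
  destruct (Hl eta He) as [de [Hde Hlim]].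
  assert (C0 : Cmod 0 < 1) by (rewrite Cmod_0; lra).
  destruct (Hg 0 C0) as [Dg [Dg1 _]].
  destruct (cder_ccont _ _ _ Dg eta He) as [e1 [He1' Hc1]].
  destruct (cder_ccont _ _ _ Dg1 eta He) as [e2 [He2' Hc2]].
  set (x := (Rmin (Rmin de s) (Rmin e1 e2) / 2)%R).
  assert (M1 := Rmin_l (Rmin de s) (Rmin e1 e2)). assert (M2 := Rmin_r (Rmin de s) (Rmin e1 e2)).
  assert (M3 := Rmin_l de s). assert (M4 := Rmin_r de s).
  assert (M5 := Rmin_l e1 e2). assert (M6 := Rmin_r e1 e2).
  assert (Hx0 : 0 < Rmin (Rmin de s) (Rmin e1 e2)).
  { repeat apply Rmin_case; lra. }
  assert (Hx : 0 < x) by (unfold x; lra).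
  assert (Hxm : Cmod x = x) by (rewrite Cmod_R, Rabs_pos_eq; lra).
  destruct (Hlim x ltac:(unfold x in *; lra)) as [L1 L2].
  specialize (Hc1 x ltac:(rewrite Hxm; unfold x in *; lra)). specialize (Hc2 x ltac:(rewrite Hxm; unfold x in *; lra)).
  rewrite Cplus_0_l, G0 in Hc1. rewrite Cplus_0_l, G10 in Hc2.
  assert (Bd : Cmod (d x) <= 2 * eta).
  { unfold d. replace (1 * f x + - (1) * g x) with ((f x - A) + - (g x - A)) by ring.
    apply Rle_trans with (1 := Cmod_triangle _ _). rewrite Cmod_opp. lra. }
  assert (Bd1 : Cmod (d1 x) <= 2 * eta).
  { unfold d1. replace (1 * f1 x + - (1) * g1 x) with ((f1 x - B) + - (g1 x - B)) by ring.
    apply Rle_trans with (1 := Cmod_triangle _ _). rewrite Cmod_opp. lra. }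
  assert (Be : energy d d1 x <= 8 * eta).
  { unfold energy. assert (A1 := Cmod_ge_0 (d x)). assert (A2 := Cmod_ge_0 (d1 x)). nra. }
  assert (EB := energy_bound a b d d1 (fun s => 1 * f2 s + - (1) * g2 s) x s s).
  assert (energy d d1 s <= K * energy d d1 x).
  { apply EB. lra. rewrite Hxm. unfold x in *; lra. rewrite Cmod_R, Rabs_pos_eq; lra.
    intros t Ht. replace (x + t * (s - x)) with (RtoC (x + t * (s - x))%R) by (rewrite RtoC_plus, RtoC_mult, RtoC_minus; ring).
    assert (Hxs : x < s) by (unfold x in *; lra).
    assert (Hy : 0 < x + t * (s - x) < 1) by nra.
    apply gsol_lin. now apply Hf. apply Hg. rewrite Cmod_R. apply Rabs_lt_between; lra. }
  assert (K * energy d d1 x <= K * (8 * eta))%R by (apply Rmult_le_compat_l; lra).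
  assert (0 < K * eta)%R by now apply Rmult_lt_0_compat. lra. }
destruct (energy_0 d d1 s Z) as [A1 A2]. unfold d, d1 in A1, A2.
split; apply Csub_eq. rewrite <- A1. unfold g; ring. rewrite <- A2. unfold g1; ring.
Qed.

Open Scope R_scope.

(** * Asymptotic expansions and non-integral powers *)

Inductive polyfun : (R -> R) -> Prop :=
| poly_const c : polyfun (fun _ => c)
| poly_id : polyfun (fun t => t)
| poly_plus p q : polyfun p -> polyfun q -> polyfun (fun t => p t + q t)
| poly_mult p q : polyfun p -> polyfun q -> polyfun (fun t => p t * q t).

Lemma poly_bounded p (B : R) : polyfun p -> exists M, 0 < M /\ forall t, Rabs t <= B -> Rabs (p t) <= M.
Proof.
intros H. induction H as [c| |p q _ [M [HM IH]] _ [M' [HM' IH']]|p q _ [M [HM IH]] _ [M' [HM' IH']]].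
- exists (Rabs c + 1). split. assert (H := Rabs_pos c); lra. intros; lra.
- exists (Rabs B + 1). split. assert (H := Rabs_pos B); lra.
  intros t Ht. assert (H := Rle_abs B). lra.
- exists (M + M'). split. lra. intros t Ht. apply Rle_trans with (1 := Rabs_triang _ _).
  specialize (IH t Ht). specialize (IH' t Ht). lra.
- exists (M * M'). split. nra. intros t Ht. rewrite Rabs_mult.
  apply Rmult_le_compat; auto; apply Rabs_pos.
Qed.

Lemma poly_lip p (B : R) : polyfun p -> exists L, 0 < L /\
  forall x y, Rabs x <= B -> Rabs y <= B -> Rabs (p x - p y) <= L * Rabs (x - y).
Proof.
intros H. induction H as [c| |p q Hp [L [HL IH]] Hq [L' [HL' IH']]|p q Hp [L [HL IH]] Hq [L' [HL' IH']]].
- exists 1. split. lra. intros. rewrite Rminus_diag, Rabs_R0. rewrite Rmult_1_l; apply Rabs_pos.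
- exists 1. split. lra. intros. lra.
- exists (L + L'). split. lra. intros x y Hx Hy.
  replace (p x + q x - (p y + q y)) with ((p x - p y) + (q x - q y)) by ring.
  apply Rle_trans with (1 := Rabs_triang _ _).
  specialize (IH x y Hx Hy). specialize (IH' x y Hx Hy). lra.
- destruct (poly_bounded p B Hp) as [M [HM BM]]. destruct (poly_bounded q B Hq) as [M' [HM' BM']].
  exists (L * M' + M * L'). split. nra. intros x y Hx Hy.
  replace (p x * q x - p y * q y) with ((p x - p y) * q x + p y * (q x - q y)) by ring.
  apply Rle_trans with (1 := Rabs_triang _ _). rewrite !Rabs_mult.
  specialize (IH x y Hx Hy). specialize (IH' x y Hx Hy). specialize (BM y Hy). specialize (BM' x Hx).
  assert (A1 := Rabs_pos (p x - p y)). assert (A2 := Rabs_pos (q x - q y)).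
  assert (A3 := Rabs_pos (p y)). assert (A4 := Rabs_pos (q x)). assert (A5 := Rabs_pos (x - y)).
  assert (Rabs (p x - p y) * Rabs (q x) <= L * Rabs (x - y) * M') by (apply Rmult_le_compat; lra).
  assert (Rabs (p y) * Rabs (q x - q y) <= M * (L' * Rabs (x - y))) by (apply Rmult_le_compat; lra).
  lra.
Qed.

Lemma poly_split p : polyfun p -> exists q, polyfun q /\ forall t, p t = p 0 + t * q t.
Proof.
intros H. induction H as [c| |p q Hp [p' [Hp' IH]] Hq [q' [Hq' IH']]|p q Hp [p' [Hp' IH]] Hq [q' [Hq' IH']]].
- exists (fun _ => 0). split. constructor. intros; ring.
- exists (fun _ => 1). split. constructor. intros; ring.
- exists (fun t => p' t + q' t). split. now constructor. intros t. rewrite IH, IH'. ring.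
- exists (fun t => (p 0 * q' t + p' t * q 0) + t * (p' t * q' t)). split.
  repeat constructor; auto. intros t. rewrite IH, IH'. ring.
Qed.

Lemma poly_comp p q : polyfun p -> polyfun q -> polyfun (fun t => p (q t)).
Proof.
intros H Hq. induction H.
- constructor.
- exact Hq.
- now apply (poly_plus (fun t => p (q t)) (fun t => q0 (q t))).
- now apply (poly_mult (fun t => p (q t)) (fun t => q0 (q t))).
Qed.

(* Having an asymptotic expansion to all orders at 0. *)
Definition AEn (N : nat) (f : R -> R) : Prop :=
  exists p C d, polyfun p /\ 0 <= C /\ 0 < d <= 1 /\ forall t, Rabs t < d -> Rabs (f t - p t) <= C * Rabs t ^ N.

Definition AE f := forall N, AEn N f.

Lemma AE_poly p : polyfun p -> AE p.
Proof. intros H N. exists p, 0, 1. split; [auto|split; [lra|split; [lra|]]].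
intros t _. rewrite Rminus_diag, Rabs_R0. lra. Qed.

Lemma AE_plus f g : AE f -> AE g -> AE (fun t => f t + g t).
Proof.
intros Hf Hg N. destruct (Hf N) as (p & C & d & Hp & HC & Hd & H).
destruct (Hg N) as (q & C' & d' & Hq & HC' & Hd' & H').
exists (fun t => p t + q t), (C + C'), (Rmin d d'). split; [now constructor|split; [lra|split]].
split. apply Rmin_case; lra. apply Rle_trans with (1 := Rmin_l _ _); lra.
intros t Ht.
assert (Rmin d d' <= d) by apply Rmin_l. assert (Rmin d d' <= d') by apply Rmin_r.
specialize (H t ltac:(lra)). specialize (H' t ltac:(lra)).
replace (f t + g t - (p t + q t)) with ((f t - p t) + (g t - q t)) by ring.
apply Rle_trans with (1 := Rabs_triang _ _). lra.
Qed.

Lemma AEn_bounded N f : AEn N f -> exists M d, 0 <= M /\ 0 < d <= 1 /\ forall t, Rabs t < d -> Rabs (f t) <= M.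
Proof.
intros (p & C & d & Hp & HC & Hd & H). destruct (poly_bounded p 1 Hp) as [M [HM B]].
exists (M + C), d. split; [lra|split; [auto|]].
intros t Ht. specialize (H t Ht). specialize (B t ltac:(lra)).
assert (P : Rabs t ^ N <= 1). { rewrite <- (pow1 N). apply pow_incr. split. apply Rabs_pos. lra. }
assert (C * Rabs t ^ N <= C * 1) by now apply Rmult_le_compat_l.
replace (f t) with ((f t - p t) + p t) by ring. apply Rle_trans with (1 := Rabs_triang _ _). lra.
Qed.

Lemma AE_mult f g : AE f -> AE g -> AE (fun t => f t * g t).
Proof.
intros Hf Hg N. destruct (AEn_bounded _ _ (Hg N)) as (M & d2 & HM & Hd2 & B).
destruct (Hf N) as (p & C & d & Hp & HC & Hd & H).
destruct (Hg N) as (q & C' & d' & Hq & HC' & Hd' & H').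
destruct (poly_bounded p 1 Hp) as [Mp [HMp Bp]].
exists (fun t => p t * q t), (C * M + Mp * C'), (Rmin d2 (Rmin d d')).
split; [now constructor|split; [nra|split]].
split. repeat apply Rmin_case; lra. apply Rle_trans with (1 := Rmin_l _ _); lra.
intros t Ht.
assert (E1 := Rmin_l d2 (Rmin d d')). assert (E2 := Rmin_r d2 (Rmin d d')).
assert (E3 : Rmin d d' <= d) by apply Rmin_l. assert (E4 : Rmin d d' <= d') by apply Rmin_r.
specialize (H t ltac:(lra)). specialize (H' t ltac:(lra)). specialize (B t ltac:(lra)). specialize (Bp t ltac:(lra)).
replace (f t * g t - (p t * q t)) with ((f t - p t) * g t + p t * (g t - q t)) by ring.
apply Rle_trans with (1 := Rabs_triang _ _). rewrite !Rabs_mult.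
set (X := Rabs t ^ N) in *.
assert (Rabs (f t - p t) * Rabs (g t) <= (C * X) * M) by (apply Rmult_le_compat; auto; apply Rabs_pos).
assert (Rabs (p t) * Rabs (g t - q t) <= Mp * (C' * X)) by (apply Rmult_le_compat; auto; apply Rabs_pos).
lra.
Qed.

Definition small (g : R -> R) := exists C d, 0 <= C /\ 0 < d <= 1 /\ forall t, Rabs t < d -> Rabs (g t) <= C * Rabs t.

Lemma AE_comp f g : AE f -> AE g -> small g -> AE (fun t => f (g t)).
Proof.
intros Hf Hg (S & d0 & HS & Hd0 & Hs) N.
destruct (AEn_bounded _ _ (Hg N)) as (M & d2 & HM & Hd2 & B).
destruct (Hf N) as (p & C & d & Hp & HC & Hd & H).
destruct (Hg N) as (q & C' & d' & Hq & HC' & Hd' & H').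
destruct (poly_bounded q 1 Hq) as [Mq [HMq Bq]].
destruct (poly_lip p (M + Mq) Hp) as [L [HL Lp]].
exists (fun t => p (q t)), (C * S ^ N + L * C'), (Rmin (Rmin d2 (d / (S + 1))) (Rmin d0 d')).
assert (HSN : 0 <= S ^ N) by now apply pow_le.
assert (HdS : 0 < d / (S + 1)) by (apply Rdiv_lt_0_compat; lra).
split; [now apply poly_comp|split; [nra|split]].
split. repeat apply Rmin_case; lra. apply Rle_trans with (1 := Rmin_l _ _).
apply Rle_trans with (1 := Rmin_l _ _); lra.
intros t Ht.
assert (E1 := Rmin_l (Rmin d2 (d / (S + 1))) (Rmin d0 d')). assert (E2 := Rmin_r (Rmin d2 (d / (S + 1))) (Rmin d0 d')).
assert (E3 : Rmin d0 d' <= d0) by apply Rmin_l. assert (E4 : Rmin d0 d' <= d') by apply Rmin_r.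
assert (E5 := Rmin_l d2 (d / (S + 1))). assert (E6 := Rmin_r d2 (d / (S + 1))).
specialize (Hs t ltac:(lra)). specialize (H' t ltac:(lra)). specialize (B t ltac:(lra)). specialize (Bq t ltac:(lra)).
assert (Hgd : Rabs (g t) < d).
{ apply Rle_lt_trans with (1 := Hs).
  assert (Ht' : Rabs t < d / (S + 1)) by lra.
  apply Rmult_lt_compat_r with (r := S + 1) in Ht'; [|lra].
  replace (d / (S + 1) * (S + 1)) with d in Ht' by (field; lra). assert (P := Rabs_pos t). nra. }
specialize (H _ Hgd).
replace (f (g t) - p (q t)) with ((f (g t) - p (g t)) + (p (g t) - p (q t))) by ring.
apply Rle_trans with (1 := Rabs_triang _ _).
specialize (Lp (g t) (q t) ltac:(lra) ltac:(lra)).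
assert (C * Rabs (g t) ^ N <= C * (S ^ N * Rabs t ^ N)).
{ apply Rmult_le_compat_l; auto. rewrite <- Rpow_mult_distr. apply pow_incr. split; auto. apply Rabs_pos. }
assert (L * Rabs (g t - q t) <= L * (C' * Rabs t ^ N)) by (apply Rmult_le_compat_l; lra).
lra.
Qed.

(** For the successive tails of a power series: unfolding [N] times leaves [t ^ N] times a bounded
    tail. The induction therefore runs over [N] for all [k] at once. *)
Lemma AE_unfold (F : nat -> (R -> R)) (c : nat -> R) :
  (exists M d, 0 <= M /\ 0 < d <= 1 /\ forall k t, (Rabs t < d -> F k t = c k + t * F (S k) t)) ->
  (forall k, AEn 0 (F k)) -> forall k, AE (F k).
Proof.
intros (_ & d & _ & Hd & H) H0 k N. revert k. induction N as [|N IH]; intros k; auto.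
destruct (IH (S k)) as (p & C & d' & Hp & HC & Hd' & H').
exists (fun t => c k + t * p t), C, (Rmin d d').
split; [repeat constructor; auto|split; [lra|split]].
split. apply Rmin_case; lra. apply Rle_trans with (1 := Rmin_l _ _); lra.
intros t Ht. assert (E3 : Rmin d d' <= d) by apply Rmin_l. assert (E4 : Rmin d d' <= d') by apply Rmin_r.
rewrite H by lra. specialize (H' t ltac:(lra)).
replace (c k + t * F (S k) t - (c k + t * p t)) with (t * (F (S k) t - p t)) by ring.
rewrite Rabs_mult. simpl.
replace (C * (Rabs t * Rabs t ^ N)) with (Rabs t * (C * Rabs t ^ N)) by ring.
apply Rmult_le_compat_l; auto. apply Rabs_pos.
Qed.

Lemma CV_rad1 u t : rad1 u -> Rabs t < 1 -> Rbar_lt (Rabs t) (CV_radius u).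
Proof. intros H Ht. apply (Rbar_lt_le_trans _ 1); auto. Qed.

Lemma PSeries_bounded u : rad1 u -> AEn 0 (PSeries u).
Proof.
intros H. exists (fun _ => 0), (Series (fun n => Rabs (u n * (1 / 2) ^ n))), (1 / 2).
assert (E : ex_series (fun n => Rabs (u n * (1 / 2) ^ n))).
{ apply CV_disk_inside. apply CV_rad1; auto. rewrite Rabs_pos_eq; lra. }
split; [constructor|split; [|split; [lra|]]].
- apply Series_pos; auto. intros; apply Rabs_pos.
- intros t Ht. rewrite Rminus_0_r. simpl. rewrite Rmult_1_r. unfold PSeries.
  assert (E' : ex_series (fun n => Rabs (u n * t ^ n))).
  { apply CV_disk_inside. apply CV_rad1; auto. lra. }
  apply Rle_trans with (1 := Series_Rabs _ E').
  apply Series_le; auto. intros n. split. apply Rabs_pos. rewrite !Rabs_mult.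
  apply Rmult_le_compat_l. apply Rabs_pos. rewrite <- !RPow_abs. apply pow_incr.
  split. apply Rabs_pos. rewrite (Rabs_pos_eq (1 / 2)); lra.
Qed.

Lemma rad1_shift u k : rad1 u -> rad1 (fun n => u (n + k)%nat).
Proof.
intros H. induction k as [|k IH].
- revert H. apply rad1_ext. intros; f_equal; lia.
- apply (rad1_ext (PS_decr_1 (fun n => u (n + k)%nat))).
  intros n; unfold PS_decr_1; f_equal; lia.
  unfold rad1. now rewrite CV_radius_decr_1.
Qed.

Lemma AE_PSeries u : rad1 u -> AE (PSeries u).
Proof.
intros H.
assert (A : forall k, AE (fun t => PSeries (fun n => u (n + k)%nat) t)).
{ apply (AE_unfold (fun k t => PSeries (fun n => u (n + k)%nat) t) u).
  - exists 0, 1. split; [lra|split; [lra|]]. intros k t Ht.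
    rewrite PSeries_decr_1.
    + simpl. f_equal. f_equal. apply PSeries_ext. intros n; unfold PS_decr_1. f_equal; lia.
    + apply CV_radius_inside. apply CV_rad1; auto. now apply rad1_shift.
  - intros k. apply PSeries_bounded. now apply rad1_shift. }
intros N. destruct (A O N) as (p & C & d & Hp & HC & Hd & E).
exists p, C, d. split; [auto|split; [auto|split; [auto|]]]. intros t Ht. rewrite <- E; auto.
right. f_equal. f_equal. apply PSeries_ext. intros; f_equal; lia.
Qed.

Lemma AE_inv2 : AE (fun t => / (2 - t)).
Proof.
intros N.
assert (A : forall k, AE (fun t => (/ 2) ^ k * / (2 - t))).
{ apply (AE_unfold (fun k t => (/ 2) ^ k * / (2 - t)) (fun k => (/ 2) ^ S k)).
  - exists 0, 1. split; [lra|split; [lra|]]. intros k t Ht. apply Rabs_lt_between in Ht. simpl. field. lra.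
  - intros k. exists (fun _ => 0), ((/ 2) ^ k), 1. split; [constructor|].
    assert (0 < (/ 2) ^ k) by (apply pow_lt; lra).
    split; [lra|split; [lra|]]. intros t Ht. apply Rabs_lt_between in Ht.
    rewrite Rminus_0_r, Rabs_mult, Rabs_inv, !Rabs_pos_eq by lra. simpl. rewrite Rmult_1_r.
    rewrite <- (Rmult_1_r ((/ 2) ^ k)) at 2. apply Rmult_le_compat_l; [lra|].
    rewrite <- Rinv_1. apply Rinv_le_contravar; lra. }
destruct (A O N) as (p & C & d & Hp & HC & Hd & E).
exists p, C, d. split; [auto|split; [auto|split; [auto|]]]. intros t Ht. rewrite <- E; auto.
right. f_equal. simpl; ring.
Qed.

Lemma Rpower_small (nu eps : R) : 0 < nu -> 0 < eps ->
  exists d, 0 < d /\ forall t, 0 < t < d -> Rpower t nu < eps.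
Proof.
intros Hn He. exists (Rpower eps (/ nu)). split. apply exp_pos.
intros t Ht. replace eps with (Rpower (Rpower eps (/ nu)) nu).
apply Rlt_Rpower_l; auto. rewrite Rpower_mult, Rinv_l by lra. now apply Rpower_1.
Qed.

(** For [nu > 0] letting [t] tend to 0 shows [p 0 = 0], and a division by [t] lowers both [nu] and
    [N] by 1. As [nu] is not a natural number, this ends at a negative [nu], where [t ^ nu] is
    unbounded while [p] is bounded. *)
Lemma noAE (N : nat) : forall (p k : R -> R) (nu C d m M : R), polyfun p ->
  (forall j : nat, nu <> INR j) -> nu < INR N -> 0 < d <= 1 -> 0 < m -> 0 <= C ->
  (forall t, 0 < t < d -> m <= Rabs (k t) <= M) ->
  (forall t, 0 < t < d -> Rabs (k t * Rpower t nu - p t) <= C * t ^ N) -> False.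
Proof.
induction N as [|N IH]; intros p k nu C d m M Hp Hj HN Hd Hm HC Hk H.
1, 2: assert (Hneg : 0 < nu \/ nu < 0) by (specialize (Hj O); simpl in Hj; lra).
1: { simpl in HN; destruct Hneg; [lra|].
  destruct (poly_bounded p 1 Hp) as [B [HB Bp]].
  destruct (Rpower_small (- nu) (m / (B + C + 1))) as [e [He Hs]]. lra. apply Rdiv_lt_0_compat; lra.
  set (t := Rmin d e / 2). assert (A1 := Rmin_l d e). assert (A2 := Rmin_r d e).
  assert (A3 : 0 < Rmin d e) by (apply Rmin_case; lra).
  assert (Ht : 0 < t < d) by (unfold t; lra). specialize (H t Ht). specialize (Hk t Ht).
  specialize (Hs t ltac:(unfold t; lra)). specialize (Bp t ltac:(rewrite Rabs_pos_eq; unfold t in *; lra)).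
  rewrite Rpower_Ropp in Hs. assert (P : 0 < Rpower t nu) by apply exp_pos.
  assert (X : Rabs (k t * Rpower t nu) <= B + C).
  { simpl in H. replace (k t * Rpower t nu) with ((k t * Rpower t nu - p t) + p t) by ring.
    apply Rle_trans with (1 := Rabs_triang _ _). lra. }
  rewrite Rabs_mult, (Rabs_pos_eq (Rpower _ _)) in X by lra.
  assert (Y : m * Rpower t nu <= B + C) by (apply Rle_trans with (2 := X); apply Rmult_le_compat_r; lra).
  apply Rmult_lt_compat_r with (r := Rpower t nu * (B + C + 1)) in Hs; [|nra].
  replace (/ Rpower t nu * (Rpower t nu * (B + C + 1))) with (B + C + 1) in Hs by (field; lra).
  replace (m / (B + C + 1) * (Rpower t nu * (B + C + 1))) with (m * Rpower t nu) in Hs by (field; lra). lra. }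
destruct Hneg as [Hpos|Hneg].
2: { apply (IH (fun t => p t) k nu C d m M); auto.
  - apply Rlt_le_trans with (1 := Hneg). apply pos_INR.
  - intros t Ht. apply Rle_trans with (1 := H t Ht). apply Rmult_le_compat_l; auto.
    simpl. assert (0 <= t ^ N) by (apply pow_le; lra). nra. }
destruct (poly_split p Hp) as [q [Hq Eq]].
destruct (poly_bounded q 1 Hq) as [B [HB Bq]].
assert (HM : 0 <= M). { specialize (Hk (d / 2) ltac:(lra)). lra. }
assert (E0 : p 0 = 0).
{ destruct (Req_dec (p 0) 0) as [|Hne]; auto. exfalso.
  assert (Hp0 : 0 < Rabs (p 0)) by now apply Rabs_pos_lt.
  destruct (Rpower_small nu (Rabs (p 0) / 2 / (M + 1))) as [e [He Hs]]. auto. apply Rdiv_lt_0_compat; lra.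
  set (e2 := Rabs (p 0) / 2 / (B + C + 1)).
  assert (He2 : 0 < e2) by (apply Rdiv_lt_0_compat; lra).
  set (t := Rmin d (Rmin e e2) / 2).
  assert (A1 := Rmin_l d (Rmin e e2)). assert (A2 := Rmin_r d (Rmin e e2)).
  assert (A3 := Rmin_l e e2). assert (A4 := Rmin_r e e2).
  assert (A5 : 0 < Rmin d (Rmin e e2)) by (repeat apply Rmin_case; lra).
  assert (Ht : 0 < t < d) by (unfold t; lra). specialize (H t Ht). specialize (Hk t Ht).
  specialize (Hs t ltac:(unfold t; lra)). specialize (Bq t ltac:(rewrite Rabs_pos_eq; unfold t in *; lra)).
  assert (P : 0 < Rpower t nu) by apply exp_pos.
  assert (Ht2 : t < e2) by (unfold t; lra).
  assert (F1 : M * Rpower t nu <= Rabs (p 0) / 2).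
  { apply Rmult_lt_compat_r with (r := M + 1) in Hs; [|lra].
    replace (Rabs (p 0) / 2 / (M + 1) * (M + 1)) with (Rabs (p 0) / 2) in Hs by (field; lra). lra. }
  assert (F2 : t * (B + C + 1) < Rabs (p 0) / 2).
  { apply Rmult_lt_compat_r with (r := B + C + 1) in Ht2; [|lra]. unfold e2 in Ht2.
    replace (Rabs (p 0) / 2 / (B + C + 1) * (B + C + 1)) with (Rabs (p 0) / 2) in Ht2 by (field; lra). lra. }
  assert (F3 : t ^ S N <= t).
  { simpl. rewrite <- (Rmult_1_r t) at 3. apply Rmult_le_compat_l. lra.
    rewrite <- (pow1 N). apply pow_incr. lra. }
  assert (F4 : C * t ^ S N <= C * t) by now apply Rmult_le_compat_l.
  assert (F5 : Rabs (p 0) <= Rabs (k t * Rpower t nu) + Rabs (k t * Rpower t nu - p t) + Rabs (t * q t)).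
  { replace (p 0) with (k t * Rpower t nu + - (k t * Rpower t nu - p t) + - (t * q t)) by (rewrite Eq; ring).
    apply Rle_trans with (1 := Rabs_triang _ _). rewrite Rabs_Ropp. apply Rplus_le_compat_r.
    apply Rle_trans with (1 := Rabs_triang _ _). rewrite Rabs_Ropp. lra. }
  rewrite !Rabs_mult, (Rabs_pos_eq t), (Rabs_pos_eq (Rpower _ _)) in F5 by lra.
  assert (F6 : Rabs (k t) * Rpower t nu <= M * Rpower t nu) by (apply Rmult_le_compat_r; lra).
  assert (F7 : t * Rabs (q t) <= t * B) by (apply Rmult_le_compat_l; lra).
  nra. }
apply (IH q k (nu - 1) C d m M); auto.
- intros j E. apply (Hj (S j)). rewrite S_INR. lra.
- rewrite S_INR in HN. lra.
- intros t Ht. specialize (H t Ht). rewrite Eq, E0, Rplus_0_l in H.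
  assert (Et : Rpower t nu = t * Rpower t (nu - 1)).
  { rewrite <- (Rpower_1 t) at 2 by lra. rewrite <- Rpower_plus. f_equal. ring. }
  rewrite Et in H. replace (k t * (t * Rpower t (nu - 1)) - t * q t) with (t * (k t * Rpower t (nu - 1) - q t)) in H by ring.
  rewrite Rabs_mult, Rabs_pos_eq in H by lra. simpl in H.
  apply Rmult_le_reg_l with t. lra. lra.
Qed.

Open Scope C_scope.

(** Expansion at the singular point [s = 1] in the variable [t = 1 - s], along the real axis, where
    the values are moreover required to be real. *)
Definition AEC (f : C -> C) : Prop :=
  exists g : R -> R, AE g /\ forall t : R, Rabs t < 1 -> f (RtoC (1 - t)) = g t.

Definition AEC0 (f : C -> C) : Prop :=
  exists g : R -> R, AE g /\ small g /\ forall t : R, Rabs t < 1 -> f (RtoC (1 - t)) = g t.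

Lemma AEC_const (c : R) : AEC (fun _ => RtoC c).
Proof. exists (fun _ => c). split; [apply AE_poly; constructor|]. auto. Qed.

Lemma AEC_id : AEC (fun s => s).
Proof. exists (fun t => 1 + -1 * t)%R. split; [apply AE_poly; repeat constructor|].
intros t _. f_equal. ring. Qed.

Lemma AEC_plus f g : AEC f -> AEC g -> AEC (fun s => f s + g s).
Proof. intros [f' [Hf Ef]] [g' [Hg Eg]]. exists (fun t => f' t + g' t)%R.
split; [now apply AE_plus|]. intros t Ht. rewrite Ef, Eg, RtoC_plus; auto. Qed.

Lemma AEC_mult f g : AEC f -> AEC g -> AEC (fun s => f s * g s).
Proof. intros [f' [Hf Ef]] [g' [Hg Eg]]. exists (fun t => f' t * g' t)%R.
split; [now apply AE_mult|]. intros t Ht. rewrite Ef, Eg, RtoC_mult; auto. Qed.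

Lemma AEC_ext f g : (forall s, f s = g s) -> AEC f -> AEC g.
Proof. intros E [f' [Hf Ef]]. exists f'. split; auto. intros t Ht. rewrite <- E; auto. Qed.

Lemma AEC_inv1 : AEC (fun s => / (1 + s)).
Proof.
exists (fun t => / (2 - t))%R. split. apply AE_inv2.
intros t Ht. apply Rabs_lt_between in Ht. rewrite RtoC_inv by lra. f_equal.
rewrite !RtoC_minus. ring.
Qed.

Lemma Cinv_sq (z : C) : / (z * z) = / z * / z.
Proof.
destruct (Ceq_dec z 0) as [->|H]; [|now field].
apply C_ext; simpl; unfold Rdiv; ring.
Qed.

Lemma AEC_CPS u f : rad1 u -> AEC0 f -> AEC (fun s => CPS u (f s)).
Proof.
intros Hu [g [Hg [Hs E]]]. exists (fun t => PSeries u (g t)). split.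
apply AE_comp; auto. now apply AE_PSeries.
intros t Ht. rewrite E by auto. apply CPS_RtoC.
Qed.

Lemma AEC0_1sq : AEC0 (fun s => 1 - s * s).
Proof.
exists (fun t => t * (2 + -1 * t))%R. split; [apply AE_poly; repeat constructor|split].
- exists 3%R, 1%R. split; [lra|split; [lra|]]. intros t Ht. rewrite Rabs_mult, Rmult_comm.
  apply Rmult_le_compat_r. apply Rabs_pos. apply Rabs_lt_between in Ht. apply Rabs_le_between. lra.
- intros t _. rewrite <- RtoC_mult, <- RtoC_minus. f_equal. ring.
Qed.

Lemma AEC0_wv : AEC0 wv.
Proof.
exists (fun t => t * / (2 - t))%R. split; [|split].
- apply AE_mult. apply AE_poly; constructor. apply AE_inv2.
- exists 1%R, 1%R. split; [lra|split; [lra|]]. intros t Ht. rewrite Rabs_mult, Rmult_comm.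
  apply Rmult_le_compat_r. apply Rabs_pos. apply Rabs_lt_between in Ht.
  rewrite Rabs_pos_eq. rewrite <- Rinv_1. apply Rinv_le_contravar; lra.
  apply Rlt_le, Rinv_0_lt_compat; lra.
- intros t Ht. apply Rabs_lt_between in Ht. unfold wv.
  rewrite RtoC_mult, RtoC_inv by lra. unfold Cdiv. f_equal; [|f_equal]; rewrite !RtoC_minus; ring.
Qed.

Lemma AEC0_opp f : AEC0 f -> AEC0 (fun s => - f s).
Proof.
intros [g [Hg [(C & d & HC & Hd & Hs) E]]]. exists (fun t => -1 * g t)%R. split; [|split].
- apply AE_mult; auto. apply AE_poly; constructor.
- exists C, d. split; [auto|split; [auto|]]. intros t Ht. rewrite Rabs_mult, Rabs_m1, Rmult_1_l. auto.
- intros t Ht. rewrite E by auto. rewrite RtoC_mult. ring.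
Qed.

Lemma AEC_Fx a b c : nonpole c -> AEC (Fx a b c) /\ AEC (Fx1 a b c).
Proof.
intros Hc. assert (Hu := rad1_hc a b c Hc). split.
- apply (AEC_CPS (hc a b c) (fun s => 1 - s * s)); auto. apply AEC0_1sq.
- unfold Fx1. apply (AEC_ext (fun s => (Ropp 2) * s * CPS1 (hc a b c) (1 - s * s))).
  { intros s. rewrite RtoC_opp. ring. }
  apply AEC_mult. apply AEC_mult. apply AEC_const. apply AEC_id.
  apply (AEC_CPS (PS_derive (hc a b c)) (fun s => 1 - s * s)); auto. now apply rad1_derive. apply AEC0_1sq.
Qed.

Lemma AEC_Ex a b : nonpole (a + b + 1 / 2) -> AEC (Ex a b) /\ AEC (Ex1 a b).
Proof.
intros Hc. destruct (AEC_Fx (a + 1 / 2) (b + 1 / 2) _ Hc) as [A1 A2]. split; unfold Ex, Ex1.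
- apply AEC_mult; auto. apply AEC_id.
- apply AEC_plus; apply AEC_mult; auto. apply AEC_const. apply AEC_id.
Qed.

Lemma AEC_ph a b : nonpole (a + b + 1 / 2) -> AEC (ph a b) /\ AEC (ph1 a b).
Proof.
intros Hc. set (u := hc (2 * a) (a - b + 1 / 2) (a + b + 1 / 2)).
assert (Hu : rad1 u) by now apply rad1_hc.
assert (A1 : AEC (fun s => pow1p (2 * a) (wv s))).
{ apply (AEC_CPS (bc (2 * a)) wv). apply rad1_bc. apply AEC0_wv. }
assert (A2 : AEC (fun s => CPS u (- wv s))).
{ apply (AEC_CPS u (fun s => - wv s)); auto. apply AEC0_opp, AEC0_wv. }
assert (A3 : AEC (fun s => CPS1 u (- wv s))).
{ apply (AEC_CPS (PS_derive u) (fun s => - wv s)). now apply rad1_derive. apply AEC0_opp, AEC0_wv. }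
split; unfold ph, ph1; fold u; cbv zeta.
- now apply AEC_mult.
- apply AEC_mult; auto. apply AEC_plus; apply AEC_mult; auto.
  + apply (AEC_ext (fun s => (- (2 * a))%R * / (1 + s))).
    { intros s. rewrite RtoC_opp, RtoC_mult. reflexivity. }
    apply AEC_mult. apply AEC_const. apply AEC_inv1.
  + apply (AEC_ext (fun s => 2 * (/ (1 + s) * / (1 + s)))).
    { intros s. unfold Cdiv. now rewrite Cinv_sq. }
    apply AEC_mult. apply AEC_const. apply AEC_mult; apply AEC_inv1.
Qed.

Lemma real_segment (x y t : R) : RtoC x + RtoC t * (RtoC y - RtoC x) = RtoC (x + t * (y - x))%R.
Proof. rewrite RtoC_plus, RtoC_mult, RtoC_minus. ring. Qed.

(** Abel's identity: the Wronskian satisfies [(1 - s^2) W' = 2 c s W] with [c = a + b + 1/2]. The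
    real part suffices for the applications, in which all functions are real on the segment. *)
Lemma wronskian_const a b f f1 f2 g g1 g2 (x y : R) : 0 <= x < 1 -> 0 <= y < 1 ->
  (forall s : R, Rmin x y <= s <= Rmax x y -> gsol a b f f1 f2 s) ->
  (forall s : R, Rmin x y <= s <= Rmax x y -> gsol a b g g1 g2 s) ->
  (Re (f x * g1 x - f1 x * g x)%C * Rpower (1 - x * x) (a + b + 1 / 2) =
   Re (f y * g1 y - f1 y * g y)%C * Rpower (1 - y * y) (a + b + 1 / 2))%R.
Proof.
intros Hx Hy Hf Hg.
apply (is_derive_const_on (fun s => Re (f s * g1 s - f1 s * g s)%C * Rpower (1 - s * s) (a + b + 1 / 2))%R).
intros s Hs.
assert (Hs' : 0 <= s < 1). { revert Hs. unfold Rmin, Rmax. destruct Rle_dec; lra. }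
destruct (Hf s Hs) as [F1 [F2 E]]. destruct (Hg s Hs) as [G1 [G2 E']].
assert (D : cder (fun s => f s * g1 s - f1 s * g s) s (f s * g2 s - f2 s * g s)).
{ eapply cder_eq; [|apply cder_minus; apply cder_mult; eauto]. ring. }
replace (RtoC s) with (0 + s * 1) in D by ring. apply cder_Re_line in D.
replace (0 + s * 1) with (RtoC s) in D by ring. rewrite Cmult_1_r in D.
set (W' := f s * g2 s - f2 s * g s) in *.
assert (Hss : (0 < 1 - s * s)%R) by nra.
assert (DR : is_derive (fun s : R => Re (f s * g1 s - f1 s * g s)%C) s (Re W')).
{ eapply is_derive_ext; [|exact D]. intros u. cbv beta. replace (0 + u * 1) with (RtoC u) by ring. reflexivity. }
set (c := (a + b + 1 / 2)%R).
assert (DP : is_derive (fun s => Rpower (1 - s * s) c) s (c * - (2 * s) / (1 - s * s) * Rpower (1 - s * s) c)%R).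
{ unfold Rpower. auto_derive; [nra|]. unfold Rminus. field. lra. }
set (W := f s * g1 s - f1 s * g s) in *.
assert (EW : (1 - s * s)%R * W' = (2 * c)%R * s * W).
{ unfold c, W, W'. rewrite !RtoC_mult, !RtoC_plus, RtoC_minus, RtoC_mult, RtoC_div by lra.
  transitivity (f s * ((1 - s * s) * g2 s) - ((1 - s * s) * f2 s) * g s). ring. rewrite E, E'. field. }
assert (EW2 : Re W' = (2 * c * s * Re W / (1 - s * s))%R).
{ apply (f_equal Re) in EW. rewrite <- RtoC_mult in EW.
  apply (Rmult_eq_reg_l (1 - s * s)); [|lra].
  replace ((1 - s * s) * (2 * c * s * Re W / (1 - s * s)))%R with (2 * c * s * Re W)%R by (field; lra).
  destruct W, W'. simpl in *. lra. }
assert (Dm := is_derive_mult (K := R_AbsRing) _ _ s _ _ DR DP Rmult_comm).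
eapply (eq_ind _ (fun l => is_derive _ _ l)). exact Dm.
change (Re W' * Rpower (1 - s * s) c + Re W * (c * - (2 * s) / (1 - s * s) * Rpower (1 - s * s) c) = 0)%R.
rewrite EW2. field. lra.
Qed.

Lemma Rpower_bounds (c : R) : exists m M, (0 < m /\ forall t, 0 < t < 1 -> m <= Rpower (2 - t) c <= M)%R.
Proof.
exists (exp (- (Rabs c * ln 2)))%R, (exp (Rabs c * ln 2))%R. split. apply exp_pos.
intros t Ht.
assert (H1 : (0 <= ln (2 - t))%R) by (rewrite <- ln_1; apply Rcomplements.ln_le; lra).
assert (H2 : (ln (2 - t) <= ln 2)%R) by (apply Rcomplements.ln_le; lra).
assert (H3 : (Rabs (c * ln (2 - t)) <= Rabs c * ln 2)%R).
{ rewrite Rabs_mult, (Rabs_pos_eq (ln _)) by auto. apply Rmult_le_compat_l; auto. apply Rabs_pos. }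
apply Rabs_le_between in H3. unfold Rpower.
split; [destruct (Req_dec (- (Rabs c * ln 2)) (c * ln (2 - t))) as [->|]|
  destruct (Req_dec (Rabs c * ln 2) (c * ln (2 - t))) as [->|]]; try lra;
apply Rlt_le, exp_increasing; lra.
Qed.

(* Uniqueness of the solution that is regular at the singular point [s = 1]: the
   Wronskian of two regular solutions would be a multiple of the non-integral
   power [x^(-c)]. *)
Lemma reg_unique a b f f1 f2 g g1 g2 : nonpole (a + b + 1 / 2) ->
  (forall s : R, 0 < s <= 1 -> gsol a b f f1 f2 s) ->
  (forall s : R, 0 < s <= 1 -> gsol a b g g1 g2 s) ->
  AEC f -> AEC f1 -> AEC g -> AEC g1 -> f 1 = 1 -> g 1 = 1 ->
  forall s : R, 0 < s < 1 -> f s = g s /\ f1 s = g1 s.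
Proof.
intros Hc Hf Hg Af Af1 Ag Ag1 Ef Eg.
set (c := (a + b + 1 / 2)%R) in *.
assert (AW : AEC (fun s => f s * g1 s + (Ropp 1) * (f1 s * g s))).
{ apply AEC_plus. now apply AEC_mult. apply AEC_mult. apply AEC_const. now apply AEC_mult. }
destruct AW as [W [HW EW]].
set (K := (Re (f (1 / 2)%R * g1 (1 / 2)%R - f1 (1 / 2)%R * g (1 / 2)%R)%C * Rpower (1 - 1 / 2 * (1 / 2)) c)%R).
assert (EK : forall s : R, 0 < s < 1 -> (Re (f s * g1 s - f1 s * g s)%C * Rpower (1 - s * s) c = K)%R).
{ intros s Hs. apply (wronskian_const a b f f1 f2 g g1 g2); try lra; intros x Hx;
  [apply Hf|apply Hg]; revert Hx; unfold Rmin, Rmax; destruct Rle_dec; lra. }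
assert (EW' : forall t : R, 0 < t < 1 -> (W t = K * Rpower (2 - t) (- c) * Rpower t (- c))%R).
{ intros t Ht.
  assert (E1 : RtoC (W t) = f (1 - t)%R * g1 (1 - t)%R - f1 (1 - t)%R * g (1 - t)%R).
  { rewrite <- EW by (rewrite Rabs_pos_eq; lra). rewrite RtoC_opp. ring. }
  assert (E2 := EK (1 - t)%R ltac:(lra)). rewrite <- E1 in E2. simpl in E2.
  replace (1 - (1 - t) * (1 - t))%R with ((2 - t) * t)%R in E2 by ring.
  rewrite <- E2, (Rmult_assoc _ (Rpower (2 - t) (- c))), Rpower_mult_distr, Rpower_Ropp by lra. field.
  unfold Rpower; apply Rgt_not_eq, exp_pos. }
assert (K0 : K = 0%R).
{ destruct (Req_dec K 0) as [|HK]; auto. exfalso.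
  destruct (nfloor_ex (Rabs c)) as [N HN]. apply Rabs_pos.
  destruct (HW (S N)) as (p & C & d & Hp & HC & Hd & H).
  destruct (Rpower_bounds (- c)) as (m & M & Hm & HB).
  assert (HK' := Rabs_pos_lt _ HK).
  apply (noAE (S N) p (fun t => K * Rpower (2 - t) (- c))%R (- c) C d (Rabs K * m) (Rabs K * M)); auto.
  - intros j E. apply (Hc j). lra.
  - rewrite S_INR. assert (A := Rle_abs (- c)). rewrite Rabs_Ropp in A. lra.
  - now apply Rmult_lt_0_compat.
  - intros t Ht. rewrite Rabs_mult, (Rabs_pos_eq (Rpower _ _)) by (apply Rlt_le, exp_pos).
    specialize (HB t ltac:(lra)). split; apply Rmult_le_compat_l; lra.
  - intros t Ht. rewrite <- EW' by lra. specialize (H t ltac:(rewrite Rabs_pos_eq; lra)).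
    rewrite (Rabs_pos_eq t) in H by lra. exact H. }
assert (W0 : forall s : R, 0 < s < 1 -> f s * g1 s - f1 s * g s = 0).
{ intros s Hs. assert (E := EK s Hs). rewrite K0 in E.
  assert (E1 := EW (1 - s)%R ltac:(rewrite Rabs_pos_eq; lra)).
  replace (1 - (1 - s))%R with s in E1 by ring. rewrite RtoC_opp in E1.
  replace (f s * g1 s - f1 s * g s) with (f s * g1 s + - (1) * (f1 s * g s)) in E |- * by ring.
  rewrite E1 in E |- *. simpl in E. apply Rmult_integral in E. destruct E as [->|E]; auto.
  exfalso. revert E. unfold Rpower; apply Rgt_not_eq, exp_pos. }
(* At [s = 1] the leading coefficient vanishes, so the equation itself determines the derivative
   from the value, because [2 c <> 0]. *)
assert (W1 : f 1 * g1 1 - f1 1 * g 1 = 0).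
{ destruct (Hf 1%R ltac:(lra)) as [_ [_ E]]. destruct (Hg 1%R ltac:(lra)) as [_ [_ E']].
  rewrite Ef, Eg in *.
  assert (Hc0 : RtoC (2 * c) <> 0).
  { apply RtoC_neq_0. specialize (Hc O). simpl in Hc. lra. }
  assert (Ec : RtoC (2 * c) = 2 * a + 2 * b + 1).
  { unfold c. rewrite RtoC_mult, !RtoC_plus, RtoC_div by lra. field. }
  assert (A1 : RtoC (2 * c) * (g1 1 - f1 1) = 0).
  { rewrite Ec. transitivity (((2 * a + 2 * b + 1) * 1 * g1 1 + 4 * a * b * 1) - ((2 * a + 2 * b + 1) * 1 * f1 1 + 4 * a * b * 1)).
    ring. rewrite <- E, <- E'. ring. }
  destruct (Ceq_dec (g1 1 - f1 1) 0) as [A2|A2]. rewrite <- A2. ring.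
  exfalso. now apply (Cmult_neq_0 _ _ Hc0 A2). }
(* On some [[s1, 1]] the function [f] has no zero, and [g / f] is constant there since the Wronskian
   vanishes. The data at [s1] then agree, and uniqueness at ordinary points does the rest. *)
destruct (Hf 1%R ltac:(lra)) as [F1 _].
destruct (cder_ccont _ _ _ F1 1%R Rlt_0_1) as [d [Hd Hcont]]. rewrite Ef in Hcont.
set (s1 := (1 - Rmin d 1 / 2)%R).
assert (M1 := Rmin_l d 1). assert (M2 := Rmin_r d 1). assert (M3 : 0 < Rmin d 1) by (apply Rmin_case; lra).
assert (Hnz : forall s : R, s1 <= s <= 1 -> f s <> 0).
{ intros s Hs E. specialize (Hcont (RtoC (s - 1))). rewrite Cmod_R, Rabs_left1 in Hcont by lra.
  replace (RtoC 1 + RtoC (s - 1)) with (RtoC s) in Hcont by (rewrite RtoC_minus; ring).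
  rewrite E in Hcont. replace (0 - 1) with (- (1)) in Hcont by ring. rewrite Cmod_m1 in Hcont.
  unfold s1 in Hs. assert (1 < 1)%R by (apply Hcont; lra). lra. }
assert (Hs1 : 0 < s1 < 1) by (unfold s1; lra).
assert (Eq : g s1 / f s1 = 1).
{ transitivity (g 1 / f 1); [|rewrite Ef, Eg; field; apply RtoC_neq_0; lra]. symmetry.
  apply (cder0_const (fun s => g s / f s) s1 1).
  intros t Ht. rewrite real_segment.
  assert (Hy : s1 <= s1 + t * (1 - s1) <= 1) by nra.
  set (y := (s1 + t * (1 - s1))%R) in *.
  destruct (Hf y ltac:(lra)) as [F [_ _]]. destruct (Hg y ltac:(lra)) as [G [_ _]].
  eapply cder_eq; [|apply cder_div; eauto]. assert (Hn := Hnz y Hy).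
  assert (Wy : f y * g1 y - f1 y * g y = 0).
  { destruct (Req_dec y 1) as [->|Hne]; auto. apply W0; lra. }
  replace (g1 y * f y - g y * f1 y) with (f y * g1 y - f1 y * g y) by ring. rewrite Wy. field; auto. }
assert (Hn1 := Hnz s1 ltac:(lra)).
assert (Eqs : f s1 = g s1). { replace (g s1) with (g s1 / f s1 * f s1) by (field; auto). rewrite Eq. ring. }
assert (Eqs1 : f1 s1 = g1 s1).
{ assert (Ws := W0 s1 Hs1). rewrite <- Eqs in Ws.
  replace (g1 s1) with ((f s1 * g1 s1 - f1 s1 * f s1) / f s1 + f1 s1) by (field; auto). rewrite Ws. field; auto. }
intros s Hs. 
assert (Hseg : forall t : R, 0 <= t <= 1 -> 0 < s1 + t * (s - s1) <= 1).
{ intros t Ht. replace (s1 + t * (s - s1))%R with ((1 - t) * s1 + t * s)%R by ring.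
  destruct (Req_dec t 0) as [->|]; [lra|]. split; nra. }
apply (ode_unique a b f f1 f2 g g1 g2 s1 s); auto.
- rewrite Cmod_R, Rabs_pos_eq; lra.
- rewrite Cmod_R, Rabs_pos_eq; lra.
- intros t Ht. rewrite real_segment. auto.
- intros t Ht. rewrite real_segment. auto.
Qed.

Lemma CPS_hc_0 a b c : CPS (hc a b c) 0 = 1.
Proof. rewrite CPS_0. unfold hc; simpl. f_equal. field. Qed.

Lemma Fx_at_1 a b c : Fx a b c 1 = 1.
Proof. unfold Fx. replace (1 - 1 * 1) with (RtoC 0) by ring. apply CPS_hc_0. Qed.

Lemma Cmod_1sq_real (s : R) : 0 < s <= 1 -> Cmod (1 - s * s) < 1.
Proof.
intros Hs. rewrite <- RtoC_mult, <- RtoC_minus, Cmod_R, Rabs_pos_eq; nra.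
Qed.

(** Both sides are regular at [s = 1] with value 1. Euler's form prepares the limit at [s = 0]: its
    series diverges there like [1 / s], so that Abel summation of [s] times the series gives the
    limit of [F]. *)
Lemma Fx_Ex a b (s : R) : nonpole (a + b + 1 / 2) -> 0 < s < 1 ->
  Fx a b (a + b + 1 / 2) s = Ex a b s /\ Fx1 a b (a + b + 1 / 2) s = Ex1 a b s.
Proof.
intros Hc. destruct (AEC_Fx a b _ Hc) as [A1 A2]. destruct (AEC_Ex a b Hc) as [A3 A4].
apply (reg_unique a b _ _ (Fx2 a b (a + b + 1 / 2)) _ _ (Ex2 a b)); auto.
- intros x Hx. apply Fx_gsol; auto. now apply Cmod_1sq_real.
- intros x Hx. apply Ex_gsol; auto. now apply Cmod_1sq_real.
- apply Fx_at_1.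
- unfold Ex. rewrite Fx_at_1. ring.
Qed.

Lemma Fx_ph a b (s : R) : nonpole (a + b + 1 / 2) -> 0 < s < 1 ->
  Fx a b (a + b + 1 / 2) s = ph a b s /\ Fx1 a b (a + b + 1 / 2) s = ph1 a b s.
Proof.
intros Hc. destruct (AEC_Fx a b _ Hc) as [A1 A2]. destruct (AEC_ph a b Hc) as [A3 A4].
apply (reg_unique a b _ _ (Fx2 a b (a + b + 1 / 2)) _ _ (ph2 a b)); auto.
- intros x Hx. apply Fx_gsol; auto. now apply Cmod_1sq_real.
- intros x Hx. apply ph_gsol; auto. simpl; lra.
- apply Fx_at_1.
- unfold ph. replace (wv 1) with (RtoC 0).
  2:{ unfold wv. field. }
  replace (- RtoC 0) with (RtoC 0) by ring. rewrite pow1p_at_0, CPS_hc_0. ring.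
Qed.

(** * The reciprocal Gamma function *)

Open Scope R_scope.

Lemma ln_1p_bound (x : R) : Rabs x <= 1 / 2 -> Rabs (ln (1 + x) - x) <= 2 * x ^ 2.
Proof.
intros H. apply Rabs_le_between in H.
assert (H1 : ln (1 + x) <= x).
{ rewrite <- (ln_exp x) at 2. apply Rcomplements.ln_le. lra. apply exp_ineq1_le. }
assert (H2 : - ln (1 + x) <= / (1 + x) - 1).
{ rewrite <- ln_Rinv by lra. rewrite <- (ln_exp (/ (1 + x) - 1)). apply Rcomplements.ln_le.
  apply Rinv_0_lt_compat; lra. assert (E := exp_ineq1_le (/ (1 + x) - 1)). lra. }
assert (H3 : / (1 + x) - 1 <= - x + 2 * x ^ 2).
{ apply Rmult_le_reg_l with (1 + x). lra. replace ((1 + x) * (/ (1 + x) - 1)) with (- x) by (field; lra). nra. }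
rewrite Rabs_left1; lra.
Qed.

Lemma ex_series_inv_sq : ex_series (fun n => / ((INR n + 1) * (INR n + 2))).
Proof.
exists 1. assert (E : forall n, sum_n (fun n => / ((INR n + 1) * (INR n + 2))) n = 1 - / (INR n + 2)).
{ induction n as [|n IH]. rewrite sum_O. simpl. field.
  rewrite sum_Sn, IH. assert (H := pos_INR n). rewrite S_INR. unfold plus; simpl. field. lra. }
change (is_lim_seq (sum_n (fun n => / ((INR n + 1) * (INR n + 2)))) 1).
apply (is_lim_seq_ext (fun n => 1 - / (INR n + 2))). intros; now rewrite E.
replace (Finite 1) with (Finite (1 - 0)) by (f_equal; ring).
apply is_lim_seq_minus'. apply is_lim_seq_const.
replace (Finite 0) with (Rbar_inv p_infty) by reflexivity.
apply is_lim_seq_inv; [|easy].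
replace p_infty with (Rbar_plus p_infty 2) by reflexivity.
apply is_lim_seq_plus with p_infty 2. apply is_lim_seq_INR. apply is_lim_seq_const. reflexivity.
Qed.

Definition gseq (z : R) (n : nat) : R := poch z (S n) / (INR (fact n) * Rpower (INR n) z).

Lemma gseq_S z n : (1 <= n)%nat ->
  gseq z (S n) = gseq z n * ((1 + z / (INR n + 1)) * Rpower (1 + / INR n) (- z)).
Proof.
intros Hn. apply le_INR in Hn. simpl in Hn. unfold gseq.
change (poch z (S (S n))) with (poch z (S n) * (z + INR (S n))). rewrite fact_simpl, mult_INR, S_INR.
replace (INR n + 1) with (INR n * (1 + / INR n)) at 3 by (field; lra).
assert (0 < / INR n) by (apply Rinv_0_lt_compat; lra).
rewrite <- Rpower_mult_distr by lra. rewrite Rpower_Ropp.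
assert (H1 := INR_fact_neq_0 n).
assert (H2 : Rpower (INR n) z <> 0) by (unfold Rpower; apply Rgt_not_eq, exp_pos).
assert (H3 : Rpower (1 + / INR n) z <> 0) by (unfold Rpower; apply Rgt_not_eq, exp_pos).
field. repeat split; auto; lra.
Qed.

(* The logarithm of the ratio of consecutive terms is of order [1 / n^2]. *)
Lemma gseq_lim z : exists l : R, is_lim_seq (gseq z) l /\ (nonpole z -> l <> 0).
Proof.
(* From the index [N] on, [z / (n + 1)] and [1 / n] are at most [1/2] in absolute value, the range
   of [ln_1p_bound]. *)
destruct (nfloor_ex (2 * Rabs z + 2)) as [N HN]. { assert (H := Rabs_pos z); lra. }
assert (Hz := Rabs_pos z).
assert (HN' : 2 * Rabs z + 1 < INR N) by lra.
assert (HN1 : (1 <= N)%nat) by (apply INR_le; simpl; lra).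
set (d := fun k => ln (1 + z / (INR (k + N) + 1)) - z * ln (1 + / INR (k + N))).
assert (Hd : forall k, Rabs (d k) <= (8 * (z ^ 2 + Rabs z)) * / ((INR k + 1) * (INR k + 2))).
{ intros k. unfold d. rewrite plus_INR. set (x := INR k + INR N).
  assert (Hk := pos_INR k). assert (Hx : 1 <= x /\ 2 * Rabs z <= x /\ INR k + 1 <= x) by (unfold x; lra).
  assert (Hi : 0 < / x) by (apply Rinv_0_lt_compat; lra).
  assert (B1 := ln_1p_bound (z / (x + 1))). assert (B2 := ln_1p_bound (/ x)).
  assert (A1 : Rabs (z / (x + 1)) <= 1 / 2).
  { unfold Rdiv. rewrite Rabs_mult, Rabs_inv, (Rabs_pos_eq (x + 1)) by lra. 
    apply (Rmult_le_reg_r (x + 1)). lra. rewrite Rmult_assoc, Rinv_l by lra. lra. }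
  specialize (B1 A1).
  assert (A2 : Rabs (/ x) <= 1 / 2).
  { rewrite Rabs_pos_eq by lra. apply (Rmult_le_reg_r x). lra. rewrite Rinv_l by lra.
    (* If [x < 2] then [N = 1], and [2 |z| + 1 < N] is absurd. *)
    assert (2 <= x \/ x < 2) by lra. destruct H; [lra|].
    assert (INR N < 2) by (unfold x in *; lra). assert (N < 2)%nat by (apply INR_lt; simpl; lra).
    assert (N = 1%nat) by lia. subst N. simpl in *. lra. }
  specialize (B2 A2).
  replace (ln (1 + z / (x + 1)) - z * ln (1 + / x)) with
   ((ln (1 + z / (x + 1)) - z / (x + 1)) + - (z * (ln (1 + / x) - / x)) + - (z * (/ (x * (x + 1))))) by (field; lra).
  assert (Q : / (x * x) <= 2 * / ((INR k + 1) * (INR k + 2))).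
  { replace (2 * / ((INR k + 1) * (INR k + 2))) with (/ ((INR k + 1) * (INR k + 2) / 2)) by (field; lra).
    apply Rinv_le_contravar. nra. nra. }
  assert (T1 : Rabs (ln (1 + z / (x + 1)) - z / (x + 1)) <= 2 * z ^ 2 * / (x * x)).
  { apply Rle_trans with (1 := B1). unfold Rdiv. rewrite Rpow_mult_distr.
    rewrite Rmult_assoc. apply Rmult_le_compat_l; [lra|]. apply Rmult_le_compat_l; [nra|].
    rewrite pow_inv. apply Rinv_le_contravar. nra. simpl; nra. }
  assert (T2 : Rabs (z * (ln (1 + / x) - / x)) <= 2 * Rabs z * / (x * x)).
  { rewrite Rabs_mult. replace (2 * Rabs z * / (x * x)) with (Rabs z * (2 * (/ x) ^ 2)) by (field; lra).
    now apply Rmult_le_compat_l. }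
  assert (T3 : Rabs (z * (/ (x * (x + 1)))) <= Rabs z * / (x * x)).
  { rewrite Rabs_mult. apply Rmult_le_compat_l; auto.
    rewrite Rabs_pos_eq. apply Rinv_le_contravar; nra. apply Rlt_le, Rinv_0_lt_compat; nra. }
  apply Rle_trans with (1 := Rabs_triang _ _). rewrite Rabs_Ropp.
  apply Rle_trans with (Rabs (ln (1 + z / (x + 1)) - z / (x + 1)) + Rabs (z * (ln (1 + / x) - / x)) + Rabs (z * / (x * (x + 1)))).
  { apply Rplus_le_compat_r. apply Rle_trans with (1 := Rabs_triang _ _). rewrite Rabs_Ropp. lra. }
  apply Rle_trans with ((2 * z ^ 2 + 3 * Rabs z) * / (x * x)); [lra|].
  apply Rle_trans with ((2 * z ^ 2 + 3 * Rabs z) * (2 * / ((INR k + 1) * (INR k + 2)))).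
  apply Rmult_le_compat_l; auto. nra.
  assert (0 < / ((INR k + 1) * (INR k + 2))) by (apply Rinv_0_lt_compat; nra).
  assert (0 <= z ^ 2) by nra. nra. }
assert (Ed : ex_series d).
{ apply (ex_series_le (K := R_AbsRing) (V := R_CompleteNormedModule) _ _ Hd).
  apply exS_scal. apply ex_series_inv_sq. }
destruct Ed as [D HD].
exists (gseq z N * exp D). split.
- apply (is_lim_seq_incr_n _ (S N)).
  apply (is_lim_seq_ext (fun n => gseq z N * exp (sum_n d n))).
  { induction n as [|n IH].
    - rewrite sum_O. replace (0 + S N)%nat with (S N) by lia. rewrite gseq_S by auto. f_equal.
      unfold d, Rminus. rewrite exp_plus, exp_ln. f_equal. unfold Rpower; f_equal.
      simpl; ring. simpl. assert (Rabs z / (INR N + 1) < 1).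
      { apply Rlt_div_l; lra. }
      assert (A := Rle_abs (- z)). rewrite Rabs_Ropp in A.
      assert (- z / (INR N + 1) <= Rabs z / (INR N + 1)).
      { apply Rmult_le_compat_r. apply Rlt_le, Rinv_0_lt_compat; lra. auto. }
      unfold Rdiv in *. lra.
    - rewrite sum_Sn. unfold plus; simpl plus. replace (S n + S N)%nat with (S (n + S N)) by lia.
      change (@Hierarchy.plus R_AbelianMonoid) with Rplus || idtac.
      rewrite gseq_S by lia. rewrite <- IH. 
      unfold plus; simpl. rewrite exp_plus, Rmult_assoc. f_equal. f_equal.
      unfold d, Rminus. replace (S n + N)%nat with (n + S N)%nat by lia.
      rewrite exp_plus, exp_ln. f_equal. unfold Rpower; f_equal; ring.
      assert (X : INR N < INR (n + S N)) by (apply lt_INR; lia).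
      assert (Rabs z / (INR (n + S N) + 1) < 1). { apply Rlt_div_l; lra. }
      assert (A := Rle_abs (- z)). rewrite Rabs_Ropp in A.
      assert (- z / (INR (n + S N) + 1) <= Rabs z / (INR (n + S N) + 1)).
      { apply Rmult_le_compat_r. apply Rlt_le, Rinv_0_lt_compat; lra. auto. }
      unfold Rdiv in *. lra. }
  apply is_lim_seq_mult'. apply is_lim_seq_const.
  apply is_lim_seq_continuous; auto. apply derivable_continuous_pt, derivable_pt_exp.
- intros Hp. apply Rmult_integral_contrapositive. split; [|apply Rgt_not_eq, exp_pos].
  unfold gseq. apply Rmult_integral_contrapositive. split. now apply poch_neq_0.
  apply Rinv_neq_0_compat, Rmult_integral_contrapositive. split. apply INR_fact_neq_0.
  unfold Rpower; apply Rgt_not_eq, exp_pos.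
Qed.

Lemma is_lim_rGamma z : is_lim_seq (gseq z) (rGamma z).
Proof.
destruct (gseq_lim z) as [l [Hl _]]. unfold rGamma. fold (gseq z). rewrite (is_lim_seq_unique _ _ Hl). exact Hl.
Qed.

Lemma rGamma_neq_0 z : nonpole z -> rGamma z <> 0.
Proof.
intros H. destruct (gseq_lim z) as [l [Hl Hn]]. unfold rGamma. fold (gseq z).
rewrite (is_lim_seq_unique _ _ Hl). auto.
Qed.

Lemma poch_shift z n : poch z (S n) = z * poch (z + 1) n.
Proof.
induction n as [|n IH]. simpl; ring.
change (poch z (S (S n))) with (poch z (S n) * (z + INR (S n))). rewrite IH, S_INR. simpl. ring.
Qed.

Lemma is_lim_ratio (x : R) : is_lim_seq (fun n => (INR n + x) / INR n) 1.
Proof.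
apply (is_lim_seq_ext_loc (fun n => 1 + x * / INR n)).
{ exists 1%nat. intros n Hn. apply le_INR in Hn; simpl in Hn. field; lra. }
replace (Finite 1) with (Finite (1 + x * 0)) by (f_equal; ring).
apply is_lim_seq_plus'. apply is_lim_seq_const. apply is_lim_seq_mult'. apply is_lim_seq_const.
replace (Finite 0) with (Rbar_inv p_infty) by reflexivity. apply is_lim_seq_inv; [|easy]. apply is_lim_seq_INR.
Qed.

Lemma rGamma_shift z : rGamma z = z * rGamma (z + 1).
Proof.
assert (H1 : is_lim_seq (fun n => gseq z n * ((INR n + (z + 1)) / INR n)) (rGamma z * 1)).
{ apply is_lim_seq_mult'. apply is_lim_rGamma. apply is_lim_ratio. }
assert (H2 : is_lim_seq (fun n => z * gseq (z + 1) n) (z * rGamma (z + 1))).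
{ apply is_lim_seq_mult'. apply is_lim_seq_const. apply is_lim_rGamma. }
apply (is_lim_seq_ext_loc _ (fun n => z * gseq (z + 1) n)) in H1.
- apply is_lim_seq_unique in H1. apply is_lim_seq_unique in H2. rewrite H1 in H2. injection H2. lra.
- exists 1%nat. intros n Hn. apply le_INR in Hn; simpl in Hn. unfold gseq.
  replace (z * (poch (z + 1) (S n) / (INR (fact n) * Rpower (INR n) (z + 1)))) with
   ((z * poch (z + 1) (S n)) / (INR (fact n) * Rpower (INR n) (z + 1))) by (unfold Rdiv; ring).
  rewrite <- poch_shift. change (poch z (S (S n))) with (poch z (S n) * (z + INR (S n))).
  rewrite Rpower_plus, Rpower_1, S_INR by lra.
  assert (H3 := INR_fact_neq_0 n).
  assert (H4 : Rpower (INR n) z <> 0) by (unfold Rpower; apply Rgt_not_eq, exp_pos).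
  field. repeat split; auto; lra.
Qed.

Lemma poch_1 n : poch 1 n = INR (fact n).
Proof.
induction n as [|n IH]. reflexivity. rewrite fact_simpl, mult_INR, <- IH, S_INR. simpl. ring.
Qed.

Lemma rGamma_1 : rGamma 1 = 1.
Proof.
assert (H1 := is_lim_rGamma 1). assert (H2 := is_lim_ratio 1).
apply (is_lim_seq_ext_loc _ (gseq 1)) in H2.
- apply is_lim_seq_unique in H1. apply is_lim_seq_unique in H2. rewrite H1 in H2. now injection H2.
- exists 1%nat. intros n Hn. apply le_INR in Hn; simpl in Hn. unfold gseq.
  rewrite poch_1, fact_simpl, mult_INR, Rpower_1, S_INR by lra.
  assert (H3 := INR_fact_neq_0 n). field. split; auto; lra.
Qed.

(** The factorials cancel and the powers of [n] combine; in the two applications the exponent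
    [a + b - c - 1/2] is 0 and -1. *)
Lemma gseq_quot a b c (n : nat) : (1 <= n)%nat ->
  poch c (S n) <> 0 ->
  poch a (S n) * poch b (S n) / (poch c (S n) * poch (1 / 2) (S n)) =
  gseq a n * gseq b n / (gseq c n * gseq (1 / 2) n) * Rpower (INR n) (a + b - c - 1 / 2).
Proof.
intros Hn Hc. apply le_INR in Hn; simpl in Hn.
assert (Hh := poch_neq_0 _ (S n) nonpole_half).
unfold gseq.
assert (E : Rpower (INR n) a * Rpower (INR n) b =
  Rpower (INR n) (a + b - c - 1 / 2) * (Rpower (INR n) c * Rpower (INR n) (1 / 2))).
{ rewrite <- !Rpower_plus. f_equal. ring. }
assert (P : forall x, Rpower (INR n) x <> 0) by (intros x; unfold Rpower; apply Rgt_not_eq, exp_pos).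
assert (H3 := INR_fact_neq_0 n).
set (pa := Rpower (INR n) a) in *. set (pb := Rpower (INR n) b) in *.
assert (Hab : pa * pb <> 0) by (unfold pa, pb; apply Rmult_integral_contrapositive; auto).
transitivity (poch a (S n) * poch b (S n) / (poch c (S n) * poch (1 / 2) (S n)) * ((pa * pb) / (pa * pb))).
{ field. repeat split; auto; unfold pa, pb; auto. }
rewrite E at 1. field. unfold pa, pb. repeat split; auto.
Qed.

(** The coefficients of [(1 - x)^(-1/2)]. *)
Definition vn (n : nat) : R := poch (1 / 2) n / INR (fact n).

(** Gauss's value of [F(a, b; c; 1)], with [c - a = b + 1/2], [c - b = a + 1/2] and
    [c - a - b = 1/2]. *)
Definition cA (a b : R) : R := rGamma (a + 1 / 2) * rGamma (b + 1 / 2) / (rGamma (a + b + 1 / 2) * rGamma (1 / 2)).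

(** The classical coefficient [Gamma(c) Gamma(-1/2) / (Gamma(a) Gamma(b))] of [(1 - x)^(1/2) = s],
    with [Gamma(-1/2) = -2 Gamma(1/2)]. *)
Definition cB (a b : R) : R := -2 * (rGamma a * rGamma b / (rGamma (a + b + 1 / 2) * rGamma (1 / 2))).

Lemma is_lim_quot a b c : nonpole c -> is_lim_seq (fun n => gseq a n * gseq b n / (gseq c n * gseq (1 / 2) n))
   (rGamma a * rGamma b / (rGamma c * rGamma (1 / 2))).
Proof.
intros Hc. apply is_lim_seq_div'. apply is_lim_seq_mult'; apply is_lim_rGamma.
apply is_lim_seq_mult'; apply is_lim_rGamma.
apply Rmult_integral_contrapositive. split; apply rGamma_neq_0; auto. apply nonpole_half.
Qed.

Lemma lim_coef_A a b : nonpole (a + b + 1 / 2) ->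
  is_lim_seq (fun n => hc (a + 1 / 2) (b + 1 / 2) (a + b + 1 / 2) n / vn n) (cA a b).
Proof.
intros Hc. apply is_lim_seq_incr_1.
apply (is_lim_seq_ext_loc (fun n => gseq (a + 1 / 2) n * gseq (b + 1 / 2) n / (gseq (a + b + 1 / 2) n * gseq (1 / 2) n))).
2: now apply is_lim_quot.
exists 1%nat. intros n Hn.
assert (E := gseq_quot (a + 1 / 2) (b + 1 / 2) (a + b + 1 / 2) n Hn (poch_neq_0 _ _ Hc)).
replace (a + 1 / 2 + (b + 1 / 2) - (a + b + 1 / 2) - 1 / 2) with 0 in E by ring.
rewrite Rpower_O, Rmult_1_r in E by (apply le_INR in Hn; simpl in Hn; lra). rewrite <- E.
unfold hc, vn. assert (H1 := poch_neq_0 _ (S n) Hc). assert (H2 := poch_neq_0 _ (S n) nonpole_half).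
assert (H3 := INR_fact_neq_0 (S n)).
set (p1 := poch _ (S n)) in *. set (p2 := poch _ (S n)) in *. set (p3 := poch _ (S n)) in *. set (p4 := poch _ (S n)) in *.
field. auto.
Qed.

Lemma lim_coef_B a b : nonpole (a + b + 1 / 2) ->
  is_lim_seq (fun n => PS_derive (hc a b (a + b + 1 / 2)) n / vn n)
   (rGamma a * rGamma b / (rGamma (a + b + 1 / 2) * rGamma (1 / 2))).
Proof.
intros Hc.
apply (is_lim_seq_ext_loc (fun n => gseq a n * gseq b n / (gseq (a + b + 1 / 2) n * gseq (1 / 2) n) * ((INR n + 1 / 2) / INR n))).
2:{ rewrite <- (Rmult_1_r (rGamma a * rGamma b / (rGamma (a + b + 1 / 2) * rGamma (1 / 2)))). apply is_lim_seq_mult'. now apply is_lim_quot. apply is_lim_ratio. }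
exists 1%nat. intros n Hn.
assert (E := gseq_quot a b (a + b + 1 / 2) n Hn (poch_neq_0 _ _ Hc)).
replace (a + b - (a + b + 1 / 2) - 1 / 2) with (- (1)) in E by field.
apply le_INR in Hn; simpl in Hn.
rewrite Rpower_Ropp, Rpower_1 in E by lra.
set (X := gseq a n * gseq b n / (gseq (a + b + 1 / 2) n * gseq (1 / 2) n)) in *.
replace (X * ((INR n + 1 / 2) / INR n)) with (X * / INR n * (INR n + 1 / 2)) by (field; lra).
rewrite <- E.
unfold PS_derive, hc, vn. rewrite fact_simpl, mult_INR.
change (poch (1 / 2) (S n)) with (poch (1 / 2) n * (1 / 2 + INR n)).
assert (H1 := poch_neq_0 _ (S n) Hc). assert (H2 := poch_neq_0 _ n nonpole_half).
assert (H3 := INR_fact_neq_0 n). assert (H4 : INR (S n) <> 0) by (apply not_0_INR; lia).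
field. repeat split; auto; lra.
Qed.

Lemma vn_bc n : vn n = bc (- (1 / 2)) n * (-1) ^ n.
Proof.
unfold vn, bc. rewrite Ropp_involutive.
replace ((-1) ^ n * poch (1 / 2) n / INR (fact n) * (-1) ^ n) with
 (((-1) ^ n * (-1) ^ n) * (poch (1 / 2) n / INR (fact n))) by (unfold Rdiv; ring).
rewrite <- Rpow_mult_distr. replace (-1 * -1) with 1 by ring. rewrite pow1. ring.
Qed.

Lemma vn_pos n : 0 < vn n.
Proof.
unfold vn. apply Rdiv_lt_0_compat. 2: apply INR_fact_lt_0.
induction n as [|n IH]; simpl. lra. assert (H := pos_INR n). apply Rmult_lt_0_compat; lra.
Qed.

Lemma PSeries_vn (s : R) : 0 < s < 1 -> PSeries vn (1 - s * s) = / s.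
Proof.
intros Hs.
assert (E := pow1p_RtoC (- (1 / 2)) (- (1 - s * s)) ltac:(nra)).
unfold pow1p in E. rewrite CPS_RtoC in E. apply (f_equal Re) in E. simpl in E.
replace (1 + - (1 - s * s)) with (s * s) in E by ring.
rewrite Rpower_Ropp in E.
replace (Rpower (s * s) (1 / 2)) with s in E.
2:{ replace (1 / 2) with (/ 2) by field. rewrite Rpower_sqrt by nra. symmetry. apply sqrt_square. lra. }
rewrite <- E. unfold PSeries. apply Series_ext. intros n.
rewrite vn_bc. replace (- (1 - s * s)) with (-1 * (1 - s * s)) by ring. rewrite Rpow_mult_distr. ring.
Qed.

(* Abel's theorem in the divergent case: the comparison series [PSeries vn (1 - s * s)] is [/ s]. *)
Lemma abel_limit (u : nat -> R) (l : R) : rad1 u -> is_lim_seq (fun n => u n / vn n) l ->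
  forall eps, 0 < eps -> exists delta, 0 < delta <= 1 /\ forall s, 0 < s < delta ->
    Rabs (s * PSeries u (1 - s * s) - l) < eps.
Proof.
intros Hu Hl eps He.
apply is_lim_seq_spec in Hl. assert (He2 : 0 < eps / 2) by lra.
destruct (Hl (mkposreal (eps / 2) He2)) as [N HN]. simpl in HN.
(* The finitely many terms where the ratio is not yet close to [l] are dominated by a geometric
   sequence; its sum adds at most [2 M], which the factor [s] makes small. *)
assert (HM : forall p, exists M, 0 <= M /\ forall n, (n < p)%nat -> Rabs (u n - l * vn n) <= M * (1 / 2) ^ n).
{ induction p as [|p [M [HM IH]]]. exists 0; split; [lra|]. intros; lia.
  exists (M + Rabs (u p - l * vn p) * 2 ^ p). 
  assert (0 < 2 ^ p) by (apply pow_lt; lra). assert (Hp := Rabs_pos (u p - l * vn p)).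
  assert (0 <= Rabs (u p - l * vn p) * 2 ^ p) by (apply Rmult_le_pos; lra).
  split. lra. intros n Hn. assert (0 < (1 / 2) ^ n) by (apply pow_lt; lra).
  destruct (Nat.eq_dec n p) as [->|Hnp].
  - replace ((M + Rabs (u p - l * vn p) * 2 ^ p) * (1 / 2) ^ p) with (M * (1 / 2) ^ p + Rabs (u p - l * vn p) * (2 ^ p * (1 / 2) ^ p)) by ring.
    rewrite <- Rpow_mult_distr. replace (2 * (1 / 2)) with 1 by field. rewrite pow1.
    assert (0 <= M * (1 / 2) ^ p) by (apply Rmult_le_pos; lra). lra.
  - apply Rle_trans with (M * (1 / 2) ^ n). apply IH; lia. apply Rmult_le_compat_r; lra. }
destruct (HM N) as [M [HM0 HMN]].
assert (Hall : forall n, Rabs (u n - l * vn n) <= eps / 2 * vn n + M * (1 / 2) ^ n).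
{ intros n. assert (P := vn_pos n). assert (P2 : 0 < (1 / 2) ^ n) by (apply pow_lt; lra).
  destruct (Nat.lt_ge_cases n N) as [H|H].
  - specialize (HMN n H). nra.
  - specialize (HN n H). replace (u n - l * vn n) with ((u n / vn n - l) * vn n) by (field; lra).
    rewrite Rabs_mult, (Rabs_pos_eq (vn n)) by lra.
    assert (Rabs (u n / vn n - l) * vn n <= eps / 2 * vn n) by (apply Rmult_le_compat_r; lra). nra. }
exists (Rmin 1 (eps / 2 / (2 * M + 1))). split.
{ split. apply Rmin_case; [lra|]. apply Rdiv_lt_0_compat; lra. apply Rmin_l. }
intros s Hs. assert (M1 := Rmin_l 1 (eps / 2 / (2 * M + 1))). assert (M2 := Rmin_r 1 (eps / 2 / (2 * M + 1))).
set (x := 1 - s * s). assert (Hx : 0 <= x < 1) by (unfold x; nra).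
assert (Hv : rad1 vn).
{ apply (rad1_ratio _ 0 0). intros n _. rewrite !Rabs_pos_eq by (apply Rlt_le, vn_pos).
  unfold vn. rewrite fact_simpl, mult_INR. simpl poch. rewrite S_INR.
  assert (H3 := INR_fact_lt_0 n). assert (Hn := pos_INR n).
  assert (Hpn : 0 < vn n) by apply vn_pos. unfold vn in Hpn.
  replace (poch (1 / 2) n * (1 / 2 + INR n) / ((INR n + 1) * INR (fact n))) with
    (((1 / 2 + INR n) / (INR n + 1)) * (poch (1 / 2) n / INR (fact n))) by (field; lra).
  apply Rmult_le_compat_r. lra.
  replace (1 + 0 / (INR n + 1)) with 1 by (field; lra). apply Rle_div_l; lra. }
assert (Ev : ex_series (fun n => vn n * x ^ n)).
{ apply ex_series_Rabs. apply CV_disk_inside, CV_rad1; auto. rewrite Rabs_pos_eq; lra. }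
assert (Eu : ex_series (fun n => u n * x ^ n)).
{ apply ex_series_Rabs. apply CV_disk_inside, CV_rad1; auto. rewrite Rabs_pos_eq; lra. }
assert (Eg : ex_series (fun n => (1 / 2) ^ n)) by (apply ex_series_geom; rewrite Rabs_pos_eq; lra).
assert (Sg : Series (fun n => (1 / 2) ^ n) = 2) by (rewrite Series_geom; [field|rewrite Rabs_pos_eq; lra]).
assert (Ebig : ex_series (fun n => eps / 2 * (vn n * x ^ n) + M * (1 / 2) ^ n)).
{ apply (ex_series_plus (K := R_AbsRing) (V := R_NormedModule)); now apply exS_scal. }
assert (B : Rabs (PSeries u x - l * PSeries vn x) <= eps / 2 * PSeries vn x + M * 2).
{ replace (M * 2) with (M * Series (fun n => (1 / 2) ^ n)) by now rewrite Sg.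
  unfold PSeries. rewrite <- !Series_scal_l, <- Series_minus, <- Series_plus; auto; try (now apply exS_scal).
  assert (L : forall n, Rabs (u n * x ^ n - l * (vn n * x ^ n)) <= eps / 2 * (vn n * x ^ n) + M * (1 / 2) ^ n).
  { intros n. replace (u n * x ^ n - l * (vn n * x ^ n)) with ((u n - l * vn n) * x ^ n) by ring.
    assert (Hp : 0 <= x ^ n <= 1). { split. apply pow_le; lra. rewrite <- (pow1 n). apply pow_incr; lra. }
    rewrite Rabs_mult, (Rabs_pos_eq (x ^ n)) by lra.
    apply Rle_trans with ((eps / 2 * vn n + M * (1 / 2) ^ n) * x ^ n). apply Rmult_le_compat_r; auto; lra.
    assert (P2 : 0 < (1 / 2) ^ n) by (apply pow_lt; lra).
    assert (0 <= M * (1 / 2) ^ n) by (apply Rmult_le_pos; lra). nra. }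
  assert (Eab : ex_series (fun n => Rabs (u n * x ^ n - l * (vn n * x ^ n)))).
  { apply (ex_series_le (K := R_AbsRing) (V := R_CompleteNormedModule) _ (fun n => eps / 2 * (vn n * x ^ n) + M * (1 / 2) ^ n)); auto.
    intros n. change (Rabs (Rabs (u n * x ^ n - l * (vn n * x ^ n))) <= eps / 2 * (vn n * x ^ n) + M * (1 / 2) ^ n).
    rewrite Rabs_Rabsolu. auto. }
  apply Rle_trans with (1 := Series_Rabs _ Eab). now apply Series_le_ex. }
unfold x in B. rewrite PSeries_vn in B by lra. fold x in B.
replace (s * PSeries u x - l) with (s * (PSeries u x - l * / s)) by (field; lra).
rewrite Rabs_mult, (Rabs_pos_eq s) by lra.
apply Rle_lt_trans with (s * (eps / 2 * / s + M * 2)). apply Rmult_le_compat_l; lra.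
replace (s * (eps / 2 * / s + M * 2)) with (eps / 2 + 2 * M * s) by (field; lra).
assert (Hs2 : s < eps / 2 / (2 * M + 1)) by lra.
apply Rmult_lt_compat_r with (r := 2 * M + 1) in Hs2; [|lra].
replace (eps / 2 / (2 * M + 1) * (2 * M + 1)) with (eps / 2) in Hs2 by (field; lra). lra.
Qed.

(** * Connection formulae *)

Open Scope C_scope.

Lemma Fx_RtoC a b c (s : R) : Fx a b c s = RtoC (PSeries (hc a b c) (1 - s * s)).
Proof. unfold Fx. rewrite <- RtoC_mult, <- RtoC_minus. apply CPS_RtoC. Qed.

Lemma Fx1_RtoC a b c (s : R) : Fx1 a b c s = RtoC (-2 * (s * PSeries (PS_derive (hc a b c)) (1 - s * s))).
Proof. unfold Fx1. rewrite <- !RtoC_mult, <- RtoC_minus, CPS_RtoC, <- RtoC_opp, <- RtoC_mult. f_equal. ring. Qed.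

Lemma Fx_limit a b : nonpole (a + b + 1 / 2) -> forall eps, 0 < eps ->
  exists delta, 0 < delta <= 1 /\ forall s : R, 0 < s < delta ->
    Cmod (Fx a b (a + b + 1 / 2) s - cA a b) < eps.
Proof.
intros Hc eps He.
destruct (abel_limit _ _ (rad1_hc (a + 1 / 2) (b + 1 / 2) _ Hc) (lim_coef_A a b Hc) eps He) as [d [Hd H]].
exists d. split; auto. intros s Hs. destruct (Fx_Ex a b s Hc ltac:(lra)) as [-> _].
unfold Ex. rewrite Fx_RtoC, <- RtoC_mult, <- RtoC_minus, Cmod_R. auto.
Qed.

Lemma Fx1_limit a b : nonpole (a + b + 1 / 2) -> forall eps, 0 < eps ->
  exists delta, 0 < delta <= 1 /\ forall s : R, 0 < s < delta ->
    Cmod (Fx1 a b (a + b + 1 / 2) s - cB a b) < eps.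
Proof.
intros Hc eps He.
destruct (abel_limit _ _ (rad1_derive _ (rad1_hc a b _ Hc)) (lim_coef_B a b Hc) (eps / 2) ltac:(lra)) as [d [Hd H]].
exists d. split; auto. intros s Hs. rewrite Fx1_RtoC, <- RtoC_minus, Cmod_R. specialize (H s Hs).
unfold cB. rewrite <- Rmult_minus_distr_l, Rabs_mult. replace (Rabs (-2)) with 2%R by (rewrite Rabs_left; lra). lra.
Qed.

Lemma connection a b (s : R) : nonpole (a + b + 1 / 2) -> 0 < s < 1 ->
  Fx a b (a + b + 1 / 2) s = cA a b * ev a b s + cB a b * od a b s /\
  Fx1 a b (a + b + 1 / 2) s = cA a b * ev1 a b s + cB a b * od1 a b s.
Proof.
intros Hc. apply (ode_from_limits a b _ _ (Fx2 a b (a + b + 1 / 2))).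
- intros x Hx. apply Fx_gsol; auto. apply Cmod_1sq_real; lra.
- intros eps He. destruct (Fx_limit a b Hc eps He) as [d [Hd H]]. destruct (Fx1_limit a b Hc eps He) as [d' [Hd' H']].
  exists (Rmin d d'). split. apply Rmin_case; lra.
  assert (A := Rmin_l d d'). assert (B := Rmin_r d d'). intros x Hx. split; [apply H|apply H']; lra.
Qed.

Lemma ev_at_0 a b : ev a b 0 = 1.
Proof. unfold ev. replace (RtoC 0 * 0) with (RtoC 0) by ring. apply CPS_hc_0. Qed.

Lemma ev1_at_0 a b : ev1 a b 0 = 0.
Proof. unfold ev1. ring. Qed.

Lemma od_at_0 a b : od a b 0 = 0.
Proof. unfold od. ring. Qed.

Lemma od1_at_0 a b : od1 a b 0 = 1.
Proof. unfold od1. cbv zeta. replace (RtoC 0 * 0) with (RtoC 0) by ring. rewrite CPS_hc_0. ring. Qed.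

(* [od 0 0] is the arcsine, whose value [PI / 2] at 1 gives [rGamma (1 / 2)]. *)
Lemma od1_asin (s : R) : 0 <= s < 1 -> (Re (od1 0 0 s) * sqrt (1 - s * s) = 1)%R.
Proof.
intros Hs.
assert (W := wronskian_const 0 0 (ev 0 0) (ev1 0 0) (ev2 0 0) (od 0 0) (od1 0 0) (od2 0 0) s 0 ltac:(lra) ltac:(lra)).
rewrite ev_at_0, od_at_0, ev1_at_0, od1_at_0 in W.
assert (Hr : forall x : R, (Rmin s 0 <= x <= Rmax s 0)%R -> Cmod x < 1).
{ intros x Hx. rewrite Rmin_right, Rmax_left in Hx by lra. rewrite Cmod_R, Rabs_pos_eq; lra. }
specialize (W (fun x Hx => ev_gsol 0 0 x (Hr x Hx)) (fun x Hx => od_gsol 0 0 x (Hr x Hx))).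
(* For [a = b = 0] the even solution is the constant 1, so the Wronskian reduces to the derivative
   of the odd solution. *)
assert (Hz : forall n, (1 <= n)%nat -> hc 0 0 (1 / 2) n = 0%R).
{ intros n Hn. unfold hc. destruct n; [lia|]. rewrite (poch_shift 0 n). unfold Rdiv; ring. }
assert (E : ev 0 0 s = 1).
{ unfold ev. rewrite CPS_head by (apply rad1_disk; [apply rad1_hc, nonpole_half|];
   rewrite <- RtoC_mult, Cmod_R, Rabs_pos_eq; nra).
  replace (CPS (fun n => hc 0 0 (1 / 2) (S n)) (s * s)) with (RtoC 0).
  unfold hc; simpl. replace (1 * 1 / (1 * 1))%R with 1%R by field. ring.
  symmetry. apply C_ext; apply Series_zero; intros n; rewrite Hz by lia; simpl; ring. }
assert (E1 : ev1 0 0 s = 0).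
{ unfold ev1. replace (CPS1 (hc 0 0 (1 / 2)) (s * s)) with (RtoC 0). ring.
  symmetry. apply C_ext; apply Series_zero; intros n; unfold PS_derive; rewrite Hz by lia; simpl; ring. }
rewrite E, E1 in W.
replace (1 * od1 0 0 s - 0 * od 0 0 s) with (od1 0 0 s) in W by ring.
replace (1 * 1 - 0 * 0) with (RtoC 1) in W by ring.
replace (0 + 0 + 1 / 2)%R with (/ 2)%R in W by field.
rewrite !Rpower_sqrt in W by nra. rewrite W. simpl. replace (1 - 0 * 0)%R with 1%R by ring. rewrite sqrt_1. ring.
Qed.

Lemma od_sin (p : R) : 0 <= p < PI / 2 -> Re (od 0 0 (sin p)) = p.
Proof.
intros Hp. assert (HPI := PI_RGT_0).
assert (E : (Re (od 0 0 (sin p)) - p = Re (od 0 0 (sin 0)) - 0)%R).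
{ apply (is_derive_const_on (fun x : R => Re (od 0 0 (sin x)) - x)%R).
  intros x Hx. rewrite Rmin_right, Rmax_left in Hx by lra.
  assert (Hc : (0 < cos x)%R) by (apply cos_gt_0; lra).
  assert (Hs0 : (0 <= sin x)%R) by (apply sin_ge_0; lra).
  assert (Hsc := sin2_cos2 x). unfold Rsqr in Hsc.
  assert (Hs : (0 <= sin x < 1)%R) by nra.
  assert (Hm : Cmod (sin x) < 1) by (rewrite Cmod_R, Rabs_pos_eq; lra).
  destruct (od_gsol 0 0 (sin x) Hm) as [D _].
  replace (RtoC (sin x)) with (0 + sin x * 1) in D by ring. apply cder_Re_line in D.
  replace (0 + sin x * 1) with (RtoC (sin x)) in D by ring. rewrite Cmult_1_r in D.
  assert (D2 : is_derive (fun u : R => Re (od 0 0 u)) (sin x) (Re (od1 0 0 (sin x)))).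
  { eapply is_derive_ext; [|exact D]. intros u. cbv beta. replace (0 + u * 1) with (RtoC u) by ring. reflexivity. }
  assert (H := od1_asin (sin x) Hs).
  replace (1 - sin x * sin x)%R with (cos x * cos x)%R in H by lra. rewrite sqrt_square in H by lra.
  assert (Dc := is_derive_comp (fun u : R => Re (od 0 0 u)) sin x _ _ D2 (is_derive_sin x)).
  eapply (eq_ind _ (fun l => is_derive _ _ l)).
  apply (is_derive_minus (K := R_AbsRing) (V := R_NormedModule) _ _ x _ _ Dc (is_derive_id x)).
  change (cos x * Re (od1 0 0 (sin x)) - 1 = 0)%R. rewrite <- H. ring. }
rewrite sin_0, od_at_0 in E. simpl in E. simpl. lra.
Qed.

(** The limit of [F(1/2, 1/2; 3/2; x)] as [x] tends to 1 is found twice: by Abel summation it is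
    [A = 1 / (2 rGamma(1/2)^2)], and at [x = (cos e)^2] the function times [cos e] is the arcsine of
    [cos e], that is [PI / 2 - e]. *)
Lemma rGamma_half_sq : (rGamma (1 / 2) * rGamma (1 / 2) = / PI)%R.
Proof.
assert (Hp : nonpole (1 / 2 + 1 / 2 + 1 / 2)) by (intros n; assert (H := pos_INR n); lra).
assert (Hn := rGamma_neq_0 _ nonpole_half).
assert (EA : cA (1 / 2) (1 / 2) = (/ (2 * (rGamma (1 / 2) * rGamma (1 / 2))))%R).
{ unfold cA. replace (1 / 2 + 1 / 2)%R with 1%R by field. rewrite rGamma_1.
  assert (H := rGamma_shift (1 / 2)). replace (1 / 2 + 1)%R with (1 + 1 / 2)%R in H by ring.
  replace (rGamma (1 + 1 / 2)) with (2 * rGamma (1 / 2))%R by (rewrite H; field). field. auto. }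
assert (HPI := PI_RGT_0).
set (A := cA (1 / 2) (1 / 2)) in *.
assert (L : forall eps, (0 < eps < 1)%R -> (Rabs (A - PI / 2) <= eps * (3 + Rabs A))%R).
{ intros eps He.
  destruct (Fx_limit (1 / 2) (1 / 2) Hp eps ltac:(lra)) as [d [Hd H]].
  set (e := (Rmin d eps / 2)%R). assert (M1 := Rmin_l d eps). assert (M2 := Rmin_r d eps).
  assert (M3 : (0 < Rmin d eps)%R) by (apply Rmin_case; lra).
  assert (He1 : (0 < e < 1)%R) by (unfold e; lra).
  assert (HPI2 := PI2_1).
  assert (Hse : (0 < sin e < d)%R).
  { split. apply sin_gt_0; lra. assert (F := Rabs_sin_le e). rewrite (Rabs_pos_eq e) in F by lra.
    assert (F' := Rle_abs (sin e)). unfold e in *; lra. }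
  specialize (H (sin e) Hse).
  set (F := PSeries (hc (1 / 2) (1 / 2) (1 / 2 + 1 / 2 + 1 / 2)) (1 - sin e * sin e)) in *.
  assert (EF : (F * cos e = PI / 2 - e)%R).
  { rewrite <- (od_sin (PI / 2 - e)) by lra. rewrite sin_shift. unfold od.
    replace (0 + 1 / 2)%R with (1 / 2)%R by ring. replace (3 / 2)%R with (1 / 2 + 1 / 2 + 1 / 2)%R by field.
    rewrite <- RtoC_mult, CPS_RtoC, <- RtoC_mult. simpl Re.
    assert (Hsc := sin2_cos2 e). unfold Rsqr in Hsc.
    unfold F. replace (1 - sin e * sin e)%R with (cos e * cos e)%R by lra. ring. }
  rewrite Fx_RtoC, <- RtoC_minus, Cmod_R in H. fold F A in H.
  assert (Hcos := Rabs_cos_1_le e).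
  replace (A - PI / 2)%R with (- (F - A) + (- (F * (cos e - 1)) - e))%R by (rewrite Rmult_minus_distr_l, EF; ring).
  assert (HFA : (Rabs F <= 1 + Rabs A)%R).
  { replace F with ((F - A) + A)%R by ring. apply Rle_trans with (1 := Rabs_triang _ _). lra. }
  apply Rle_trans with (1 := Rabs_triang _ _). rewrite Rabs_Ropp.
  assert (T := Rabs_triang (- (F * (cos e - 1))) (- e)). rewrite !Rabs_Ropp, Rabs_mult, (Rabs_pos_eq e) in T by lra.
  assert (T2 : (Rabs F * Rabs (cos e - 1) <= (1 + Rabs A) * eps)%R).
  { apply Rmult_le_compat; try apply Rabs_pos; auto. apply Rle_trans with (1 := Hcos). unfold e in *; nra. }
  unfold Rminus at 2. unfold e in *. lra. }
assert (E : A = (PI / 2)%R).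
{ destruct (Req_dec A (PI / 2)) as [|Hne]; auto. exfalso.
  assert (Hpos : (0 < Rabs (A - PI / 2))%R) by (apply Rabs_pos_lt; lra).
  assert (HA := Rabs_pos A).
  set (x := (Rabs (A - PI / 2) / 2 / (3 + Rabs A))%R).
  assert (Hx : (0 < x)%R) by (repeat apply Rdiv_lt_0_compat; lra).
  assert (Hxe : (x * (3 + Rabs A) = Rabs (A - PI / 2) / 2)%R) by (unfold x; field; lra).
  specialize (L (Rmin (1 / 2) x)). assert (M1 := Rmin_l (1 / 2) x). assert (M2 := Rmin_r (1 / 2) x).
  assert (M3 : (0 < Rmin (1 / 2) x)%R) by (apply Rmin_case; lra).
  specialize (L ltac:(lra)). nra. }
rewrite EA in E.
assert (Hq : (rGamma (1 / 2) * rGamma (1 / 2) <> 0)%R) by now apply Rmult_integral_contrapositive.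
set (q := (rGamma (1 / 2) * rGamma (1 / 2))%R) in *.
assert (E2 : (PI * q = 1)%R).
{ replace PI with (2 * (PI / 2))%R by field. rewrite <- E. field. auto. }
apply (Rmult_eq_reg_l PI); [|lra]. rewrite E2. field. lra.
Qed.

Lemma rGamma_half : rGamma (1 / 2) = (/ sqrt PI)%R.
Proof.
assert (HPI := PI_RGT_0).
assert (Hn := rGamma_neq_0 _ nonpole_half).
assert (H0 : (0 <= rGamma (1 / 2))%R).
{ assert (L := is_lim_rGamma (1 / 2)).
  apply (is_lim_seq_le (fun _ => 0%R) (gseq (1 / 2)) 0 (rGamma (1 / 2))); auto.
  2: apply is_lim_seq_const.
  intros n. unfold gseq. apply Rlt_le, Rdiv_lt_0_compat.
  assert (H := vn_pos (S n)). unfold vn in H. assert (Hf := INR_fact_lt_0 (S n)).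
  replace (poch (1 / 2) (S n)) with (poch (1 / 2) (S n) / INR (fact (S n)) * INR (fact (S n)))%R by (field; lra).
  now apply Rmult_lt_0_compat.
  apply Rmult_lt_0_compat. apply INR_fact_lt_0. apply exp_pos. }
rewrite <- sqrt_inv, <- rGamma_half_sq. symmetry. now apply sqrt_square.
Qed.

Definition ps1 (a b : R) (s : C) : C := cA a b * ev a b s + cB a b * od a b s.

Definition ps1' (a b : R) (s : C) : C := cA a b * ev1 a b s + cB a b * od1 a b s.

Definition ps1'' (a b : R) (s : C) : C := cA a b * ev2 a b s + cB a b * od2 a b s.

Lemma ps1_gsol a b s : Cmod s < 1 -> gsol a b (ps1 a b) (ps1' a b) (ps1'' a b) s.
Proof. intros Hs. apply gsol_lin. now apply ev_gsol. now apply od_gsol. Qed.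

Lemma ps1_at_0 a b : ps1 a b 0 = cA a b /\ ps1' a b 0 = cB a b.
Proof. unfold ps1, ps1'. rewrite ev_at_0, od_at_0, ev1_at_0, od1_at_0. split; ring. Qed.

Lemma seg0_lt1 (s : C) (t : R) : Cmod s < 1 -> 0 <= t <= 1 -> Cmod (0 + t * (s - 0)) < 1.
Proof. intros Hs Ht. now apply Cmod_seg. Qed.

Lemma xpw_at_0 r : xpw r 0 = 1.
Proof. unfold xpw. replace (- (RtoC 0 * 0)) with (RtoC 0) by ring. apply pow1p_at_0. Qed.

(** At [s = 0] the factor [x^(1 - c)] has value 1 and derivative 0, so the second solution has there
    the same data as its hypergeometric factor, namely [cA] and [cB] of the changed parameters. *)
Lemma ps2_eq a b (s : C) : Cmod s < 1 ->
  xpw (1 / 2 - a - b) s * ps1 (1 / 2 - b) (1 / 2 - a) s =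
  cA (1 / 2 - b) (1 / 2 - a) * ev a b s + cB (1 / 2 - b) (1 / 2 - a) * od a b s /\
  xm1 (1 / 2 - a - b) (ps1 (1 / 2 - b) (1 / 2 - a)) (ps1' (1 / 2 - b) (1 / 2 - a)) s =
  cA (1 / 2 - b) (1 / 2 - a) * ev1 a b s + cB (1 / 2 - b) (1 / 2 - a) * od1 a b s.
Proof.
intros Hs. set (a' := (1 / 2 - b)%R). set (b' := (1 / 2 - a)%R). set (r := (1 / 2 - a - b)%R).
destruct (ps1_at_0 a' b') as [P0 P0'].
apply (ode_unique a b (fun s => xpw r s * ps1 a' b' s) (xm1 r (ps1 a' b') (ps1' a' b'))
  (xm2 r (ps1 a' b') (ps1' a' b') (ps1'' a' b'))
  (fun s => cA a' b' * ev a b s + cB a' b' * od a b s) (fun s => cA a' b' * ev1 a b s + cB a' b' * od1 a b s)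
  (fun s => cA a' b' * ev2 a b s + cB a' b' * od2 a b s) 0 s); auto.
- rewrite Cmod_0. lra.
- intros t Ht. assert (H := seg0_lt1 s t Hs Ht). apply xm_gsol; auto. now apply ps1_gsol.
- intros t Ht. assert (H := seg0_lt1 s t Hs Ht). apply gsol_lin. now apply ev_gsol. now apply od_gsol.
- rewrite xpw_at_0, P0, ev_at_0, od_at_0. ring.
- unfold xm1. rewrite xpw_at_0, P0, P0', ev1_at_0, od1_at_0. field. 
Qed.

(** An identity between Gamma values, obtained as the Wronskian of the two local solutions at
    [x = 0]: the left side is its value at [s = 0], the right side its normalised limit at
    [s = 1]. *)
Lemma wronskian_value a b : nonpole (a + b + 1 / 2) -> nonpole (1 / 2 - b + (1 / 2 - a) + 1 / 2) ->
  (cA a b * cB (1 / 2 - b) (1 / 2 - a) - cB a b * cA (1 / 2 - b) (1 / 2 - a) = - 2 * (1 / 2 - a - b))%R.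
Proof.
intros Hc Hc'. set (a' := (1 / 2 - b)%R) in *. set (b' := (1 / 2 - a)%R) in *. set (r := (1 / 2 - a - b)%R).
set (c := (a + b + 1 / 2)%R) in *. set (c' := (a' + b' + 1 / 2)%R) in *.
set (D := (cA a b * cB a' b' - cB a b * cA a' b')%R).
set (f := fun s : R => PSeries (hc a b c) (1 - s * s)). set (f1 := fun s : R => (-2 * (s * PSeries (PS_derive (hc a b c)) (1 - s * s)))%R).
set (g := fun s : R => PSeries (hc a' b' c') (1 - s * s)). set (g1 := fun s : R => (-2 * (s * PSeries (PS_derive (hc a' b' c')) (1 - s * s)))%R).
(* The factor [x^r] of the second solution and the weight [x^c] of Abel's identity multiply to [x],
   as [r + c = 1]; this clears the denominator, so that the right side is continuous at [s = 1]. *)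
assert (Key : forall s : R, 0 < s < 1 -> (D = f s * ((1 - s * s) * g1 s - 2 * r * s * g s) - (1 - s * s) * f1 s * g s)%R).
{ intros s Hs. assert (Hm : Cmod s < 1) by (rewrite Cmod_R, Rabs_pos_eq; lra).
  set (psi := fun s => xpw r s * ps1 a' b' s). set (psi1 := xm1 r (ps1 a' b') (ps1' a' b')).
  assert (Hseg : forall x : R, (Rmin s 0 <= x <= Rmax s 0)%R -> Cmod x < 1).
  { intros x Hx. rewrite Rmin_right, Rmax_left in Hx by lra. rewrite Cmod_R, Rabs_pos_eq; lra. }
  assert (W := wronskian_const a b (ps1 a b) (ps1' a b) (ps1'' a b) psi psi1 (xm2 r (ps1 a' b') (ps1' a' b') (ps1'' a' b'))
    s 0 ltac:(lra) ltac:(lra) (fun x Hx => ps1_gsol a b x (Hseg x Hx))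
    (fun x Hx => xm_gsol a b _ _ _ x (Hseg x Hx) (ps1_gsol a' b' x (Hseg x Hx)))).
  destruct (ps2_eq a b 0) as [Q0 Q1]. rewrite Cmod_0; lra.
  fold r in Q0, Q1. fold a' b' in Q0, Q1. fold psi1 in Q1. rewrite ev_at_0, od_at_0 in Q0. rewrite ev1_at_0, od1_at_0 in Q1.
  destruct (ps1_at_0 a b) as [P0 P0'].
  rewrite P0, P0', Q1 in W. unfold psi at 2 in W. rewrite Q0 in W.
  destruct (connection a b s Hc Hs) as [C1 C2]. fold (ps1 a b s) in C1. fold (ps1' a b s) in C2.
  destruct (connection a' b' s Hc' Hs) as [C3 C4]. fold (ps1 a' b' s) in C3. fold (ps1' a' b' s) in C4.
  unfold psi, psi1, xm1 in W. rewrite <- C1, <- C2, <- C3, <- C4 in W.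
  fold c c' in W. rewrite !Fx_RtoC, !Fx1_RtoC in W. fold (f s) (f1 s) (g s) (g1 s) in W.
  assert (Ex : xpw r s = RtoC (Rpower (1 - s * s) r)).
  { unfold xpw. rewrite <- RtoC_mult, <- RtoC_opp, pow1p_RtoC by nra. f_equal. }
  rewrite Ex in W.
  assert (Hss : (0 < 1 - s * s)%R) by nra.
  rewrite <- !RtoC_mult, <- !RtoC_minus, <- RtoC_div, <- !RtoC_mult, <- !RtoC_minus, <- !RtoC_mult, <- !RtoC_minus in W by lra.
  simpl Re in W.
  replace (1 - 0 * 0)%R with 1%R in W by ring.
  replace (Rpower 1 c) with 1%R in W by (unfold Rpower; rewrite ln_1, Rmult_0_r, exp_0; auto).
  match type of W with _ = (?X * 1)%R => replace X with D in W by (unfold D; ring) end.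
  rewrite Rmult_1_r in W. rewrite <- W.
  assert (EP : (Rpower (1 - s * s) r * Rpower (1 - s * s) c = 1 - s * s)%R).
  { rewrite <- Rpower_plus. replace (r + c)%R with 1%R by (unfold r, c; field). now apply Rpower_1. }
  set (P := Rpower (1 - s * s) r) in *. set (P' := Rpower (1 - s * s) c) in *.
  transitivity ((P * P') * (f s * (g1 s - 2 * r * s / (1 - s * s) * g s) - f1 s * g s))%R.
  ring. rewrite EP. field. lra. }
(* The Wronskian is computed by letting [s] tend to 1, where everything is continuous. *)
assert (Hreal : forall u : nat -> R, rad1 u -> continuous (fun s : R => PSeries u (1 - s * s)) 1).
{ intros u Hu. apply (continuous_comp (fun s : R => 1 - s * s)%R (PSeries u)).
  - apply (ex_derive_continuous (K := R_AbsRing) (V := R_NormedModule)). auto_derive. auto.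
  - apply continuity_pt_filterlim. apply PSeries_continuity. apply (CV_rad1 u); auto.
    replace (1 - 1 * 1)%R with 0%R by ring. rewrite Rabs_R0; lra. }
assert (Hu := rad1_hc a b c Hc). assert (Hu' := rad1_hc a' b' c' Hc').
assert (Cf := Hreal _ Hu). assert (Cf1 := Hreal _ (rad1_derive _ Hu)).
assert (Cg := Hreal _ Hu'). assert (Cg1 := Hreal _ (rad1_derive _ Hu')).
set (R0 := fun s : R => (f s * ((1 - s * s) * g1 s - 2 * r * s * g s) - (1 - s * s) * f1 s * g s)%R).
assert (CR : continuous R0 1).
{ assert (Cs : continuous (fun s : R => s) 1) by apply continuous_id.
  assert (Cq : continuous (fun s : R => 1 - s * s)%R 1).
  { apply (ex_derive_continuous (K := R_AbsRing) (V := R_NormedModule)). auto_derive. auto. }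
  assert (Ck : forall k : R, continuous (fun _ : R => k) 1) by (intros; apply continuous_const).
  pose proof (fun p q => continuous_mult (K := R_AbsRing) p q 1%R) as Cm.
  assert (Cf' : continuous f 1) by exact Cf. assert (Cg' : continuous g 1) by exact Cg.
  assert (Cf1' : continuous f1 1) by (apply Cm; [apply Ck|]; now apply Cm).
  assert (Cg1' : continuous g1 1) by (apply Cm; [apply Ck|]; now apply Cm).
  apply (continuous_minus (V := R_NormedModule) (fun s => f s * ((1 - s * s) * g1 s - 2 * r * s * g s))%R
    (fun s => (1 - s * s) * f1 s * g s)%R).
  - apply Cm; auto. apply (continuous_minus (V := R_NormedModule) (fun s => (1 - s * s) * g1 s)%R (fun s => 2 * r * s * g s)%R).
    now apply Cm. apply Cm; auto.
  - apply Cm; auto. }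
assert (V1 : R0 1%R = (-2 * r)%R).
{ unfold R0, f, g. replace (1 - 1 * 1)%R with 0%R by ring. rewrite !PSeries_0. unfold hc; simpl. field. }
destruct (Req_dec D (-2 * r)) as [E|E]; auto. exfalso.
assert (Hpos : (0 < Rabs (D - -2 * r))%R) by (apply Rabs_pos_lt; lra).
destruct (CR (fun y => Rabs (y - -2 * r) < Rabs (D - -2 * r))%R) as [d Hd].
{ rewrite V1. exists (mkposreal _ Hpos). intros y Hy. exact Hy. }
set (e := (Rmin d 1 / 2)%R). assert (M1 := Rmin_l d 1). assert (M2 := Rmin_r d 1).
assert (M3 : (0 < Rmin d 1)%R) by (apply Rmin_case; [apply cond_pos|lra]).
assert (HR : R0 (1 - e)%R = D) by (symmetry; apply Key; unfold e; lra).
assert (Hb : ball 1%R d (1 - e)%R).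
{ change (Rabs (1 - e - 1) < d)%R. rewrite Rabs_left1; unfold e; lra. }
specialize (Hd _ Hb). cbv beta in Hd. rewrite HR in Hd. exact (Rlt_irrefl _ Hd).
Qed.

(* The continuation of [F(a, b; c; 1 - s^2)] to the half-plane [Re s > 0] and the unit disk. *)
Definition Gf (a b : R) (s : C) : C := if Rlt_dec 0 (Re s) then ph a b s else ps1 a b s.

Lemma Cmod_convex (x y : C) (r t : R) : 0 <= t <= 1 -> Cmod x < r -> Cmod y < r -> Cmod (x + t * (y - x)) < r.
Proof.
intros Ht Hx Hy. replace (x + t * (y - x)) with ((1 - t)%R * x + t * y) by (rewrite RtoC_minus; ring).
apply Rle_lt_trans with (1 := Cmod_triangle _ _). rewrite !Cmod_mult, !Cmod_R, !Rabs_pos_eq by lra.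
destruct (Req_dec t 0) as [->|]. lra. nra.
Qed.

Lemma Re_convex (x y : C) (t : R) : 0 <= t <= 1 -> 0 < Re x -> 0 < Re y -> 0 < Re (x + t * (y - x)).
Proof.
intros Ht Hx Hy. destruct x as [x x'], y as [y y']; simpl in *.
destruct (Req_dec t 0) as [->|]. lra. nra.
Qed.

(** Both agree with [Fx] at [s = 1/2] together with their derivatives, and the half-disk is convex,
    so the segment from [1/2] stays where both solve the equation. *)
Lemma ph_ps1 a b s : nonpole (a + b + 1 / 2) -> 0 < Re s -> Cmod s < 1 -> ph a b s = ps1 a b s.
Proof.
intros Hc Hs Hm.
destruct (Fx_ph a b (1 / 2) Hc ltac:(lra)) as [E1 E2]. destruct (connection a b (1 / 2) Hc ltac:(lra)) as [E3 E4].
assert (H2 : Cmod (1 / 2)%R < 1) by (rewrite Cmod_R, Rabs_pos_eq; lra).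
apply (ode_unique a b (ph a b) (ph1 a b) (ph2 a b) (ps1 a b) (ps1' a b) (ps1'' a b) (1 / 2)%R s); auto.
- intros t Ht. apply ph_gsol; auto. apply Re_convex; auto. simpl; lra.
- intros t Ht. apply ps1_gsol. now apply Cmod_convex.
- rewrite <- E1, E3. reflexivity.
- rewrite <- E2, E4. reflexivity.
Qed.

Lemma Gf_ps1 a b s : nonpole (a + b + 1 / 2) -> Cmod s < 1 -> Gf a b s = ps1 a b s.
Proof. intros Hc Hs. unfold Gf. destruct Rlt_dec; auto. now apply ph_ps1. Qed.

Lemma Gf_cder a b s : nonpole (a + b + 1 / 2) -> 0 < Re s \/ Cmod s < 1 -> exists l, cder (Gf a b) s l.
Proof.
intros Hc [Hs|Hs].
- exists (ph1 a b s). apply (cder_ext_loc (ph a b) _ _ _ (Re s)); auto.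
  + intros x Hx. unfold Gf. destruct Rlt_dec as [|H]; auto. exfalso. apply H.
    assert (A := re_le_Cmod (x - s)). apply Rabs_le_between in A.
    replace (Re (x - s)) with (Re x - Re s)%R in A by (destruct x, s; simpl; ring). lra.
  + now apply ph_gsol.
- exists (ps1' a b s). apply (cder_ext_loc (ps1 a b) _ _ _ (1 - Cmod s)). lra.
  + intros x Hx. symmetry. apply Gf_ps1; auto. replace x with (x - s + s) by ring.
    apply Rle_lt_trans with (1 := Cmod_triangle _ _). lra.
  + now apply ps1_gsol.
Qed.

Lemma Gf_hypF a b (s0 : R) : nonpole (a + b + 1 / 2) -> 0 < s0 < 1 ->
  exists d, 0 < d /\ forall s, Cmod (s - s0) < d -> Gf a b s = hypF a b (a + b + 1 / 2) (1 - s * s).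
Proof.
intros Hc Hs0.
(* The first bound keeps [s] in the unit disk. The second keeps [1 - s^2] there: it differs from
   [1 - s0^2] by at most [2 d <= s0^2 / 2]. *)
set (d := (Rmin (1 - s0) (s0 * s0 / 4))%R).
assert (M1 := Rmin_l (1 - s0) (s0 * s0 / 4)). assert (M2 := Rmin_r (1 - s0) (s0 * s0 / 4)). fold d in M1, M2.
assert (Hd : 0 < d) by (apply Rmin_case; nra).
exists d. split; auto.
assert (B : forall s, Cmod (s - s0) < d -> Cmod s < 1 /\ Cmod (1 - s * s) < 1).
{ intros s Hs.
  assert (H1 : Cmod s < s0 + d).
  { replace s with ((s - s0) + s0) by ring. apply Rle_lt_trans with (1 := Cmod_triangle _ _).
    rewrite Cmod_R, (Rabs_pos_eq s0) by lra. lra. }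
  split. lra.
  replace (1 - s * s) with ((1 - s0 * s0)%R + - ((s - s0) * (s + s0))) by (rewrite RtoC_minus, RtoC_mult; ring).
  apply Rle_lt_trans with (1 := Cmod_triangle _ _). rewrite Cmod_opp, Cmod_mult, Cmod_R, Rabs_pos_eq by nra.
  assert (H2 : Cmod (s + s0) <= 2).
  { apply Rle_trans with (1 := Cmod_triangle _ _). rewrite Cmod_R, (Rabs_pos_eq s0) by lra. lra. }
  assert (H3 := Cmod_ge_0 (s - s0)). assert (H4 := Cmod_ge_0 (s + s0)). nra. }
intros s Hs. destruct (B s Hs) as [Hm _]. rewrite Gf_ps1 by auto.
assert (Seg : forall t : R, 0 <= t <= 1 -> Cmod (s0 + t * (s - s0) - s0) < d).
{ intros t Ht. replace (s0 + t * (s - s0) - s0) with (t * (s - s0)) by ring.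
  rewrite Cmod_mult, Cmod_R, Rabs_pos_eq by lra. assert (H3 := Cmod_ge_0 (s - s0)). nra. }
destruct (connection a b s0 Hc Hs0) as [E1 E2].
symmetry. change (hypF a b (a + b + 1 / 2) (1 - s * s)) with (Fx a b (a + b + 1 / 2) s).
apply (ode_unique a b (Fx a b (a + b + 1 / 2)) (Fx1 a b (a + b + 1 / 2)) (Fx2 a b (a + b + 1 / 2)) (ps1 a b) (ps1' a b) (ps1'' a b) s0 s); auto.
- rewrite Cmod_R, Rabs_pos_eq; lra.
- intros t Ht. apply Fx_gsol; auto. now apply B, Seg.
- intros t Ht. apply ps1_gsol. now apply B, Seg.
Qed.

Lemma ev_opp a b s : ev a b (- s) = ev a b s.
Proof. unfold ev. now replace (- s * - s) with (s * s) by ring. Qed.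

Lemma ps1_opp a b s : ps1 a b (- s) = - ps1 a b s + 2 * cA a b * ev a b s.
Proof. unfold ps1. rewrite ev_opp. unfold od. replace (- s * - s) with (s * s) by ring. ring. Qed.

(** Cramer's rule for the two local solutions written in the basis [ev], [od]; the determinant is
    [wronskian_value]. *)
Lemma ev_combination a b s : nonpole (a + b + 1 / 2) -> nonpole (1 / 2 - b + (1 / 2 - a) + 1 / 2) ->
  (1 / 2 - a - b <> 0)%R -> Cmod s < 1 ->
  ev a b s = (cB (1 / 2 - b) (1 / 2 - a) / (-2 * (1 / 2 - a - b)))%R * Gf a b s
   + (- cB a b / (-2 * (1 / 2 - a - b)))%R * (xpw (1 / 2 - a - b) s * Gf (1 / 2 - b) (1 / 2 - a) s).
Proof.
intros Hc Hc' Hr Hs. rewrite !Gf_ps1 by auto.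
destruct (ps2_eq a b s Hs) as [-> _]. unfold ps1.
assert (W := wronskian_value a b Hc Hc').
set (r := (1 / 2 - a - b)%R) in *.
set (A' := cA (1 / 2 - b) (1 / 2 - a)) in *. set (B' := cB (1 / 2 - b) (1 / 2 - a)) in *.
set (A := cA a b) in *. set (B := cB a b) in *.
assert (E1 : (B' / (-2 * r) * A + (- B / (-2 * r)) * A' = 1)%R).
{ transitivity ((A * B' - B * A') / (-2 * r))%R. field; auto. rewrite W. field; auto. }
assert (E2 : (B' / (-2 * r) * B + (- B / (-2 * r)) * B' = 0)%R) by (field; auto).
apply (f_equal RtoC) in E1, E2. rewrite RtoC_plus, !RtoC_mult in E1, E2.
set (x := RtoC (B' / (-2 * r))) in *. set (y := RtoC (- B / (-2 * r))) in *.
transitivity ((x * A + y * A') * ev a b s + (x * B + y * B') * od a b s). rewrite E1, E2. ring. ring.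
Qed.

(** * Modularity of the Eisenstein series *)

Fixpoint csum (f : nat -> C) (n : nat) : C :=
  match n with O => 0 | S n => csum f n + f n end.

Lemma csum_S f n : csum f (S n) = csum f n + f n.
Proof. reflexivity. Qed.

Lemma csum_ext f g n : (forall i, (i < n)%nat -> f i = g i) -> csum f n = csum g n.
Proof.
induction n as [|n IH]; intros H; simpl; auto. rewrite IH, H; auto.
Qed.

Lemma csum_plus f g n : csum (fun i => f i + g i) n = csum f n + csum g n.
Proof. induction n as [|n IH]; simpl. ring. rewrite IH. ring. Qed.

Lemma csum_minus f g n : csum (fun i => f i - g i) n = csum f n - csum g n.
Proof. induction n as [|n IH]; simpl. ring. rewrite IH. ring. Qed.

Lemma csum_scal c f n : csum (fun i => c * f i) n = c * csum f n.
Proof. induction n as [|n IH]; simpl. ring. rewrite IH. ring. Qed.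

Lemma csum_0 n : csum (fun _ => 0) n = 0.
Proof. induction n as [|n IH]; simpl. auto. rewrite IH. ring. Qed.

Lemma csum_switch (f : nat -> nat -> C) n m :
  csum (fun i => csum (f i) m) n = csum (fun j => csum (fun i => f i j) n) m.
Proof.
induction n as [|n IH]; simpl. now rewrite csum_0. rewrite IH, <- csum_plus. reflexivity.
Qed.

Lemma csum_split f n m : csum f (n + m) = csum f n + csum (fun i => f (n + i)%nat) m.
Proof.
induction m as [|m IH]; simpl. rewrite Nat.add_0_r. ring.
rewrite Nat.add_succ_r. simpl. rewrite IH. ring.
Qed.

Lemma csum_first f n : csum f (S n) = f O + csum (fun i => f (S i)) n.
Proof. change (S n) with (1 + n)%nat. rewrite csum_split. simpl csum at 1. now rewrite Cplus_0_l. Qed.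

Lemma csum_rev f n : csum f n = csum (fun i => f (n - S i)%nat) n.
Proof.
induction n as [|n IH]; auto. rewrite (csum_first (fun i => f (S n - S i)%nat)). simpl.
rewrite Nat.sub_0_r, IH. ring.
Qed.

Lemma Cmod_csum_le f n (B : R) : (forall i, (i < n)%nat -> Cmod (f i) <= B) -> Cmod (csum f n) <= INR n * B.
Proof.
induction n as [|n IH]; intros H. simpl. rewrite Cmod_0. lra.
simpl csum. rewrite S_INR. apply Rle_trans with (1 := Cmod_triangle _ _).
specialize (IH (fun i Hi => H i (Nat.lt_lt_succ_r _ _ Hi))). specialize (H n ltac:(lia)). lra.
Qed.

Lemma Cmod_csum_le_sq f n (B : R) : 0 <= B ->
  (forall i, (i < n)%nat -> Cmod (f i) <= B / (INR i + 1) ^ 2) -> Cmod (csum f n) <= 2 * B.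
Proof.
intros HB H.
destruct n as [|n]. simpl. rewrite Cmod_0. lra.
(* The form that passes through the induction: [1 / (n + 2)^2] is less than
   [1 / (n + 1) - 1 / (n + 2)]. *)
assert (G : Cmod (csum f (S n)) <= B * (2 - / (INR n + 1))).
{ induction n as [|n IH].
  - simpl csum. rewrite Cplus_0_l. apply Rle_trans with (1 := H O ltac:(lia)). simpl. right. field.
  - change (csum f (S (S n))) with (csum f (S n) + f (S n)). apply Rle_trans with (1 := Cmod_triangle _ _).
    specialize (IH (fun i Hi => H i (Nat.lt_lt_succ_r _ _ Hi))). specialize (H (S n) ltac:(lia)).
    rewrite S_INR in *. assert (Hn := pos_INR n).
    apply Rle_trans with (B * (2 - / (INR n + 1)) + B / (INR n + 1 + 1) ^ 2)%R. lra.
    unfold Rdiv. rewrite <- Rmult_plus_distr_l. apply Rmult_le_compat_l; auto.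
    assert (E : (/ (INR n + 1) - / (INR n + 1 + 1) - / (INR n + 1 + 1) ^ 2 = / ((INR n + 1) * (INR n + 1 + 1) ^ 2))%R).
    { field. lra. }
    assert (0 < / ((INR n + 1) * (INR n + 1 + 1) ^ 2))%R. { apply Rinv_0_lt_compat. nra. } lra. }
apply Rle_trans with (1 := G). rewrite (Rmult_comm 2). apply Rmult_le_compat_l; auto.
assert (0 < / (INR n + 1))%R. { apply Rinv_0_lt_compat. assert (H0 := pos_INR n); lra. } lra.
Qed.

Definition clim (u : nat -> C) (l : C) : Prop := is_lim_seq (fun n => Cmod (u n - l)) 0.

Lemma clim_le u l (v : nat -> R) : (forall n, Cmod (u n - l) <= v n) -> is_lim_seq v 0 -> clim u l.
Proof.
intros H Hv. apply (is_lim_seq_le_le (fun _ => 0%R) _ v); auto.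
intros n; split; auto. apply Cmod_ge_0. apply is_lim_seq_const.
Qed.

Lemma clim_plus u v l m : clim u l -> clim v m -> clim (fun n => u n + v n) (l + m).
Proof.
intros Hu Hv. apply (clim_le _ _ (fun n => Cmod (u n - l) + Cmod (v n - m))%R).
- intros n. replace (u n + v n - (l + m)) with ((u n - l) + (v n - m)) by ring. apply Cmod_triangle.
- replace (Finite 0) with (Finite (0 + 0)) by (f_equal; ring). now apply is_lim_seq_plus'.
Qed.

Lemma clim_scal c u l : clim u l -> clim (fun n => c * u n) (c * l).
Proof.
intros Hu. apply (clim_le _ _ (fun n => Cmod c * Cmod (u n - l))%R).
- intros n. replace (c * u n - c * l) with (c * (u n - l)) by ring. rewrite Cmod_mult. lra.
- replace (Finite 0) with (Finite (Cmod c * 0)) by (f_equal; ring). apply is_lim_seq_mult'; auto. apply is_lim_seq_const.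
Qed.

Lemma clim_ext u v l : (forall n, u n = v n) -> clim u l -> clim v l.
Proof. intros E. apply is_lim_seq_ext. intros n. now rewrite E. Qed.

Lemma clim_unique u l m : clim u l -> clim u m -> l = m.
Proof.
intros Hl Hm.
assert (H : clim (fun _ => l - m) 0).
{ apply (clim_le _ _ (fun n => Cmod (u n - l) + Cmod (u n - m))%R).
  - intros n. replace (l - m - 0) with (- (u n - l) + (u n - m)) by ring.
    apply Rle_trans with (1 := Cmod_triangle _ _). rewrite Cmod_opp. lra.
  - replace (Finite 0) with (Finite (0 + 0)) by (f_equal; ring). now apply is_lim_seq_plus'. }
unfold clim in H. apply is_lim_seq_unique in H. rewrite Lim_seq_const in H. injection H. intros E.
apply Cmod_eq_0 in E. replace l with (l - m - 0 + m) by ring. rewrite E. ring.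
Qed.

Lemma Re_csum f n : Re (csum f (S n)) = sum_n (fun i => Re (f i)) n.
Proof.
induction n as [|n IH]. rewrite sum_O. simpl csum. now rewrite Cplus_0_l. rewrite sum_Sn, <- IH. reflexivity.
Qed.

Lemma Im_csum f n : Im (csum f (S n)) = sum_n (fun i => Im (f i)) n.
Proof.
induction n as [|n IH]. rewrite sum_O. simpl csum. now rewrite Cplus_0_l. rewrite sum_Sn, <- IH. reflexivity.
Qed.

Lemma CSeries_clim f : cabs f -> clim (csum f) (CSeries f).
Proof.
intros H. unfold clim. apply is_lim_seq_incr_1.
apply (is_lim_seq_le_le (fun _ => 0%R) _ (fun n => Rabs (sum_n (fun i => Re (f i)) n - Series (fun i => Re (f i)))
   + Rabs (sum_n (fun i => Im (f i)) n - Series (fun i => Im (f i))))%R).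
- intros n. split. apply Cmod_ge_0. rewrite <- Re_csum, <- Im_csum. apply Rle_trans with (1 := Cmod_le_abs _). apply Rle_refl.
- apply is_lim_seq_const.
- assert (A : forall g : nat -> R, ex_series g -> is_lim_seq (fun n => Rabs (sum_n g n - Series g)) 0).
  { intros g Hg. apply Series_correct in Hg. change (is_lim_seq (sum_n g) (Series g)) in Hg.
    replace (Finite 0) with (Rbar_abs (Series g - Series g)%R) by (simpl; rewrite Rminus_diag, Rabs_R0; auto).
    apply is_lim_seq_abs. apply is_lim_seq_minus'; auto. apply is_lim_seq_const. }
  replace (Finite 0) with (Finite (0 + 0)) by (f_equal; ring). apply is_lim_seq_plus'; apply A.
  now apply cabs_Re. now apply cabs_Im.
Qed.

(** Half of the decay, [(sqrt rho) ^ n], absorbs one factor [n] by Bernoulli's inequality; the other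
    half goes to the induction hypothesis. *)
Lemma pow_geom_bounded (a : nat) : forall rho : R, (0 < rho < 1)%R ->
  exists K, (0 <= K)%R /\ forall n, (INR n ^ a * rho ^ n <= K)%R.
Proof.
induction a as [|a IH]; intros rho Hr.
- exists 1%R. split. lra. intros n. simpl. rewrite Rmult_1_l. rewrite <- (pow1 n). apply pow_incr; lra.
- assert (Hs : (0 < sqrt rho < 1)%R).
  { split. apply sqrt_lt_R0; lra. rewrite <- sqrt_1. apply sqrt_lt_1; lra. }
  destruct (IH _ Hs) as [K [HK H]]. set (s := sqrt rho) in *.
  assert (Es : (s * s = rho)%R) by (apply sqrt_sqrt; lra).
  set (d := (/ s - 1)%R). assert (Hd : (0 < d)%R).
  { unfold d. assert (1 < / s)%R by (rewrite <- Rinv_1; apply Rinv_lt_contravar; lra). lra. }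
  exists (K * / d)%R. split. apply Rmult_le_pos; auto. apply Rlt_le, Rinv_0_lt_compat; auto.
  intros n. rewrite <- Es, Rpow_mult_distr. simpl.
  replace (INR n * INR n ^ a * (s ^ n * s ^ n))%R with ((INR n ^ a * s ^ n) * (INR n * s ^ n))%R by ring.
  assert (Hp : (0 < s ^ n)%R) by (apply pow_lt; lra). assert (Hn := pos_INR n).
  apply Rmult_le_compat; auto.
  + apply Rmult_le_pos; [apply pow_le; auto|lra].
  + apply Rmult_le_pos; lra.
  + assert (B := Rlt_le _ _ Hd). assert (P := poly n d Hd).
    replace (1 + d)%R with (/ s)%R in P by (unfold d; ring). rewrite pow_inv in P.
    apply Rmult_le_reg_l with d; auto. rewrite Rinv_r by lra.
    apply Rmult_le_compat_r with (r := (s ^ n)%R) in P; [|lra]. rewrite Rinv_l in P by lra. nra.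
Qed.

(** Boxes have sizes [2^p] because the identity for [f] doubles the exponent and can only be
    iterated along powers of 2. *)
Definition N2 (p : nat) : nat := Nat.pow 2 p.

Lemma N2_pos p : (1 <= INR (N2 p))%R.
Proof. apply (le_INR 1). unfold N2. assert (H := Nat.pow_nonzero 2 p). lia. Qed.

Lemma N2_S p : N2 (S p) = (N2 p + N2 p)%nat.
Proof. unfold N2. simpl. lia. Qed.

Lemma N2_pow p : INR (N2 p) = (2 ^ p)%R.
Proof. unfold N2. now rewrite pow_INR. Qed.

Lemma is_lim_inv_N2 (K : R) : is_lim_seq (fun p => K / INR (N2 p))%R 0.
Proof.
replace (Finite 0) with (Finite (K * 0)) by (f_equal; ring).
apply is_lim_seq_mult'. apply is_lim_seq_const.
apply (is_lim_seq_ext (fun p => (/ 2) ^ p)%R).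
intros p. rewrite N2_pow, pow_inv; auto.
apply is_lim_seq_geom. rewrite Rabs_pos_eq; lra.
Qed.

Lemma is_lim_N2 : filterlim N2 eventually eventually.
Proof.
intros P [N H]. exists N. intros n Hn. apply H. unfold N2. assert (E := Nat.pow_gt_lin_r 2 n). lia.
Qed.

Lemma clim_N2 u l : clim u l -> clim (fun p => u (N2 p)) l.
Proof.
intros H. unfold clim in *. apply (filterlim_comp _ _ _ N2 (fun n => Cmod (u n - l)) _ eventually); auto. apply is_lim_N2.
Qed.

(** * Divisor sums and Lambert series *)

Lemma divisor_sum_csum e n : RtoC (INR (divisor_sum e n)) =
  csum (fun i => if Nat.eqb (Nat.modulo n (S i)) 0 then RtoC (INR (S i) ^ e) else 0) n.
Proof.
unfold divisor_sum.
assert (G : forall (p : nat -> bool) (f : nat -> nat) N,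
  RtoC (INR (fold_right Nat.add 0%nat (map f (filter p (seq 1 N))))) =
  csum (fun i => if p (S i) then RtoC (INR (f (S i))) else 0) N).
{ intros p f N. 
  assert (A : forall l m, fold_right Nat.add m l = (fold_right Nat.add 0%nat l + m)%nat).
  { induction l as [|x l IH]; intros m; simpl; auto. rewrite IH. lia. }
  induction N as [|N IH]. reflexivity.
  rewrite seq_S, filter_app, map_app, fold_right_app, A, plus_INR, RtoC_plus, IH. simpl csum. f_equal.
  simpl. destruct (p (S N)); simpl; auto. now rewrite Nat.add_0_r. }
rewrite (G (fun d => Nat.eqb (Nat.modulo n d) 0) (fun d => Nat.pow d e)). apply csum_ext. intros i _.
destruct Nat.eqb; auto. now rewrite pow_INR.
Qed.

Lemma divisor_sum_csum_le e n N : (n <= N)%nat -> (1 <= n)%nat -> RtoC (INR (divisor_sum e n)) =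
  csum (fun i => if Nat.eqb (Nat.modulo n (S i)) 0 then RtoC (INR (S i) ^ e) else 0) N.
Proof.
intros H Hn. replace N with (n + (N - n))%nat by lia. rewrite csum_split, <- divisor_sum_csum.
rewrite (csum_ext _ (fun _ => 0)). rewrite csum_0. ring.
intros i _. rewrite Nat.mod_small by lia. destruct n; [lia|]. reflexivity.
Qed.

(** The multiples of [r + 1] up to [N] are indexed by their cofactor; in the induction the new
    number [N + 1] appears on the right exactly once if it is a multiple, and not at all
    otherwise. *)
Lemma csum_multiples (g : nat -> C) r N M : (N <= M)%nat ->
  csum (fun n => if Nat.eqb (Nat.modulo (S n) (S r)) 0 then g (S n) else 0) N =
  csum (fun m => if Nat.leb (S m * S r) N then g (S m * S r)%nat else 0) M.
Proof.
intros HM. induction N as [|N IH].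
- simpl csum at 1. rewrite (csum_ext _ (fun _ => 0)). now rewrite csum_0.
  intros i _. reflexivity.
- rewrite (csum_S _ N). rewrite IH by lia.
  assert (E : (if Nat.eqb (Nat.modulo (S N) (S r)) 0 then g (S N) else 0) =
    csum (fun m => if Nat.eqb (S m * S r) (S N) then g (S N) else 0) M).
  { assert (Z : forall K, (forall m, (m < K)%nat -> (S m * S r)%nat <> S N) ->
      csum (fun m => if Nat.eqb (S m * S r) (S N) then g (S N) else 0) K = 0).
    { intros K HK. rewrite (csum_ext _ (fun _ => 0)). apply csum_0.
      intros i Hi. destruct (Nat.eqb_spec (S i * S r) (S N)); auto. now apply HK in e. }
    destruct (Nat.eqb_spec (Nat.modulo (S N) (S r)) 0) as [E0|E0].
    - apply Nat.Div0.mod_divides in E0. destruct E0 as [c Hc].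
      destruct c as [|c]; [lia|].
      assert (c < M)%nat by nia.
      replace M with (c + S (M - S c))%nat by lia. rewrite csum_split, csum_first, Z.
      2:{ intros m Hm Em. nia. }
      rewrite Nat.add_0_r. replace (Nat.eqb (S c * S r) (S N)) with true by (symmetry; apply Nat.eqb_eq; lia).
      rewrite (csum_ext _ (fun _ => 0)). rewrite csum_0. ring.
      intros i _. destruct (Nat.eqb_spec (S (c + S i) * S r) (S N)); auto. nia.
    - rewrite Z; auto. intros m _ Em. apply E0. rewrite <- Em. apply Nat.Div0.mod_mul. }
  rewrite E, <- csum_plus. apply csum_ext. intros m _.
  destruct (Nat.leb_spec (S m * S r) N), (Nat.leb_spec (S m * S r) (S N)), (Nat.eqb_spec (S m * S r) (S N)); try lia; try ring.
  rewrite e. ring.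
Qed.

Lemma lambert_partial e (q : C) N :
  csum (fun n => INR (divisor_sum e (S n)) * q ^ S n) N =
  csum (fun r => csum (fun m => if Nat.leb (S m * S r) N then INR (S r) ^ e * q ^ (S m * S r) else 0) N) N.
Proof.
transitivity (csum (fun n => csum (fun r => if Nat.eqb (Nat.modulo (S n) (S r)) 0 then INR (S r) ^ e * q ^ S n else 0) N) N).
- apply csum_ext. intros n Hn. rewrite (divisor_sum_csum_le e (S n) N) by lia. rewrite Cmult_comm, <- csum_scal.
  apply csum_ext. intros r _. destruct Nat.eqb; rewrite ?RtoC_pow; ring.
- rewrite csum_switch. apply csum_ext. intros r _.
  exact (csum_multiples (fun n => INR (S r) ^ e * q ^ n) r N N (Nat.le_refl _)).
Qed.

(** The divisor sums only collect the pairs [(m, r)] of the square with product at most [N]. Each of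
    the other pairs, fewer than [N^2] in number, carries a power of [q] beyond the [N]-th. *)
Lemma lambert_error e (q : C) N : Cmod q <= 1 ->
  Cmod (csum (fun r => csum (fun m => INR (S r) ^ e * q ^ (S m * S r)) N) N -
   csum (fun n => INR (divisor_sum e (S n)) * q ^ S n) N) <= INR N * (INR N * (INR N ^ e * Cmod q ^ N)).
Proof.
intros Hq. rewrite lambert_partial, <- csum_minus.
assert (Hq0 := Cmod_ge_0 q).
apply Cmod_csum_le. intros r Hr. rewrite <- csum_minus. apply Cmod_csum_le. intros m Hm.
assert (H0 : 0 <= INR N ^ e * Cmod q ^ N). { apply Rmult_le_pos; apply pow_le; auto. apply pos_INR. }
destruct (Nat.leb_spec (S m * S r) N).
- replace (INR (S r) ^ e * q ^ (S m * S r) - INR (S r) ^ e * q ^ (S m * S r)) with (RtoC 0) by ring. now rewrite Cmod_0.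
- replace (INR (S r) ^ e * q ^ (S m * S r) - 0) with (INR (S r) ^ e * q ^ (S m * S r)) by ring.
  rewrite Cmod_mult, !Cmod_pow, Cmod_R, Rabs_pos_eq by apply pos_INR.
  apply Rmult_le_compat; try (apply pow_le; auto; apply pos_INR).
  apply pow_incr. split. apply pos_INR. apply le_INR; lia.
  replace (S m * S r)%nat with (N + (S m * S r - N))%nat by lia. rewrite pow_add.
  rewrite <- (Rmult_1_r (Cmod q ^ N)) at 2. apply Rmult_le_compat_l. now apply pow_le.
  rewrite <- (pow1 (S m * S r - N)). apply pow_incr; auto.
Qed.

Lemma nome_add (z w : C) : nome (z + w) = nome z * nome w.
Proof. unfold nome. rewrite <- Cexp_add. f_equal. ring. Qed.

Lemma nome_1 : nome 1 = 1.
Proof.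
unfold nome. replace (2 * PI * Ci * 1) with ((0, 2 * PI)%R : C) by (apply C_ext; simpl; ring).
unfold Cexp. cbv [Re Im fst snd]. rewrite exp_0, cos_2PI, sin_2PI. apply C_ext; simpl; ring.
Qed.

Lemma nome_half : nome (1 / 2) = - (1).
Proof.
unfold nome. replace (2 * PI * Ci * (1 / 2)) with ((0, PI)%R : C).
2:{ replace (2 * PI * Ci * (1 / 2)) with (PI * Ci) by field. apply C_ext; simpl; ring. }
unfold Cexp. cbv [Re Im fst snd]. rewrite exp_0, cos_PI, sin_PI. apply C_ext; simpl; ring.
Qed.

Lemma nome_plus1 (z : C) : nome (z + 1) = nome z.
Proof. rewrite nome_add, nome_1. ring. Qed.

Lemma Cmod_nome (z : C) : Cmod (nome z) = exp (- (2 * PI * Im z)).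
Proof. unfold nome. rewrite Cmod_Cexp. f_equal. destruct z; simpl. ring. Qed.

Lemma Cmod_nome_lt1 (z : C) : 0 < Im z -> Cmod (nome z) < 1.
Proof.
intros H. rewrite Cmod_nome, <- exp_0. apply exp_increasing. assert (P := PI_RGT_0). nra.
Qed.

Lemma nome_mult (m : nat) (z : C) : nome (INR m * z) = nome z ^ m.
Proof.
induction m as [|m IH].
- simpl. replace (0 * z) with (RtoC 0) by ring. unfold nome. rewrite Cmult_0_r. apply Cexp_0.
- rewrite S_INR, RtoC_plus. replace ((INR m + 1) * z) with (INR m * z + z) by ring.
  rewrite nome_add, IH. simpl. ring.
Qed.

Lemma Cmod_lt1_neq (e : C) : Cmod e < 1 -> e <> 1 /\ e <> - (1).
Proof. intros H. split; intros E; rewrite E in H; [rewrite Cmod_1 in H|rewrite Cmod_m1 in H]; lra. Qed.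

Lemma halves (w : C) : nome ((w + 1) / 2) = - nome (w / 2) /\ nome w = nome (w / 2) * nome (w / 2).
Proof.
split.
- replace ((w + 1) / 2) with (w / 2 + 1 / 2) by field. rewrite nome_add, nome_half. ring.
- rewrite <- nome_add. f_equal. field.
Qed.

Lemma Im_div_real (z : C) (d : R) : d <> 0%R -> Im (z / d) = (Im z / d)%R.
Proof. intros H. destruct z; simpl. field. auto. Qed.

Lemma Re_div_real (z : C) (d : R) : d <> 0%R -> Re (z / d) = (Re z / d)%R.
Proof. intros H. destruct z; simpl. field. auto. Qed.

Lemma Cinv_pow_div (w D : C) k : w <> 0 -> D <> 0 -> / (w / D) ^ k = D ^ k * / w ^ k.
Proof.
intros Hw HD. unfold Cdiv. rewrite Cpow_mult_l, Cpow_inv by auto.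
assert (A := Cpow_nz w k Hw). assert (B := Cpow_nz D k HD). field. auto.
Qed.

Lemma N2_neq_0 p : RtoC (INR (N2 p)) <> 0.
Proof. intros E. apply (f_equal Re) in E. simpl in E. assert (H := N2_pos p). lra. Qed.

Lemma RtoC_N2_S p : RtoC (INR (N2 (S p))) = 2 * INR (N2 p).
Proof. rewrite N2_S, plus_INR, RtoC_plus. ring. Qed.

(** One point of each pair [(m, n)], [(- m, - n)] of nonzero lattice points with [|m|, |n| <= N];
    for even [k] this is half of the full sum over the square. *)
Definition box (k N : nat) (t : C) : C :=
  csum (fun m => / INR (S m) ^ k) N +
  csum (fun m => / (INR (S m) * t) ^ k
   + csum (fun n => / (INR (S m) * t + INR (S n)) ^ k + / (INR (S m) * t - INR (S n)) ^ k) N) N.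

Lemma INR_S_neq_0 m : RtoC (INR (S m)) <> 0.
Proof. intros E. apply (f_equal Re) in E. simpl Re in E. now apply (not_0_INR (S m)). Qed.

Lemma box_neq (m n : nat) (t : C) : Im t <> 0%R -> INR (S m) * t + INR (S n) <> 0 /\ INR (S m) * t - INR (S n) <> 0.
Proof.
intros Ht. assert (H := INR_S_neq_0 m). assert (Hm : INR (S m) <> 0%R) by (apply not_0_INR; lia).
split; intros E; apply (f_equal Im) in E; destruct t as [x y]; cbv [Im Re Cplus Cmult Cminus Copp RtoC fst snd] in E; cbv [Im snd] in Ht;
 apply Ht; apply (Rmult_eq_reg_l (INR (S m))); lra.
Qed.

(** As [m (- 1 / t) + n = (n t - m) / t], the action of [S] permutes the square up to signs, which
    the even power ignores. The identity is exact for each finite [N]. *)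
Lemma box_S (k N : nat) (t : C) : (forall x : C, (- x) ^ k = x ^ k) -> Im t <> 0%R ->
  box k N (S_act t) = t ^ k * box k N t.
Proof.
intros Hk Ht.
assert (Ht0 : t <> 0). { intros E. apply Ht. rewrite E. reflexivity. }
assert (Htk := Cpow_nz t k Ht0).
assert (A1 : forall m, / (INR (S m) * S_act t) ^ k = t ^ k * / INR (S m) ^ k).
{ intros m. replace (INR (S m) * S_act t) with ((- INR (S m)) / t) by (unfold S_act; field; auto).
  rewrite Cinv_pow_div, Hk; auto. intros E. apply (INR_S_neq_0 m). replace (RtoC (INR (S m))) with (- - INR (S m)) by ring. rewrite E; ring. }
assert (A2 : forall m n, / (INR (S m) * S_act t + INR (S n)) ^ k = t ^ k * / (INR (S n) * t - INR (S m)) ^ k).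
{ intros m n. destruct (box_neq n m t Ht).
  replace (INR (S m) * S_act t + INR (S n)) with ((INR (S n) * t - INR (S m)) / t) by (unfold S_act; field; auto).
  now rewrite Cinv_pow_div. }
assert (A3 : forall m n, / (INR (S m) * S_act t - INR (S n)) ^ k = t ^ k * / (INR (S n) * t + INR (S m)) ^ k).
{ intros m n. destruct (box_neq n m t Ht).
  replace (INR (S m) * S_act t - INR (S n)) with (- ((INR (S n) * t + INR (S m)) / t)) by (unfold S_act; field; auto).
  now rewrite Hk, Cinv_pow_div. }
assert (A4 : forall m, / INR (S m) ^ k = t ^ k * / (INR (S m) * t) ^ k).
{ intros m. rewrite Cpow_mult_l. assert (B := Cpow_nz _ k (INR_S_neq_0 m)). field; auto. }
unfold box. rewrite !csum_plus.
rewrite (csum_ext (fun m => / (INR (S m) * S_act t) ^ k) (fun m => t ^ k * / INR (S m) ^ k)) by auto.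
rewrite (csum_ext (fun m => / INR (S m) ^ k) (fun m => t ^ k * / (INR (S m) * t) ^ k)) at 1 by auto.
rewrite (csum_ext (fun m => csum (fun n => / (INR (S m) * S_act t + INR (S n)) ^ k + / (INR (S m) * S_act t - INR (S n)) ^ k) N)
  (fun m => csum (fun n => t ^ k * (/ (INR (S n) * t + INR (S m)) ^ k + / (INR (S n) * t - INR (S m)) ^ k)) N)).
2:{ intros m _. apply csum_ext. intros n _. rewrite A2, A3. ring. }
rewrite csum_switch, !csum_scal.
rewrite (csum_ext (fun j => csum (fun i => t ^ k * (/ (INR (S j) * t + INR (S i)) ^ k + / (INR (S j) * t - INR (S i)) ^ k)) N)
  (fun j => t ^ k * csum (fun i => (/ (INR (S j) * t + INR (S i)) ^ k + / (INR (S j) * t - INR (S i)) ^ k)) N)).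
2:{ intros; apply csum_scal. }
rewrite csum_scal. ring.
Qed.

(** In the sum of [n^(k - 1) e^n] only the even [n] survive on the left. The points 1 and -1 are
    excluded because [f] has its pole at 1. *)
Definition doubling (k : nat) (f : C -> C) : Prop :=
  forall e : C, e <> 1 -> e <> - (1) -> f e + f (- e) = 2 ^ k * f (e * e).

(** The distribution relation over all [2^p]-th roots of [nome z]. For large [p] the arguments
    [(z + j) / 2^p], taken modulo 1, are small or contribute little, and [f] may be replaced by its
    polar part: this produces the row of terms [(z + j)^(- k)]. *)
Lemma doubling_iter k f p (z : C) : doubling k f -> 0 < Im z ->
  csum (fun j => f (nome ((z + INR j) / INR (N2 p)))) (N2 p) = INR (N2 p) ^ k * f (nome z).
Proof.
intros Hf Hz. induction p as [|p IH].
- unfold N2; simpl. rewrite Cpow_1_l. replace ((z + 0) / 1) with z by field. ring.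
- rewrite N2_S, csum_split, <- N2_S, <- csum_plus.
  rewrite (csum_ext _ (fun j => 2 ^ k * f (nome ((z + INR j) / INR (N2 p))))).
  + rewrite csum_scal, IH, RtoC_N2_S, Cpow_mult_l. ring.
  + intros j _. assert (HN := N2_neq_0 p). set (w := (z + INR j) / INR (N2 p)).
    destruct (halves w) as [E1 E2]. rewrite plus_INR, RtoC_plus, RtoC_N2_S.
    replace ((z + INR j) / (2 * INR (N2 p))) with (w / 2) by (unfold w; field; auto).
    replace ((z + (INR (N2 p) + INR j)) / (2 * INR (N2 p))) with ((w + 1) / 2) by (unfold w; field; auto).
    rewrite E1, E2. assert (Hw : Cmod (nome (w / 2)) < 1).
    { apply Cmod_nome_lt1. rewrite Im_div_real by lra. unfold w. assert (P := N2_pos p). rewrite Im_div_real by lra.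
      replace (Im (z + INR j)) with (Im z) by (destruct z; simpl; ring).
      apply Rdiv_lt_0_compat; [|lra]. apply Rdiv_lt_0_compat; lra. }
    destruct (Cmod_lt1_neq _ Hw). apply Hf; auto.
Qed.

Lemma nome_real_neq (x : R) : 0 < x < 1 -> nome (x / 2) <> 1 /\ nome (x / 2) <> - (1).
Proof.
intros Hx. assert (HP := PI_RGT_0).
assert (E : Im (nome (x / 2)) = sin (PI * x)).
{ unfold nome, Cexp. replace (2 * PI * Ci * (x / 2)) with ((0, PI * x)%R : C).
  cbv [Re Im fst snd]. rewrite exp_0. simpl. ring.
  replace (2 * PI * Ci * (x / 2)) with (PI * x * Ci) by field. apply C_ext; simpl; ring. }
assert (H : 0 < sin (PI * x)) by (apply sin_gt_0; nra).
split; intros E2; rewrite E2 in E; simpl in E; lra.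
Qed.

(** The row [m = 0]: the sum runs over the roots of unity of order dividing [2^p], without the root
    1, which is the pole. *)
Definition zrow (f : C -> C) (p : nat) : C := csum (fun j => f (nome (INR (S j) / INR (N2 p)))) (N2 p - 1).

Lemma zrow_S k f p : doubling k f -> zrow f (S p) = 2 ^ k * zrow f p + f (- (1)).
Proof.
intros Hf. unfold zrow. assert (HN := N2_neq_0 p). assert (P := N2_pos p).
assert (HNn : (1 <= N2 p)%nat) by (apply INR_le; simpl; lra).
replace (N2 (S p) - 1)%nat with ((N2 p - 1) + S (N2 p - 1))%nat by (rewrite N2_S; lia).
rewrite csum_split, csum_first.
replace (INR (S (N2 p - 1 + 0)) / INR (N2 (S p))) with (1 / 2).
2:{ replace (S (N2 p - 1 + 0)) with (N2 p) by lia. rewrite RtoC_N2_S. field; auto. }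
rewrite nome_half.
rewrite (csum_ext (fun i => f (nome (INR (S (N2 p - 1 + S i)) / INR (N2 (S p)))))
  (fun i => f (- nome (INR (S i) / INR (N2 p) / 2)))).
2:{ intros i _. destruct (halves (INR (S i) / INR (N2 p))) as [E _]. rewrite <- E. f_equal. f_equal.
  replace (S (N2 p - 1 + S i)) with (N2 p + S i)%nat by lia. rewrite plus_INR, RtoC_plus, RtoC_N2_S. field; auto. }
rewrite <- csum_scal.
rewrite (csum_ext (fun i => 2 ^ k * f (nome (INR (S i) / INR (N2 p))))
  (fun i => f (nome (INR (S i) / INR (N2 (S p)))) + f (- nome (INR (S i) / INR (N2 p) / 2)))).
- rewrite csum_plus. ring.
- intros i Hi. set (x := (INR (S i) / INR (N2 p))%R).
  assert (Hx : 0 < x < 1).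
  { assert (A := lt_0_INR (S i) ltac:(lia)). assert (B := lt_INR (S i) (N2 p) ltac:(lia)).
    unfold x. split. apply Rdiv_lt_0_compat; lra. apply Rlt_div_l; lra. }
  assert (Ex : INR (S i) / INR (N2 p) = x) by (unfold x; rewrite RtoC_div; auto; lra).
  rewrite Ex. destruct (nome_real_neq x Hx). destruct (halves x) as [_ E]. rewrite E.
  replace (INR (S i) / INR (N2 (S p))) with (x / 2).
  symmetry; now apply Hf. rewrite <- Ex, RtoC_N2_S. field; auto.
Qed.

(** The recurrence in closed form. It replaces the value of the zeta function at [k]: after division
    by [2^(p k)], the limit is [f (- 1) / (2^k - 1)]. *)
Lemma zrow_eq k f p : doubling k f -> (2 ^ k - 1) * zrow f p = (INR (N2 p) ^ k - 1) * f (- (1)).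
Proof.
intros Hf. induction p as [|p IH].
- unfold zrow, N2. simpl. rewrite Cpow_1_l. ring.
- rewrite (zrow_S k f p Hf), RtoC_N2_S, Cpow_mult_l.
  transitivity (2 ^ k * ((2 ^ k - 1) * zrow f p) + (2 ^ k - 1) * f (- (1))). ring. rewrite IH. ring.
Qed.

(** Polar part at [w = 0] of order [k2 + 2], with an error smaller by two powers of [w]. The width
    [3/4] is that of the scaled rows in [row_error], and it stays away from the neighbouring poles
    at 1 and -1. *)
Definition polar (f : C -> C) (kap : C) (k2 : nat) (C2 : R) : Prop :=
  forall w : C, w <> 0 -> Rabs (Re w) <= 3 / 4 -> Rabs (Im w) <= 1 ->
  Cmod (f (nome w) - kap * / w ^ (k2 + 2)) <= C2 * / Cmod w ^ k2.

Lemma polar_scaled f kap k2 C2 (y : C) (D : R) : polar f kap k2 C2 -> 0 < D -> y <> 0 ->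
  Rabs (Re y) <= 3 / 4 * D -> Rabs (Im y) <= D ->
  Cmod (f (nome (y / D)) - D ^ (k2 + 2) * (kap * / y ^ (k2 + 2))) <= C2 * (D ^ k2 * / Cmod y ^ k2).
Proof.
intros H HD Hy Hr Hi.
assert (HD0 : RtoC D <> 0) by (intros E; apply (f_equal Re) in E; simpl in E; lra).
assert (Hw : y / D <> 0).
{ intros E. apply Hy. replace y with (y / D * D) by (field; auto). rewrite E. ring. }
assert (B := H (y / D) Hw). rewrite Re_div_real, Im_div_real in B by lra.
assert (X1 : Rabs (Re y / D) <= 3 / 4).
{ unfold Rdiv at 1. rewrite Rabs_mult, Rabs_inv, (Rabs_pos_eq D) by lra. apply (Rle_div_l (Rabs (Re y)) (3 / 4) D); lra. }
assert (X2 : Rabs (Im y / D) <= 1).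
{ unfold Rdiv at 1. rewrite Rabs_mult, Rabs_inv, (Rabs_pos_eq D) by lra. apply (Rle_div_l (Rabs (Im y)) 1 D); lra. }
specialize (B X1 X2).
rewrite Cinv_pow_div in B by auto.
replace (kap * (D ^ (k2 + 2) * / y ^ (k2 + 2))) with (D ^ (k2 + 2) * (kap * / y ^ (k2 + 2))) in B by ring.
rewrite Cmod_div, Cmod_R, (Rabs_pos_eq D) in B by (auto; lra).
assert (Hy0 : 0 < Cmod y) by now apply Cmod_gt_0.
replace (/ (Cmod y / D) ^ k2)%R with (D ^ k2 * / Cmod y ^ k2)%R in B.
2:{ unfold Rdiv. rewrite Rpow_mult_distr, pow_inv.
  assert (A1 := pow_nonzero (Cmod y) k2 ltac:(lra)). assert (A2 := pow_nonzero D k2 ltac:(lra)). field. auto. }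
exact B.
Qed.

Lemma csum_symmetric (g : C -> C) (z : C) (N : nat) (D : R) : (1 <= N)%nat -> D = (2 * INR N)%R ->
  (forall w, g (w + 1) = g w) ->
  csum (fun j => g ((z + INR j) / D)) (N + N) =
  g (z / D) + csum (fun n => g ((z + INR (S n)) / D) + g ((z - INR (S n)) / D)) N - g ((z + INR N) / D).
Proof.
intros HN HD Hg.
assert (HD0 : RtoC D <> 0).
{ intros E; apply (f_equal Re) in E; simpl in E. apply le_INR in HN. simpl in HN. lra. }
rewrite csum_split, csum_plus.
assert (E1 : csum (fun j => g ((z + INR j) / D)) N = g (z / D) + csum (fun n => g ((z + INR (S n)) / D)) N - g ((z + INR N) / D)).
{ assert (E := csum_first (fun j => g ((z + INR j) / D)) N). rewrite csum_S in E.
  simpl (INR 0) in E. replace (z + 0) with z in E by ring. rewrite <- E. ring. }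
assert (E2 : csum (fun i => g ((z + INR (N + i)) / D)) N = csum (fun n => g ((z - INR (S n)) / D)) N).
{ rewrite csum_rev. apply csum_ext. intros i Hi. rewrite <- (Hg ((z - INR (S i)) / D)). f_equal.
  replace (N + (N - S i))%nat with ((N + N) - S i)%nat by lia.
  rewrite minus_INR, plus_INR, RtoC_minus, RtoC_plus by lia.
  assert (ED : RtoC D = INR N + INR N) by (rewrite HD, RtoC_mult; ring).
  rewrite ED in *. field. auto. }
rewrite E1, E2. ring.
Qed.

(** The row has [2 N + 1] points, each with an error of order [D^k2 / m^k2]. Division by
    [D^(k2 + 2)], where [D = 2 N], leaves the order [1 / (N m^2)] as [k2 >= 2]; summed over the rows
    [m], this still tends to 0. *)
Lemma row_error f kap k2 C2 p (z : C) (m : R) : (2 <= k2)%nat -> 0 <= C2 ->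
  doubling (k2 + 2) f -> polar f kap k2 C2 ->
  1 <= m <= INR (N2 p) -> m / 4 <= Im z -> Im z <= 2 * INR (N2 p) -> Rabs (Re z) <= INR (N2 p) / 2 ->
  Cmod (f (nome z) - kap * (/ z ^ (k2 + 2) +
    csum (fun n => / (z + INR (S n)) ^ (k2 + 2) + / (z - INR (S n)) ^ (k2 + 2)) (N2 p)))
  <= (C2 * 4 ^ k2 + (Cmod kap * 4 ^ (k2 + 2) + C2 * 4 ^ k2)) / INR (N2 p) / m ^ 2.
Proof.
intros Hk HC Hd Hp Hm Him Him2 Hre.
set (N := N2 p) in *. set (k := (k2 + 2)%nat) in *. set (D := (2 * INR N)%R).
assert (HN : 1 <= INR N) by apply N2_pos.
assert (HNn : (1 <= N)%nat) by (apply INR_le; simpl; lra).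
assert (HD : 2 <= D) by (unfold D; lra).
assert (HD0 : RtoC D <> 0) by (intros E; apply (f_equal Re) in E; simpl in E; lra).
assert (It := doubling_iter k f (S p) z Hd ltac:(lra)).
rewrite N2_S in It. fold N in It.
replace (RtoC (INR (N + N))) with (RtoC D) in It by (unfold D; rewrite plus_INR; f_equal; ring).
rewrite (csum_symmetric (fun w => f (nome w)) z N D) in It; auto.
2:{ intros w. now rewrite nome_plus1. }
set (bd := (C2 * (D ^ k2 * / (m / 4) ^ k2))%R).
assert (Hpt : forall x : R, Rabs x <= INR N -> Cmod (f (nome ((z + x) / D)) - D ^ k * (kap * / (z + x) ^ k)) <= bd).
{ intros x Hx.
  assert (Hzx : Im (z + x) = Im z) by (destruct z; simpl; ring).
  assert (Hrx : Re (z + x) = (Re z + x)%R) by (destruct z; simpl; ring).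
  assert (Hmod : m / 4 <= Cmod (z + x)).
  { apply Rle_trans with (2 := im_le_Cmod _). rewrite Hzx. apply Rle_trans with (2 := Rle_abs _). lra. }
  apply Rle_trans with (C2 * (D ^ k2 * / Cmod (z + x) ^ k2))%R.
  - apply polar_scaled; auto.
    + lra.
    + apply Cmod_gt_0. lra.
    + rewrite Hrx. apply Rle_trans with (1 := Rabs_triang _ _). unfold D. lra.
    + rewrite Hzx, Rabs_pos_eq; unfold D; lra.
  - unfold bd. apply Rmult_le_compat_l; auto. apply Rmult_le_compat_l. apply pow_le; lra.
    apply Rinv_le_contravar. apply pow_lt; lra. apply pow_incr; lra. }
set (K1 := (Cmod kap * 4 ^ k + C2 * 4 ^ k2)%R).
(* The point counted twice satisfies [1/4 <= Re w <= 3/4], at a distance from the poles, so its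
   contribution is bounded. *)
assert (Hlast : Cmod (f (nome ((z + INR N) / D))) <= K1).
{ set (w := (z + INR N) / D).
  assert (Hrw : Re w = ((Re z + INR N) / D)%R) by (unfold w; rewrite Re_div_real by lra; destruct z; simpl; f_equal; ring).
  assert (Hiw : Im w = (Im z / D)%R) by (unfold w; rewrite Im_div_real by lra; destruct z; simpl; f_equal; ring).
  apply Rabs_le_between in Hre.
  assert (Hw4 : / 4 <= Cmod w).
  { apply Rle_trans with (2 := re_le_Cmod _). apply Rle_trans with (2 := Rle_abs _). rewrite Hrw.
    apply Rle_div_r. lra. unfold D; lra. }
  assert (Hw0 : w <> 0) by (apply Cmod_gt_0; lra).
  assert (B := Hp w Hw0).
  assert (Hx1 : Rabs (Re w) <= 3 / 4).
  { rewrite Hrw, Rabs_pos_eq. apply Rle_div_l; unfold D; lra. apply Rmult_le_pos; [lra|]. apply Rlt_le, Rinv_0_lt_compat; lra. }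
  assert (Hx2 : Rabs (Im w) <= 1).
  { rewrite Hiw, Rabs_pos_eq. apply Rle_div_l; unfold D; lra. apply Rmult_le_pos; [lra|]. apply Rlt_le, Rinv_0_lt_compat; lra. }
  specialize (B Hx1 Hx2). fold k in B.
  assert (P4 : forall j, / Cmod w ^ j <= 4 ^ j).
  { intros j. replace 4%R with (/ / 4)%R by field. rewrite <- pow_inv. apply pow_incr. split.
    apply Rlt_le, Rinv_0_lt_compat; lra. apply Rinv_le_contravar; lra. }
  replace (f (nome w)) with ((f (nome w) - kap * / w ^ k) + kap * / w ^ k) by ring.
  apply Rle_trans with (1 := Cmod_triangle _ _). unfold K1. rewrite Cmod_mult, Cmod_inv, Cmod_pow by now apply Cpow_nz.
  rewrite Rplus_comm. apply Rplus_le_compat. apply Rmult_le_compat_l; auto. apply Cmod_ge_0.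
  apply Rle_trans with (1 := B). apply Rmult_le_compat_l; auto. }
set (row := / z ^ k + csum (fun n => / (z + INR (S n)) ^ k + / (z - INR (S n)) ^ k) N).
assert (EQ : D ^ k * (f (nome z) - kap * row) =
  (f (nome ((z + 0%R) / D)) - D ^ k * (kap * / (z + 0%R) ^ k)) +
  csum (fun n => (f (nome ((z + INR (S n)) / D)) - D ^ k * (kap * / (z + INR (S n)) ^ k)) +
    (f (nome ((z + (- INR (S n))%R) / D)) - D ^ k * (kap * / (z + (- INR (S n))%R) ^ k))) N - f (nome ((z + INR N) / D))).
{ rewrite Cplus_0_r. transitivity (D ^ k * f (nome z) - D ^ k * (kap * row)). ring. rewrite <- It. unfold row.
  rewrite (csum_ext (fun n => (f (nome ((z + INR (S n)) / D)) - D ^ k * (kap * / (z + INR (S n)) ^ k)) +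
    (f (nome ((z + (- INR (S n))%R) / D)) - D ^ k * (kap * / (z + (- INR (S n))%R) ^ k)))
    (fun n => (f (nome ((z + INR (S n)) / D)) + f (nome ((z - INR (S n)) / D))) -
       (D ^ k * kap) * (/ (z + INR (S n)) ^ k + / (z - INR (S n)) ^ k))).
  2:{ intros i _. rewrite RtoC_opp. fold (z - INR (S i)). ring. }
  rewrite csum_minus, csum_scal. ring. }
assert (Hbd0 : 0 <= bd).
{ unfold bd. apply Rmult_le_pos; auto. apply Rmult_le_pos. apply pow_le; lra.
  apply Rlt_le, Rinv_0_lt_compat, pow_lt; lra. }
assert (Main : (D ^ k * Cmod (f (nome z) - kap * row) <= (2 * INR N + 1) * bd + K1)%R).
{ replace (D ^ k)%R with (Cmod (D ^ k)).
  2:{ rewrite Cmod_pow, Cmod_R, Rabs_pos_eq; lra. }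
  rewrite <- Cmod_mult, EQ.
  apply Rle_trans with (1 := Cmod_triangle _ _). rewrite Cmod_opp.
  apply Rplus_le_compat; auto.
  apply Rle_trans with (1 := Cmod_triangle _ _).
  replace ((2 * INR N + 1) * bd)%R with (bd + INR N * (2 * bd))%R by ring.
  apply Rplus_le_compat. apply Hpt. rewrite Rabs_R0. lra.
  apply Cmod_csum_le. intros i Hi. apply Rle_trans with (1 := Cmod_triangle _ _).
  assert (Hi' : INR (S i) <= INR N) by (apply le_INR; lia).
  assert (A1 := Hpt (INR (S i)) ltac:(rewrite Rabs_pos_eq; [lra|apply pos_INR])).
  assert (A2 := Hpt (- INR (S i))%R ltac:(rewrite Rabs_Ropp, Rabs_pos_eq; [lra|apply pos_INR])). lra. }
assert (HDk : (0 < D ^ k)%R) by (apply pow_lt; lra).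
apply Rmult_le_reg_l with (D ^ k)%R; auto. apply Rle_trans with (1 := Main).
assert (HK1 : 0 <= K1).
{ unfold K1. apply Rplus_le_le_0_compat; apply Rmult_le_pos; auto; try apply Cmod_ge_0; apply pow_le; lra. }
assert (Hmk : (m ^ 2 <= m ^ k2)%R) by (apply Rle_pow; auto; lra).
assert (Hm2 : (0 < m ^ 2)%R) by (apply pow_lt; lra).
assert (HDk2 : (m ^ 2 <= D ^ k2)%R).
{ apply Rle_trans with (D ^ 2)%R. apply pow_incr. unfold D; lra. apply Rle_pow; auto; lra. }
assert (EDk : (D ^ k = D ^ k2 * (4 * INR N * INR N))%R) by (unfold k; rewrite pow_add; unfold D; ring).
rewrite EDk.
replace (D ^ k2 * (4 * INR N * INR N) * ((C2 * 4 ^ k2 + K1) / INR N / m ^ 2))%R with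
  ((4 * INR N) * (C2 * 4 ^ k2 * (D ^ k2 * / m ^ 2)) + (4 * INR N) * (K1 * (D ^ k2 * / m ^ 2)))%R by (field; lra).
assert (H4 : (0 < 4 ^ k2)%R) by (apply pow_lt; lra).
assert (HD2 : (0 < D ^ k2)%R) by (apply pow_lt; lra).
apply Rplus_le_compat.
- apply Rmult_le_compat; try lra. unfold bd.
  replace (C2 * 4 ^ k2 * (D ^ k2 * / m ^ 2))%R with (C2 * (D ^ k2 * (4 ^ k2 * / m ^ 2)))%R by ring.
  apply Rmult_le_compat_l; auto. apply Rmult_le_compat_l; [lra|].
  unfold Rdiv. rewrite Rpow_mult_distr, pow_inv, Rinv_mult, Rinv_inv, Rmult_comm.
  apply Rmult_le_compat_l; [lra|]. apply Rinv_le_contravar; auto.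
- rewrite <- (Rmult_1_l K1) at 1. apply Rmult_le_compat; try lra.
  rewrite <- (Rmult_1_r K1) at 1. apply Rmult_le_compat_l; auto.
  apply Rmult_le_reg_r with (m ^ 2)%R; auto. rewrite Rmult_assoc, Rinv_l by lra. lra.
Qed.

Lemma zero_row_error f kap k2 C2 p : (2 <= k2)%nat -> 0 <= C2 -> (forall x : C, (- x) ^ (k2 + 2) = x ^ (k2 + 2)) ->
  doubling (k2 + 2) f -> polar f kap k2 C2 ->
  Cmod (2 * (kap * csum (fun n => / INR (S n) ^ (k2 + 2)) (N2 p)) - f (- (1)) / (2 ^ (k2 + 2) - 1))
  <= (2 * C2 + 2 * Cmod kap + 2 * Cmod (f (- (1)))) / INR (N2 p).
Proof.
intros Hk HC Hev Hd Hp.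
set (N := N2 p) in *. set (k := (k2 + 2)%nat) in *. set (D := (2 * INR N)%R).
assert (HN : 1 <= INR N) by apply N2_pos.
assert (HNn : (1 <= N)%nat) by (apply INR_le; simpl; lra).
assert (HD : 2 <= D) by (unfold D; lra).
assert (HD0 : RtoC D <> 0) by (intros E; apply (f_equal Re) in E; simpl in E; lra).
assert (HDk0 := Cpow_nz _ k HD0).
assert (E2k : (2 ^ k - 1 : C) = RtoC (2 ^ k - 1)%R) by (rewrite RtoC_minus, RtoC_pow; auto).
assert (H2k : (4 <= 2 ^ k)%R).
{ replace 4%R with (2 ^ 2)%R by ring. apply Rle_pow. lra. unfold k; lia. }
assert (H2k0 : (2 ^ k - 1 : C) <> 0).
{ rewrite E2k. intros E; apply (f_equal Re) in E; simpl in E; lra. }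
assert (Z := zrow_eq k f (S p) Hd). unfold zrow in Z. rewrite N2_S in Z. fold N in Z.
replace (RtoC (INR (N + N))) with (RtoC D) in Z by (unfold D; rewrite plus_INR; f_equal; ring).
set (g := fun w : C => f (nome w)).
(* The [2 N - 1] roots of unity other than 1 are grouped into the pairs of exponents [n] and [- n]
   with [n < N], and the root -1 of exponent [N]. *)
assert (ET : csum (fun j => f (nome (INR (S j) / D))) (N + N - 1) =
  csum (fun n => g (INR (S n) / D) + g ((- INR (S n)) / D)) (N - 1) + f (- (1))).
{ replace (N + N - 1)%nat with ((N - 1) + S (N - 1))%nat by lia.
  rewrite csum_split, csum_first, csum_plus.
  replace (RtoC (INR (S (N - 1 + 0)))) with (RtoC (INR N)) by (do 2 f_equal; lia).
  replace (INR N / D) with (1 / 2).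
  2:{ assert (ED : RtoC D = 2 * INR N) by (unfold D; now rewrite RtoC_mult).
      assert (HN0 : RtoC (INR N) <> 0) by (intros E; apply (f_equal Re) in E; simpl in E; lra).
      rewrite ED. field. auto. }
  rewrite nome_half.
  rewrite (csum_rev (fun i => f (nome (INR (S (N - 1 + S i)) / D)))).
  rewrite (csum_ext (fun i => f (nome (INR (S (N - 1 + S (N - 1 - S i))) / D))) (fun n => g ((- INR (S n)) / D))).
  unfold g. ring.
  intros i Hi. unfold g. f_equal. rewrite <- (nome_plus1 (- _ / _)). f_equal.
  replace (S (N - 1 + S (N - 1 - S i)))%nat with (N + N - S i)%nat by lia.
  rewrite minus_INR, plus_INR, RtoC_minus, RtoC_plus by lia.
  assert (ED : RtoC D = INR N + INR N) by (unfold D; rewrite RtoC_mult; ring).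
  rewrite ED in *. field. auto. }
rewrite ET in Z.
set (S0 := csum (fun n => / INR (S n) ^ k) (N - 1)).
assert (ES : csum (fun n => / INR (S n) ^ k) N = S0 + / INR N ^ k).
{ replace N with (S (N - 1)) at 1 by lia. rewrite csum_S. unfold S0. do 3 f_equal. do 2 f_equal. lia. }
assert (Hpt : forall x : R, 1 <= Rabs x <= INR N -> Cmod (g (x / D) - D ^ k * (kap * / x ^ k)) <= C2 * D ^ k2).
{ intros x Hx. apply Rle_trans with (C2 * (D ^ k2 * / Cmod x ^ k2))%R.
  - apply polar_scaled; auto; try lra.
    + apply Cmod_gt_0. rewrite Cmod_R. lra.
    + simpl. unfold D. lra.
    + simpl. rewrite Rabs_R0. lra.
  - apply Rmult_le_compat_l; auto. rewrite <- (Rmult_1_r (D ^ k2)) at 2. apply Rmult_le_compat_l. apply pow_le; lra.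
    rewrite Cmod_R, <- Rinv_1. apply Rinv_le_contravar. lra. rewrite <- (pow1 k2). apply pow_incr; lra. }
assert (Hsum : Cmod (csum (fun n => g (INR (S n) / D) + g ((- INR (S n)) / D)) (N - 1) - D ^ k * (2 * (kap * S0))) <= INR N * (2 * (C2 * D ^ k2))).
{ replace (D ^ k * (2 * (kap * S0))) with (csum (fun n => D ^ k * (kap * / INR (S n) ^ k) + D ^ k * (kap * / INR (S n) ^ k)) (N - 1)).
  2:{ rewrite <- (csum_ext (fun n => (2 * D ^ k * kap) * / INR (S n) ^ k)). rewrite csum_scal. fold S0. ring. intros; ring. }
  rewrite <- csum_minus.
  apply Rle_trans with (INR (N - 1) * (2 * (C2 * D ^ k2)))%R.
  - apply Cmod_csum_le. intros i Hi.
    assert (Hi1 : 1 <= INR (S i)) by (apply (le_INR 1); lia).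
    assert (Hi2 : INR (S i) <= INR N) by (apply le_INR; lia).
    assert (A1 := Hpt (INR (S i)) ltac:(rewrite Rabs_pos_eq; lra)).
    assert (A2 := Hpt (- INR (S i))%R ltac:(rewrite Rabs_Ropp, Rabs_pos_eq; lra)).
    rewrite RtoC_opp, Hev in A2.
    replace (g (INR (S i) / D) + g (- INR (S i) / D) - (D ^ k * (kap * / INR (S i) ^ k) + D ^ k * (kap * / INR (S i) ^ k)))
      with ((g (INR (S i) / D) - D ^ k * (kap * / INR (S i) ^ k)) + (g (- INR (S i) / D) - D ^ k * (kap * / INR (S i) ^ k))) by ring.
    apply Rle_trans with (1 := Cmod_triangle _ _). lra.
  - apply Rmult_le_compat_r. assert (0 <= D ^ k2)%R by (apply pow_le; lra). nra. apply le_INR. lia. }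
set (T0 := csum (fun n => g (INR (S n) / D) + g ((- INR (S n)) / D)) (N - 1)) in *.
set (c := 2 ^ k - 1 : C) in *. set (F := f (- (1))) in *.
assert (ET0 : T0 = ((D ^ k - 1) / c - 1) * F).
{ replace T0 with ((c * (T0 + F)) / c - F) by (field; auto). rewrite Z. field; auto. }
assert (HNk0 : RtoC (INR N) ^ k <> 0) by (apply Cpow_nz; intros E; apply (f_equal Re) in E; simpl in E; lra).
rewrite ES.
replace (2 * (kap * (S0 + / INR N ^ k)) - F / c) with
  (- (/ D ^ k * (T0 - D ^ k * (2 * (kap * S0)))) + 2 * kap * / INR N ^ k + - (/ D ^ k * (F * (/ c + 1))))
  by (rewrite ET0; field; auto).
assert (HDk : (0 < D ^ k)%R) by (apply pow_lt; lra).
assert (MDk : Cmod (/ D ^ k) = (/ D ^ k)%R).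
{ rewrite Cmod_inv, Cmod_pow, Cmod_R, Rabs_pos_eq; auto; lra. }
assert (MNk : Cmod (/ INR N ^ k) <= / INR N).
{ rewrite Cmod_inv, Cmod_pow, Cmod_R, Rabs_pos_eq by (auto; lra). apply Rinv_le_contravar. lra.
  rewrite <- (pow_1 (INR N)) at 1. apply Rle_pow. lra. unfold k; lia. }
assert (Mc : Cmod (/ c + 1) <= 2).
{ apply Rle_trans with (1 := Cmod_triangle _ _). rewrite Cmod_1, Cmod_inv, E2k, Cmod_R, Rabs_pos_eq by (auto; lra).
  assert (/ (2 ^ k - 1) <= 1)%R by (rewrite <- Rinv_1; apply Rinv_le_contravar; lra). lra. }
assert (EDk : (D ^ k = D ^ k2 * (4 * INR N * INR N))%R) by (unfold k; rewrite pow_add; unfold D; ring).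
assert (HD2 : (1 <= D ^ k2)%R) by (apply pow_R1_Rle; lra).
assert (MDk2 : (/ D ^ k <= / INR N)%R).
{ apply Rinv_le_contravar. lra. rewrite EDk. assert (INR N <= 4 * INR N * INR N)%R by nra. nra. }
assert (HF := Cmod_ge_0 F). assert (Hkap := Cmod_ge_0 kap).
assert (HiN : 0 < / INR N) by (apply Rinv_0_lt_compat; lra).
apply Rle_trans with (1 := Cmod_triangle _ _). rewrite Cmod_opp.
apply Rle_trans with ((2 * C2 * / INR N + 2 * Cmod kap * / INR N) + 2 * Cmod F * / INR N)%R.
2:{ unfold Rdiv. right. ring. }
apply Rplus_le_compat.
- apply Rle_trans with (1 := Cmod_triangle _ _). rewrite Cmod_opp.
  apply Rplus_le_compat.
  + rewrite Cmod_mult, MDk. apply Rle_trans with (/ D ^ k * (INR N * (2 * (C2 * D ^ k2))))%R.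
    apply Rmult_le_compat_l; auto. apply Rlt_le, Rinv_0_lt_compat; auto.
    rewrite EDk. replace (/ (D ^ k2 * (4 * INR N * INR N)) * (INR N * (2 * (C2 * D ^ k2))))%R with (/ 2 * (C2 * / INR N))%R by (field; lra).
    assert (0 <= C2 * / INR N)%R by (apply Rmult_le_pos; lra). lra.
  + rewrite !Cmod_mult, Cmod_R, Rabs_pos_eq by lra. apply Rmult_le_compat_l; auto. lra.
- rewrite !Cmod_mult, MDk. replace (2 * Cmod F * / INR N)%R with (/ INR N * (Cmod F * 2))%R by ring.
  apply Rmult_le_compat; auto. apply Rlt_le, Rinv_0_lt_compat; auto.
  apply Rmult_le_pos; auto. apply Cmod_ge_0. apply Rmult_le_compat_l; auto.
Qed.

Lemma divisor_sum_le e n : INR (divisor_sum e n) <= INR n * INR n ^ e.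
Proof.
assert (H := divisor_sum_csum e n).
assert (B : Cmod (RtoC (INR (divisor_sum e n))) <= INR n * INR n ^ e).
{ rewrite H. apply Cmod_csum_le. intros i Hi.
  destruct Nat.eqb.
  - rewrite Cmod_R, Rabs_pos_eq by (apply pow_le, pos_INR). apply pow_incr. split. apply pos_INR. apply le_INR; lia.
  - rewrite Cmod_0. apply pow_le, pos_INR. }
rewrite Cmod_R in B. apply Rle_trans with (2 := B). apply Rle_abs.
Qed.

(** The index is shifted: [sig e n] belongs to [q ^ (n + 1)], whence the factor [q] in front of
    [CPS (sig e) q]. *)
Definition sig (e : nat) (n : nat) : R := INR (divisor_sum e (S n)).

Lemma rad1_sig e : rad1 (sig e).
Proof.
apply rad1_bounded. intros r Hr. destruct (Req_dec r 0) as [->|Hr0].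
- exists (Rabs (sig e 0)). intros [|n]. simpl. rewrite Rmult_1_r. lra.
  simpl. rewrite Rmult_0_l, Rmult_0_r, Rabs_R0. apply Rabs_pos.
- destruct (pow_geom_bounded (S e) r ltac:(lra)) as [K [HK H]].
  exists (K / r)%R. intros n. assert (Hp : (0 <= r ^ n)%R) by (apply pow_le; lra).
  assert (Hs : (0 <= sig e n)%R) by apply pos_INR.
  rewrite Rabs_pos_eq by now apply Rmult_le_pos.
  apply (Rle_div_r (sig e n * r ^ n) K r); [lra|]. apply Rle_trans with (2 := H (S n)).
  replace (sig e n * r ^ n * r)%R with (sig e n * r ^ S n)%R by (simpl; ring).
  apply Rmult_le_compat_r. apply pow_le; lra. apply (divisor_sum_le e (S n)).
Qed.

Lemma lambert_CPS e (q : C) : Cmod q < 1 ->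
  cabs (fun n => INR (divisor_sum e (S n)) * q ^ S n) /\
  CSeries (fun n => INR (divisor_sum e (S n)) * q ^ S n) = q * CPS (sig e) q.
Proof.
intros Hq. assert (A := cabs_CPS _ _ (rad1_disk _ _ (rad1_sig e) Hq)).
assert (E : forall n, q * (sig e n * q ^ n) = INR (divisor_sum e (S n)) * q ^ S n).
{ intros n. unfold sig. simpl. ring. }
split.
- apply (ex_series_ext (fun n => Cmod (q * (sig e n * q ^ n)))). intros n; now rewrite E. now apply cabs_scal.
- unfold CPS. rewrite <- CSeries_scal by auto. apply CSeries_ext. intros n; now rewrite E.
Qed.

(** The bound is uniform in [Q] because it is applied to all powers [Q = q^m] of one nome at the
    same time. *)
Definition lambert_tail (f : C -> C) (e : nat) (C3 : R) : Prop :=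
  forall n Q, Cmod Q <= 1 / 2 ->
  Cmod (f Q - csum (fun r => INR (S r) ^ e * Q ^ S r) n) <= C3 * INR (S n) ^ e * Cmod Q ^ S n.

Lemma lambert_limit f e C3 (q : C) : 0 <= C3 -> lambert_tail f e C3 -> 0 < Cmod q <= 1 / 2 ->
  clim (fun N => csum (fun m => f (q ^ S m)) N) (CSeries (fun n => INR (divisor_sum e (S n)) * q ^ S n)).
Proof.
intros HC Ht Hq. destruct (lambert_CPS e q ltac:(lra)) as [A _].
set (L := CSeries (fun n => INR (divisor_sum e (S n)) * q ^ S n)).
assert (HL := CSeries_clim _ A). fold L in HL. unfold clim in HL.
(* The exponent is [e] for the coefficients, 2 for the number of pairs, and 1 more to leave a factor
   [1 / (N + 1)] that tends to 0. *)
destruct (pow_geom_bounded (e + 3) (Cmod q) ltac:(lra)) as [K [HK HB]].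
set (rho := Cmod q) in *.
apply (clim_le _ _ (fun N => (C3 + 1) * (K * / (INR N + 1)) / rho + Cmod (csum (fun n => INR (divisor_sum e (S n)) * q ^ S n)%C N - L)%C)%R).
2:{ replace (Finite 0) with (Finite ((C3 + 1) * (K * 0) / rho + 0)) by (f_equal; field; lra).
  apply is_lim_seq_plus'; auto. apply is_lim_seq_mult'; [|apply is_lim_seq_const]. apply is_lim_seq_mult'. apply is_lim_seq_const.
  apply is_lim_seq_mult'. apply is_lim_seq_const.
  apply (is_lim_seq_ext (fun n => / INR (S n))%R). intros n; now rewrite S_INR.
  apply (is_lim_seq_incr_1 (fun n => / INR n)%R).
  replace (Finite 0) with (Rbar_inv p_infty) by reflexivity. apply is_lim_seq_inv; [|easy]. apply is_lim_seq_INR. }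
intros N. set (Nr := INR N). set (M := (INR N + 1)%R). assert (HN := pos_INR N).
assert (HM : (1 <= M /\ Nr <= M)%R) by (unfold M, Nr; lra).
assert (Hrho : (0 < rho <= 1 / 2)%R) by exact Hq.
set (dbl := csum (fun r => csum (fun m => INR (S r) ^ e * q ^ (S m * S r)) N) N).
assert (B1 : Cmod (csum (fun m => f (q ^ S m)) N - dbl) <= Nr * (C3 * M ^ e * rho ^ S N)).
{ unfold dbl. rewrite csum_switch, <- csum_minus. apply Cmod_csum_le. intros m Hm.
  assert (Hqm : Cmod (q ^ S m) <= rho).
  { rewrite Cmod_pow. fold rho. simpl. rewrite <- (Rmult_1_r rho) at 3. apply Rmult_le_compat_l. lra.
    rewrite <- (pow1 m). apply pow_incr; lra. }
  rewrite (csum_ext (fun i => INR (S i) ^ e * q ^ (S m * S i)) (fun r => INR (S r) ^ e * (q ^ S m) ^ S r)).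
  2:{ intros i _. now rewrite Cpow_mult_r. }
  apply Rle_trans with (1 := Ht N (q ^ S m) ltac:(lra)).
  rewrite S_INR. fold M. apply Rmult_le_compat_l. apply Rmult_le_pos; auto. apply pow_le; lra.
  apply pow_incr. split; auto. apply Cmod_ge_0. }
assert (Hq1 : Cmod q <= 1) by (fold rho; lra).
assert (B2 := lambert_error e q N Hq1). fold dbl rho Nr in B2.
assert (Big : (M ^ (e + 3) * rho ^ S N <= K)%R).
{ assert (H := HB (S N)). rewrite S_INR in H. exact H. }
assert (HMe : (0 < M ^ e)%R) by (apply pow_lt; lra).
assert (HrN : (0 < rho ^ N)%R) by (apply pow_lt; lra).
assert (HrS : (rho ^ S N = rho * rho ^ N)%R) by reflexivity.
assert (EM : (M ^ (e + 3) = M ^ e * M * M * M)%R) by (rewrite pow_add; ring).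
assert (Bb : (M * M * (M ^ e * rho ^ N) <= K * / M / rho)%R).
{ unfold Rdiv. apply Rmult_le_reg_r with (rho * M)%R. nra.
  replace (K * / M * / rho * (rho * M))%R with K by (field; lra).
  replace (M * M * (M ^ e * rho ^ N) * (rho * M))%R with (M ^ (e + 3) * rho ^ S N)%R by (rewrite EM, HrS; ring). auto. }
assert (P1 : (0 <= M ^ e * rho ^ N)%R) by (apply Rmult_le_pos; lra).
assert (B1' : (Nr * (C3 * M ^ e * rho ^ S N) <= C3 * (M * M * (M ^ e * rho ^ N)))%R).
{ rewrite HrS. replace (Nr * (C3 * M ^ e * (rho * rho ^ N)))%R with (C3 * ((Nr * rho) * (M ^ e * rho ^ N)))%R by ring.
  apply Rmult_le_compat_l; auto. apply Rmult_le_compat_r; auto. assert (0 <= Nr)%R by exact HN. nra. }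
assert (B2' : (Nr * (Nr * (Nr ^ e * rho ^ N)) <= M * M * (M ^ e * rho ^ N))%R).
{ assert (0 <= Nr)%R by exact HN.
  assert (Nr ^ e <= M ^ e)%R by (apply pow_incr; lra). assert (0 <= Nr ^ e)%R by now apply pow_le.
  rewrite <- Rmult_assoc. apply Rmult_le_compat.
  - nra.
  - apply Rmult_le_pos; lra.
  - nra.
  - apply Rmult_le_compat_r; lra. }
replace (csum (fun m => f (q ^ S m)) N - L) with
  ((csum (fun m => f (q ^ S m)) N - dbl) + (dbl - csum (fun n => INR (divisor_sum e (S n)) * q ^ S n) N)
   + (csum (fun n => INR (divisor_sum e (S n)) * q ^ S n) N - L)) by ring.
apply Rle_trans with (1 := Cmod_triangle _ _). apply Rplus_le_compat_r.
apply Rle_trans with (1 := Cmod_triangle _ _). 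
change (Nr + 1)%R with M.
replace ((C3 + 1) * (K * / M) / rho)%R with (C3 * (K * / M / rho) + K * / M / rho)%R by (field; lra).
assert (C3 * (M * M * (M ^ e * rho ^ N)) <= C3 * (K * / M / rho))%R by now apply Rmult_le_compat_l.
lra.
Qed.

(** The constant term is half the value of the zeta function at [1 - k], for [k = k2 + 2]: it is
    [1 / 240] for weight 4 and [- 1 / 504] for weight 6. *)
Definition eis (f : C -> C) (k2 : nat) (t : C) : C :=
  f (- (1)) / (2 * (2 ^ (k2 + 2) - 1)) + CSeries (fun n => INR (divisor_sum (k2 + 1) (S n)) * nome t ^ S n).

(** A neighbourhood of [i]. The bounds are such that [z = m t] fulfils the conditions of [row_error]
    and that [|nome t| <= 1/2], as [lambert_tail] requires. *)
Definition tdom (t : C) : Prop := Rabs (Re t) <= 1 / 2 /\ 1 / 4 <= Im t <= 2.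

Lemma Cmod_nome_half t : 1 / 4 <= Im t -> 0 < Cmod (nome t) <= 1 / 2.
Proof.
intros H. rewrite Cmod_nome. split. apply exp_pos.
assert (H1 := PI2_1). rewrite exp_Ropp. replace (1 / 2)%R with (/ 2)%R by field.
apply Rinv_le_contravar. lra. apply Rle_trans with (2 := exp_ineq1_le _). nra.
Qed.

Lemma box_limit f kap k2 C2 C3 t : (2 <= k2)%nat -> 0 <= C2 -> 0 <= C3 ->
  (forall x : C, (- x) ^ (k2 + 2) = x ^ (k2 + 2)) ->
  doubling (k2 + 2) f -> polar f kap k2 C2 -> lambert_tail f (k2 + 1) C3 -> tdom t ->
  clim (fun p => kap * box (k2 + 2) (N2 p) t) (eis f k2 t).
Proof.
intros Hk HC2 HC3 Hev Hd Hp Ht [Hre Him].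
set (k := (k2 + 2)%nat) in *.
assert (Hq := Cmod_nome_half t ltac:(lra)).
assert (L3 := clim_N2 _ _ (lambert_limit f (k2 + 1) C3 (nome t) HC3 Ht Hq)).
assert (H2k : (4 <= 2 ^ k)%R).
{ replace 4%R with (2 ^ 2)%R by ring. apply Rle_pow. lra. unfold k; lia. }
assert (H2k0 : (2 ^ k - 1 : C) <> 0).
{ rewrite <- RtoC_pow, <- RtoC_minus. intros E; apply (f_equal Re) in E; simpl in E; lra. }
assert (L1 : clim (fun p => kap * csum (fun m => / INR (S m) ^ k) (N2 p)) (f (- (1)) / (2 * (2 ^ k - 1)))).
{ apply (clim_le _ _ (fun p => (2 * C2 + 2 * Cmod kap + 2 * Cmod (f (- (1))%C)) / INR (N2 p))%R).
  2: apply is_lim_inv_N2.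
  intros p. assert (B := zero_row_error f kap k2 C2 p Hk HC2 Hev Hd Hp). fold k in B.
  set (X := kap * csum (fun m => / INR (S m) ^ k) (N2 p)) in *.
  replace (X - f (- (1)) / (2 * (2 ^ k - 1))) with ((1 / 2)%R * (2 * X - f (- (1)) / (2 ^ k - 1))).
  2:{ rewrite RtoC_div by lra. field. auto. }
  rewrite Cmod_mult, Cmod_R, Rabs_pos_eq by lra.
  assert (H0 := Cmod_ge_0 (2 * X - f (- (1)) / (2 ^ k - 1))). apply Rle_trans with (2 := B). lra. }
set (row := fun p m => / (INR (S m) * t) ^ k
   + csum (fun n => / (INR (S m) * t + INR (S n)) ^ k + / (INR (S m) * t - INR (S n)) ^ k) (N2 p)).
assert (L2 : clim (fun p => csum (fun m => kap * row p m - f (nome t ^ S m)) (N2 p)) 0).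
{ set (K := (C2 * 4 ^ k2 + (Cmod kap * 4 ^ (k2 + 2) + C2 * 4 ^ k2))%R).
  apply (clim_le _ _ (fun p => (2 * K) / INR (N2 p))%R). 2: apply is_lim_inv_N2.
  intros p. replace (csum (fun m => kap * row p m - f (nome t ^ S m)) (N2 p) - 0) with
    (csum (fun m => kap * row p m - f (nome t ^ S m)) (N2 p)) by ring.
  assert (HN := N2_pos p).
  assert (HK : (0 <= K)%R).
  { assert (H4 : (0 < 4 ^ k2)%R) by (apply pow_lt; lra). assert (H4' : (0 < 4 ^ (k2 + 2))%R) by (apply pow_lt; lra).
    assert (H5 := Cmod_ge_0 kap). unfold K. repeat apply Rplus_le_le_0_compat; apply Rmult_le_pos; lra. }
  replace (2 * K / INR (N2 p))%R with (2 * (K / INR (N2 p)))%R by (unfold Rdiv; ring).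
  apply Cmod_csum_le_sq. apply Rmult_le_pos; auto. apply Rlt_le, Rinv_0_lt_compat; lra.
  intros m Hm. replace (kap * row p m - f (nome t ^ S m)) with (- (f (nome t ^ S m) - kap * row p m)) by ring.
  rewrite Cmod_opp, <- nome_mult, <- S_INR.
  assert (H1 : 1 <= INR (S m)) by (apply (le_INR 1); lia).
  assert (H2 : INR (S m) <= INR (N2 p)) by (apply le_INR; lia).
  assert (Ei : Im (INR (S m) * t) = (INR (S m) * Im t)%R) by (destruct t; cbv [Im Re Cmult RtoC fst snd]; ring).
  assert (Er : Re (INR (S m) * t) = (INR (S m) * Re t)%R) by (destruct t; cbv [Im Re Cmult RtoC fst snd]; ring).
  apply row_error; auto.
  - rewrite Ei. nra.
  - rewrite Ei. nra.
  - rewrite Er, Rabs_mult, (Rabs_pos_eq (INR (S m))) by lra. nra. }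
assert (L := clim_plus _ _ _ _ (clim_plus _ _ _ _ L1 L2) L3).
unfold eis. fold k. rewrite Cplus_0_r in L. revert L. apply clim_ext. intros p.
unfold box. fold (row p). rewrite csum_minus, csum_scal. ring.
Qed.

Theorem eis_S f kap k2 C2 C3 t : (2 <= k2)%nat -> 0 <= C2 -> 0 <= C3 ->
  (forall x : C, (- x) ^ (k2 + 2) = x ^ (k2 + 2)) ->
  doubling (k2 + 2) f -> polar f kap k2 C2 -> lambert_tail f (k2 + 1) C3 -> tdom t -> tdom (S_act t) ->
  eis f k2 (S_act t) = t ^ (k2 + 2) * eis f k2 t.
Proof.
intros Hk HC2 HC3 Hev Hd Hp Ht D1 D2.
apply (clim_unique (fun p => kap * box (k2 + 2) (N2 p) (S_act t))).
- now apply (box_limit f kap k2 C2 C3).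
- apply (clim_ext (fun p => t ^ (k2 + 2) * (kap * box (k2 + 2) (N2 p) t))).
  + intros p. rewrite box_S; auto. ring. destruct D1 as [_ D1]. lra.
  + apply clim_scal. now apply (box_limit f kap k2 C2 C3).
Qed.

(* [R4 q] and [R6 q] are the sums of [n ^ 3 * q ^ n] and [n ^ 5 * q ^ n]. *)
Definition R4 (q : C) : C := q * (1 + 4 * q + q ^ 2) / (1 - q) ^ 4.

Definition R6 (q : C) : C := q * (1 + 26 * q + 66 * q ^ 2 + 26 * q ^ 3 + q ^ 4) / (1 - q) ^ 6.

Lemma one_minus_neq_0 (e : C) : e <> 1 -> 1 - e <> 0.
Proof. intros H E. apply H. replace e with (1 - (1 - e)) by ring. rewrite E. ring. Qed.

Lemma doubling_nz (e : C) : e <> 1 -> e <> - (1) -> 1 - e <> 0 /\ 1 - - e <> 0 /\ 1 - e * e <> 0.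
Proof.
intros H1 H2. assert (A := one_minus_neq_0 e H1).
assert (B : 1 - - e <> 0).
{ apply one_minus_neq_0. intros E. apply H2. rewrite <- E. ring. }
split; [auto|split; auto]. replace (1 - e * e) with ((1 - e) * (1 - - e)) by ring. now apply Cmult_neq_0.
Qed.

Lemma doubling_R4 : doubling 4 R4.
Proof. intros e H1 H2. destruct (doubling_nz e H1 H2) as [A [B D]]. unfold R4. field. auto. Qed.

Lemma doubling_R6 : doubling 6 R6.
Proof. intros e H1 H2. destruct (doubling_nz e H1 H2) as [A [B D]]. unfold R6. field. auto. Qed.

(* [T4 M Q] and [T6 M Q] are the sums of [(M + n) ^ 3 * Q ^ n] and [(M + n) ^ 5 * Q ^ n]. *)
Definition T4 (M Q : C) : C := let i := / (1 - Q) in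
  M ^ 3 * i + 3 * M ^ 2 * Q * i ^ 2 + 3 * M * (Q + Q ^ 2) * i ^ 3 + (Q + 4 * Q ^ 2 + Q ^ 3) * i ^ 4.

Definition T6 (M Q : C) : C := let i := / (1 - Q) in
  M ^ 5 * i + 5 * M ^ 4 * Q * i ^ 2 + 10 * M ^ 3 * (Q + Q ^ 2) * i ^ 3 + 10 * M ^ 2 * (Q + 4 * Q ^ 2 + Q ^ 3) * i ^ 4
  + 5 * M * (Q + 11 * Q ^ 2 + 11 * Q ^ 3 + Q ^ 4) * i ^ 5
  + (Q + 26 * Q ^ 2 + 66 * Q ^ 3 + 26 * Q ^ 4 + Q ^ 5) * i ^ 6.

Lemma Cmod_half_neq (Q : C) : Cmod Q <= 1 / 2 -> 1 - Q <> 0.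
Proof. intros H. apply one_minus_neq_0. intros E. rewrite E, Cmod_1 in H. lra. Qed.

(** The recursion for [T] is the one satisfied by the sum of [(M + n)^e Q^n]; using closed rational
    forms of this sum, the tail is found without any infinite series. *)
Lemma tail_eq (f : C -> C) (T : C -> C -> C) e (Q : C) n :
  (forall M, T M Q = M ^ e + Q * T (M + 1) Q) -> f Q = Q * T 1 Q ->
  f Q - csum (fun r => INR (S r) ^ e * Q ^ S r) n = Q ^ S n * T (INR (S n)) Q.
Proof.
intros HT Hf. induction n as [|n IH].
- rewrite Hf. simpl. ring.
- rewrite csum_S. replace (f Q - (csum (fun r => INR (S r) ^ e * Q ^ S r) n + INR (S n) ^ e * Q ^ S n))
   with (f Q - csum (fun r => INR (S r) ^ e * Q ^ S r) n - INR (S n) ^ e * Q ^ S n) by ring.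
  rewrite IH, (HT (INR (S n))), (S_INR (S n)), RtoC_plus. rewrite (Cpow_S Q (S n)). ring.
Qed.

Lemma Cmod_plus_le (x y : C) (a b : R) : Cmod x <= a -> Cmod y <= b -> Cmod (x + y) <= a + b.
Proof. intros. apply Rle_trans with (1 := Cmod_triangle _ _). lra. Qed.

Lemma Cmod_mult_le (x y : C) (a b : R) : Cmod x <= a -> Cmod y <= b -> Cmod (x * y) <= a * b.
Proof. intros. rewrite Cmod_mult. apply Rmult_le_compat; auto; apply Cmod_ge_0. Qed.

Lemma Cmod_pow_le (x : C) (a : R) n : Cmod x <= a -> Cmod (x ^ n) <= a ^ n.
Proof. intros. rewrite Cmod_pow. apply pow_incr. split; auto. apply Cmod_ge_0. Qed.

Lemma Cmod_real_le (x : R) : 0 <= x -> Cmod x <= x.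
Proof. intros. rewrite Cmod_R, Rabs_pos_eq; lra. Qed.

(** Computes a bound along with its proof: the right side is an existential variable, filled in from
    the structure of the expression and the bounds of its atoms. *)
Ltac cbound := repeat first [ eassumption | (apply Cmod_real_le; lra) | apply Cmod_plus_le | apply Cmod_mult_le | apply Cmod_pow_le ].

Lemma Cmod_inv_1m (Q : C) : Cmod Q <= 1 / 2 -> Cmod (/ (1 - Q)) <= 2.
Proof.
intros H. rewrite Cmod_inv by now apply Cmod_half_neq.
replace 2%R with (/ (1 / 2))%R by field. apply Rinv_le_contravar. lra.
assert (T := Cmod_triangle (1 - Q) Q). replace (1 - Q + Q) with (RtoC 1) in T by ring. rewrite Cmod_1 in T. lra.
Qed.

(** [158 = 2 + 12 + 48 + 96] is the expression [T4] with [M] and [Q] replaced by 1 and [1 / (1 - Q)]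
    by its bound 2. *)
Lemma lambert_tail_R4 : lambert_tail R4 3 158.
Proof.
intros n Q HQ. assert (Hn := Cmod_half_neq Q HQ).
rewrite (tail_eq R4 T4).
- rewrite Cmod_mult, Cmod_pow, Rmult_comm. apply Rmult_le_compat_r. apply pow_le, Cmod_ge_0.
  set (m := INR (S n)). assert (Hm : 1 <= m) by (apply (le_INR 1); lia).
  assert (Hm0 : 0 <= m) by lra.
  assert (HQ1 : Cmod Q <= 1) by lra. assert (Hi := Cmod_inv_1m Q HQ). assert (Hmm := Cmod_real_le m Hm0).
  unfold T4. set (i := / (1 - Q)) in *. eapply Rle_trans. cbound.
  assert (m ^ 1 <= m ^ 3)%R by (apply Rle_pow; lra || lia).
  assert (m ^ 2 <= m ^ 3)%R by (apply Rle_pow; lra || lia).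
  assert (m ^ 0 <= m ^ 3)%R by (apply Rle_pow; lra || lia).
  assert (E : forall j, (1 ^ j = 1)%R) by apply pow1.
  try rewrite !E. simpl (m ^ 0)%R in *. simpl (m ^ 1)%R in *. lra.
- intros M. unfold T4. field. auto.
- unfold R4, T4. field. auto.
Qed.

(** The constant is [2 + 20 + 160 + 960 + 3840 + 7680], found from [T6] in the same way. *)
Lemma lambert_tail_R6 : lambert_tail R6 5 12662.
Proof.
intros n Q HQ. assert (Hn := Cmod_half_neq Q HQ).
rewrite (tail_eq R6 T6).
- rewrite Cmod_mult, Cmod_pow, Rmult_comm. apply Rmult_le_compat_r. apply pow_le, Cmod_ge_0.
  set (m := INR (S n)). assert (Hm : 1 <= m) by (apply (le_INR 1); lia).
  assert (Hm0 : 0 <= m) by lra.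
  assert (HQ1 : Cmod Q <= 1) by lra. assert (Hi := Cmod_inv_1m Q HQ). assert (Hmm := Cmod_real_le m Hm0).
  unfold T6. set (i := / (1 - Q)) in *. eapply Rle_trans. cbound.
  assert (A : forall j, (j <= 5)%nat -> (m ^ j <= m ^ 5)%R) by (intros; apply Rle_pow; lra || lia).
  assert (A0 := A 0%nat ltac:(lia)). assert (A1 := A 1%nat ltac:(lia)). assert (A2 := A 2%nat ltac:(lia)).
  assert (A3 := A 3%nat ltac:(lia)). assert (A4 := A 4%nat ltac:(lia)).
  assert (E : forall j, (1 ^ j = 1)%R) by apply pow1.
  try rewrite !E. simpl (m ^ 0)%R in *. simpl (m ^ 1)%R in *. lra.
- intros M. unfold T6. field. auto.
- unfold R6, T6. field. auto.
Qed.

(* [(1 - q)^2 / q = 2 cosh z - 2] with [q = exp z] *)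
Definition Sq (z : C) : C := Cexp z + Cexp (- z) - 2.

Lemma cder_Cexp_opp (z : C) : cder (fun z => Cexp (- z)) z (- Cexp (- z)).
Proof.
eapply cder_eq; [|apply (cder_comp Cexp (fun z => - z)); [apply cder_Cexp|]].
2:{ apply (cder_ext (fun z => - (1) * z)). intros; ring. apply cder_scal, cder_id. }
cbv beta. ring.
Qed.

(** A bound of the exponential for [|Re z| <= 2 PI], the strip that contains [z = 2 PI i w] when
    [|Im w| <= 1]. *)
Definition E0 : R := exp (2 * PI).

Lemma Cmod_Cexp_strip (z : C) : Rabs (Re z) <= 2 * PI -> Cmod (Cexp z) <= E0 /\ Cmod (Cexp (- z)) <= E0.
Proof.
intros H. apply Rabs_le_between in H. rewrite !Cmod_Cexp. unfold E0.
assert (A : forall x y, (x <= y)%R -> (exp x <= exp y)%R).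
{ intros x y [Hl| ->]; [left; now apply exp_increasing|right; auto]. }
split; apply A. lra. destruct z; simpl in *; lra.
Qed.

Lemma seg_from_0 (z : C) (t : R) : 0 <= t <= 1 -> Rabs (Re z) <= 2 * PI ->
  Rabs (Re (0 + t * (z - 0))) <= 2 * PI /\ Cmod (0 + t * (z - 0)) <= Cmod z.
Proof.
intros Ht Hz. replace (0 + t * (z - 0)) with (t * z) by ring. split.
- replace (Re (t * z)) with (t * Re z)%R by (destruct z; simpl; ring).
  rewrite Rabs_mult, (Rabs_pos_eq t) by lra. assert (H := Rabs_pos (Re z)). nra.
- rewrite Cmod_mult, Cmod_R, Rabs_pos_eq by lra. assert (H := Cmod_ge_0 z). nra.
Qed.

(** Four applications of the mean value inequality from 0, each gaining one power of [|z|]: to [sh],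
    to [Sq] with derivative [sh], to [sh - 2 z] with derivative [Sq], and to [Sq - z^2]. *)
Lemma Sq_expansion (z : C) : Rabs (Re z) <= 2 * PI -> Cmod (Sq z - z * z) <= 2 * E0 * Cmod z ^ 4.
Proof.
set (sh := fun z => Cexp z - Cexp (- z)).
assert (Dsh : forall z, cder sh z (Cexp z + Cexp (- z))).
{ intros x. eapply cder_eq; [|apply cder_minus; [apply cder_Cexp|apply cder_Cexp_opp]]. ring. }
assert (DS : forall z, cder Sq z (sh z)).
{ intros x. unfold Sq, sh. eapply cder_eq; [|apply cder_minus; [apply cder_plus; [apply cder_Cexp|apply cder_Cexp_opp]|apply cder_const]]. ring. }
assert (Z1 : sh 0 = 0) by (unfold sh; replace (- RtoC 0) with (RtoC 0) by ring; ring).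
assert (Z2 : Sq 0 = 0) by (unfold Sq; replace (- RtoC 0) with (RtoC 0) by ring; rewrite Cexp_0; ring).
assert (B1 : forall z, Rabs (Re z) <= 2 * PI -> Cmod (sh z) <= 2 * E0 * Cmod z).
{ intros x Hx. assert (H := cmvt sh (fun z => Cexp z + Cexp (- z)) 0 x (2 * E0)).
  rewrite Z1 in H. replace (sh x - 0) with (sh x) in H by ring. replace (x - 0) with x in H at 5 by ring.
  replace (Cmod x) with (Cmod (x - 0)) by (f_equal; ring). apply H; auto.
  intros t Ht. destruct (seg_from_0 x t Ht Hx) as [S1 _]. destruct (Cmod_Cexp_strip _ S1).
  apply Rle_trans with (1 := Cmod_triangle _ _). lra. }
assert (HE : 0 < E0) by apply exp_pos.
assert (B2 : forall z, Rabs (Re z) <= 2 * PI -> Cmod (Sq z) <= 2 * E0 * Cmod z * Cmod z).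
{ intros x Hx. assert (H := cmvt Sq sh 0 x (2 * E0 * Cmod x)).
  rewrite Z2 in H. replace (Sq x - 0) with (Sq x) in H by ring.
  replace (Cmod x) with (Cmod (x - 0)) at 2 by (f_equal; ring). apply H; auto.
  intros t Ht. destruct (seg_from_0 x t Ht Hx) as [S1 S2]. apply Rle_trans with (1 := B1 _ S1).
  apply Rmult_le_compat_l; lra. }
assert (B3 : forall z, Rabs (Re z) <= 2 * PI -> Cmod (sh z - 2 * z) <= 2 * E0 * Cmod z * Cmod z * Cmod z).
{ intros x Hx. assert (H := cmvt (fun z => sh z - 2 * z) Sq 0 x (2 * E0 * Cmod x * Cmod x)). cbv beta in H.
  rewrite Z1 in H. replace (sh x - 2 * x - (0 - 2 * 0)) with (sh x - 2 * x) in H by ring.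
  replace (Cmod x) with (Cmod (x - 0)) at 3 by (f_equal; ring). apply H; auto.
  - intros t Ht. eapply cder_eq; [|apply cder_minus; [apply Dsh|apply cder_2s]]. unfold Sq. ring.
  - intros t Ht. destruct (seg_from_0 x t Ht Hx) as [S1 S2]. apply Rle_trans with (1 := B2 _ S1).
    assert (S3 := Cmod_ge_0 (0 + t * (x - 0))). apply Rmult_le_compat; try nra. }
intros Hz. assert (H := cmvt (fun z => Sq z - z * z) (fun z => sh z - 2 * z) 0 z (2 * E0 * Cmod z * Cmod z * Cmod z)).
cbv beta in H. rewrite Z2 in H. replace (Sq z - z * z - (0 - 0 * 0)) with (Sq z - z * z) in H by ring.
replace (2 * E0 * Cmod z ^ 4)%R with (2 * E0 * Cmod z * Cmod z * Cmod z * Cmod (z - 0))%R.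
2:{ replace (z - 0) with z by ring. ring. }
apply H.
- intros t Ht. apply cder_minus; auto. apply cder_sq.
- intros t Ht. destruct (seg_from_0 z t Ht Hz) as [S1 S2]. apply Rle_trans with (1 := B3 _ S1).
  assert (S3 := Cmod_ge_0 (0 + t * (z - 0))). set (y := Cmod (0 + t * (z - 0))) in *.
  apply Rmult_le_compat; auto. apply Rmult_le_pos; [|auto]. nra. apply Rmult_le_compat; try nra.
Qed.

Lemma sin_lower (u : R) : 0 <= u <= 3 * PI / 4 -> u / 6 <= sin u.
Proof.
intros Hu. assert (P4 := PI_4). assert (HP := PI2_1).
destruct (Rle_dec u 1) as [H1|H1].
- assert (H := Rabs_sin_sub_le u). rewrite (Rabs_pos_eq u) in H by lra. apply Rabs_le_between in H. nra.
- assert (A : 1 / 2 <= sin u); [|lra].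
  assert (S1 : 1 / 2 <= sin 1).
  { assert (H := Rabs_sin_sub_le 1). rewrite Rabs_R1 in H. apply Rabs_le_between in H. lra. }
  destruct (Rle_dec u (PI / 2)) as [H2|H2].
  + apply Rle_trans with (1 := S1). apply sin_incr_1; lra.
  + rewrite <- (sin_PI_x u). apply Rle_trans with (sin (PI / 6)). rewrite sin_PI6. lra.
    apply sin_incr_1; lra.
Qed.

(** For [z = x + i y] and [e = exp x] the modulus of [Sq z] is [(e - 1)^2 / e + 2 (1 - cos y)], two
    non-negative terms that control [x^2] and [y^2]. The bound on [Im z] keeps away from the next
    zeros, at [2 PI i] and [- 2 PI i]. *)
Lemma Sq_lower (z : C) : Rabs (Re z) <= 2 * PI -> Rabs (Im z) <= 3 * PI / 2 ->
  / (36 * E0) * Cmod z ^ 2 <= Cmod (Sq z).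
Proof.
intros Hx Hy. assert (HP := PI_RGT_0).
assert (HE : 1 <= E0) by (unfold E0; apply Rle_trans with (2 := exp_ineq1_le _); lra).
destruct z as [x y]. simpl in Hx, Hy.
assert (ES : Sq (x, y) * Cexp (x, y) = (1 - Cexp (x, y)) * (1 - Cexp (x, y))).
{ unfold Sq. transitivity (Cexp (x, y) * Cexp (x, y) + Cexp (x, y) * Cexp (- (x, y)) - 2 * Cexp (x, y)). ring.
  rewrite <- (Cexp_add (x, y) (- (x, y))). replace ((x, y) + - (x, y)) with (RtoC 0) by ring. rewrite Cexp_0. ring. }
assert (EM : (Cmod (Sq (x, y)) * exp x = (1 - 2 * exp x * cos y + exp x * exp x))%R).
{ replace (exp x) with (Cmod (Cexp (x, y))) at 1 by now rewrite Cmod_Cexp.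
  rewrite <- Cmod_mult, ES, Cmod_mult. 
  replace (Cmod (1 - Cexp (x, y)) * Cmod (1 - Cexp (x, y)))%R with (Cmod (1 - Cexp (x, y)) ^ 2)%R by ring.
  rewrite Cmod2_alt. unfold Cexp. simpl. assert (H := sin2_cos2 y). unfold Rsqr in H.
  transitivity (1 - 2 * exp x * cos y + exp x * exp x * (sin y * sin y + cos y * cos y))%R. ring. rewrite H. ring. }
set (e := exp x) in *. assert (He : 0 < e) by apply exp_pos.
assert (HeE : e <= E0 /\ / e <= E0).
{ destruct (Cmod_Cexp_strip (x, y) Hx) as [A B]. rewrite Cmod_Cexp in A, B. simpl in A, B. rewrite exp_Ropp in B. fold e in A, B. auto. }
assert (EM2 : Cmod (Sq (x, y)) = ((e - 1) * (e - 1) / e + 2 * (1 - cos y))%R).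
{ apply (Rmult_eq_reg_r e); [|lra]. rewrite EM. field. lra. }
assert (L1 : x ^ 2 * / E0 <= (e - 1) * (e - 1) / e).
{ destruct (Rle_dec 0 x) as [Hx0|Hx0].
  - assert (H := exp_ineq1_le x). fold e in H.
    apply Rmult_le_compat. nra. apply Rlt_le, Rinv_0_lt_compat; lra. nra. apply Rinv_le_contravar; lra.
  - assert (H := exp_ineq1_le (- x)). rewrite exp_Ropp in H. fold e in H.
    replace ((e - 1) * (e - 1) / e)%R with ((/ e - 1) * (/ e - 1) * e)%R by (field; lra).
    apply Rmult_le_compat. nra. apply Rlt_le, Rinv_0_lt_compat; lra. nra.
    rewrite <- (Rinv_inv e). apply Rinv_le_contravar. apply Rinv_0_lt_compat; lra. lra. }
assert (L2 : y ^ 2 / 36 <= 2 * (1 - cos y)).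
{ replace y with (2 * (y / 2))%R at 2 by field. rewrite cos_2a_sin.
  replace (2 * (1 - (1 - 2 * sin (y / 2) * sin (y / 2))))%R with (4 * (Rabs (sin (y / 2))) ^ 2)%R by (rewrite pow2_abs; ring).
  assert (H : Rabs (y / 2) / 6 <= Rabs (sin (y / 2))).
  { apply Rabs_le_between in Hy. unfold Rabs at 1. destruct Rcase_abs.
    - rewrite <- Rabs_Ropp, <- sin_neg. apply Rle_trans with (2 := Rle_abs _). apply sin_lower. lra.
    - apply Rle_trans with (2 := Rle_abs _). apply sin_lower. lra. }
  assert (H0 := Rabs_pos (y / 2)). assert (E : (Rabs (y / 2) ^ 2 = y ^ 2 / 4)%R) by (rewrite pow2_abs; field). nra. }
rewrite EM2, Cmod2_alt. simpl Re. simpl Im.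
assert (HiE : 0 < / E0 <= 1).
{ split. apply Rinv_0_lt_compat; lra. rewrite <- Rinv_1. apply Rinv_le_contravar; lra. }
rewrite Rinv_mult. nra.
Qed.

Lemma inv_Sq (z : C) : z <> 0 -> Rabs (Re z) <= 2 * PI -> Rabs (Im z) <= 3 * PI / 2 ->
  Sq z <> 0 /\ Cmod (/ Sq z) <= 36 * E0 * / Cmod z ^ 2 /\
  Cmod (/ Sq z - / (z * z)) <= 72 * E0 * E0.
Proof.
intros Hz Hx Hy.
assert (HE : 1 <= E0) by (unfold E0; assert (HP := PI_RGT_0); apply Rle_trans with (2 := exp_ineq1_le _); lra).
assert (Hm : 0 < Cmod z) by now apply Cmod_gt_0.
assert (L := Sq_lower z Hx Hy). assert (U := Sq_expansion z Hx).
assert (Hm2 : (0 < Cmod z ^ 2)%R) by (apply pow_lt; auto).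
assert (HiE : 0 < / (36 * E0)) by (apply Rinv_0_lt_compat; lra).
assert (Hpos : (0 < / (36 * E0) * Cmod z ^ 2)%R) by now apply Rmult_lt_0_compat.
assert (HS : Sq z <> 0) by (apply Cmod_gt_0; lra).
assert (B : Cmod (/ Sq z) <= 36 * E0 * / Cmod z ^ 2).
{ rewrite Cmod_inv by auto. replace (36 * E0 * / Cmod z ^ 2)%R with (/ (/ (36 * E0) * Cmod z ^ 2))%R by (field; lra).
  now apply Rinv_le_contravar. }
split; [auto|split; auto].
replace (/ Sq z - / (z * z)) with (- (Sq z - z * z) * / Sq z * / (z * z)) by (field; auto).
rewrite !Cmod_mult, Cmod_opp, (Cmod_inv (z * z)), (Cmod_mult z z) by now apply Cmult_neq_0.
apply Rle_trans with (2 * E0 * Cmod z ^ 4 * (36 * E0 * / Cmod z ^ 2) * / (Cmod z * Cmod z))%R.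
- apply Rmult_le_compat_r. apply Rlt_le, Rinv_0_lt_compat. nra.
  apply Rmult_le_compat; auto; apply Cmod_ge_0.
- right. field. lra.
Qed.

Lemma zeta_bounds (w : C) : w <> 0 -> Rabs (Re w) <= 3 / 4 -> Rabs (Im w) <= 1 ->
  let z := 2 * PI * Ci * w in
  z <> 0 /\ Rabs (Re z) <= 2 * PI /\ Rabs (Im z) <= 3 * PI / 2 /\ Cmod z = (2 * PI * Cmod w)%R /\ Cmod z <= 16.
Proof.
intros Hw Hr Hi z. assert (HP := PI_RGT_0). assert (HP4 := PI_4).
assert (E1 : Re z = (- (2 * PI * Im w))%R) by (unfold z; destruct w; simpl; ring).
assert (E2 : Im z = (2 * PI * Re w)%R) by (unfold z; destruct w; simpl; ring).
assert (E3 : Cmod z = (2 * PI * Cmod w)%R).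
{ unfold z. rewrite !Cmod_mult, Cmod_Ci, !Cmod_R, !Rabs_pos_eq by lra. ring. }
assert (Hm : 0 < Cmod w) by now apply Cmod_gt_0.
split; [|split; [|split; [|split]]]; auto.
- apply Cmod_gt_0. rewrite E3. nra.
- rewrite E1, Rabs_Ropp, !Rabs_mult, (Rabs_pos_eq 2), (Rabs_pos_eq PI) by lra. nra.
- rewrite E2, !Rabs_mult, (Rabs_pos_eq 2), (Rabs_pos_eq PI) by lra. nra.
- rewrite E3. assert (B := Cmod_le_abs w). nra.
Qed.

Lemma nome_Sq (w : C) : let z := 2 * PI * Ci * w in let q := nome w in
  q <> 0 /\ Sq z = (1 - q) * (1 - q) / q.
Proof.
intros z q. assert (Hq : q <> 0) by apply Cexp_neq_0. split; auto.
unfold Sq. change (Cexp z) with q.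
assert (E : q * Cexp (- z) = 1).
{ unfold q, nome. fold z. rewrite <- Cexp_add. replace (z + - z) with (RtoC 0) by ring. apply Cexp_0. }
replace (Cexp (- z)) with (q * Cexp (- z) / q) by (field; auto). rewrite E. field; auto.
Qed.

Lemma inv_zeta_le (w z : C) j : w <> 0 -> Cmod z = (2 * PI * Cmod w)%R -> (/ Cmod z ^ j <= / Cmod w ^ j)%R.
Proof.
intros Hw E. assert (Hm : 0 < Cmod w) by now apply Cmod_gt_0. assert (HP := PI2_1).
apply Rinv_le_contravar. now apply pow_lt. apply pow_incr. nra.
Qed.

Lemma Ci_neq_0 : Ci <> 0.
Proof. intros E. apply (f_equal Im) in E. simpl in E. lra. Qed.

Lemma PI_neq_0C : RtoC PI <> 0.
Proof. apply RtoC_neq_0, PI_neq0. Qed.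

(** [R4 = 6 / Sq^2 + 1 / Sq], and [1 / Sq] differs from [1 / z^2] by a bounded function; the polar
    part is thus [6 / z^4]. *)
Lemma polar_R4 : exists C2, 0 <= C2 /\ polar R4 (6 / (2 * PI * Ci) ^ 4) 2 C2.
Proof.
assert (HE : 1 <= E0) by (unfold E0; assert (HP := PI_RGT_0); apply Rle_trans with (2 := exp_ineq1_le _); lra).
set (A := (36 * E0)%R). set (K := (72 * E0 * E0)%R).
exists (6 * (K * (A + 1)) + A)%R.
assert (HA : 1 <= A) by (unfold A; lra). assert (HK : 0 <= K) by (unfold K; nra).
split. nra.
intros w Hw Hr Hi. destruct (zeta_bounds w Hw Hr Hi) as [Hz [Hzr [Hzi [Hzm _]]]].
destruct (nome_Sq w) as [Hq ES]. cbv zeta in *. set (z := 2 * PI * Ci * w) in *. set (q := nome w) in *.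
destruct (inv_Sq z Hz Hzr Hzi) as [HS [B1 B2]]. fold A K in B1, B2.
assert (H1q : 1 - q <> 0).
{ intros E. apply HS. rewrite ES, E. field; auto. }
assert (HPi : 2 * PI * Ci <> 0).
{ intros E. apply Hz. unfold z. rewrite E. ring. }
replace (R4 q - 6 / (2 * PI * Ci) ^ 4 * / w ^ (2 + 2)) with
  (6 * ((/ Sq z - / (z * z)) * (/ Sq z + / (z * z))) + / Sq z).
2:{ transitivity (6 * (/ Sq z * / Sq z) + / Sq z - 6 * / (z ^ 4)). field; auto.
  replace (6 / (2 * PI * Ci) ^ 4 * / w ^ (2 + 2)) with (6 * / z ^ 4).
  2:{ unfold z. simpl. field. repeat split; auto; [exact Ci_neq_0|exact PI_neq_0C]. }
  rewrite ES. unfold R4. f_equal. field. auto. }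
assert (Bz : Cmod (/ (z * z)) <= / Cmod z ^ 2).
{ rewrite Cmod_inv, Cmod_mult by now apply Cmult_neq_0. right. f_equal. ring. }
assert (Hzp : 0 < Cmod z) by now apply Cmod_gt_0.
assert (Hi2 : 0 < / Cmod z ^ 2) by (apply Rinv_0_lt_compat, pow_lt; auto).
eapply Rle_trans. cbound.
apply Rle_trans with ((6 * (K * (A + 1)) + A) * / Cmod z ^ 2)%R. right; ring.
apply Rmult_le_compat_l. nra. now apply inv_zeta_le.
Qed.

(** Here [R6 = 120 / Sq^3 + 30 / Sq^2 + 1 / Sq]. *)
Lemma polar_R6 : exists C2, 0 <= C2 /\ polar R6 (120 / (2 * PI * Ci) ^ 6) 4 C2.
Proof.
assert (HE : 1 <= E0) by (unfold E0; assert (HP := PI_RGT_0); apply Rle_trans with (2 := exp_ineq1_le _); lra).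
set (A := (36 * E0)%R). set (K := (72 * E0 * E0)%R).
exists (120 * (K * (A * A + A + 1)) + 30 * (A * A) + 256 * A)%R.
assert (HA : 1 <= A) by (unfold A; lra). assert (HK : 0 <= K) by (unfold K; nra).
assert (HC : 0 <= 120 * (K * (A * A + A + 1)) + 30 * (A * A) + 256 * A) by nra.
split. auto.
intros w Hw Hr Hi. destruct (zeta_bounds w Hw Hr Hi) as [Hz [Hzr [Hzi [Hzm Hz16]]]].
destruct (nome_Sq w) as [Hq ES]. cbv zeta in *. set (z := 2 * PI * Ci * w) in *. set (q := nome w) in *.
destruct (inv_Sq z Hz Hzr Hzi) as [HS [B1 B2]]. fold A K in B1, B2.
assert (H1q : 1 - q <> 0).
{ intros E. apply HS. rewrite ES, E. field; auto. }
replace (R6 q - 120 / (2 * PI * Ci) ^ 6 * / w ^ (4 + 2)) with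
  (120 * ((/ Sq z - / (z * z)) * (/ Sq z * / Sq z + / Sq z * / (z * z) + / (z * z) * / (z * z))) + 30 * (/ Sq z * / Sq z) + / Sq z).
2:{ transitivity (120 * (/ Sq z * / Sq z * / Sq z) + 30 * (/ Sq z * / Sq z) + / Sq z - 120 * / (z ^ 6)). field; auto.
  replace (120 / (2 * PI * Ci) ^ 6 * / w ^ (4 + 2)) with (120 * / z ^ 6).
  2:{ unfold z. simpl. field. repeat split; auto; [exact Ci_neq_0|exact PI_neq_0C]. }
  rewrite ES. unfold R6. f_equal. field. auto. }
assert (Bz : Cmod (/ (z * z)) <= / Cmod z ^ 2).
{ rewrite Cmod_inv, Cmod_mult by now apply Cmult_neq_0. right. f_equal. ring. }
assert (Hzp : 0 < Cmod z) by now apply Cmod_gt_0.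
set (i2 := (/ Cmod z ^ 2)%R) in *.
assert (Hi2 : 0 < i2) by (apply Rinv_0_lt_compat, pow_lt; auto).
assert (Ei4 : (/ Cmod z ^ 4 = i2 * i2)%R) by (unfold i2; field; lra).
(* As [|z| <= 16], the summand [1 / Sq] of order [|z|^(-2)] may be counted at the order [|z|^(-4)],
   at the price of a factor 256. *)
assert (Hi1 : (1 <= 256 * i2)%R).
{ unfold i2. apply Rmult_le_reg_r with (Cmod z ^ 2)%R. apply pow_lt; auto. rewrite Rmult_assoc, Rinv_l by (apply pow_nonzero; lra). nra. }
eapply Rle_trans. cbound.
apply Rle_trans with ((120 * (K * (A * A + A + 1)) + 30 * (A * A) + 256 * A) * / Cmod z ^ 4)%R.
- rewrite Ei4. assert (0 <= A * i2)%R by nra. nra.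
- apply Rmult_le_compat_l; auto. now apply inv_zeta_le.
Qed.

Lemma R4_m1 : R4 (- (1)) = 1 / 8.
Proof. unfold R4. field. Qed.

Lemma R6_m1 : R6 (- (1)) = - (1 / 4).
Proof. unfold R6. field. Qed.

Lemma E4_eis t : E4 t = 240 * eis R4 2 t.
Proof. unfold E4, eis. rewrite R4_m1. simpl (2 + 1)%nat. simpl (2 + 2)%nat. field. Qed.

Lemma E6_eis t : E6 t = - (504) * eis R6 4 t.
Proof. unfold E6, eis. rewrite R6_m1. simpl (4 + 1)%nat. simpl (4 + 2)%nat. field. Qed.

Theorem E4_S t : tdom t -> tdom (S_act t) -> E4 (S_act t) = t ^ 4 * E4 t.
Proof.
intros D1 D2. destruct polar_R4 as [C2 [HC HP]]. rewrite !E4_eis.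
rewrite (eis_S R4 (6 / (2 * PI * Ci) ^ 4) 2 C2 158 t); auto; try lra; try lia. simpl (2 + 2)%nat. ring.
intros x. simpl. ring. exact doubling_R4. exact lambert_tail_R4.
Qed.

Theorem E6_S t : tdom t -> tdom (S_act t) -> E6 (S_act t) = t ^ 6 * E6 t.
Proof.
intros D1 D2. destruct polar_R6 as [C2 [HC HP]]. rewrite !E6_eis.
rewrite (eis_S R6 (120 / (2 * PI * Ci) ^ 6) 4 C2 12662 t); auto; try lra; try lia. simpl (4 + 2)%nat. ring.
intros x. simpl. ring. exact doubling_R6. exact lambert_tail_R6.
Qed.

(** * Estimates near the cusp *)

Lemma lambert_head e (B g : R) (q : C) : 0 <= B -> 0 < g ->
  (forall n, sig e (n + 2) <= B * g ^ n) -> Cmod q < 1 -> Cmod q * g < 1 -> sig e 0 = 1%R ->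
  Cmod (q * CPS (sig e) q - q - sig e 1 * q ^ 2) <= Cmod q ^ 3 * (B / (1 - Cmod q * g)).
Proof.
intros HB Hg H Hq Hqg H0. assert (Hr := rad1_sig e).
assert (Hr1 : rad1 (fun n => sig e (S n))).
{ unfold rad1. change (Rbar_le 1 (CV_radius (PS_decr_1 (sig e)))). now rewrite CV_radius_decr_1. }
assert (Hr2 : rad1 (fun n => sig e (S (S n)))).
{ unfold rad1. change (Rbar_le 1 (CV_radius (PS_decr_1 (fun n => sig e (S n))))). now rewrite CV_radius_decr_1. }
rewrite (CPS_head (sig e)), (CPS_head (fun n => sig e (S n))), H0 by now apply rad1_disk.
set (T := CPS (fun n => sig e (S (S n))) q).
replace (q * (1 + q * (sig e 1 + q * T)) - q - sig e 1 * q ^ 2) with (q ^ 3 * T) by ring.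
rewrite Cmod_mult, Cmod_pow. apply Rmult_le_compat_l. apply pow_le, Cmod_ge_0.
assert (Hq0 := Cmod_ge_0 q).
assert (Hgq : Rabs (Cmod q * g) < 1) by (rewrite Rabs_pos_eq; nra).
assert (EB : ex_series (fun n => B * (Cmod q * g) ^ n)%R) by (apply exS_scal; now apply ex_series_geom).
assert (L : forall n, Cmod (sig e (S (S n)) * q ^ n) <= B * (Cmod q * g) ^ n).
{ intros n. rewrite Cmod_mult, Cmod_pow, Cmod_R, Rabs_pos_eq by apply pos_INR.
  specialize (H n). replace (n + 2)%nat with (S (S n)) in H by lia.
  rewrite Rpow_mult_distr. replace (B * (Cmod q ^ n * g ^ n))%R with (B * g ^ n * Cmod q ^ n)%R by ring.
  apply Rmult_le_compat_r; auto. now apply pow_le. }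
apply Rle_trans with (1 := Cmod_CSeries_le _ (cabs_le _ _ L EB)).
unfold Rdiv. rewrite <- (Series_geom _ Hgq), <- Series_scal_l.
apply Series_le; auto. intros n. split; auto. apply Cmod_ge_0.
Qed.

(** [(n + 4) / (n + 3) <= 4/3]. The rates 4 and 8 used below are convenient numbers above [(4/3)^4]
    and [(4/3)^6]. *)
Lemma pow_growth (k n : nat) (g : R) : (4 / 3) ^ k <= g -> ((INR n + 3) ^ k <= 3 ^ k * g ^ n)%R.
Proof.
intros Hg. assert (Hg0 : 0 < g) by (apply Rlt_le_trans with (2 := Hg); apply pow_lt; lra).
induction n as [|n IH]. simpl. rewrite Rplus_0_l. lra.
rewrite S_INR. assert (Hn := pos_INR n).
apply Rle_trans with ((4 / 3 * (INR n + 3)) ^ k)%R. apply pow_incr. lra.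
rewrite Rpow_mult_distr. simpl.
replace (3 ^ k * (g * g ^ n))%R with (g * (3 ^ k * g ^ n))%R by ring.
apply Rmult_le_compat; auto; apply pow_le; lra.
Qed.

Lemma sig_le e n : sig e (n + 2) <= (INR n + 3) ^ S e.
Proof.
unfold sig. apply Rle_trans with (1 := divisor_sum_le e _).
replace (S (n + 2)) with (n + 3)%nat by lia. rewrite plus_INR. simpl INR.
replace (1 + 1 + 1)%R with 3%R by ring. simpl. lra.
Qed.

(** As 530 is less than [exp (2 PI)], this region contains a half-plane [Im t >= h0] with [h0 < 1].
    It is the domain of all numerical estimates that follow. *)
Definition reg (t : C) : Prop := 0 < Im t /\ Cmod (nome t) <= 1 / 530.

(** The second coefficient of the divisor series is [9 = 1 + 2^3]; the tail adds at most
    [82 / 530 < 0.16]. *)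
Lemma E4_expansion t : reg t -> Cmod (E4 t - 1 - 240 * nome t) <= 240 * (9.16 * Cmod (nome t) ^ 2).
Proof.
intros [_ Hq]. set (q := nome t) in *. assert (Hq0 := Cmod_ge_0 q).
destruct (lambert_CPS 3 q ltac:(lra)) as [_ E].
unfold E4. fold q. rewrite E.
assert (H := lambert_head 3 81 4 q ltac:(lra) ltac:(lra)).
assert (Hb : forall n, sig 3 (n + 2) <= 81 * 4 ^ n).
{ intros n. apply Rle_trans with (1 := sig_le 3 n). replace 81%R with (3 ^ 4)%R by ring. apply pow_growth. lra. }
specialize (H Hb ltac:(lra) ltac:(lra) eq_refl).
replace (sig 3 1) with 9%R in H by (unfold sig; simpl; ring).
replace (1 + 240 * (q * CPS (sig 3) q) - 1 - 240 * q) with (240 * ((q * CPS (sig 3) q - q - 9 * q ^ 2) + 9 * q ^ 2)) by ring.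
rewrite Cmod_mult, Cmod_R, Rabs_pos_eq by lra. apply Rmult_le_compat_l. lra.
apply Rle_trans with (1 := Cmod_triangle _ _). rewrite (Cmod_mult 9), Cmod_R, Cmod_pow, Rabs_pos_eq by lra.
set (r := Cmod q) in *.
assert (B : 81 / (1 - r * 4) <= 82) by (apply Rle_div_l; lra).
assert (r ^ 3 * (81 / (1 - r * 4)) <= r ^ 3 * 82)%R by (apply Rmult_le_compat_l; auto; apply pow_le; auto).
assert (r ^ 3 <= r ^ 2 * (1 / 530))%R by (simpl; rewrite !Rmult_1_r, <- Rmult_assoc; apply Rmult_le_compat_l; nra).
assert (0 <= r ^ 2)%R by nra. lra.
Qed.

(** Likewise [33 = 1 + 2^5], and the tail adds at most [741 / 530 < 1.4]. *)
Lemma E6_expansion t : reg t -> Cmod (E6 t - 1 + 504 * nome t) <= 504 * (34.4 * Cmod (nome t) ^ 2).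
Proof.
intros [_ Hq]. set (q := nome t) in *. assert (Hq0 := Cmod_ge_0 q).
destruct (lambert_CPS 5 q ltac:(lra)) as [_ E].
unfold E6. fold q. rewrite E.
assert (H := lambert_head 5 729 8 q ltac:(lra) ltac:(lra)).
assert (Hb : forall n, sig 5 (n + 2) <= 729 * 8 ^ n).
{ intros n. apply Rle_trans with (1 := sig_le 5 n). replace 729%R with (3 ^ 6)%R by ring. apply pow_growth. lra. }
specialize (H Hb ltac:(lra) ltac:(lra) eq_refl).
replace (sig 5 1) with 33%R in H by (unfold sig; simpl; ring).
replace (1 - 504 * (q * CPS (sig 5) q) - 1 + 504 * q) with (- (504 * ((q * CPS (sig 5) q - q - 33 * q ^ 2) + 33 * q ^ 2))) by ring.
rewrite Cmod_opp, Cmod_mult, Cmod_R, Rabs_pos_eq by lra. apply Rmult_le_compat_l. lra.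
apply Rle_trans with (1 := Cmod_triangle _ _). rewrite (Cmod_mult 33), Cmod_R, Cmod_pow, Rabs_pos_eq by lra.
set (r := Cmod q) in *.
assert (B : 729 / (1 - r * 8) <= 741) by (apply Rle_div_l; lra).
assert (r ^ 3 * (729 / (1 - r * 8)) <= r ^ 3 * 741)%R by (apply Rmult_le_compat_l; auto; apply pow_le; auto).
assert (r ^ 3 <= r ^ 2 * (1 / 530))%R by (simpl; rewrite !Rmult_1_r, <- Rmult_assoc; apply Rmult_le_compat_l; nra).
assert (0 <= r ^ 2)%R by nra. lra.
Qed.

Definition y4 (t : C) : C := E4 t - 1.

Lemma y4_bound t : reg t -> Cmod (y4 t) <= 244.2 * Cmod (nome t).
Proof.
intros Hr. assert (H := E4_expansion t Hr). destruct Hr as [_ Hq]. unfold y4.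
replace (E4 t - 1) with ((E4 t - 1 - 240 * nome t) + 240 * nome t) by ring.
apply Rle_trans with (1 := Cmod_triangle _ _). rewrite Cmod_mult, Cmod_R, Rabs_pos_eq by lra.
assert (Hq0 := Cmod_ge_0 (nome t)). nra.
Qed.

Lemma y4_lt t : reg t -> Cmod (y4 t) <= 0.461.
Proof. intros Hr. assert (H := y4_bound t Hr). destruct Hr as [_ Hq]. lra. Qed.

Lemma bc_3half_small n : Rabs (bc (3 / 2) (n + 3)) <= 1 / 16.
Proof.
induction n as [|n IH].
- unfold bc. simpl. rewrite Rabs_left1; lra.
- assert (E := bc_S (3 / 2) (n + 3)). replace (S n + 3)%nat with (S (n + 3)) by lia.
  assert (Hn := pos_INR n). rewrite S_INR, plus_INR in E. simpl INR in E.
  set (x := bc (3 / 2) (n + 3)) in *. set (x' := bc (3 / 2) (S (n + 3))) in *.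
  assert (E' : x' = ((3 / 2 - (INR n + (1 + 1 + 1))) / (INR n + (1 + 1 + 1) + 1) * x)%R).
  { apply (Rmult_eq_reg_l (INR n + (1 + 1 + 1) + 1)%R); [|lra]. rewrite E. field. lra. }
  rewrite E', Rabs_mult.
  assert (B : Rabs ((3 / 2 - (INR n + (1 + 1 + 1))) / (INR n + (1 + 1 + 1) + 1)) <= 1).
  { unfold Rdiv. rewrite Rabs_mult, Rabs_inv, (Rabs_pos_eq (INR n + (1 + 1 + 1) + 1)), Rabs_left1 by lra.
    apply (Rle_div_l (- (3 * / 2 - (INR n + (1 + 1 + 1)))) 1); lra. }
  assert (H := Rabs_pos x). nra.
Qed.

Lemma pow1p_3half_bound (z : C) : Cmod z < 1 ->
  Cmod (pow1p (3 / 2) z - 1 - 3 / 2 * z) <= 3 / 8 * Cmod z ^ 2 + Cmod z ^ 3 * (1 / 16 / (1 - Cmod z)).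
Proof.
intros Hz. assert (Hr := rad1_bc (3 / 2)).
assert (Hs : forall k, rad1 (fun n => bc (3 / 2) (k + n))).
{ induction k as [|k IH]. auto. apply (rad1_ext (PS_decr_1 (fun n => bc (3 / 2) (k + n)))).
  intros n; unfold PS_decr_1; f_equal; lia. unfold rad1. now rewrite CV_radius_decr_1. }
unfold pow1p. rewrite (CPS_head (bc (3 / 2))) by now apply rad1_disk.
rewrite (CPS_head (fun n => bc (3 / 2) (S n))) by (apply rad1_disk; auto; apply (Hs 1%nat)).
rewrite (CPS_head (fun n => bc (3 / 2) (S (S n)))) by (apply rad1_disk; auto; apply (Hs 2%nat)).
set (T := CPS (fun n => bc (3 / 2) (S (S (S n)))) z).
replace (bc (3 / 2) 0) with 1%R by (unfold bc; simpl; field).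
replace (bc (3 / 2) 1) with (3 / 2)%R by (unfold bc; simpl; field).
replace (bc (3 / 2) 2) with (3 / 8)%R by (unfold bc; simpl; field).
replace (1 + z * ((3 / 2)%R + z * ((3 / 8)%R + z * T)) - 1 - 3 / 2 * z) with ((3 / 8)%R * z ^ 2 + z ^ 3 * T)
  by (rewrite (RtoC_div 3 2) by lra; field).
assert (Hz0 := Cmod_ge_0 z).
apply Rle_trans with (1 := Cmod_triangle _ _). rewrite !Cmod_mult, !Cmod_pow, Cmod_R, Rabs_pos_eq by lra.
apply Rplus_le_compat_l. apply Rmult_le_compat_l. now apply pow_le.
assert (Hg : Rabs (Cmod z) < 1) by (rewrite Rabs_pos_eq; auto).
assert (L : forall n, Cmod (bc (3 / 2) (S (S (S n))) * z ^ n) <= 1 / 16 * Cmod z ^ n).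
{ intros n. rewrite Cmod_mult, Cmod_pow, Cmod_R. apply Rmult_le_compat_r. now apply pow_le.
  replace (S (S (S n))) with (n + 3)%nat by lia. apply bc_3half_small. }
assert (EB : ex_series (fun n => 1 / 16 * Cmod z ^ n)%R) by (apply exS_scal; now apply ex_series_geom).
apply Rle_trans with (1 := Cmod_CSeries_le _ (cabs_le _ _ L EB)).
unfold Rdiv at 2. rewrite <- (Series_geom _ Hg), <- Series_scal_l.
apply Series_le; auto. intros n. split; auto. apply Cmod_ge_0.
Qed.

(** The branch of [E4 ^ (3/2)] that is 1 at the cusp; the binomial series applies on all of [reg]
    since [|E4 - 1| <= 0.461]. *)
Definition Vf (t : C) : C := pow1p (3 / 2) (y4 t).

Definition sf (t : C) : C := E6 t / Vf t.

Lemma Vf_expansion t : reg t -> Cmod (Vf t - 1 - 360 * nome t) <= 0.1035.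
Proof.
intros Hr. assert (B0 := y4_bound t Hr). assert (B1 := y4_lt t Hr). assert (B2 := E4_expansion t Hr).
assert (H := pow1p_3half_bound (y4 t) ltac:(lra)). fold (Vf t) in H.
destruct Hr as [_ Hq]. assert (Hq0 := Cmod_ge_0 (nome t)).
replace (Vf t - 1 - 360 * nome t) with ((Vf t - 1 - 3 / 2 * y4 t) + (3 / 2)%R * (E4 t - 1 - 240 * nome t)).
2:{ unfold y4. rewrite (RtoC_div 3 2) by lra. field. }
apply Rle_trans with (1 := Cmod_triangle _ _). rewrite (Cmod_mult (3 / 2)%R), Cmod_R, Rabs_pos_eq by lra.
set (q := Cmod (nome t)) in *. set (m := Cmod (y4 t)) in *. assert (Hm : 0 <= m) by apply Cmod_ge_0.
assert (D : 1 / 16 / (1 - m) <= 0.116) by (apply Rle_div_l; lra).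
assert (m ^ 2 <= 0.21253)%R by nra.
assert (m ^ 3 <= 0.098)%R by (simpl; nra).
assert (Hm3 : (0 <= m ^ 3)%R) by now apply pow_le.
assert (m ^ 3 * (1 / 16 / (1 - m)) <= 0.098 * 0.116)%R.
{ apply Rmult_le_compat; auto. apply Rlt_le, Rdiv_lt_0_compat; lra. }
assert (q ^ 2 <= (1 / 530) ^ 2)%R by (apply pow_incr; lra). lra.
Qed.

Lemma Vf_sq t : reg t -> Vf t * Vf t = E4 t ^ 3.
Proof.
intros Hr. assert (B := y4_lt t Hr). assert (H : Cmod (y4 t) < 1) by lra.
unfold Vf. rewrite pow1p_add by auto.
replace (3 / 2 + 3 / 2)%R with (1 + (1 + 1))%R by field. rewrite <- !pow1p_add, pow1p_1 by auto.
unfold y4. ring.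
Qed.

Lemma Vf_neq_0 t : reg t -> Vf t <> 0.
Proof. intros Hr. apply pow1p_neq_0. assert (B := y4_lt t Hr). lra. Qed.

Lemma E4_neq_0 t : reg t -> E4 t <> 0.
Proof.
intros Hr E. assert (H := Vf_sq t Hr). rewrite E in H. assert (N := Vf_neq_0 t Hr).
apply (Cmult_neq_0 _ _ N N). rewrite H. simpl. ring.
Qed.

Definition dot (z w : C) : R := (Re z * Re w + Im z * Im w)%R.

Lemma dot_le z w : Rabs (dot z w) <= Cmod z * Cmod w.
Proof.
unfold dot. apply Rabs_le. split; [|apply Re_Cconj_mult_le].
assert (H := Re_Cconj_mult_le (- z) w). rewrite Cmod_opp in H. destruct z, w; simpl in *. lra.
Qed.

Lemma Re_div_dot (z w : C) : w <> 0 -> 0 < dot z w -> 0 < Re (z / w).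
Proof.
intros Hw H. assert (Hm : 0 < Cmod w ^ 2) by (apply pow_lt; now apply Cmod_gt_0).
rewrite Cmod2_alt in Hm.
replace (Re (z / w)) with (dot z w / (Re w ^ 2 + Im w ^ 2))%R. now apply Rdiv_lt_0_compat.
unfold dot. destruct z, w; simpl in *. field. lra.
Qed.

(* The image of the half-plane under [s] stays in the half-plane [Re s > 0], except near
   the point [tau = i] and its translates, where [s] is small. *)
Lemma sf_region t : reg t -> 0 < Re (sf t) \/ Cmod (sf t) < 1.
Proof.
intros Hr. assert (e1 := E6_expansion t Hr). assert (e2 := Vf_expansion t Hr). assert (HV := Vf_neq_0 t Hr).
destruct Hr as [_ Hq]. assert (Hq0 := Cmod_ge_0 (nome t)). assert (Hq2 := Cmod2_alt (nome t)).
set (x := Re (nome t)) in *. set (y := Im (nome t)) in *. set (q := Cmod (nome t)) in *.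
assert (Hqq : (q ^ 2 <= (1 / 530) ^ 2)%R) by (apply pow_incr; lra).
assert (He1 : Cmod (E6 t - 1 + 504 * nome t) <= 0.0618) by lra. clear e1.
set (P := 1 - 504 * nome t) in *. set (W := 1 + 360 * nome t) in *.
set (d1 := E6 t - 1 + 504 * nome t) in *. set (d2 := Vf t - 1 - 360 * nome t) in *.
assert (EE : E6 t = P + d1) by (unfold P, d1; ring). assert (EV : Vf t = W + d2) by (unfold W, d2; ring).
assert (P2 : (Cmod P ^ 2 = 1 - 1008 * x + 254016 * q ^ 2)%R).
{ rewrite Cmod2_alt, Hq2. unfold P, x, y. destruct (nome t); simpl; ring. }
assert (W2 : (Cmod W ^ 2 = 1 + 720 * x + 129600 * q ^ 2)%R).
{ rewrite Cmod2_alt, Hq2. unfold W, x, y. destruct (nome t); simpl; ring. }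
assert (HP0 := Cmod_ge_0 P). assert (HW0 := Cmod_ge_0 W).
(* For larger [x = Re q] the numerator [1 - 504 q] is so much smaller than the denominator
   [1 + 360 q] that [|s| < 1]; otherwise their scalar product, hence [Re s], stays positive. *)
destruct (Rle_dec x (9 / 20 / 530)) as [Hx|Hx].
- left. unfold sf. apply Re_div_dot; auto. rewrite EE, EV.
  assert (D0 : (dot P W = 1 - 144 * x - 181440 * q ^ 2)%R).
  { rewrite Hq2. unfold dot, P, W, x, y. destruct (nome t); simpl; ring. }
  assert (D1 := dot_le P d2). assert (D2 := dot_le d1 (W + d2)).
  assert (BV : Cmod (W + d2) <= Cmod W + 0.1035) by (apply Rle_trans with (1 := Cmod_triangle _ _); lra).
  replace (dot (P + d1) (W + d2)) with (dot P W + dot P d2 + dot d1 (W + d2))%R.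
  2:{ unfold dot. destruct P, W, d1, d2; simpl; ring. }
  apply Rabs_le_between in D1, D2.
  assert (F1 : Cmod P * Cmod d2 <= Cmod P * 0.1035) by (apply Rmult_le_compat_l; lra).
  assert (F2 : Cmod d1 * Cmod (W + d2) <= 0.0618 * (Cmod W + 0.1035)) by (apply Rmult_le_compat; auto; apply Cmod_ge_0).
  (* These squares bound [|P|] and [|W|] linearly by [|P|^2] and [|W|^2], which are known in terms
     of [x] and [q^2]; what remains is linear. *)
  assert (G1 := pow2_ge_0 (Cmod P - 1.2)). assert (G2 := pow2_ge_0 (Cmod W - 1.3)).
  ring_simplify in G1. ring_simplify in G2.
  lra.
- right. unfold sf. rewrite Cmod_div by auto.
  assert (Hxq : x ^ 2 <= q ^ 2) by (rewrite Hq2; nra).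
  assert (G1 : Cmod P <= 1.025) by nra.
  assert (G2 : 1.3 <= Cmod W) by nra.
  assert (A1 : Cmod (E6 t) <= 1.09) by (rewrite EE; apply Rle_trans with (1 := Cmod_triangle _ _); lra).
  assert (A2 : 1.19 <= Cmod (Vf t)).
  { assert (T := Cmod_triangle (W + d2) (- d2)). replace (W + d2 + - d2) with W in T by ring.
    rewrite Cmod_opp in T. rewrite EV. lra. }
  apply Rlt_div_l; lra.
Qed.

(** [Delta / q - 1] for the discriminant [Delta]; its smallness allows powers of [Delta / q] to be
    taken by the binomial series. *)
Definition df (t : C) : C := (E4 t ^ 3 - E6 t ^ 2) / (1728 * nome t) - 1.

Lemma nome_neq_0 t : nome t <> 0.
Proof. apply Cexp_neq_0. Qed.

(** The terms of first order in [q] cancel, because [3 * 240 + 2 * 504 = 1728]; what is left is of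
    second order and is divided by [1728 q]. *)
Lemma df_bound t : reg t -> Cmod (df t) < 1.
Proof.
intros Hr. assert (e1 := E4_expansion t Hr). assert (e2 := E6_expansion t Hr).
destruct Hr as [_ Hq]. assert (Hn := nome_neq_0 t). assert (Hq0 : 0 < Cmod (nome t)) by now apply Cmod_gt_0.
set (q := nome t) in *. set (r := Cmod q) in *.
set (a := E4 t - 1 - 240 * q) in *. set (b := E6 t - 1 + 504 * q) in *.
set (u := 240 * q + a). set (v := - (504 * q) + b).
assert (EE : E4 t = 1 + u) by (unfold u, a; ring). assert (EF : E6 t = 1 + v) by (unfold v, b; ring).
assert (Hn2 : 1728 * q <> 0) by (apply Cmult_neq_0; auto; apply RtoC_neq_0; lra).
assert (Er2 : (r ^ 2 = r * r)%R) by ring.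
assert (Hu : Cmod u <= 244.2 * r).
{ unfold u. apply Rle_trans with (1 := Cmod_triangle _ _). rewrite Cmod_mult, Cmod_R, Rabs_pos_eq by lra. fold r. nra. }
assert (Hv : Cmod v <= 536.8 * r).
{ unfold v. apply Rle_trans with (1 := Cmod_triangle _ _). rewrite Cmod_opp, Cmod_mult, Cmod_R, Rabs_pos_eq by lra. fold r. nra. }
replace (df t) with ((3 * a + - (2 * b) + 3 * (u * u) + u * u * u + - (v * v)) / (1728 * q)).
2:{ unfold df. fold q. rewrite EE, EF. unfold u, v. field. auto. }
rewrite Cmod_div, Cmod_mult, Cmod_R, Rabs_pos_eq by (auto; lra). fold r.
apply Rlt_div_l. lra.
assert (Huu : Cmod (u * u) <= 59634 * (r * r)).
{ rewrite Cmod_mult. assert (H := Cmod_ge_0 u). apply Rle_trans with ((244.2 * r) * (244.2 * r))%R. apply Rmult_le_compat; auto. nra. }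
assert (Huuu : Cmod (u * u * u) <= 59634 * (r * r) * 0.461).
{ rewrite Cmod_mult. apply Rmult_le_compat; auto; try apply Cmod_ge_0. lra. }
assert (Hvv : Cmod (v * v) <= 288155 * (r * r)).
{ rewrite Cmod_mult. assert (H := Cmod_ge_0 v). apply Rle_trans with ((536.8 * r) * (536.8 * r))%R. apply Rmult_le_compat; auto. nra. }
assert (Main : Cmod (3 * a + - (2 * b) + 3 * (u * u) + u * u * u + - (v * v)) <=
  3 * (240 * (9.16 * r ^ 2)) + 2 * (504 * (34.4 * r ^ 2)) + 3 * (59634 * (r * r)) + 59634 * (r * r) * 0.461 + 288155 * (r * r)).
{ repeat apply Cmod_plus_le; auto; rewrite ?Cmod_opp; auto;
  rewrite (Cmod_mult _ _), Cmod_R, Rabs_pos_eq by lra; lra. }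
apply Rle_lt_trans with (1 := Main). rewrite Er2. nra.
Qed.

(** * A half-plane of height less than 1 inside the region of the estimates *)

Lemma PI_gt_314 : 3.14 < PI.
Proof.
assert (H := proj1 (PI_2_3_7_ineq 1)). unfold tg_alt, PI_2_3_7_tg, Ratan_seq in H. simpl in H. lra.
Qed.

Lemma exp_2PI_gt : 530 < exp (2 * PI).
Proof.
assert (H := exp_ge_taylor 0.785 5 ltac:(lra)). simpl in H.
(* [8 * 0.785 = 6.28 < 2 PI]; the Taylor polynomial of degree 5 at 0.785 exceeds 2.1915, whose
   eighth power exceeds 530. *)
apply Rlt_le_trans with (exp 0.785 ^ 8)%R.
- apply Rlt_le_trans with (2.1915 ^ 8)%R. lra. apply pow_incr. lra.
- replace (exp 0.785 ^ 8)%R with (exp (0.785 * 8)).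
  apply Rlt_le, exp_increasing. assert (P := PI_gt_314). lra.
  replace (0.785 * 8)%R with (0.785 + (0.785 + (0.785 + (0.785 + (0.785 + (0.785 + (0.785 + 0.785)))))))%R by field.
  rewrite !exp_plus. ring.
Qed.

Lemma reg_above : exists h0 : R, 0 < h0 < 1 /\ forall t : C, h0 <= Im t -> reg t.
Proof.
assert (P := PI_gt_314). exists (ln 530 / (2 * PI))%R.
assert (H1 : 0 < ln 530) by (rewrite <- ln_1; apply ln_increasing; lra).
assert (H2 : ln 530 < 2 * PI) by (rewrite <- (ln_exp (2 * PI)); apply ln_increasing; [lra|apply exp_2PI_gt]).
assert (H3 : 0 < ln 530 / (2 * PI)) by (apply Rdiv_lt_0_compat; lra).
split. split; auto. apply Rlt_div_l; lra.
intros t Ht. split. lra.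
rewrite Cmod_nome. apply Rle_div_l in Ht; [|lra].
rewrite exp_Ropp. replace (1 / 530)%R with (/ 530)%R by field. apply Rinv_le_contravar. lra.
rewrite <- (exp_ln 530) by lra. destruct (Req_dec (ln 530) (2 * PI * Im t)) as [->|]; [lra|]. apply Rlt_le, exp_increasing. lra.
Qed.

(** * Holomorphy of the modular functions and powers of [x] *)

Lemma Im_sub_le (x t : C) : Rabs (Im x - Im t) <= Cmod (x - t).
Proof. replace (Im x - Im t)%R with (Im (x - t)) by (destruct x, t; simpl; ring). apply im_le_Cmod. Qed.

Lemma cder_lin (c t : C) : cder (fun z => c * z) t c.
Proof. apply (cder_eq _ _ (c * 1)). ring. apply cder_scal, cder_id. Qed.

Lemma cder_Cexp_lin (c t : C) : cder (fun z => Cexp (c * z)) t (c * Cexp (c * t)).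
Proof. apply (cder_comp Cexp (fun z => c * z)). apply cder_Cexp. apply cder_lin. Qed.

Lemma cder_nome (t : C) : cder nome t (2 * PI * Ci * nome t).
Proof. exact (cder_Cexp_lin (2 * PI * Ci) t). Qed.

Lemma cder_lambert e (t : C) : 0 < Im t ->
  exists l, cder (fun z => CSeries (fun n => INR (divisor_sum e (S n)) * nome z ^ S n)) t l.
Proof.
intros Ht. eexists. apply (cder_ext_loc (fun z => nome z * CPS (sig e) (nome z)) _ _ _ (Im t) Ht).
- intros x Hx. symmetry. apply lambert_CPS, Cmod_nome_lt1.
  assert (H := Im_sub_le x t). apply Rabs_le_between in H. lra.
- apply (cder_mult nome (fun z => CPS (sig e) (nome z))). apply cder_nome.
  apply (cder_CPS_comp (sig e) nome). apply rad1_sig. now apply Cmod_nome_lt1. apply cder_nome.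
Qed.

Lemma cder_E4 t : 0 < Im t -> exists l, cder E4 t l.
Proof.
intros Ht. destruct (cder_lambert 3 t Ht) as [l Hl]. eexists.
apply (cder_plus (fun _ => 1)). apply cder_const. apply cder_scal. apply Hl.
Qed.

Lemma cder_E6 t : 0 < Im t -> exists l, cder E6 t l.
Proof.
intros Ht. destruct (cder_lambert 5 t Ht) as [l Hl]. eexists.
apply (cder_minus (fun _ => 1)). apply cder_const. apply cder_scal. apply Hl.
Qed.

Lemma cder_y4 t : 0 < Im t -> exists l, cder y4 t l.
Proof.
intros Ht. destruct (cder_E4 t Ht) as [l Hl]. eexists.
apply (cder_minus E4 (fun _ => 1)). apply Hl. apply cder_const.
Qed.

Lemma cder_df t : 0 < Im t -> exists l, cder df t l.
Proof.
intros Ht. destruct (cder_E4 t Ht) as [l Hl]. destruct (cder_E6 t Ht) as [l' Hl']. eexists.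
apply (cder_minus (fun t => (E4 t ^ 3 - E6 t ^ 2) / (1728 * nome t)) (fun _ => 1)); [|apply cder_const].
apply (cder_div (fun t => E4 t ^ 3 - E6 t ^ 2) (fun t => 1728 * nome t)).
- apply Cmult_neq_0. apply RtoC_neq_0; lra. apply nome_neq_0.
- apply (cder_minus (fun t => E4 t ^ 3)); apply cder_pow; eassumption.
- apply cder_scal, cder_nome.
Qed.

Lemma cder_Vf t : reg t -> exists l, cder Vf t l.
Proof.
intros Ht. destruct (cder_y4 t (proj1 Ht)) as [l Hl]. eexists.
apply (cder_comp (pow1p (3 / 2)) y4); [|apply Hl]. apply cder_pow1p. assert (B := y4_lt t Ht). lra.
Qed.

Lemma cder_sf t : reg t -> exists l, cder sf t l.
Proof.
intros Ht. destruct (cder_Vf t Ht) as [l Hl]. destruct (cder_E6 t (proj1 Ht)) as [l' Hl']. eexists.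
apply (cder_div E6 Vf); eauto. now apply Vf_neq_0.
Qed.

(* The branch of [x ^ r], [x = 1728 / j], that is [(1728 q) ^ r] times a power series in [q]. *)
Definition Xf (r : R) (t : C) : C :=
  Rpower 1728 r * Cexp (2 * PI * Ci * r * t) * (pow1p r (df t) * pow1p (- 3 * r) (y4 t)).

(** The logarithmic derivative of [x = 1728 q (1 + df) / (1 + y4)^3], where [ld] and [ly] stand for
    the derivatives of [df] and [y4]. *)
Definition xlog (t ld ly : C) : C := 2 * PI * Ci + ld / (1 + df t) - 3 * ly / (1 + y4 t).

Lemma cder_Xf r t ld ly : reg t -> cder df t ld -> cder y4 t ly ->
  cder (Xf r) t (r * Xf r t * xlog t ld ly).
Proof.
intros Ht Hd Hy. assert (Bd := df_bound t Ht). assert (By := y4_lt t Ht).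
assert (By' : Cmod (y4 t) < 1) by lra.
eapply cder_eq.
2:{ apply (cder_mult (fun t => Rpower 1728 r * Cexp (2 * PI * Ci * r * t)) (fun t => pow1p r (df t) * pow1p (- 3 * r) (y4 t))).
    apply cder_scal, cder_Cexp_lin.
    apply (cder_mult (fun t => pow1p r (df t)) (fun t => pow1p (- 3 * r) (y4 t))).
    apply (cder_comp (pow1p r) df); [apply cder_pow1p; auto|apply Hd].
    apply (cder_comp (pow1p (- 3 * r)) y4); [apply cder_pow1p; auto|apply Hy]. }
unfold Xf, xlog. cbv beta. rewrite RtoC_mult. replace (RtoC (-3)) with (- RtoC 3) by (rewrite <- RtoC_opp; f_equal; lra). field.
split; apply C1z_neq_0; auto.
Qed.

Definition xser (t : C) : C := 1728 * nome t * ((1 + df t) / (1 + y4 t) ^ 3).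

Lemma xser_eq t : reg t -> xser t = 1 - sf t * sf t /\ x_of t = 1 - sf t * sf t.
Proof.
intros Ht. assert (HE := E4_neq_0 t Ht). assert (HV := Vf_sq t Ht). assert (HV0 := Vf_neq_0 t Ht).
assert (Bd := C1z_neq_0 _ (df_bound t Ht)). assert (Hq := nome_neq_0 t).
assert (E : sf t * sf t = E6 t ^ 2 / E4 t ^ 3).
{ rewrite <- HV. unfold sf. field. auto. }
assert (D : E4 t ^ 3 - E6 t ^ 2 = 1728 * nome t * (1 + df t)).
{ unfold df. field; auto. }
assert (DN : E4 t ^ 3 - E6 t ^ 2 <> 0).
{ rewrite D. apply Cmult_neq_0; auto. apply Cmult_neq_0; auto. apply RtoC_neq_0; lra. }
rewrite E. split.
- unfold xser. replace (1 + y4 t) with (E4 t) by (unfold y4; ring).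
  transitivity ((1728 * nome t * (1 + df t)) / E4 t ^ 3). field; auto.
  rewrite <- D. field. auto.
- unfold x_of, j_inv. field; auto.
Qed.

Lemma cder_xser t ld ly : reg t -> cder df t ld -> cder y4 t ly ->
  cder xser t (xser t * xlog t ld ly).
Proof.
intros Ht Hd Hy. assert (Bd := C1z_neq_0 _ (df_bound t Ht)). assert (By := y4_lt t Ht).
assert (By' := C1z_neq_0 (y4 t) ltac:(lra)).
eapply cder_eq.
2:{ apply (cder_mult (fun t => 1728 * nome t) (fun t => (1 + df t) / (1 + y4 t) ^ 3)).
    apply cder_scal, cder_nome.
    apply (cder_div (fun t => 1 + df t) (fun t => (1 + y4 t) ^ 3)). now apply Cpow_nz.
    apply (cder_plus (fun _ => 1)); [apply cder_const|apply Hd].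
    apply cder_pow. apply (cder_plus (fun _ => 1)); [apply cder_const|apply Hy]. }
unfold xser, xlog. cbv beta. simpl INR. simpl pred. rewrite !RtoC_plus. field.
auto.
Qed.

(** Both are branches of the same power of [x], so the product of one with the inverse of the other
    has derivative 0; on a disk the equality at the centre then suffices. *)
Lemma Xf_xpw r (t0 : C) (d : R) :
  (forall t, Cmod (t - t0) < d -> reg t /\ Cmod (sf t) < 1) -> Xf r t0 = xpw r (sf t0) ->
  forall t, Cmod (t - t0) < d -> Xf r t = xpw r (sf t).
Proof.
intros H H0 t Ht.
assert (D : forall z, Cmod (z - t0) < d -> cder (fun z => Xf r z * xpw (- r) (sf z)) z 0).
{ intros z Hz. destruct (H z Hz) as [Hr Hs].
  destruct (cder_df z (proj1 Hr)) as [ld Hd]. destruct (cder_y4 z (proj1 Hr)) as [ly Hy].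
  destruct (cder_sf z Hr) as [ls Hls].
  destruct (xser_eq z Hr) as [E _].
  assert (U : xser z * xlog z ld ly = - (2 * sf z) * ls).
  { apply (cder_unique xser z). now apply cder_xser.
    apply (cder_ext_loc (fun z => 1 - sf z * sf z) _ _ _ (d - Cmod (z - t0))). lra.
    - intros x Hx. symmetry. apply xser_eq. apply H.
      replace (x - t0) with ((x - z) + (z - t0)) by ring.
      apply Rle_lt_trans with (1 := Cmod_triangle _ _). lra.
    - eapply cder_eq. 2:{ apply (cder_minus (fun _ => 1)). apply cder_const. apply (cder_mult sf sf); apply Hls. }
      ring. }
  assert (N : 1 - sf z * sf z <> 0).
  { replace (1 - sf z * sf z) with (1 + - (sf z * sf z)) by ring. apply C1z_neq_0. rewrite Cmod_opp. now apply Cmod_mult_lt1. }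
  eapply cder_eq. 2:{ apply (cder_mult (Xf r) (fun z => xpw (- r) (sf z))). apply cder_Xf; eauto.
    apply (cder_comp (xpw (- r)) sf). now apply cder_xpw. apply Hls. }
  cbv beta. rewrite E in U. rewrite RtoC_opp.
  replace (xlog z ld ly) with (- (2 * sf z) * ls / (1 - sf z * sf z)) by (rewrite <- U; field; auto).
  field. auto. }
assert (E : Xf r t * xpw (- r) (sf t) = Xf r t0 * xpw (- r) (sf t0)).
{ apply (cder0_const (fun z => Xf r z * xpw (- r) (sf z)) t0 t). intros u Hu. apply D.
  assert (G := Cmod_convex 0 (t - t0) d u Hu). replace (t0 + u * (t - t0) - t0) with (0 + u * (t - t0 - 0)) by ring.
  apply G; auto. rewrite Cmod_0. apply Rle_lt_trans with (2 := Ht). apply Cmod_ge_0. }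
assert (P : forall z, Cmod (z - t0) < d -> xpw r (sf z) * xpw (- r) (sf z) = 1).
{ intros z Hz. apply pow1p_opp. rewrite Cmod_opp. now apply Cmod_mult_lt1, H. }
rewrite H0, P in E.
2:{ replace (t0 - t0) with (RtoC 0) by ring. rewrite Cmod_0. apply Rle_lt_trans with (2 := Ht). apply Cmod_ge_0. }
rewrite <- (Cmult_1_r (Xf r t)), <- (P t Ht).
replace (Xf r t * (xpw r (sf t) * xpw (- r) (sf t))) with ((Xf r t * xpw (- r) (sf t)) * xpw r (sf t)) by ring.
rewrite E. ring.
Qed.

(** * Positivity and real values on the imaginary axis *)

Lemma PSeries_sig_mono e (q q' : R) : 0 <= q <= q' -> q' < 1 ->
  1 <= PSeries (sig e) q <= PSeries (sig e) q'.
Proof.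
intros H H'.
assert (S0 : sig e 0 = 1%R).
{ unfold sig. change (divisor_sum e 1) with (Nat.pow 1 e + 0)%nat. now rewrite Nat.pow_1_l. }
assert (Ex : forall x, 0 <= x < 1 -> ex_series (fun n => sig e n * x ^ n)%R).
{ intros x Hx. assert (G : ex_pseries (sig e) x).
  { apply CV_radius_inside. apply Rbar_lt_le_trans with 1; [|apply rad1_sig]. simpl. rewrite Rabs_pos_eq; lra. }
  apply ex_pseries_R in G. exact G. }
assert (Pos : forall n, 0 <= sig e n) by (intros n; apply pos_INR).
unfold PSeries. split.
- rewrite Series_incr_1 by (apply Ex; lra). rewrite S0.
  assert (0 <= Series (fun k => sig e (S k) * q ^ S k))%R.
  { apply Series_pos. intros n. apply Rmult_le_pos; auto. apply pow_le; lra.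
    apply (ex_series_incr_1 (fun n => sig e n * q ^ n)%R). apply Ex; lra. }
  simpl in *. lra.
- apply Series_le_ex; try (apply Ex; lra). intros n. apply Rmult_le_compat_l; auto. apply pow_incr. lra.
Qed.

Lemma nome_axis (t : R) : nome (Ci * t) = RtoC (exp (- (2 * PI * t))).
Proof.
unfold nome. replace (2 * PI * Ci * (Ci * t)) with (RtoC (- (2 * PI * t))). apply Cexp_RtoC.
rewrite RtoC_opp, !RtoC_mult. replace (2 * PI * Ci * (Ci * t)) with (2 * PI * t * (Ci * Ci)) by ring.
replace (Ci * Ci) with (- (1)). ring. apply C_ext; simpl; ring.
Qed.

Lemma Im_axis (t : R) : Im (Ci * t) = t.
Proof. simpl. ring. Qed.

Lemma E_axis (t : R) : 0 < t -> let q := exp (- (2 * PI * t)) in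
  E4 (Ci * t) = RtoC (1 + 240 * (q * PSeries (sig 3) q)) /\ E6 (Ci * t) = RtoC (1 - 504 * (q * PSeries (sig 5) q)).
Proof.
intros Ht q. assert (Hq : Cmod (nome (Ci * t)) < 1) by (apply Cmod_nome_lt1; rewrite Im_axis; auto).
unfold E4, E6. destruct (lambert_CPS 3 _ Hq) as [_ ->]. destruct (lambert_CPS 5 _ Hq) as [_ ->].
rewrite nome_axis. fold q. rewrite !CPS_RtoC.
rewrite RtoC_plus, RtoC_minus, !RtoC_mult. auto.
Qed.

Lemma E6_i : E6 Ci = 0.
Proof.
assert (S : S_act Ci = Ci) by (apply C_ext; unfold S_act; simpl; field).
assert (D : tdom Ci) by (unfold tdom; simpl; rewrite Rabs_R0; lra).
assert (H := E6_S Ci D). rewrite S in H. specialize (H D).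
replace (Ci ^ 6) with (- (1)) in H by (apply C_ext; simpl; ring).
destruct (E6 Ci) as [x y]. injection H as H1 H2. apply C_ext; simpl; lra.
Qed.

(** On the axis [E6] is 1 minus an increasing function of [q], and it vanishes at [i] by modularity;
    its sign above [i] follows without numerical evaluation. *)
Lemma E6_axis (t : R) : 1 <= t -> exists e : R, E6 (Ci * t) = e /\ 0 <= e < 1 /\ (1 < t -> 0 < e).
Proof.
intros Ht. destruct (E_axis t ltac:(lra)) as [_ E]. destruct (E_axis 1 ltac:(lra)) as [_ E1].
rewrite Cmult_1_r, E6_i in E1. apply RtoC_inj in E1.
set (q := exp (- (2 * PI * t))) in *. set (q1 := exp (- (2 * PI * 1))) in *.
assert (P := PI_gt_314).
assert (Q0 : 0 < q) by apply exp_pos.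
assert (Q1 : q1 < 1) by (apply Rlt_le_trans with (exp 0); [apply exp_increasing; lra|rewrite exp_0; lra]).
assert (Q : q <= q1 /\ (1 < t -> q < q1)).
{ destruct (Req_dec t 1) as [->|]. split. apply Rle_refl. lra.
  assert (q < q1) by (unfold q, q1; apply exp_increasing; nra). lra. }
destruct (PSeries_sig_mono 5 q q1 ltac:(lra) Q1) as [M1 M2].
eexists; split; [apply E|]. split; [split|]; [nra|nra|]. intros H. destruct Q as [_ Q]. specialize (Q H). nra.
Qed.

Lemma Rpower_1_sub_sq r (q d y s : R) : 0 < q -> -1 < d -> -1 < y ->
  (1 + - (s * s) = 1728 * q * ((1 + d) / (1 + y) ^ 3))%R ->
  (Rpower (1 + - (s * s)) r = Rpower 1728 r * Rpower q r * (Rpower (1 + d) r * Rpower (1 + y) (-3 * r)))%R.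
Proof.
intros Hq Hd Hy E. assert (H3 : 0 < (1 + y) ^ 3) by (apply pow_lt; lra).
assert (I3 : 0 < / (1 + y) ^ 3) by now apply Rinv_0_lt_compat.
rewrite E. unfold Rdiv. rewrite <- !Rpower_mult_distr; auto; try lra; try (apply Rmult_lt_0_compat; lra).
f_equal. f_equal. unfold Rpower. f_equal. rewrite ln_Rinv, ln_pow by (auto; lra). simpl INR. ring.
Qed.

(** This settles the choice of branches: on the axis all quantities are real, and [Xf r] and [xpw r]
    are both the real power of the positive number [x]. *)
Lemma axis (t : R) : 1 <= t ->
  exists s : R, sf (Ci * t) = s /\ 0 <= s < 1 /\ (1 < t -> 0 < s) /\ forall r, Xf r (Ci * t) = xpw r s.
Proof.
intros Ht. destruct reg_above as [h [Hh Hreg]]. assert (Hr : reg (Ci * t)) by (apply Hreg; rewrite Im_axis; lra).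
assert (By := y4_lt _ Hr). assert (Bd := df_bound _ Hr).
destruct (E_axis t ltac:(lra)) as [E4t _]. destruct (E6_axis t Ht) as [e [E6t [He He']]].
set (q := exp (- (2 * PI * t))) in *. assert (Q0 : 0 < q) by apply exp_pos.
assert (P := PI_gt_314).
assert (Q1 : q < 1) by (apply Rlt_le_trans with (exp 0); [apply exp_increasing; nra|rewrite exp_0; lra]).
destruct (PSeries_sig_mono 3 q q ltac:(lra) Q1) as [M1 _].
set (y := (240 * (q * PSeries (sig 3) q))%R) in *.
assert (Hy0 : 0 < y) by (unfold y; nra).
assert (Ey : y4 (Ci * t) = y) by (unfold y4; rewrite E4t, RtoC_plus; ring).
rewrite Ey, Cmod_R, Rabs_pos_eq in By by lra.
assert (EV : Vf (Ci * t) = RtoC (Rpower (1 + y) (3 / 2))) by (unfold Vf; rewrite Ey; apply pow1p_RtoC; lra).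
assert (HV : 1 <= Rpower (1 + y) (3 / 2)).
{ rewrite <- (Rpower_O (1 + y)) at 1 by lra. apply Rle_Rpower; lra. }
set (V := Rpower (1 + y) (3 / 2)) in *.
exists (e / V)%R.
assert (Es : sf (Ci * t) = (e / V)%R) by (unfold sf; rewrite E6t, EV, RtoC_div by lra; auto).
assert (Hs : 0 <= e / V < 1).
{ split. apply Rdiv_le_0_compat; lra. apply Rlt_div_l; lra. }
split; auto. split; auto. split. intros H. apply Rdiv_lt_0_compat. auto. lra.
intros r. destruct (xser_eq _ Hr) as [E _].
assert (Ed : exists d : R, df (Ci * t) = d).
{ exists (((1 + y) ^ 3 - e ^ 2) / (1728 * q) - 1)%R. unfold df. rewrite E4t, E6t, nome_axis. fold q.
  rewrite RtoC_minus, RtoC_div, RtoC_minus, !RtoC_pow, RtoC_mult by lra. auto. }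
destruct Ed as [d Ed]. rewrite Ed, Cmod_R in Bd. apply Rabs_def2 in Bd.
set (s := (e / V)%R) in *.
unfold xser in E. rewrite Es, Ed, Ey, nome_axis in E. fold q in E.
assert (E' : (1 + - (s * s) = 1728 * q * ((1 + d) / (1 + y) ^ 3))%R).
{ apply RtoC_inj. rewrite RtoC_plus, RtoC_opp, !RtoC_mult, RtoC_div by (apply pow_nonzero; lra).
  rewrite RtoC_pow, !RtoC_plus, E. ring. }
unfold xpw. replace (- (RtoC s * s)) with (RtoC (- (s * s))) by (rewrite RtoC_opp, RtoC_mult; auto).
rewrite pow1p_RtoC by nra. rewrite (Rpower_1_sub_sq r q d y s) by (auto; lra).
unfold Xf. rewrite Ed, Ey, !pow1p_RtoC by lra.
replace (2 * PI * Ci * r * (Ci * t)) with (RtoC (r * - (2 * PI * t))).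
rewrite Cexp_RtoC. replace (Rpower q r) with (exp (r * - (2 * PI * t))) by (unfold Rpower, q; now rewrite ln_exp).
rewrite !RtoC_mult. auto.
apply C_ext; simpl; ring.
Qed.

(** * Neighbourhoods of the axis and the action of [S] near [i] *)

Lemma ccont_ball f z (eps : R) : ccont f z -> 0 < eps ->
  exists d, 0 < d /\ forall x, Cmod (x - z) < d -> Cmod (f x - f z) < eps.
Proof.
intros Hf He. destruct (Hf eps He) as [d [Hd H]]. exists d; split; auto. intros x Hx.
specialize (H _ Hx). now replace (z + (x - z)) with x in H by ring.
Qed.

Lemma reg_near (t : R) : 1 <= t -> exists d, 0 < d /\ forall x, Cmod (x - Ci * t) < d -> reg x.
Proof.
intros Ht. destruct reg_above as [h [Hh Hr]]. exists (t - h)%R. split. lra.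
intros x Hx. apply Hr. assert (H := Im_sub_le x (Ci * t)). rewrite Im_axis in H. apply Rabs_le_between in H. lra.
Qed.

Lemma sf_near (t eps : R) : 1 <= t -> 0 < eps ->
  exists d, 0 < d /\ forall x, Cmod (x - Ci * t) < d -> reg x /\ Cmod (sf x - sf (Ci * t)) < eps.
Proof.
intros Ht He. destruct (reg_near t Ht) as [d1 [Hd1 H1]].
assert (Hc : ccont sf (Ci * t)).
{ apply ccont_cder, cder_sf, H1. replace (Ci * t - Ci * t) with (RtoC 0) by ring. now rewrite Cmod_0. }
destruct (ccont_ball _ _ _ Hc He) as [d2 [Hd2 H2]].
exists (Rmin d1 d2). split. now apply Rmin_pos. intros x Hx.
assert (M1 := Rmin_l d1 d2). assert (M2 := Rmin_r d1 d2). split. apply H1; lra. apply H2; lra.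
Qed.

Lemma Csq_eq (A B : C) : A * A = B * B -> A = B \/ A = - B.
Proof.
intros H. assert (E : (A - B) * (A + B) = 0) by (replace ((A - B) * (A + B)) with (A * A - B * B) by ring; rewrite H; ring).
destruct (Ceq_dec (A - B) 0) as [D|D]; [left; now apply Csub_eq|right].
destruct (Ceq_dec (A + B) 0) as [D'|D']. apply Csub_eq. rewrite <- D'. ring.
now apply Cmult_neq_0 in E.
Qed.

(** Modularity of [E4] determines the factor of [E4 ^ (3/2)] only up to sign, as [t^6] or [- t^6].
    Since [i^6 = -1] and [Vf Ci] is not 0, continuity at the fixed point [i] leaves only [- t^6],
    while [E6] acquires [t^6]. *)
Lemma sf_S : exists d, 0 < d /\ forall t, Cmod (t - Ci) < d -> Cmod (S_act t - Ci) < d ->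
  sf (S_act t) = - sf t.
Proof.
destruct (reg_near 1 (Rle_refl 1)) as [d1 [Hd1 H1]]. rewrite Cmult_1_r in H1.
assert (Hi : reg Ci) by (apply H1; replace (Ci - Ci) with (RtoC 0) by ring; now rewrite Cmod_0).
assert (N := Vf_neq_0 Ci Hi). assert (HV : 0 < Cmod (Vf Ci)) by now apply Cmod_gt_0.
destruct (cder_Vf Ci Hi) as [l Hl].
destruct (ccont_ball Vf Ci _ (cder_ccont _ _ _ Hl) HV) as [d2 [Hd2 H2]].
assert (Hl2 := cder_mult (fun t => t ^ 6) Vf Ci _ _ (cder_pow (fun t => t) Ci 1 6 (cder_id Ci)) Hl).
destruct (ccont_ball _ Ci _ (cder_ccont _ _ _ Hl2) HV) as [d3 [Hd3 H3]]. clear Hl Hl2.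
set (d := Rmin (1 / 2) (Rmin d1 (Rmin d2 d3))).
assert (Hd : 0 < d) by (repeat apply Rmin_pos; lra).
assert (D0 : d <= 1 / 2) by apply Rmin_l.
assert (D0' : d <= Rmin d1 (Rmin d2 d3)) by apply Rmin_r.
assert (M1 := Rmin_l d1 (Rmin d2 d3)). assert (M2 := Rmin_r d1 (Rmin d2 d3)).
assert (M3 := Rmin_l d2 d3). assert (M4 := Rmin_r d2 d3).
exists d. split; auto. intros t Ht HSt.
assert (Dom : forall z, Cmod (z - Ci) < d -> tdom z).
{ intros z Hz. assert (A := re_le_Cmod (z - Ci)). assert (B := im_le_Cmod (z - Ci)).
  apply Rabs_le_between in A, B. destruct z as [x y]. unfold tdom. simpl in *. split. apply Rabs_le. lra. lra. }
assert (Ht0 : t <> 0).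
{ intros ->. destruct (Dom 0 Ht) as [_ K]. simpl in K. lra. }
assert (R1 : reg t) by (apply H1; lra). assert (R2 : reg (S_act t)) by (apply H1; lra).
assert (SV : Vf (S_act t) * Vf (S_act t) = (t ^ 6 * Vf t) * (t ^ 6 * Vf t)).
{ rewrite Vf_sq by auto. rewrite E4_S by auto.
  replace (t ^ 6 * Vf t * (t ^ 6 * Vf t)) with (t ^ 12 * (Vf t * Vf t)) by ring. rewrite Vf_sq by auto. ring. }
apply Csq_eq in SV. destruct SV as [E|E].
- exfalso. specialize (H2 (S_act t) ltac:(lra)). specialize (H3 t ltac:(lra)). cbv beta in H3.
  replace (Ci ^ 6) with (- (1)) in H3 by (apply C_ext; simpl; ring). rewrite <- E in H3.
  assert (T := Cmod_triangle (Vf (S_act t) - - (1) * Vf Ci) (- (Vf (S_act t) - Vf Ci))).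
  rewrite Cmod_opp in T.
  replace (Vf (S_act t) - - (1) * Vf Ci + - (Vf (S_act t) - Vf Ci)) with (2 * Vf Ci) in T by ring.
  rewrite Cmod_mult, Cmod_R, Rabs_pos_eq in T by lra. lra.
- unfold sf. rewrite E, E6_S by auto. field. split. now apply Vf_neq_0. auto.
Qed.

(** From [h' |t|^2 < Im t], [h' < Im t] and [h' >= 1/2] one gets [|t - i|^2 < 2 (1 - h')], so
    [1 - h <= d^2 / 2] suffices. The claim is for all [h' >= h] because the final height is a
    maximum of two. *)
Lemma lens (d : R) : 0 < d -> exists h : R, 0 < h < 1 /\
  forall h' t, h <= h' -> h' < Im t -> h' < Im (S_act t) -> Cmod (t - Ci) < d.
Proof.
intros Hd. set (m := (Rmin (1 / 2) (d * d / 2))%R).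
assert (M1 := Rmin_l (1 / 2) (d * d / 2)). assert (M2 := Rmin_r (1 / 2) (d * d / 2)).
assert (Hm : 0 < m) by (apply Rmin_pos; nra). fold m in M1, M2.
exists (1 - m)%R. split. lra. intros h t Hh H1 H2.
destruct t as [x y]. assert (Hxy : 0 < x * x + y * y) by (simpl in *; nra).
replace (Im (S_act (x, y))) with (y / (x * x + y * y))%R in H2.
2:{ unfold S_act. simpl. field. simpl in H1. nra. }
simpl in H1. apply (Rlt_div_r h y (x * x + y * y)) in H2; [|lra].
assert (Hy : (h * y < 1)%R) by nra.
apply Rsqr_incrst_0; [|apply Cmod_ge_0|lra]. unfold Rsqr.
replace (Cmod ((x, y) - Ci) * Cmod ((x, y) - Ci))%R with (x * x + (y - 1) * (y - 1))%R.
2:{ replace (Cmod ((x, y) - Ci) * Cmod ((x, y) - Ci))%R with (Cmod ((x, y) - Ci) ^ 2)%R by ring. rewrite Cmod2_alt. simpl. ring. }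
nra.
Qed.

(** The residues 5 and 11 modulo 12 together form the residue 5 modulo 6, which is the case of an
    integral [c = (5 - k) / 6]. *)
Lemma Q2R_neq_5_mod_6 (k : Q) : ~ cong12 k 5 -> ~ cong12 k 11 -> forall z : Z, Q2R k <> (5 + 6 * IZR z)%R.
Proof.
intros H5 H11 z E.
assert (K : (k == inject_Z (5 + 6 * z))%Q).
{ apply eqR_Qeq. rewrite E. unfold Q2R, inject_Z, Qnum, Qden. rewrite plus_IZR, mult_IZR. field. }
destruct (Z.Even_or_Odd z) as [[n ->]|[n ->]]; [apply H5|apply H11]; exists n; rewrite K;
  unfold Qeq, inject_Z, Qminus, Qplus, Qopp, Qmult, Qnum, Qden; lia.
Qed.

(** * Continuation of the Stiller basis *)

Definition cfA (a b : R) : R := (cB (1 / 2 - b) (1 / 2 - a) / (-2 * (1 / 2 - a - b)))%R.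

Definition cfB (a b : R) : R := (- cB a b / (-2 * (1 / 2 - a - b)))%R.

Definition Y1 (a b : R) (t : C) : C := Gf a b (sf t).

(* The second summand is a multiple of the solution [x ^ (1 - c) F(a - c + 1, b - c + 1; 2 - c; x)]. *)
Definition Y3 (a b : R) (t : C) : C :=
  cfA a b * Y1 a b t + cfB a b * (Xf (1 / 2 - a - b) t * Y1 (1 / 2 - b) (1 / 2 - a) t).

(* [c] and [2 - c] are no poles of [Gamma], and [c <> 1], for [c = a + b + 1/2]. *)
Definition generic (a b : R) : Prop :=
  nonpole (a + b + 1 / 2) /\ nonpole (1 / 2 - b + (1 / 2 - a) + 1 / 2) /\ (1 / 2 - a - b <> 0)%R.

Lemma rGamma_half_inv : (/ rGamma (1 / 2) = sqrt PI)%R.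
Proof. rewrite rGamma_half. apply Rinv_inv. Qed.

Lemma par_sum k : (par_a k + par_b k + 1 / 2 = par_c k)%R.
Proof. unfold par_a, par_b, par_c. field. Qed.

Lemma generic_par k : (forall z : Z, k <> (5 + 6 * IZR z)%R) -> generic (par_a k) (par_b k).
Proof.
intros Hk. unfold par_a, par_b. split; [|split].
- intros n E. apply (Hk (Z.of_nat n)). rewrite <- INR_IZR_INZ. lra.
- intros n E. apply (Hk (- 2 - Z.of_nat n)%Z). rewrite minus_IZR, <- INR_IZR_INZ. lra.
- intros E. apply (Hk (- 1)%Z). lra.
Qed.

(** The division by the Wronskian [-2 (1 - c)] turns [Gamma(2 - c)] into [Gamma(1 - c)], and
    [1 - c = (1 + k) / 6]. *)
Lemma G12_cfA k : generic (par_a k) (par_b k) -> (4 * G12 k = cfA (par_a k) (par_b k))%R.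
Proof.
intros [_ [Hc' R0]]. set (a := par_a k) in *. set (b := par_b k) in *.
unfold cfA, cB, G12, Gamma.
replace (1 / 2 - b + (1 / 2 - a) + 1 / 2)%R with (1 / 2 - a - b + 1)%R by field.
assert (N := rGamma_neq_0 _ Hc').
replace (1 / 2 - b + (1 / 2 - a) + 1 / 2)%R with (1 / 2 - a - b + 1)%R in N by field.
rewrite <- rGamma_half_inv.
replace ((1 + k) / 6)%R with (1 / 2 - a - b)%R by (unfold a, b, par_a, par_b; field).
rewrite (rGamma_shift (1 / 2 - a - b)).
replace ((2 + k) / 12)%R with (1 / 2 - b)%R by (unfold b, par_b; field).
replace ((6 + k) / 12)%R with (1 / 2 - a)%R by (unfold a, par_a; field).
assert (N' := rGamma_neq_0 _ nonpole_half). field. repeat split; auto. lra.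
Qed.

Lemma G21_cA k : generic (par_a k) (par_b k) -> (4 * G21 k = 2 * cA (par_a k) (par_b k))%R.
Proof.
intros [Hc _]. set (a := par_a k) in *. set (b := par_b k) in *.
unfold cA, G21, Gamma. assert (N := rGamma_neq_0 _ Hc). rewrite <- rGamma_half_inv.
replace ((5 - k) / 6)%R with (a + b + 1 / 2)%R by (unfold a, b, par_a, par_b; field).
replace ((6 - k) / 12)%R with (a + 1 / 2)%R by (unfold a, par_a; field).
replace ((10 - k) / 12)%R with (b + 1 / 2)%R by (unfold b, par_b; field).
assert (N' := rGamma_neq_0 _ nonpole_half). field. auto.
Qed.

Lemma cder_Y1 a b t : nonpole (a + b + 1 / 2) -> reg t -> exists l, cder (Y1 a b) t l.
Proof.
intros Hc Ht. destruct (cder_sf t Ht) as [l Hl]. destruct (Gf_cder a b (sf t) Hc (sf_region t Ht)) as [l' Hl'].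
eexists. apply (cder_comp (Gf a b) sf); eassumption.
Qed.

Lemma cder_Y3 a b t : generic a b -> reg t -> exists l, cder (Y3 a b) t l.
Proof.
intros [Hc [Hc' _]] Ht. destruct (cder_Y1 a b t Hc Ht) as [l Hl]. destruct (cder_Y1 _ _ t Hc' Ht) as [l' Hl'].
destruct (cder_df t (proj1 Ht)) as [ld Hd]. destruct (cder_y4 t (proj1 Ht)) as [ly Hy].
eexists. apply (cder_plus (fun t => cfA a b * Y1 a b t)).
apply cder_scal, Hl. apply cder_scal. apply (cder_mult (Xf (1 / 2 - a - b))).
exact (cder_Xf _ t ld ly Ht Hd Hy). apply Hl'.
Qed.

Lemma sf_small_near (t : R) : 1 <= t -> exists d, 0 < d /\ forall x, Cmod (x - Ci * t) < d ->
  reg x /\ Cmod (sf x) < 1.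
Proof.
intros Ht. destruct (axis t Ht) as [s [Es [Hs _]]].
destruct (sf_near t (1 - s) Ht ltac:(lra)) as [d [Hd H]]. exists d. split; auto. intros x Hx.
destruct (H x Hx) as [H1 H2]. split; auto.
replace (sf x) with ((sf x - sf (Ci * t)) + s) by (rewrite Es; ring).
apply Rle_lt_trans with (1 := Cmod_triangle _ _). rewrite Cmod_R, Rabs_pos_eq by lra. lra.
Qed.

(** Above [i] this yields the germ of [y3]; at [t = 1], where [s] vanishes, it yields the invariance
    of [Y3] under [S]. *)
Lemma Y3_ev a b (t : R) : generic a b -> 1 <= t -> exists d, 0 < d /\ forall x, Cmod (x - Ci * t) < d ->
  reg x /\ Cmod (sf x) < 1 /\ Y3 a b x = ev a b (sf x).
Proof.
intros [Hc [Hc' Hr]] Ht. destruct (sf_small_near t Ht) as [d [Hd H]]. exists d. split; auto. intros x Hx.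
destruct (H x Hx) as [H1 H2]. repeat split; auto; try apply H1.
rewrite (ev_combination a b (sf x) Hc Hc' Hr H2).
unfold Y3. rewrite (Xf_xpw _ (Ci * t) d H); auto.
destruct (axis t Ht) as [s [Es [_ [_ E]]]]. now rewrite Es.
Qed.

Lemma Y1_germ k (t : R) : generic (par_a k) (par_b k) -> 1 < t ->
  exists d, 0 < d /\ forall x, Cmod (x - Ci * t) < d -> Y1 (par_a k) (par_b k) x = y1 k (x_of x).
Proof.
intros [Hc _] Ht. destruct (axis t ltac:(lra)) as [s [Es [Hs [Hs0 _]]]].
destruct (Gf_hypF _ _ s Hc) as [e [He H]]. specialize (Hs0 Ht). lra.
destruct (sf_near t e ltac:(lra) He) as [d [Hd Hn]]. exists d. split; auto. intros x Hx.
destruct (Hn x Hx) as [H1 H2]. rewrite Es in H2. unfold Y1, y1.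
rewrite (H _ H2), par_sum. now rewrite (proj2 (xser_eq x H1)).
Qed.

Lemma Y3_germ k (t : R) : generic (par_a k) (par_b k) -> 1 < t ->
  exists d, 0 < d /\ forall x, Cmod (x - Ci * t) < d -> Y3 (par_a k) (par_b k) x = y3 k (x_of x).
Proof.
intros Hg Ht. destruct (Y3_ev _ _ t Hg ltac:(lra)) as [d [Hd H]]. exists d. split; auto. intros x Hx.
destruct (H x Hx) as [H1 [_ E]]. rewrite E. unfold y3.
replace (par_a k + par_b k - par_c k + 1)%R with (1 / 2)%R by (rewrite <- par_sum; field).
rewrite (proj2 (xser_eq x H1)). replace (1 - (1 - sf x * sf x)) with (sf x * sf x) by ring. reflexivity.
Qed.

Lemma locally_ball (P : C -> Prop) (z : C) :
  (exists d, 0 < d /\ forall x, Cmod (x - z) < d -> P x) -> locally (T := C_UniformSpace) z P.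
Proof.
intros [d [Hd H]]. apply locally_C. exists (mkposreal d Hd). intros y Hy. apply H. exact Hy.
Qed.

Lemma E4_T t : E4 (T_act t) = E4 t.
Proof. unfold E4, T_act. now rewrite nome_plus1. Qed.

Lemma E6_T t : E6 (T_act t) = E6 t.
Proof. unfold E6, T_act. now rewrite nome_plus1. Qed.

Lemma sf_T t : sf (T_act t) = sf t.
Proof. unfold sf, Vf, y4. now rewrite E4_T, E6_T. Qed.

Lemma Xf_T r t : Xf r (T_act t) = Cexp (2 * PI * Ci * r) * Xf r t.
Proof.
unfold Xf. replace (df (T_act t)) with (df t) by (unfold df; now rewrite E4_T, E6_T; unfold T_act; rewrite nome_plus1).
replace (y4 (T_act t)) with (y4 t) by (unfold y4; now rewrite E4_T).
replace (2 * PI * Ci * r * T_act t) with (2 * PI * Ci * r + 2 * PI * Ci * r * t) by (unfold T_act; ring).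
rewrite Cexp_add. ring.
Qed.

Lemma Z1_par k : Z1 k = Cexp (2 * PI * Ci * (1 / 2 - par_a k - par_b k)%R).
Proof.
unfold Z1, theta. f_equal. rewrite RtoC_mult.
replace (1 / 2 - par_a k - par_b k)%R with ((1 + k) / 6)%R by (unfold par_a, par_b; field). ring.
Qed.

Lemma Y1_T a b t : Y1 a b (T_act t) = Y1 a b t.
Proof. unfold Y1. now rewrite sf_T. Qed.

Lemma Y3_T a b t : let z := Cexp (2 * PI * Ci * (1 / 2 - a - b)%R) in
  Y3 a b (T_act t) = cfA a b * (1 - z) * Y1 a b t + z * Y3 a b t.
Proof. intros z. unfold Y3. rewrite !Y1_T, Xf_T. fold z. ring. Qed.

(* [S] exchanges [s] and [- s]: [Y3] is even in [s], and [Y1 (s) + Y1 (- s)] is a multiple of [Y3]. *)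
Lemma Y_S a b : generic a b -> exists d, 0 < d /\ forall t, Cmod (t - Ci) < d -> Cmod (S_act t - Ci) < d ->
  Y1 a b (S_act t) = - Y1 a b t + 2 * cA a b * Y3 a b t /\ Y3 a b (S_act t) = Y3 a b t.
Proof.
intros Hg. destruct sf_S as [d1 [Hd1 H1]]. destruct (Y3_ev a b 1 Hg (Rle_refl 1)) as [d2 [Hd2 H2]].
rewrite Cmult_1_r in H2. exists (Rmin d1 d2). split. now apply Rmin_pos.
assert (M1 := Rmin_l d1 d2). assert (M2 := Rmin_r d1 d2). intros t Ht HS.
assert (E := H1 t ltac:(lra) ltac:(lra)).
destruct (H2 t ltac:(lra)) as [_ [B E3]]. destruct (H2 (S_act t) ltac:(lra)) as [_ [B' E3']].
rewrite E3, E3', E, ev_opp. split; auto.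
unfold Y1. rewrite !Gf_ps1 by (auto; apply Hg). rewrite E, ps1_opp. ring.
Qed.

Lemma Mmult_row2 (u v p q r s : C) :
  Mmult (T := C_Ring) (row2 u v) (mat2 p q r s) = row2 (u * p + v * r) (u * q + v * s).
Proof. unfold Mmult. simpl Nat.pred. unfold mk_matrix, mk_Tn. rewrite !sum_Sn, !sum_O. reflexivity. Qed.

Theorem proposition3p4 (k : Q)
  (hk0 : ~ cong12 k 0) (hk4 : ~ cong12 k 4)
  (hk5 : ~ cong12 k 5) (hk11 : ~ cong12 k 11) :
  exists h : R, (0 < h < 1)%R /\
  exists Y1 Y3 : C -> C,
    stiller_continuation (Q2R k) h Y1 Y3 /\
    (forall tau : C, (h < Im tau)%R ->
       stiller_row Y1 Y3 (T_act tau)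
       = Mmult (T := C_Ring) (stiller_row Y1 Y3 tau) (rho_T (Q2R k))) /\
    (forall tau : C, (h < Im tau)%R -> (h < Im (S_act tau))%R ->
       stiller_row Y1 Y3 (S_act tau)
       = Mmult (T := C_Ring) (stiller_row Y1 Y3 tau) (rho_S (Q2R k))).
Proof.
assert (Hg := generic_par _ (Q2R_neq_5_mod_6 k hk5 hk11)). set (x := Q2R k) in *. clearbody x.
set (a := par_a x) in *. set (b := par_b x) in *.
destruct reg_above as [h0 [Hh0 Hreg]]. destruct (Y_S a b Hg) as [d [Hd HS]].
destruct (lens d Hd) as [h1 [Hh1 Hlens]].
assert (M1 := Rmax_l h0 h1). assert (M2 := Rmax_r h0 h1). set (h := Rmax h0 h1) in *.
assert (Hh : h < 1) by (apply Rmax_case; lra).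
exists h. split. lra. exists (Y1 a b), (Y3 a b).
assert (Hreg' : forall t, h < Im t -> reg t) by (intros t Ht; apply Hreg; lra).
split; [split; [|split]|split].
- intros t Ht. destruct (cder_Y1 a b t (proj1 Hg)) as [l Hl]; auto. exists l. now apply cder_is_derive.
- intros t Ht. destruct (cder_Y3 a b t Hg) as [l Hl]; auto. exists l. now apply cder_is_derive.
- intros t Ht. split; apply locally_ball. now apply Y1_germ. now apply Y3_germ.
- intros t Ht. unfold stiller_row, rho_T.
  rewrite Mmult_row2, Y1_T, Y3_T, Z1_par. fold a b. assert (G := f_equal RtoC (G12_cfA x Hg)).
  rewrite RtoC_mult in G. fold a b in G. rewrite <- G. f_equal; ring.
- intros t Ht1 Ht2. assert (B := Hlens h t M2 Ht1 Ht2).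
  (* The two conditions on heights are symmetric in [t] and [S_act t], so [lens] places both points
     near [i]. *)
  assert (SS : S_act (S_act t) = t).
  { unfold S_act. assert (t <> 0). { intros ->. simpl in Ht1. lra. } field. auto. }
  assert (B' : Cmod (S_act t - Ci) < d) by (apply (Hlens h); rewrite ?SS; auto).
  destruct (HS t B B') as [E1 E3]. unfold stiller_row, rho_S. rewrite Mmult_row2, E1, E3.
  assert (G := f_equal RtoC (G21_cA x Hg)). fold a b in G. rewrite !RtoC_mult in G. rewrite <- G.
  f_equal; [|ring].
  (* The factor [i] of the second basis function meets the [i] of the matrix entry, which makes the
     coefficient the real number [4 G21 = 2 cA]. *)
  replace (Ci * Y3 a b t * - (4 * Ci * G21 x)) with (- (Ci * Ci) * (4 * G21 x * Y3 a b t)) by ring.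
  replace (Ci * Ci) with (- (1)) by (apply C_ext; simpl; ring). ring.
Qed.
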